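(* Let $\rho_->\rho_+$. There are constants $\epsilon>0$ and $\alpha>0$ such that, for any initial data $f_0$ with $\|(f_0)_x\|_{B_0}\le\epsilon$, there is a solution $f_x\in\mathcal{B}_\alpha$ of the Muskat problem $$\partial_tf_x(x,t)+\frac{\rho_--\rho_+}{2}\,\Lambda f_x(x,t)=\partial_xN(f)(x,t),\qquad f_x(x,0)=(f_0)_x(x),$$ for $x\in\mathbb{R}$, $t\ge 0$, where $$N(f)(x,t)=-\frac{\rho_--\rho_+}{2\pi}\int\frac{\partial_xf(x,t)-\partial_xf(x',t)}{x-x'}\cdot\frac{\left(\frac{f(x,t)-f(x',t)}{x-x'}\right)^2}{1+\left(\frac{f(x,t)-f(x',t)}{x-x'}\right)^2}\,dx'.$$ The solution is unique in a ball in $\mathcal{B}_\alpha$, i.e. there is a ball in $\mathcal{B}_\alpha$ in which it is the only solution.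
   Context: The equation is the $x$-derivative of the Muskat equation $$\partial_tf(x,t)=\frac{\rho_--\rho_+}{2\pi}\,\mathrm{p.v.}\int\frac{\partial_xf(x,t)-\partial_xf(x',t)}{(x-x')^2+(f(x,t)-f(x',t))^2}(x-x')\,dx',\qquad f(x,0)=f_0(x),$$ for the interface $\{(x,f(x,t)):x\in\mathbb{R}\}$ between two fluids in a porous medium, with constant density $\rho_+$ above and $\rho_-$ below. The integral defining $N(f)$ is understood in the principal value sense. Fourier transform: $\widehat u(\xi)=\int e^{-i\xi x}u(x)\,dx$. $\Lambda$ is the operator with symbol $|\xi|$. $B_0$ is the space of functions $u$ on $\mathbb{R}$ whose Fourier transforms are bounded measures, with norm $\|u\|_{B_0}=\int_{\mathbb{R}}d|\widehat u|$. For $\alpha\ge0$, $\mathcal{B}_\alpha$ is the subspace of $C^0_t(\mathbb{R}_{\ge0};B_0)$ of functions $u(x,t)$ for which the norm $$\|u\|_{\mathcal{B}_\alpha}=\inf\Big\{\mu(\mathbb{R}):\ \mu\text{ a positive bounded measure on }\mathbb{R},\ |e^{\alpha t|\xi|}\widehat u(\xi,t)|\le\mu\text{ for all }t\ge0\Big\}$$ is finite (the inequality is between measures in $\xi$; the Fourier transform is in $x$). *)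

(* Defs.v *)
From HB Require Import structures.
From mathcomp Require Import all_boot all_order all_algebra.
From mathcomp Require Import all_classical all_reals all_analysis.
From mathcomp Require Import ring lra.

Set Implicit Arguments.
Unset Strict Implicit.
Unset Printing Implicit Defensive.

Import Order.TTheory GRing.Theory Num.Theory.
Import numFieldNormedType.Exports.

Local Open Scope classical_set_scope.
Local Open Scope ring_scope.

(* Charges are finite valued: a complex measure is a bounded measure. *)
Record complex_measure d (T : measurableType d) (R : realType) :=
  ComplexMeasure {
    re_part : {charge set T -> \bar R} ;
    im_part : {charge set T -> \bar R} }.

Section total_variation.
Local Open Scope ereal_scope.
Context d (T : measurableType d) (R : realType).
Variable nu : complex_measure T R.

Definition modulus (A : set T) : R :=
  Num.sqrt (fine (re_part nu A) ^+ 2 + fine (im_part nu A) ^+ 2)%R.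

(* |nu|(A) is the supremum of the sums of the |nu(B_i)| over the finite families
   of pairwise disjoint measurable subsets B_i of A. *)
Definition total_variation (A : set T) : \bar R :=
  ereal_sup [set s | exists (n : nat) (B : nat -> set T),
    [/\ forall i, measurable (B i), trivIset setT B, forall i, B i `<=` A &
        s = \sum_(i < n) (modulus (B i))%:E] ].

Lemma modulus_ge0 A : (0 <= modulus A)%R. Proof. exact: sqrtr_ge0. Qed.

Lemma modulus0 : modulus set0 = 0%R.
Proof. by rewrite /modulus !charge0/= expr0n/= addr0 sqrtr0. Qed.

Lemma le_hypotD (a b c e : R) : (Num.sqrt ((a + c) ^+ 2 + (b + e) ^+ 2) <=
  Num.sqrt (a ^+ 2 + b ^+ 2) + Num.sqrt (c ^+ 2 + e ^+ 2))%R.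
Proof.
set x := Num.sqrt (a ^+ 2 + b ^+ 2)%R; set y := Num.sqrt (c ^+ 2 + e ^+ 2)%R.
have x0 : (0 <= x)%R by exact: sqrtr_ge0.
have y0 : (0 <= y)%R by exact: sqrtr_ge0.
have xE : (x ^+ 2 = a ^+ 2 + b ^+ 2)%R by rewrite sqr_sqrtr// addr_ge0// sqr_ge0.
have yE : (y ^+ 2 = c ^+ 2 + e ^+ 2)%R by rewrite sqr_sqrtr// addr_ge0// sqr_ge0.
rewrite -(ger0_norm (addr_ge0 x0 y0)) -sqrtr_sqr ler_wsqrtr//.
have xy : (a * c + b * e <= x * y)%R.
  apply: (le_trans (ler_norm _)).
  rewrite -(ger0_norm (mulr_ge0 x0 y0)) -!sqrtr_sqr ler_wsqrtr// exprMn xE yE.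
  rewrite -subr_ge0 (_ : _ - _ = (a * e - b * c) ^+ 2)%R ?sqr_ge0//.
  by rewrite !expr2; ring.
rewrite (sqrrD x) xE yE.
rewrite -subr_ge0 (_ : _ - _ = (x * y - (a * c + b * e)) *+ 2)%R.
  by rewrite mulrn_wge0// subr_ge0.
rewrite !expr2 !mulr2n; ring.
Qed.

Lemma modulus_le_nneseries (F : (set T)^nat) : (forall k, measurable (F k)) ->
  trivIset setT F ->
  (modulus (\bigcup_k F k))%:E <= \sum_(0 <= k <oo) (modulus (F k))%:E.
Proof.
move=> mF tF.
have mU : measurable (\bigcup_k F k) by exact: bigcup_measurable.
have cv (c : {charge set T -> \bar R}) :
    (\sum_(0 <= k < n) fine (c (F k)))%R @[n --> \oo] --> fine (c (\bigcup_k F k)).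
  have H := @charge_semi_sigma_additive _ _ _ c F mF tF mU.
  rewrite (_ : (fun n => _) = fine \o (fun n => (\sum_(0 <= k < n) c (F k))%E)).
    by apply: fine_cvg; rewrite fineK ?fin_num_measure.
  apply/funext => n /=; rewrite -[LHS]/(fine _%:E) -sumEFin; congr fine.
  by apply: eq_bigr => k _; rewrite fineK// fin_num_measure.
pose G n := Num.sqrt ((\sum_(0 <= k < n) fine (re_part nu (F k))) ^+ 2 +
                      (\sum_(0 <= k < n) fine (im_part nu (F k))) ^+ 2)%R.
have GE : (G n)%:E @[n --> \oo] --> (modulus (\bigcup_k F k))%:E.
  apply: cvg_EFin; first exact: nearW.
  apply: (@continuous_cvg _ _ _ _ _ _ (@Num.sqrt R)); first exact: sqrt_continuous.
  by apply: cvgD; rewrite expr2; under eq_fun do rewrite expr2; apply: cvgM; exact: cv.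
rewrite -(cvg_lim _ GE)//.
apply: lee_lim; [by apply/cvg_ex; eexists; exact: GE| |].
  by apply: is_cvg_nneseries => n _ _; rewrite lee_fin modulus_ge0.
apply: nearW => n; rewrite sumEFin lee_fin.
rewrite /G; elim: n => [|n ih].
  by rewrite !big_nil expr0n/= addr0 sqrtr0.
rewrite !big_nat_recr//=; apply: (le_trans (le_hypotD _ _ _ _)).
by rewrite lerD.
Qed.

Lemma total_variation0 : total_variation set0 = 0.
Proof.
apply/eqP; rewrite eq_le; apply/andP; split.
  apply: ge_ereal_sup => _ [n [B [_ _ B0 ->]]].
  rewrite big1// => i _.
  have -> : B i = set0 by apply/seteqP; split=> // ? /B0.
  by rewrite modulus0.
apply: ereal_sup_ubound; exists 0%N, (fun=> set0).
split=> [i||i|]; [exact: measurable0| |exact: sub0set|by rewrite big_ord0].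
by apply/trivIsetP => i j _ _ _; rewrite set0I.
Qed.

Lemma total_variation_ge0 A : 0 <= total_variation A.
Proof.
apply: ereal_sup_ubound; exists 0%N, (fun=> set0).
split=> [i||i|]; [exact: measurable0| |exact: sub0set|by rewrite big_ord0].
by apply/trivIsetP => i j _ _ _; rewrite set0I.
Qed.

Lemma le_total_variation A B : A `<=` B ->
  total_variation A <= total_variation B.
Proof.
move=> AB; apply: ereal_sup_le => _ [n [C [mC tC CA ->]]].
exists n, C; split => // i; exact: subset_trans (CA i) AB.
Qed.

Lemma total_variationU A B : A `&` B = set0 ->
  total_variation A + total_variation B <= total_variation (A `|` B).
Proof.
move=> AB0; set V := total_variation (A `|` B).
have [->|Vy] := eqVneq V +oo; first by rewrite leey.
have Bfin : total_variation B \is a fin_num.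
  rewrite ge0_fin_numE ?total_variation_ge0//.
  by rewrite (le_lt_trans (@le_total_variation B (A `|` B) _)) ?ltey//; right.
rewrite -leeBrDr//; apply: ge_ereal_sup => _ [n [C [mC tC CA ->]]].
rewrite leeBrDr// addeC -leeBrDr ?sumEFin//; apply: ge_ereal_sup => _ [m [D [mD tD DB ->]]].
rewrite leeBrDr// addeC -sumEFin; apply: ereal_sup_ubound.
exists (n + m)%N, (fun i => if (i < n)%N then C i else D (i - n)%N).
split => [i|||]; first by case: ifP.
- apply/trivIsetP => i j _ _ ij.
  have CD p q : C p `&` D q = set0.
    by apply/seteqP; split=> // x [/CA ? /DB ?]; rewrite -AB0.
  case: ifPn => i_n; case: ifPn => j_n; rewrite ?CD// 1?setIC ?CD//.
    by rewrite setIC; move/trivIsetP : tC; exact.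
  rewrite setIC; move/trivIsetP : tD; apply => //.
  apply: contra ij => /eqP; rewrite -!leqNgt in i_n j_n.
  by move=> h; apply/eqP; rewrite -(subnK i_n) -(subnK j_n) h.
- move=> i; case: ifP => _ x; [move=> /CA; left|move=> /DB; right] => //.
rewrite big_split_ord/=; congr (_ + _); apply: eq_bigr => i _.
  by rewrite ltn_ord.
by rewrite ltnNge leq_addr/= addKn.
Qed.

Lemma total_variation_sigma_additive :
  measure_function.semi_sigma_additive total_variation.
Proof.
move=> F mF tF mU.
have cvF : cvgn (fun n => \sum_(0 <= i < n) total_variation (F i)).
  by apply: is_cvg_nneseries => *; exact: total_variation_ge0.
suff <- : \sum_(0 <= i <oo) total_variation (F i) =
  total_variation (\bigcup_n F n) by exact: cvF.
apply/eqP; rewrite eq_le; apply/andP; split.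
  apply: lime_le => //; apply: nearW => n.
  apply: (@le_trans _ _ (total_variation (\bigcup_(i < n) F i))); last first.
    by apply: le_total_variation; exact: bigcup_subset.
  elim: n => [|n ih].
    by rewrite big_nil total_variation_ge0.
  rewrite big_nat_recr//= bigcup_mkord big_ord_recr/= -bigcup_mkord.
  apply: (le_trans _ (total_variationU _)); first by rewrite leeD2r.
  rewrite setIC setI_bigcupr bigcup0// => i /= i_n.
  by move/trivIsetP : tF; apply => //; rewrite gt_eqF.
apply: ge_ereal_sup => _ [n [B [mB tB BU ->]]].
apply: (@le_trans _ _ (\sum_(i < n) \sum_(0 <= k <oo) (modulus (B i `&` F k))%:E)).
  apply: lee_sum => i _.
  rewrite {1}(_ : B i = \bigcup_k (B i `&` F k)).
    apply: modulus_le_nneseries => [k|]; first exact: measurableI.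
    exact: trivIset_setIl.
  by rewrite -setI_bigcupr; apply/esym/setIidPl; exact: BU.
rewrite -nneseries_sum; last by move=> *; rewrite lee_fin modulus_ge0.
apply: lee_nneseries => [k _ _|k _].
  by apply: sume_ge0 => i _; rewrite lee_fin modulus_ge0.
apply: ereal_sup_ubound; exists n, (fun i => B i `&` F k); split => //.
- by move=> i; exact: measurableI.
- exact: trivIset_setIr.
Qed.

HB.instance Definition _ := isMeasure.Build d T R total_variation
  total_variation0 total_variation_ge0 total_variation_sigma_additive.
End total_variation.

(* Integral of a real function against a signed measure, through its Jordan
   decomposition (which does not depend on the Hahn decomposition chosen). *)
Section charge_integral.
Context d (T : measurableType d) (R : realType).
Variable nu : {charge set T -> \bar R}.

Let hahn_ex := cid (Hahn_decomposition nu).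
Let hahn_ex2 := cid (svalP hahn_ex).

Definition positive_variation : {measure set T -> \bar R} :=
  jordan_pos (svalP hahn_ex2).

Definition negative_variation : {measure set T -> \bar R} :=
  jordan_neg (svalP hahn_ex2).

Definition charge_integral (D : set T) (g : T -> R) : R :=
  \int[positive_variation]_(x in D) g x - \int[negative_variation]_(x in D) g x.
End charge_integral.

Section wiener_spaces.
Context (R : realType).

Local Notation cmeasure := (complex_measure (measurableTypeR R) R).
Implicit Types (nu : cmeasure) (u w : R -> R) (v : R -> R -> R).

(* The measure nu is the Fourier transform of the real function u, with
   \hat u(xi) = \int e^{-i xi x} u(x) dx: since u need not be integrable, this is
   expressed by Fourier inversion, u(x) = (2 pi)^-1 \int e^{i xi x} d nu(xi),
   whose real and imaginary parts are written out. *)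
Definition is_fourier u nu := forall x : R,
  charge_integral (re_part nu) setT (fun xi => cos (xi * x)) -
  charge_integral (im_part nu) setT (fun xi => sin (xi * x)) = 2 * pi * u x /\
  charge_integral (re_part nu) setT (fun xi => sin (xi * x)) +
  charge_integral (im_part nu) setT (fun xi => cos (xi * x)) = 0.

Definition in_B0 u := exists nu, is_fourier u nu.

(* \hat u is unique, so this is an infimum over at most one value; it is +oo
   outside B_0. *)
Definition B0_norm u : \bar R :=
  ereal_inf [set total_variation nu setT | nu in is_fourier u].

(* Time is the first argument of functions of (t, x). *)

Definition continuous_in_B0 v :=
  (forall t, 0 <= t -> in_B0 (v t)) /\
  (forall t, 0 <= t ->
    B0_norm (fun x => v s x - v t x) @[s --> within `[0, +oo[ (nbhs t)]
      --> 0%E).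

(* |e^{alpha t |xi|} \hat v(xi, t)| <= mu for all t >= 0. *)
Definition dominates (alpha : R) v
    (mu : {finite_measure set (measurableTypeR R) -> \bar R}) :=
  forall t, 0 <= t -> exists2 nu, is_fourier (v t) nu &
    forall A : set (measurableTypeR R), measurable A ->
      (\int[total_variation nu]_(xi in A) (expR (alpha * t * `|xi|))%:E <= mu A)%E.

Definition Balpha_norm (alpha : R) v : \bar R :=
  ereal_inf [set (mu : set (measurableTypeR R) -> \bar R) setT
            | mu in dominates alpha v].

Definition in_Balpha (alpha : R) v :=
  continuous_in_B0 v /\ (Balpha_norm alpha v < +oo)%E.

(* w = Lambda u: the measure \hat w is |xi| \hat u. *)
Definition is_Lambda u w := exists nu nu' : cmeasure,
  [/\ is_fourier u nu, is_fourier w nu',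
      (total_variation nu).-integrable setT (fun xi => `|xi|%:E) &
      forall A : set (measurableTypeR R), measurable A ->
        re_part nu' A = (charge_integral (re_part nu) A (fun xi => `|xi|))%:E /\
        im_part nu' A = (charge_integral (im_part nu) A (fun xi => `|xi|))%:E].

End wiener_spaces.

Section muskat.
Context (R : realType).
Implicit Types (g : R -> R) (f : R -> R -> R).

Definition truncated_integral (h : R -> R) (x : R) (p : R * R) : R :=
  \int[lebesgue_measure]_(x' in [set x' | p.1 < `|x - x'| < p.2]) h x'.

(* Principal value at x' = x and at infinity. *)
Definition pv_filter : set_system (R * R) := filter_prod 0^'+ +oo.

Definition slope g (x x' : R) : R := (g x - g x') / (x - x').

Definition muskat_integrand g (x x' : R) : R :=
  (derive1 g x - derive1 g x') / (x - x') *
  (slope g x x' ^+ 2 / (1 + slope g x x' ^+ 2)).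

Definition pv_exists g (x : R) :=
  cvg (truncated_integral (muskat_integrand g x) x @ pv_filter).

Definition muskat_N (rho_m rho_p : R) g (x : R) : R :=
  - ((rho_m - rho_p) / (2 * pi)) *
    lim (truncated_integral (muskat_integrand g x) x @ pv_filter).

Definition dx f (t x : R) : R := derive1 (f t) x.

(* The equation is required pointwise at every t > 0; at t = 0, where Lambda f_x
   need not be a function, the datum is attained in C([0, +oo), B_0). *)
Definition muskat_solution (rho_m rho_p alpha : R) (f0 : R -> R) f :=
  [/\ forall t x, 0 <= t -> derivable (f t) x 1,
      in_Balpha alpha (dx f),
      forall x, dx f 0 x = derive1 f0 x &
      forall t, 0 < t -> exists2 w, is_Lambda (dx f t) w &
        forall x, [/\ derivable (fun s => dx f s x) t 1,
          pv_exists (f t) x,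
          derivable (muskat_N rho_m rho_p (f t)) x 1 &
          derive1 (fun s => dx f s x) t + (rho_m - rho_p) / 2 * w x =
          derive1 (muskat_N rho_m rho_p (f t)) x]].

End muskat.

(* Main.v *)
From HB Require Import structures.
Require Import Defs.
From mathcomp Require Import all_boot all_order all_algebra.
From mathcomp Require Import all_classical all_reals all_analysis.
From mathcomp Require Import measurable_realfun simple_functions.
From mathcomp Require Import ring lra.
Import Order.TTheory GRing.Theory Num.Theory.
Import numFieldNormedType.Exports.
Set Implicit Arguments.
Unset Strict Implicit.
Unset Printing Implicit Defensive.
Local Open Scope classical_set_scope.
Local Open Scope ring_scope.

(** The unknown f_x is described by a positive measure on a phase space: a finite
    measure [p] on triples h = (xi, eta, theta) stands for the function
    [ev p x y 0], the integral of cos (xi x - eta y + theta) against [p].  The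
    angle theta carries what the argument of a complex density would carry, so
    that inequalities between positive measures replace absolute values of
    complex ones, and monotone limits are available.  For f_x only y = 0 matters;
    y is the displacement x - x' in the integral that defines N.

    On such measures the nonlinearity is monotone.  The slope (f(x) - f(x-y))/y
    is the average of f_x(x - ty) over t in [0,1] ([slopem]); a product of
    transforms is the transform of a kind of convolution ([mulm]); the geometric
    series of S^2/(1+S^2) converges in mass as soon as the slope S has mass at
    most 1/2 ([tailm]).  The truncated integrals of sin(eta y)/y converge to a
    constant times the sign of eta, so the principal value exists and the
    derivative of N(f) is the transform of |xi| times a measure [Tm], with mass
    cubic in the mass of [p] ([muskat_N_E], [muskat_N_derive]).  Frequencies add,
    so a bound e^{b|xi|} p <= P passes through the whole construction ([wle_Tm]).

    Existence.  With c = (rho_- - rho_+)/2 and alpha = c/2, the Duhamel kernel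
    e^{-c(t-s)|xi|} |xi|, tested on measures that decay like e^{-alpha s|xi|},
    has integral in s at most e^{-alpha t|xi|}/alpha: the smoothing pays for the
    derivative and the weight survives ([duh_bound]).  Hence the iteration
    started from 0 increases to a fixed point dominated by a single measure of
    small mass ([mild_exists]).  It is continuous in time ([near_mild]) and solves
    the differential equation for t > 0 ([is_derive_mild]).

    Uniqueness.  The other solution is an arbitrary one, of which only the values
    are known.  The kernel 1/(1 + X^2 (xi - x)^2) is an average of cosines
    ([bump_unif]), so the average of a Fourier transform against it is computed
    from the values of the function ([bump_transform]).  For the difference of two
    solutions this average obeys, up to an error that disappears as X grows, an
    equation of relaxation with rate c|x| and a source c|x| times the average of
    a bound of the difference of the nonlinear terms ([gap_average]).  Local
    averages control measures ([mle_kernel]), so the difference is bounded by a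
    measure with half the mass of any measure bounding it before, hence is zero
    ([gap_vanishes]).  The same averages show that a transform determines its
    Fourier measure, which identifies Lambda f_x ([is_Lambda_E]). *)

(** * Measures built from positive functionals *)

Section nnm.
Local Open Scope ereal_scope.
Context (R : realType) d (T : measurableType d).
Definition nnm (f : T -> \bar R) := measurable_fun setT f /\ forall x, 0 <= f x.

(** Integration against a measure, seen as a countably additive and
    homogeneous functional on nonnegative measurable functions. *)
Definition posfun (L : (T -> \bar R) -> \bar R) :=
  [/\ forall f, nnm f -> 0 <= L f,
      forall f : nat -> T -> \bar R, (forall n, nnm (f n)) ->
        L (fun x => \sum_(n <oo) f n x) = \sum_(n <oo) L (f n) &
      forall k f, (0 <= k)%R -> nnm f -> L (fun x => k%:E * f x) = k%:E * L f].

Lemma nnm_cst (k : \bar R) : 0 <= k -> nnm (fun=> k).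
Proof. by move=> k0; split=> //; exact: measurable_cst. Qed.

Lemma nnmD f g : nnm f -> nnm g -> nnm (fun x => f x + g x).
Proof.
move=> [mf f0] [mg g0]; split; first exact: emeasurable_funD.
by move=> x; rewrite adde_ge0.
Qed.

Lemma nnmM f g : nnm f -> nnm g -> nnm (fun x => f x * g x).
Proof.
move=> [mf f0] [mg g0]; split; first exact: emeasurable_funM.
by move=> x; rewrite mule_ge0.
Qed.

Lemma nnm_EFin (w : T -> R) : measurable_fun setT w -> (forall x, (0 <= w x)%R) ->
  nnm (fun x => (w x)%:E).
Proof. by move=> mw w0; split=> [|x]; [exact/measurable_EFinP|rewrite lee_fin]. Qed.

Lemma nnm_indic (A : set T) : measurable A -> nnm (fun x => (\1_A x)%:E).
Proof. by move=> mA; apply: nnm_EFin. Qed.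

Lemma nnm_series (f : nat -> T -> \bar R) : (forall n, nnm (f n)) ->
  nnm (fun x => \sum_(n <oo) f n x).
Proof.
move=> mf; split; last first.
  by move=> x; apply: nneseries_ge0 => n _ _; have [_] := mf n.
apply: ge0_emeasurable_sum => //.
- by move=> n x _ _; have [_] := mf n.
- by move=> n _; have [] := mf n.
Qed.

Lemma nnm_comp d' (Y : measurableType d') (phi : T -> Y) (f : Y -> \bar R) :
  measurable_fun setT phi -> measurable_fun setT f /\ (forall x, 0 <= f x) ->
  nnm (fun x => f (phi x)).
Proof. by move=> mphi [mf f0]; split=> [|x //]; exact: measurableT_comp. Qed.

Lemma nnm_integral (m : {measure set T -> \bar R}) f : nnm f -> 0 <= \int[m]_x f x.
Proof. by move=> [_ f0]; apply: integral_ge0. Qed.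

Section posfun_theory.
Import HBNNSimple.
Variables (L : (T -> \bar R) -> \bar R) (pL : posfun L).

Lemma posfun0 : L (fun=> 0) = 0.
Proof.
have [_ _ Lk] := pL.
have := Lk 0%R (fun=> 0) (lexx _) (nnm_cst (lexx 0)).
by under [X in L X]eq_fun do rewrite mul0e; rewrite mul0e.
Qed.

Lemma posfunD f g : nnm f -> nnm g -> L (fun x => f x + g x) = L f + L g.
Proof.
move=> nf ng; have [L0 Ls _] := pL.
pose h (n : nat) : T -> \bar R := if n is 0%N then f else if n is 1%N then g else fun=> 0.
have nh n : nnm (h n) by move: n => [//|[//|n]] /=; exact: nnm_cst.
have sum2 (a : nat -> \bar R) : (forall n, 0 <= a n) -> (forall n, (1 < n)%N -> a n = 0) ->
    \sum_(n <oo) a n = a 0%N + a 1%N.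
  move=> a0 a1; rewrite (nneseries_split 0 2)//.
  rewrite [X in _ + X]eseries0; last by move=> i; rewrite add0n/= => ? _; exact: a1.
  by rewrite adde0 add0n !big_nat_recr//= big_nil add0e.
have := Ls h nh; rewrite [in RHS]sum2 => [<-||].
- by congr L; apply/funext => x; rewrite sum2// => [n|[//|[//|n]]//]; have [_] := nh n.
- by move=> n; exact: L0.
- by move=> [//|[//|n]] _; exact: posfun0.
Qed.

Lemma posfun_sum (I : Type) (s : seq I) (f : I -> T -> \bar R) :
  (forall i, nnm (f i)) ->
  L (fun x => \sum_(i <- s) f i x) = \sum_(i <- s) L (f i).
Proof.
move=> nf; have nS s' : nnm (fun x => \sum_(i <- s') f i x).
  elim: s' => [|i s' ih]; first by under eq_fun do rewrite big_nil; exact: nnm_cst.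
  by under eq_fun do rewrite big_cons; exact: nnmD.
elim: s => [|i s ih].
  by under [X in L X]eq_fun do rewrite big_nil; rewrite big_nil posfun0.
by under [X in L X]eq_fun do rewrite big_cons; rewrite posfunD// big_cons ih.
Qed.

Lemma le_posfun f g : nnm f -> nnm g -> (forall x, g x \is a fin_num) ->
  (forall x, g x <= f x) -> L g <= L f.
Proof.
move=> nf ng fg gf; have [L0 _ _] := pL.
have nfg : nnm (fun x => f x - g x).
  split; first by apply: emeasurable_funB; [case: nf|case: ng].
  by move=> x; rewrite sube_ge0 ?fg ?orbT.
rewrite (_ : f = fun x => g x + (f x - g x)); last first.
  by apply/funext => x; rewrite addeC subeK.
by rewrite posfunD// leeDl// L0.
Qed.

Hypothesis L1 : L (fun=> 1) < +oo.

(** A positive functional is integration against the measure A |-> L(1_A):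
    this holds for simple functions, and a nonnegative function is a
    countable sum of differences of its simple approximations. Every
    operation on measures below is obtained this way from its action on
    functions. *)
Lemma posfun_measure : exists mu : {finite_measure set T -> \bar R},
  forall f, nnm f -> \int[mu]_x f x = L f.
Proof.
have [L0 Ls Lk] := pL.
pose m (A : set T) : \bar R :=
  if A \in measurable then L (fun x => (\1_A x)%:E) else 0.
have mE A : measurable A -> m A = L (fun x => (\1_A x)%:E).
  by move=> mA; rewrite /m mem_set.
have m0 : m set0 = 0.
  rewrite mE// (_ : (fun x => _) = fun=> 0) ?posfun0//.
  by apply/funext => x; rewrite indic0.
have mge0 A : 0 <= m A.
  by rewrite /m; case: ifPn => // /set_mem mA; apply/L0/nnm_indic.
have msa : semi_sigma_additive m.
  move=> F mF tF mU.
  have -> : m (\bigcup_n F n) = \sum_(n <oo) m (F n).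
    rewrite mE// (_ : (fun x => _) = fun x => \sum_(n <oo) (\1_(F n) x)%:E).
      rewrite Ls; last by move=> n; exact: nnm_indic.
      by apply: eq_eseriesr => n _; rewrite mE.
    apply/funext => x.
    by rewrite -[LHS]/(\d_x (\bigcup_n F n)) (measure_semi_bigcup (\d_x))//.
  exact: is_cvg_ereal_nneg_natsum.
have [mu muE] : exists mu : {finite_measure set T -> \bar R}, forall A, mu A = m A.
  pose mA := isMeasure.Build _ T R m m0 mge0 msa.
  pose mu0 : {measure set T -> \bar R} := HB.pack m mA.
  have fin : fin_num_fun m.
    move=> A mA'; rewrite ge0_fin_numE// (le_lt_trans _ L1)// mE//.
    apply: le_posfun => [| |x|x]; [exact: nnm_cst|exact: nnm_indic|by []|].
    by rewrite lee_fin indicE; case: (_ \in _).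
  pose mB := Measure_isFinite.Build _ T R mu0 fin.
  pose mu : {finite_measure set T -> \bar R} := HB.pack (Measure.sort mu0) mu0 mB.
  by exists mu.
exists mu => f [mf f0].
have Lsf (g : {nnsfun T >-> R}) : L (fun x => (g x)%:E) = \int[mu]_x (g x)%:E.
  rewrite integralT_nnsfun sintegralE fsbig_finite//=.
  rewrite (_ : (fun x => (g x)%:E) = fun x => \sum_(i <- finmap.enum_fset (fset_set (range g)))
     (`|i|%:E * (\1_(g @^-1` [set i]) x)%:E)); last first.
    apply/funext => x; rewrite [in LHS](fimfunE g) fsbig_finite//= -sumEFin.
    rewrite big_seq [RHS]big_seq; apply: eq_bigr => i.
    rewrite in_fset_set// inE => -[y _ <-].
    by rewrite EFinM ger0_norm.
  rewrite posfun_sum; last first.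
    move=> i; apply: nnmM; last by apply: nnm_indic.
    by apply: nnm_cst; rewrite lee_fin normr_ge0.
  rewrite big_seq [RHS]big_seq; apply: eq_bigr => i.
  rewrite in_fset_set// inE => -[y _ <-].
  rewrite Lk; last by apply: nnm_indic.
    by rewrite ger0_norm// muE -mE.
  exact: normr_ge0.
(* f is the sum of the increments of its simple approximations, on which L is additive. *)
pose g := nnsfun_approx measurableT mf.
pose h n : T -> \bar R := if n is n'.+1 then fun x => (g n'.+1 x)%:E - (g n' x)%:E
                else fun x => (g 0%N x)%:E.
have ng n : nnm (fun x => (g n x)%:E) by apply: nnm_EFin => //.
have nh n : nnm (h n).
  case: n => [|n]; first exact: ng.
  split; first by apply: emeasurable_funB; [case: (ng n.+1)|case: (ng n)].
  move=> x; rewrite /h -EFinB lee_fin subr_ge0.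
  by have /(_ n n.+1 (leqnSn _))/lefP := @nd_nnsfun_approx _ _ _ _ measurableT _ mf.
have part n x : \sum_(0 <= i < n.+1) h i x = (g n x)%:E.
  elim: n => [|n ih]; first by rewrite big_nat1.
  by rewrite big_nat_recr//= ih /= -EFinB -EFinD addrC subrK.
have fE x : f x = \sum_(n <oo) h n x.
  apply/esym/cvg_lim => //.
  rewrite -cvg_shiftS /=; under eq_fun do rewrite part.
  exact: cvg_nnsfun_approx.
have -> : f = fun x => \sum_(n <oo) h n x by apply/funext.
rewrite Ls// integral_nneseries//; last 2 first.
  by move=> n; have [] := nh n.
  by move=> n x _; have [_] := nh n.
apply: eq_eseriesr => n _; case: n => [|n] /=; first by rewrite Lsf.
have LD k : L (fun x => (g k.+1 x)%:E) = L (h k.+1) + L (fun x => (g k x)%:E).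
  rewrite -posfunD//; congr L; apply/funext => x /=.
  by rewrite -EFinB -EFinD subrK.
have ID : \int[mu]_x (g n.+1 x)%:E = \int[mu]_x h n.+1 x + \int[mu]_x (g n x)%:E.
  rewrite -ge0_integralD//; last 4 first.
  - by move=> x _; have [_] := nh n.+1.
  - by have [] := nh n.+1.
  - by move=> x _; have [_] := ng n.
  - by have [] := ng n.
  by apply: eq_integral => x _ /=; rewrite -EFinB -EFinD subrK.
have fing : \int[mu]_x (g n x)%:E \is a fin_num.
  apply: integrable_fin_num => //; apply: measurable_bounded_integrable => //.
    exact: fin_num_fun_lty.
  exact: simple_bounded.
have := LD n; rewrite !Lsf ID; rewrite addeC => /esym; rewrite addeC.
move=> /(congr1 (fun z => z - \int[mu]_x (g n x)%:E)).
by rewrite !addeK.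
Qed.
End posfun_theory.
End nnm.

(** The zero measure is a default for functionals that do not come from a
    finite measure. *)
HB.lock Definition mk (R : realType) d (T : measurableType d) (L : (T -> \bar R) -> \bar R) :
    {finite_measure set T -> \bar R} :=
  if pselect (exists mu : {finite_measure set T -> \bar R},
     forall f, nnm f -> (\int[mu]_x f x = L f)%E) is left h then projT1 (cid h) else mzero.

HB.lock Definition pushf (R : realType) dX dY (X : measurableType dX) (Y : measurableType dY)
    (phi : X -> Y) (m : {finite_measure set X -> \bar R}) : {finite_measure set Y -> \bar R} :=
  mk (fun f => \int[m]_x f (phi x))%E.

HB.lock Definition push2 (R : realType) dX dY dZ (X : measurableType dX) (Y : measurableType dY)
    (Z : measurableType dZ) (phi : X * Y -> Z) (m : {finite_measure set X -> \bar R})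
    (n : {finite_measure set Y -> \bar R}) : {finite_measure set Z -> \bar R} :=
  mk (fun f => \int[m]_x \int[n]_y f (phi (x, y)))%E.

Definition mixf (R : realType) (X Y Z : Type) (phi1 phi2 : X * Y -> Z) (f : Z -> \bar R)
    (xy : X * Y) : \bar R :=
  (2^-1%:E * (f (phi1 xy) + f (phi2 xy)))%E.

(** The average of two images of a product measure: cos a cos b is the
    average of cos(a+b) and cos(a-b), so products of cosine transforms are
    of this form. *)
HB.lock Definition mix2 (R : realType) dX dY dZ (X : measurableType dX) (Y : measurableType dY)
    (Z : measurableType dZ) (phi1 phi2 : X * Y -> Z) (m : {finite_measure set X -> \bar R})
    (n : {finite_measure set Y -> \bar R}) : {finite_measure set Z -> \bar R} :=
  mk (fun f => \int[m]_x \int[n]_y mixf phi1 phi2 f (x, y))%E.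

HB.lock Definition madd (R : realType) d (X : measurableType d)
    (m n : {finite_measure set X -> \bar R}) : {finite_measure set X -> \bar R} :=
  mk (fun f => \int[m]_x f x + \int[n]_x f x)%E.

HB.lock Definition dens (R : realType) d (X : measurableType d) (w : X -> R)
    (m : {finite_measure set X -> \bar R}) : {finite_measure set X -> \bar R} :=
  mk (fun f => \int[m]_x ((w x)%:E * f x))%E.

HB.lock Definition mser (R : realType) d (X : measurableType d)
    (m : nat -> {finite_measure set X -> \bar R}) : {finite_measure set X -> \bar R} :=
  mk (fun f => \sum_(k <oo) \int[m k]_x f x)%E.

Section mk.
Local Open Scope ereal_scope.
Context (R : realType).

Lemma posfun_integral d (T : measurableType d) (m : {measure set T -> \bar R}) :
  posfun (fun f => \int[m]_x f x).
Proof.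
split=> [f|f nf|k f k0 [mf f0]]; first exact: nnm_integral.
  by apply: integral_nneseries => // [n|n x _]; [case: (nf n)|case: (nf n)].
by rewrite ge0_integralZl_EFin.
Qed.

Lemma posfun_kernel dX dY (X : measurableType dX) (Y : measurableType dY)
    (L : (X -> \bar R) -> \bar R) (K : (Y -> \bar R) -> X -> \bar R) :
  posfun L -> (forall f, nnm f -> nnm (K f)) -> (forall x, posfun (K ^~ x)) ->
  posfun (fun f => L (K f)).
Proof.
move=> [L0 Ls Lk] nK pK; split.
- by move=> f /nK; exact: L0.
- move=> f nf; rewrite -Ls => [|n]; last exact: nK.
  by congr L; apply/funext => x; have [_ + _] := pK x; exact.
- move=> k f k0 nf; rewrite -Lk//; last exact: nK.
  by congr L; apply/funext => x; have [_ _] := pK x; exact.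
Qed.

Lemma posfunDf d (T : measurableType d) (L1 L2 : (T -> \bar R) -> \bar R) :
  posfun L1 -> posfun L2 -> posfun (fun f => L1 f + L2 f).
Proof.
move=> [p0 ps pk] [q0 qs qk]; split.
- by move=> f nf; rewrite adde_ge0 ?p0 ?q0.
- by move=> f nf; rewrite ps// qs// nneseriesD// => n _ _; [exact: p0|exact: q0].
- by move=> k f k0 nf; rewrite pk// qk// ge0_muleDr ?p0 ?q0.
Qed.

Lemma posfun_seriesf d (T : measurableType d) (L : nat -> (T -> \bar R) -> \bar R) :
  (forall n, posfun (L n)) -> posfun (fun f => \sum_(n <oo) L n f).
Proof.
move=> pL; split.
- by move=> f nf; apply: nneseries_ge0 => n _ _; have [+ _ _] := pL n; exact.
- move=> f nf; rewrite nneseries_interchange; last first.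
    by move=> i j; have [+ _ _] := pL j; exact.
  by apply: eq_eseriesr => n _; have [_ + _] := pL n; exact.
- move=> k f k0 nf; rewrite -nneseriesZl//; last first.
    by move=> n _; have [+ _ _] := pL n; exact.
  by apply: eq_eseriesr => n _; have [_ _] := pL n; exact.
Qed.

Lemma posfun_comp dX dY (X : measurableType dX) (Y : measurableType dY) (phi : X -> Y)
    (L : (X -> \bar R) -> \bar R) : measurable_fun setT phi ->
  posfun L -> posfun (fun f => L (f \o phi)).
Proof.
move=> mphi pL; apply: (@posfun_kernel _ _ _ _ L (fun f => f \o phi)) => //.
  by move=> f nf; exact: (nnm_comp mphi).
by move=> x; split=> //= f [].
Qed.

Lemma mkE d (T : measurableType d) (L : (T -> \bar R) -> \bar R) :
  posfun L -> L (fun=> 1) < +oo -> forall f, nnm f -> \int[mk L]_x f x = L f.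
Proof.
move=> pL L1 f nf; rewrite mk.unlock; case: pselect => [h|]; first by case: cid => mu /=; exact.
by move/(_ (posfun_measure pL L1)).
Qed.

Lemma integral1 d (T : measurableType d) (m : {measure set T -> \bar R}) :
  \int[m]_x 1 = m setT.
Proof. by rewrite integral_cst// mul1e. Qed.

Lemma fin_total d (T : measurableType d) (m : {finite_measure set T -> \bar R}) :
  m setT < +oo.
Proof. exact: fin_num_fun_lty. Qed.

Lemma nnm_fubini dX dY (X : measurableType dX) (Y : measurableType dY)
  (m : {finite_measure set Y -> \bar R}) (f : X * Y -> \bar R) :
  nnm f -> nnm (fun x => \int[m]_y f (x, y)).
Proof.
move=> [mf f0]; split; first exact: (measurable_fun_fubini_tonelli_F f).
by move=> x; apply: integral_ge0.
Qed.

Lemma nnm_sec dX dY (X : measurableType dX) (Y : measurableType dY)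
  (f : X * Y -> \bar R) x : nnm f -> nnm (fun y => f (x, y)).
Proof. by apply: nnm_comp; exact: pair1_measurable. Qed.

Section ops.
Context dX dY dZ (X : measurableType dX) (Y : measurableType dY) (Z : measurableType dZ).

Lemma pushfE (phi : X -> Y) (m : {finite_measure set X -> \bar R}) f : measurable_fun setT phi -> nnm f ->
  \int[pushf phi m]_y f y = \int[m]_x f (phi x).
Proof.
move=> mphi nf; rewrite pushf.unlock mkE//; last by rewrite integral1 fin_total.
exact: (posfun_comp mphi (posfun_integral m)).
Qed.

Lemma push2E (phi : X * Y -> Z) (m : {finite_measure set X -> \bar R})
    (n : {finite_measure set Y -> \bar R}) f : measurable_fun setT phi -> nnm f ->
  \int[push2 phi m n]_z f z = \int[m]_x \int[n]_y f (phi (x, y)).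
Proof.
move=> mphi nf; rewrite push2.unlock mkE//; last first.
  under eq_integral do rewrite integral1.
  by rewrite integral_cst// lte_mul_pinfty ?fin_total// ge0_fin_numE ?fin_total.
apply: (@posfun_kernel _ _ _ _ (fun f => \int[m]_x f x)
    (fun f x => \int[n]_y f (phi (x, y)))) => [|g ng|x].
- exact: posfun_integral.
- apply: (@nnm_fubini _ _ _ _ n (fun z => g (phi z))).
  exact: nnm_comp ng.
- apply: (@posfun_comp _ _ _ _ (fun y => phi (x, y)) (fun f => \int[n]_x f x)).
    by apply: measurableT_comp => //; exact: pair1_measurable.
  exact: posfun_integral.
Qed.

Lemma nnm_mixf (phi1 phi2 : X * Y -> Z) (f : Z -> \bar R) : measurable_fun setT phi1 -> measurable_fun setT phi2 ->
  nnm f -> nnm (mixf phi1 phi2 f).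
Proof.
move=> m1 m2 nf; apply: nnmM; first by apply: nnm_cst; rewrite lee_fin invr_ge0.
by apply: nnmD; exact: nnm_comp.
Qed.

Lemma mix2E (phi1 phi2 : X * Y -> Z) (m : {finite_measure set X -> \bar R})
    (n : {finite_measure set Y -> \bar R}) f : measurable_fun setT phi1 -> measurable_fun setT phi2 ->
  nnm f -> \int[mix2 phi1 phi2 m n]_z f z = \int[m]_x \int[n]_y mixf phi1 phi2 f (x, y).
Proof.
move=> m1 m2 nf; rewrite mix2.unlock mkE//; last first.
  under eq_integral => x _ do under eq_integral => y _ do
    rewrite /mixf -EFinD -EFinM -[(1 + 1)%R]/2%:R mulVf//.
  under eq_integral do rewrite integral1.
  by rewrite integral_cst// lte_mul_pinfty ?fin_total// ge0_fin_numE ?fin_total.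
apply: (@posfun_kernel _ _ _ _ (fun f => \int[m]_x f x)
    (fun f x => \int[n]_y mixf phi1 phi2 f (x, y))) => [|g ng|x].
- exact: posfun_integral.
- by apply: (@nnm_fubini _ _ _ _ n); exact: nnm_mixf.
- apply: (@posfun_kernel _ _ _ _ (fun f => \int[n]_x f x)
    (fun f y => mixf phi1 phi2 f (x, y))) => [|g ng|y].
  + exact: posfun_integral.
  + by apply: (@nnm_sec _ _ _ _ (mixf phi1 phi2 g)); exact: nnm_mixf.
  + rewrite /mixf; split.
    * by move=> g [_ g0]; rewrite mule_ge0 ?adde_ge0 ?lee_fin ?invr_ge0.
    * move=> g ng; rewrite nneseriesZl; last first.
        by move=> i _; rewrite adde_ge0//; case: (ng i).
      by congr (_ * _); rewrite nneseriesD// => i _ _; case: (ng i).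
    * move=> k g k0 [_ g0]; rewrite -ge0_muleDr ?g0//.
      by rewrite muleCA.
Qed.

Lemma maddE (m n : {finite_measure set X -> \bar R}) f : nnm f -> \int[madd m n]_x f x = \int[m]_x f x + \int[n]_x f x.
Proof.
move=> nf; rewrite madd.unlock mkE//; first by apply: posfunDf; exact: posfun_integral.
by rewrite !integral1 lte_add_pinfty// fin_total.
Qed.

Lemma densE (w : X -> R) (m : {finite_measure set X -> \bar R}) f : measurable_fun setT w -> (forall x, (0 <= w x)%R) ->
  \int[m]_x (w x)%:E < +oo -> nnm f ->
  \int[dens w m]_x f x = \int[m]_x ((w x)%:E * f x).
Proof.
move=> mw w0 wfin nf; have nw : nnm (fun x => (w x)%:E) by exact: nnm_EFin.
rewrite dens.unlock mkE//; last by under eq_integral do rewrite mule1.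
apply: (@posfun_kernel _ _ _ _ (fun f => \int[m]_x f x) (fun f x => (w x)%:E * f x)).
- exact: posfun_integral.
- by move=> g ng; exact: nnmM.
- move=> x; split => [g [_ g0]|g ng|k g k0 ng]; first by rewrite mule_ge0 ?lee_fin.
  by rewrite nneseriesZl// => n _; case: (ng n).
  by rewrite muleCA.
Qed.

Lemma mserE (m : nat -> {finite_measure set X -> \bar R}) f : \sum_(k <oo) m k setT < +oo -> nnm f ->
  \int[mser m]_x f x = \sum_(k <oo) \int[m k]_x f x.
Proof.
move=> sfin nf; rewrite mser.unlock mkE//.
- by apply: posfun_seriesf => k; exact: posfun_integral.
- by under eq_eseriesr do rewrite integral1.
Qed.
End ops.

End mk.

Section order.
Local Open Scope ereal_scope.
Context (R : realType) d (T : measurableType d).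
Implicit Types (m n p q : {finite_measure set T -> \bar R}).

Definition mle m n := forall f, nnm f -> \int[m]_x f x <= \int[n]_x f x.

Lemma mle_refl m : mle m m. Proof. by move=> f _. Qed.

Lemma le_nnm m f g : nnm f -> nnm g -> (forall x, f x <= g x) ->
  \int[m]_x f x <= \int[m]_x g x.
Proof. by move=> [mf f0] [mg g0] fg; apply: ge0_le_integral. Qed.

Lemma mle_total m n : mle m n -> m setT <= n setT.
Proof. by move=> /(_ _ (nnm_cst T (@lee01 R))); rewrite !integral1. Qed.

Import HBNNSimple.

(** An inequality on sets extends to functions because nonnegative functions
    are increasing limits of simple ones. *)
Lemma mle_set (m n : {measure set T -> \bar R}) f :
  (forall A, measurable A -> m A <= n A) -> nnm f ->
  \int[m]_x f x <= \int[n]_x f x.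
Proof.
move=> mn [mf f0].
pose g := nnsfun_approx measurableT mf.
have lim (k : {measure set T -> \bar R}) :
    \int[k]_x f x = limn (fun j => \int[k]_x (g j x)%:E).
  rewrite -monotone_convergence//.
  - by apply: eq_integral => x _; apply/esym/cvg_lim => //; exact: cvg_nnsfun_approx.
  - by move=> j; apply/measurable_EFinP.
  - by move=> j x _; rewrite lee_fin.
  - by move=> x _ i j ij; rewrite lee_fin; exact/lefP/nd_nnsfun_approx.
have cv (k : {measure set T -> \bar R}) : cvgn (fun j => \int[k]_x (g j x)%:E).
  apply: ereal_nondecreasing_is_cvgn => i j ij; apply: ge0_le_integral => //.
  - by move=> x _; rewrite lee_fin.
  - exact/measurable_EFinP.
  - exact/measurable_EFinP.
  - by move=> x _; rewrite lee_fin; exact/lefP/nd_nnsfun_approx.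
rewrite !lim; apply: lee_lim => //; apply: nearW => j.
rewrite !integralT_nnsfun !sintegralE !fsbig_finite//=.
rewrite big_seq [leRHS]big_seq; apply: lee_sum => i.
by rewrite in_fset_set// inE => -[x _ <-]; rewrite lee_wpmul2l ?lee_fin ?mn.
Qed.

(** The absolute value of the signed measure p - q is at most e. *)
Definition near_by (p q e : {finite_measure set T -> \bar R}) := forall f, nnm f ->
  \int[p]_x f x <= \int[q]_x f x + \int[e]_x f x /\
  \int[q]_x f x <= \int[p]_x f x + \int[e]_x f x.

Lemma near_sym p q e : near_by p q e -> near_by q p e.
Proof. by move=> h f /h[]. Qed.

End order.

Section bounded.
Context (R : realType).

Definition bm d (T : measurableType d) (g : T -> R) :=
  measurable_fun setT g /\ exists C : R, forall x, `|g x| <= C.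

Definition RI d (T : measurableType d) (m : {finite_measure set T -> \bar R}) (g : T -> R) : R :=
  \int[m]_x g x.

Definition mass d (T : measurableType d) (m : {finite_measure set T -> \bar R}) : R :=
  fine (m setT).

Section basic.
Context d (T : measurableType d).
Implicit Types (m : {finite_measure set T -> \bar R}) (g h : T -> R).

Lemma massE m : (mass m)%:E = m setT.
Proof. by rewrite fineK// ge0_fin_numE ?fin_total. Qed.

Lemma bm_cst (c : R) : bm (fun _ : T => c).
Proof. by split=> //; exists `|c|. Qed.

Lemma bmD g h : bm g -> bm h -> bm (fun x => g x + h x).
Proof.
move=> [mg [C gC]] [mh [D hD]]; split; first exact: measurable_funD.
by exists (C + D) => x; rewrite (le_trans (ler_normD _ _))// lerD.
Qed.

Lemma bmN g : bm g -> bm (fun x => - g x).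
Proof.
move=> [mg [C gC]]; split; first exact: measurableT_comp.
by exists C => x; rewrite normrN.
Qed.

Lemma bmB g h : bm g -> bm h -> bm (fun x => g x - h x).
Proof. by move=> bg bh; apply: bmD => //; exact: bmN. Qed.

Lemma bmM g h : bm g -> bm h -> bm (fun x => g x * h x).
Proof.
move=> [mg [C gC]] [mh [D hD]]; split; first exact: measurable_funM.
by exists (C * D) => x; rewrite normrM ler_pM.
Qed.

Lemma bm_norm g : bm g -> bm (fun x => `|g x|).
Proof.
move=> [mg [C gC]]; split; first exact: measurableT_comp.
by exists C => x; rewrite normr_id.
Qed.

Lemma bm_max g h : bm g -> bm h -> bm (fun x => Num.max (g x) (h x)).
Proof.
move=> [mg [C gC]] [mh [D hD]]; split; first exact: measurable_maxr.
exists (Num.max C D) => x; rewrite le_max; case: (leP (g x) (h x)) => _;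
by rewrite ?gC ?hD ?orbT.
Qed.

Lemma bm_integrable m g : bm g -> m.-integrable setT (EFin \o g).
Proof.
move=> [mg [C gC]]; apply: measurable_bounded_integrable => //.
  exact: fin_total.
exists C; split; first by rewrite num_real.
by move=> y Cy x _; apply: le_trans (gC x) (ltW Cy).
Qed.

Lemma RI_E m g : bm g -> (RI m g)%:E = (\int[m]_x (g x)%:E)%E.
Proof. by move=> bg; rewrite fineK//; apply: integrable_fin_num => //; exact: bm_integrable. Qed.

Lemma RI_cst m c : RI m (fun=> c) = c * mass m.
Proof. by rewrite /RI Rintegral_cst. Qed.

Lemma RID m g h : bm g -> bm h -> RI m (fun x => g x + h x) = RI m g + RI m h.
Proof. by move=> bg bh; apply: RintegralD => //; exact: bm_integrable. Qed.

Lemma RIB m g h : bm g -> bm h -> RI m (fun x => g x - h x) = RI m g - RI m h.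
Proof. by move=> bg bh; apply: RintegralB => //; exact: bm_integrable. Qed.

Lemma RIZ m c g : bm g -> RI m (fun x => c * g x) = c * RI m g.
Proof. by move=> bg; apply: RintegralZl => //; exact: bm_integrable. Qed.

Lemma RIN m g : bm g -> RI m (fun x => - g x) = - RI m g.
Proof.
move=> bg; rewrite -mulN1r -RIZ//; congr RI; apply/funext => x.
by rewrite mulN1r.
Qed.

Lemma le_RI m g h : bm g -> bm h -> (forall x, g x <= h x) -> RI m g <= RI m h.
Proof. by move=> bg bh gh; apply: le_Rintegral => //; exact: bm_integrable. Qed.

Lemma RI_ge0 m g : (forall x, 0 <= g x) -> 0 <= RI m g.
Proof. by move=> g0; apply: Rintegral_ge0. Qed.

Lemma le_norm_RI m g : bm g -> `|RI m g| <= RI m (fun x => `|g x|).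
Proof. by move=> bg; apply: le_normr_Rintegral => //; exact: bm_integrable. Qed.

Lemma RI_bound m g C : bm g -> (forall x, `|g x| <= C) -> `|RI m g| <= C * mass m.
Proof.
move=> bg gC; apply: le_trans (le_norm_RI m bg) _.
by rewrite -RI_cst; apply: le_RI => //; [exact: bm_norm|exact: bm_cst].
Qed.

Lemma nnm_bm g : bm g -> (forall x, 0 <= g x) -> nnm (fun x => (g x)%:E).
Proof. by move=> [mg _] g0; exact: nnm_EFin. Qed.

Lemma mle_RI m m' g : mle m m' -> bm g -> (forall x, 0 <= g x) -> RI m g <= RI m' g.
Proof. by move=> mm bg g0; rewrite -lee_fin !RI_E//; exact/mm/nnm_bm. Qed.

Lemma near_RI (p q e : {finite_measure set T -> \bar R}) g : near_by p q e -> bm g ->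
  `|RI p g - RI q g| <= RI e (fun x => `|g x|).
Proof.
move=> pq bg.
pose gp x := Num.max (g x) 0; pose gn x := Num.max (- g x) 0.
have bp : bm gp by apply: bm_max => //; exact: bm_cst.
have bn : bm gn by apply: bm_max; [exact: bmN|exact: bm_cst].
have p0 x : 0 <= gp x by rewrite le_max lexx orbT.
have n0 x : 0 <= gn x by rewrite le_max lexx orbT.
have ge : g = fun x => gp x - gn x.
  by apply/funext => x; rewrite /gp /gn; case: (leP (g x)); case: (leP (- g x)); lra.
have ne : (fun x => `|g x|) = fun x => gp x + gn x.
  apply/funext => x; rewrite /gp /gn; case: (leP (g x)) => h; case: (leP (- g x)) => h'.
  - by have -> : g x = 0 by [lra]; rewrite normr0 addr0.
  - by rewrite ler0_norm// add0r.
  - by rewrite gtr0_norm// addr0.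
  - by exfalso; move: h h'; clear; lra.
have key h : bm h -> (forall x, 0 <= h x) -> `|RI p h - RI q h| <= RI e h.
  move=> bh h0; have [] := pq _ (nnm_bm bh h0).
  by rewrite -!RI_E// -!EFinD !lee_fin ler_norml => ? ?; apply/andP; split; lra.
have P := key _ bp p0; have N := key _ bn n0.
rewrite ne RID// [in X in `|X|]ge !RIB//.
move: P N; rewrite !ler_norml => /andP[? ?] /andP[? ?].
by apply/andP; split; lra.
Qed.

(** A bounded function is a nonnegative one minus a constant; this reduces
    identities between integrals to the nonnegative case. *)
Lemma RI_shift m (F : (T -> R) -> R) :
  (forall g, bm g -> (forall x, 0 <= g x) -> RI m g = F g) ->
  (forall g c, bm g -> F (fun x => g x + c) = F g + F (fun=> c)) ->
  forall g, bm g -> RI m g = F g.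
Proof.
move=> Fg Fs g bg; have [_ [C gC]] := bg.
have C0 (x : T) : 0 <= C by apply: le_trans (normr_ge0 (g x)) (gC x).
have bC : bm (fun _ : T => C) by exact: bm_cst.
have [x0|x0] := pselect (exists x : T, True); last first.
  have e (h : T -> R) : h = fun=> 0.
    by apply/funext => x; exfalso; apply: x0; exists x.
  by rewrite (e g); apply: Fg => //; exact: bm_cst.
have [x _] := x0.
have h : RI m (fun x => g x + C) = F (fun x => g x + C).
  apply: Fg; first exact: bmD.
  by move=> y; have := gC y; rewrite ler_norml -lerBlDr sub0r => /andP[].
move: h; rewrite RID// Fs// (Fg (fun=> C))//.
exact: addIr.
Qed.

Lemma cvg_RI m (g_ : nat -> T -> R) g C : (forall n, measurable_fun setT (g_ n)) ->
  measurable_fun setT g -> (forall n x, `|g_ n x| <= C) ->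
  (forall x, g_ n x @[n --> \oo] --> g x) ->
  RI m (g_ n) @[n --> \oo] --> RI m g.
Proof.
move=> mg_ mg gC cg.
have bg : bm g.
  split=> //; exists C => x.
  have /cvg_norm h := cg x.
  rewrite -(cvg_lim _ h)//; apply: limr_le; first by apply/cvg_ex; eexists; exact: h.
  exact: nearW.
have bg_ n : bm (g_ n) by split=> //; exists C.
have [] := @dominated_convergence _ _ _ m setT measurableT
  (fun n x => (g_ n x)%:E) (fun x => (g x)%:E) (fun=> C%:E).
- by move=> n; apply/measurable_EFinP.
- exact/measurable_EFinP.
- by apply: aeW => x _; apply: cvg_EFin; [exact: nearW|exact: cg].
- exact: (@bm_integrable m (fun=> C) (bm_cst C)).
- by apply: aeW => x n _; rewrite lee_fin.
move=> _ _ h.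
rewrite (_ : (fun n => _) = fine \o (fun n => \int[m]_x (g_ n x)%:E)%E)//.
by apply: fine_cvg; rewrite RI_E.
Qed.

End basic.

Lemma bm_comp dX dY (X : measurableType dX) (Y : measurableType dY) (phi : X -> Y) g :
  measurable_fun setT phi -> bm g -> bm (fun x => g (phi x)).
Proof.
move=> mphi [mg [C gC]]; split; first exact: measurableT_comp.
by exists C.
Qed.

Lemma bm_sec dX dY (X : measurableType dX) (Y : measurableType dY) (g : X * Y -> R) x :
  bm g -> bm (fun y => g (x, y)).
Proof. by apply: bm_comp; exact: pair1_measurable. Qed.

Section ops_RI.
Context dX dY dZ (X : measurableType dX) (Y : measurableType dY) (Z : measurableType dZ).
Local Open Scope ereal_scope.

Lemma RI_pushf (phi : X -> Y) (m : {finite_measure set X -> \bar R}) g :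
  measurable_fun setT phi -> bm g -> RI (pushf phi m) g = RI m (fun x => g (phi x)).
Proof.
move=> mphi; apply: (@RI_shift _ _ _ (fun g => RI m (fun x => g (phi x)))) => [h bh h0|h c bh].
  by apply: EFin_inj; rewrite !RI_E ?pushfE//; [exact: nnm_bm|exact: bm_comp].
by rewrite RID//; [exact: bm_comp|exact: bm_cst].
Qed.

Lemma bm_RI (n : {finite_measure set Y -> \bar R}) (g : X * Y -> R) : bm g ->
  bm (fun x => RI n (fun y => g (x, y))).
Proof.
move=> [mg [C gC]]; split; last first.
  exists (C * mass n)%R => x; apply: RI_bound => //.
  by apply: bm_sec; split=> //; exists C.
have C0 z : (0 <= C + g z)%R.
  by have := gC z; rewrite ler_norml addrC -lerBlDr sub0r => /andP[].
have bgx x : bm (fun y => g (x, y)).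
  by apply: bm_sec; split=> //; exists C.
rewrite (_ : (fun x => _) = fun x => (RI n (fun y => C + g (x, y)) - C * mass n)%R); last first.
  by apply/funext => x; rewrite RID ?RI_cst//; [rewrite addrC addKr|exact: bm_cst].
apply: measurable_funB => //; apply/measurable_EFinP.
rewrite (_ : EFin \o _ = fun x => \int[n]_y (C + g (x, y))%:E); last first.
  by apply/funext => x; rewrite /comp RI_E//; apply: bmD => //; exact: bm_cst.
apply: (measurable_fun_fubini_tonelli_F (fun z => (C + g z)%:E)).
  by apply/measurable_EFinP; exact: measurable_funD.
by move=> z; rewrite lee_fin.
Qed.

Lemma RI_push2 (phi : X * Y -> Z) (m : {finite_measure set X -> \bar R})
    (n : {finite_measure set Y -> \bar R}) g : measurable_fun setT phi -> bm g ->
  RI (push2 phi m n) g = RI m (fun x => RI n (fun y => g (phi (x, y)))).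
Proof.
have bmphi h : measurable_fun setT phi -> bm h -> bm (fun z => h (phi z)).
  by move=> mphi [mh [C hC]]; split; [exact: measurableT_comp|exists C].
move=> mphi; apply: (@RI_shift _ _ _ (fun g => RI m (fun x => RI n (fun y => g (phi (x, y)))))).
  move=> h bh h0; apply: EFin_inj; rewrite !RI_E ?push2E//.
  - by apply: eq_integral => x _; rewrite RI_E//; apply: (@bm_sec _ _ _ _ (h \o phi)); exact: bmphi.
  - exact: nnm_bm.
  - by apply: (@bm_RI n (fun z => h (phi z))); exact: bmphi.
move=> h c bh; rewrite -RID.
- by congr RI; apply/funext => x; rewrite RID//; [apply: (@bm_sec _ _ _ _ (h \o phi)); exact: bmphi|exact: bm_cst].
- by apply: (@bm_RI n (fun z => h (phi z))); exact: bmphi.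
- exact: bm_cst.
Qed.

Lemma RI_mix2 (phi1 phi2 : X * Y -> Z) (m : {finite_measure set X -> \bar R})
    (n : {finite_measure set Y -> \bar R}) g :
  measurable_fun setT phi1 -> measurable_fun setT phi2 -> bm g ->
  RI (mix2 phi1 phi2 m n) g =
  RI m (fun x => RI n (fun y => 2^-1 * (g (phi1 (x, y)) + g (phi2 (x, y)))))%R.
Proof.
have bmphi h : measurable_fun setT phi1 -> measurable_fun setT phi2 ->
    bm h -> bm (fun z => 2^-1 * (h (phi1 z) + h (phi2 z)))%R.
  move=> mp1 mp2 bh; apply: bmM; first exact: bm_cst.
  by apply: bmD; [exact: (bm_comp mp1)|exact: (bm_comp mp2)].
move=> mp1 mp2; apply: (@RI_shift _ _ _ (fun g => RI m (fun x => RI n (fun y =>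
    2^-1 * (g (phi1 (x, y)) + g (phi2 (x, y)))))%R)).
  move=> h bh h0; apply: EFin_inj; rewrite !RI_E ?mix2E//.
  - by apply: eq_integral => x _; rewrite RI_E//;
      apply: (@bm_sec _ _ _ _ (fun z => 2^-1 * (h (phi1 z) + h (phi2 z)))%R); exact: bmphi.
  - exact: nnm_bm.
  - by apply: (@bm_RI n (fun z => 2^-1 * (h (phi1 z) + h (phi2 z)))%R); exact: bmphi.
move=> h c bh; rewrite -RID.
- congr RI; apply/funext => x; rewrite -RID.
  + by congr RI; apply/funext => y; field.
  + by apply: (@bm_sec _ _ _ _ (fun z => 2^-1 * (h (phi1 z) + h (phi2 z)))%R); exact: bmphi.
  + exact: bm_cst.
- by apply: (@bm_RI n (fun z => 2^-1 * (h (phi1 z) + h (phi2 z)))%R); exact: bmphi.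
- by apply: bm_cst.
Qed.

Lemma RI_madd (m n : {finite_measure set X -> \bar R}) g : bm g ->
  RI (madd m n) g = (RI m g + RI n g)%R.
Proof.
apply: (@RI_shift _ _ _ (fun g => RI m g + RI n g)%R) => [h bh h0|h c bh].
  by apply: EFin_inj; rewrite EFinD !RI_E// maddE//; exact: nnm_bm.
have bc := bm_cst X c.
by rewrite !RID// addrACA.
Qed.

Lemma RI_dens w (m : {finite_measure set X -> \bar R}) g :
  bm w -> (forall x, (0 <= w x)%R) -> bm g ->
  RI (dens w m) g = RI m (fun x => w x * g x)%R.
Proof.
move=> bw w0; have mw : measurable_fun setT w by case: bw.
have wfin : \int[m]_x (w x)%:E < +oo by rewrite -RI_E// ltry.
apply: (@RI_shift _ _ _ (fun g => RI m (fun x => w x * g x)%R)) => [h bh h0|h c bh].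
  apply: EFin_inj; rewrite !RI_E//; last exact: bmM.
  by rewrite densE//; exact: nnm_bm.
have bc := bm_cst X c.
rewrite -RID; [|exact: bmM|exact: bmM].
by congr RI; apply/funext => x; rewrite mulrDr.
Qed.

Lemma cvg_RI_mser (m : nat -> {finite_measure set X -> \bar R}) g :
  \sum_(k <oo) m k setT < +oo -> bm g ->
  (\sum_(0 <= k < n) RI (m k) g)%R @[n --> \oo] --> RI (mser m) g.
Proof.
move=> sfin bg.
have pos h : bm h -> (forall x, (0 <= h x)%R) ->
    (\sum_(0 <= k < n) RI (m k) h)%R @[n --> \oo] --> RI (mser m) h.
  move=> bh h0.
  rewrite (_ : (fun n => _) = fine \o (fun n => \sum_(0 <= k < n) \int[m k]_x (h x)%:E)).
    apply: fine_cvg; rewrite RI_E// mserE//; last exact: nnm_bm.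
    by apply: is_cvg_ereal_nneg_natsum => k _; apply: integral_ge0 => x _; rewrite lee_fin.
  apply/funext => n /=; rewrite -[LHS]/(fine _%:E) -sumEFin; congr fine.
  by apply: eq_bigr => k _; rewrite RI_E.
have [_ [C gC]] := bg.
have bc := bm_cst X C.
have [[x0 _]|x0] := pselect (exists x : X, True); last first.
  by apply: pos => // x; exfalso; apply: x0; exists x.
have C0 := le_trans (normr_ge0 _) (gC x0).
have h1 := pos _ (bmD bg bc).
have h2 := pos _ bc (fun _ => C0).
have {}h1 := h1 (fun x => _).
rewrite (_ : (fun n => _) = fun n => (\sum_(0 <= k < n) RI (m k) (fun x => g x + C) -
    \sum_(0 <= k < n) RI (m k) (fun=> C))%R); last first.
  apply/funext => n; rewrite -sumrB; apply: eq_bigr => k _.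
  by rewrite RID// addrK.
rewrite (_ : RI (mser m) g = RI (mser m) (fun x => g x + C)%R - RI (mser m) (fun=> C))%R; last first.
  by rewrite RID// addrK.
apply: cvgB => //; apply: h1 => x.
by have := gC x; rewrite ler_norml -lerBlDr sub0r => /andP[].
Qed.

End ops_RI.
End bounded.

(** * Increasing limits, bilinear operations and parameters *)

Section families.
Local Open Scope ereal_scope.
Context (R : realType).

Definition minc d (T : measurableType d) (p_ : nat -> {finite_measure set T -> \bar R})
    (p : {finite_measure set T -> \bar R}) := forall f, nnm f ->
  nondecreasing_seq (fun n => \int[p_ n]_x f x) /\
  \int[p_ n]_x f x @[n --> \oo] --> \int[p]_x f x.

Lemma nondecreasing_le_lim (u : nat -> \bar R) (l : \bar R) n : nondecreasing_seq u ->
  u k @[k --> \oo] --> l -> u n <= l.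
Proof.
move=> nu ul; move/ereal_nondecreasing_cvgn : nu => ul'.
rewrite (cvg_unique _ ul ul')//; apply: ereal_sup_ubound; by exists n.
Qed.

(** Both the measure and the integrand may increase, because the two
    monotone limits exchange. *)
Lemma minc_int d (T : measurableType d) (p_ : nat -> {finite_measure set T -> \bar R}) p
    (g_ : nat -> T -> \bar R) g : minc p_ p -> (forall n, nnm (g_ n)) -> nnm g ->
  (forall x, nondecreasing_seq (g_^~ x)) -> (forall x, g_ n x @[n --> \oo] --> g x) ->
  nondecreasing_seq (fun n => \int[p_ n]_x g_ n x) /\
  \int[p_ n]_x g_ n x @[n --> \oo] --> \int[p]_x g x.
Proof.
move=> pp ng_ ng nd cg.
have ndi : nondecreasing_seq (fun n => \int[p_ n]_x g_ n x).
  move=> i j ij; apply: (@le_trans _ _ (\int[p_ i]_x g_ j x)).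
    by apply: le_nnm => // x; exact: nd.
  by have [+ _] := pp _ (ng_ j); exact.
split=> //; have [s ps] : exists s : \bar R, \int[p_ n]_x g_ n x @[n --> \oo] --> s.
  by exists (ereal_sup (range (fun n => \int[p_ n]_x g_ n x))); exact: ereal_nondecreasing_cvgn.
suff -> : \int[p]_x g x = s by [].
have gle n x : g_ n x <= g x.
  exact: (nondecreasing_le_lim n (nd x) (cg x)).
apply/eqP; rewrite eq_le; apply/andP; split.
  have -> : \int[p]_x g x = limn (fun n => \int[p]_x g_ n x).
    rewrite -monotone_convergence//.
    + by apply: eq_integral => x _; apply/esym/cvg_lim => //; exact: cg.
    + by move=> n; case: (ng_ n).
    + by move=> n x _; case: (ng_ n).
  apply: lime_le.
    by apply: ereal_nondecreasing_is_cvgn => i j ij; apply: le_nnm => // x; exact: nd.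
  apply: nearW => n; have [ndn cn] := pp _ (ng_ n).
  rewrite -(cvg_lim _ cn)// -(cvg_lim _ ps)//; apply: lee_lim.
  + exact: ereal_nondecreasing_is_cvgn.
  + exact: ereal_nondecreasing_is_cvgn.
  + exists n => // j /= nj; apply: le_nnm => // x; exact: nd.
have [ndn cn] := pp _ ng.
rewrite -(cvg_lim _ cn)// -(cvg_lim _ ps)//; apply: lee_lim.
+ exact: ereal_nondecreasing_is_cvgn.
+ exact: ereal_nondecreasing_is_cvgn.
+ by apply: nearW => j; apply: le_nnm => // x; exact: gle.
Qed.

Lemma minc_cst d (T : measurableType d) (p : {finite_measure set T -> \bar R}) :
  minc (fun=> p) p.
Proof. by move=> f nf; split; [|exact: cvg_cst]. Qed.

Lemma minc_series d (T : measurableType d) (m_ : nat -> nat -> {finite_measure set T -> \bar R}) m :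
  (forall k, minc (fun n => m_ n k) (m k)) ->
  (forall n, \sum_(k <oo) m_ n k setT < +oo) -> \sum_(k <oo) m k setT < +oo ->
  minc (fun n => mser (m_ n)) (mser m).
Proof.
move=> mm fin_ fin f nf.
have E n : \int[mser (m_ n)]_x f x = \int[counting]_k \int[m_ n k]_x f x.
  by rewrite mserE// ge0_integral_count// => k; exact: nnm_integral.
under eq_fun do rewrite E.
rewrite mserE// -ge0_integral_count => [|k]; last exact: nnm_integral.
have ge n k : 0 <= \int[m_ n k]_x f x by exact: nnm_integral.
split.
  move=> i j ij; apply: ge0_le_integral => // k _.
  by have [+ _] := mm k f nf; exact.
have -> : \int[counting]_k \int[m k]_x f x =
    \int[counting]_k limn (fun n => \int[m_ n k]_x f x).
  by apply: eq_integral => k _; apply/esym/cvg_lim => //; have [] := mm k f nf.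
apply: cvg_monotone_convergence => //.
by move=> k _ i j ij; have [+ _] := mm k f nf; exact.
Qed.

Lemma minc_pushf dX dY (X : measurableType dX) (Y : measurableType dY) (phi : X -> Y) m_ m :
  measurable_fun setT phi -> minc m_ m -> minc (fun n => pushf phi (m_ n)) (pushf phi m).
Proof.
move=> mphi mm f nf; under eq_fun do rewrite pushfE//.
by rewrite pushfE//; exact: (mm _ (nnm_comp mphi nf)).
Qed.

Lemma minc_madd dX (X : measurableType dX) m_ m n_ n :
  minc m_ m -> minc n_ n -> @minc _ X (fun k => madd (m_ k) (n_ k)) (madd m n).
Proof.
move=> mm nn f nf; under eq_fun do rewrite maddE//; rewrite maddE//.
have [d1 c1] := mm f nf; have [d2 c2] := nn f nf; split.
  by move=> i j ij; apply: leeD; [exact: d1|exact: d2].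
apply: cvgeD => //; apply: ge0_adde_def; rewrite inE; exact: nnm_integral.
Qed.

Section binary.
Context dX dY dZ (X : measurableType dX) (Y : measurableType dY) (Z : measurableType dZ).
Variables (phi1 phi2 : X * Y -> Z).
Hypotheses (m1 : measurable_fun setT phi1) (m2 : measurable_fun setT phi2).
Implicit Types (m : {finite_measure set X -> \bar R}) (n : {finite_measure set Y -> \bar R}).

Lemma nnm_mix_in n f : nnm f -> nnm (fun x => \int[n]_y mixf phi1 phi2 f (x, y)).
Proof. by move=> nf; apply: nnm_fubini; exact: nnm_mixf. Qed.

Lemma nnm_mix_sec (f : Z -> \bar R) x : nnm f -> nnm (fun y => mixf phi1 phi2 f (x, y)).
Proof. by move=> nf; apply: nnm_sec; exact: nnm_mixf. Qed.

Lemma minc_mix2 (m_ : nat -> {finite_measure set X -> \bar R}) m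
    (n_ : nat -> {finite_measure set Y -> \bar R}) n : minc m_ m -> minc n_ n ->
  minc (fun k => mix2 phi1 phi2 (m_ k) (n_ k)) (mix2 phi1 phi2 m n).
Proof.
move=> mm nn f nf; under eq_fun do rewrite mix2E//; rewrite mix2E//.
apply: (minc_int (g_ := fun k x => \int[n_ k]_y mixf phi1 phi2 f (x, y)) mm).
- by move=> k; exact: nnm_mix_in.
- exact: nnm_mix_in.
- by move=> x; have [] := nn _ (nnm_mix_sec x nf).
- by move=> x; have [] := nn _ (nnm_mix_sec x nf).
Qed.

Lemma mix2_total m n : mix2 phi1 phi2 m n setT = m setT * n setT.
Proof.
rewrite -integral1 (mix2E _ _ m1 m2 (nnm_cst _ (@lee01 R))).
under eq_integral => x _ do under eq_integral => y _ do
  rewrite /mixf -EFinD -EFinM -[(1 + 1)%R]/2%:R mulVf//.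
under eq_integral do rewrite integral1.
by rewrite integral_cst// muleC.
Qed.

(** A bilinear difference is split as (m - m') n + m' (n - n'). *)
Lemma near_mix2 m m' dm n n' dn M N :
  near_by m m' dm -> near_by n n' dn -> mle m M -> mle m' M -> mle n N -> mle n' N ->
  near_by (mix2 phi1 phi2 m n) (mix2 phi1 phi2 m' n')
          (madd (mix2 phi1 phi2 dm N) (mix2 phi1 phi2 M dn)).
Proof.
have key (a a' da A : {finite_measure set X -> \bar R}) (b b' db B : {finite_measure set Y -> \bar R}) : near_by a a' da -> near_by b b' db ->
    mle a' A -> mle b B -> forall f, nnm f ->
    \int[mix2 phi1 phi2 a b]_x f x <= \int[mix2 phi1 phi2 a' b']_x f x +
      \int[madd (mix2 phi1 phi2 da B) (mix2 phi1 phi2 A db)]_x f x.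
  move=> aa bb aA bB f nf; rewrite maddE// !mix2E//.
  have ni (c : {finite_measure set Y -> \bar R}) : nnm (fun x => \int[c]_y mixf phi1 phi2 f (x, y)) by exact: nnm_mix_in.
  have ns (x : X) : nnm (fun y => mixf phi1 phi2 f (x, y)) by exact: nnm_mix_sec.
  apply: (@le_trans _ _ (\int[a']_x \int[b]_y mixf phi1 phi2 f (x, y) +
                         \int[da]_x \int[b]_y mixf phi1 phi2 f (x, y))).
    by have [] := aa _ (ni b).
  rewrite [X in _ <= _ + X]addeC addeA; apply: leeD; last first.
    by apply: le_nnm => // x; exact: bB.
  apply: (@le_trans _ _ (\int[a']_x (\int[b']_y mixf phi1 phi2 f (x, y) +
                         \int[db]_y mixf phi1 phi2 f (x, y)))).
    by apply: le_nnm => // [|x]; [exact: nnmD|have [] := bb _ (ns x)].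
  rewrite ge0_integralD//; last 4 first.
  - by move=> x _; case: (ni b').
  - by case: (ni b').
  - by move=> x _; case: (ni db).
  - by case: (ni db).
  by apply: leeD => //; exact: aA.
move=> mm nn mM m'M nN n'N f nf; split; first exact: key.
by apply: key => //; exact: near_sym.
Qed.
End binary.

(** Measurability of a family of measures in its parameter, in the form
    needed to integrate it in time: the integrand may also depend on the
    parameter. *)
Definition tmeas d (T : measurableType d) (m : R -> {finite_measure set T -> \bar R}) :=
  forall d' (X : measurableType d') (tau : X -> R) (F : X * T -> \bar R),
    measurable_fun setT tau -> nnm F -> nnm (fun x => \int[m (tau x)]_y F (x, y)).

Lemma tmeas_cst d (T : measurableType d) (m : {finite_measure set T -> \bar R}) :
  tmeas (fun=> m).
Proof. by move=> d' X tau F mtau nF; exact: nnm_fubini. Qed.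

Lemma tmeas_pushf dX dY (X : measurableType dX) (Y : measurableType dY) (phi : X -> Y) m :
  measurable_fun setT phi -> tmeas m -> tmeas (fun t => pushf phi (m t)).
Proof.
move=> mphi tm d' W tau F mtau nF.
rewrite (_ : (fun x => _) = fun x => \int[m (tau x)]_y F (x, phi y)); last first.
  by apply/funext => x; rewrite pushfE//; exact: nnm_sec.
apply: (tm _ _ tau (fun z => F (z.1, phi z.2))) => //.
apply: (nnm_comp (phi := fun z => (z.1, phi z.2)) _ nF).
apply: measurable_fun_pair; first exact: measurable_fst.
by apply: measurableT_comp => //; exact: measurable_snd.
Qed.

Lemma tmeas_madd d (T : measurableType d) m n : tmeas m -> tmeas n ->
  @tmeas _ T (fun t => madd (m t) (n t)).
Proof.
move=> tm tn d' W tau F mtau nF.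
rewrite (_ : (fun x => _) = fun x => \int[m (tau x)]_y F (x, y) + \int[n (tau x)]_y F (x, y)).
  by apply: nnmD; [exact: tm|exact: tn].
by apply/funext => x; rewrite maddE//; exact: nnm_sec.
Qed.

Lemma tmeas_mser d (T : measurableType d) (m : R -> nat -> {finite_measure set T -> \bar R}) :
  (forall t, \sum_(k <oo) m t k setT < +oo) ->
  (forall k, tmeas (fun t => m t k)) -> tmeas (fun t => mser (m t)).
Proof.
move=> fin tm d' W tau F mtau nF.
rewrite (_ : (fun x => _) = fun x => \sum_(k <oo) \int[m (tau x) k]_y F (x, y)).
  by apply: nnm_series => k; exact: tm.
by apply/funext => x; rewrite mserE//; exact: nnm_sec.
Qed.

Lemma tmeas_mix2 dX dY dZ (X : measurableType dX) (Y : measurableType dY)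
    (Z : measurableType dZ) (phi1 phi2 : X * Y -> Z) m n :
  measurable_fun setT phi1 -> measurable_fun setT phi2 -> tmeas m -> tmeas n ->
  tmeas (fun t => mix2 phi1 phi2 (m t) (n t)).
Proof.
move=> m1 m2 tm tn d' W tau F mtau nF.
pose G (z : (W * X) * Y) := mixf phi1 phi2 (fun w => F (z.1.1, w)) (z.1.2, z.2).
have nG : nnm G.
  have mp phi : measurable_fun setT phi -> nnm (fun z : (W * X) * Y => F (z.1.1, phi (z.1.2, z.2))).
    move=> mphi; apply: (nnm_comp (phi := fun z : (W * X) * Y => (z.1.1, phi (z.1.2, z.2))) _ nF).
    apply: measurable_fun_pair.
      by apply: (measurableT_comp measurable_fst); exact: measurable_fst.
    apply: measurableT_comp => //; apply: measurable_fun_pair; last exact: measurable_snd.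
    by apply: (measurableT_comp measurable_snd); exact: measurable_fst.
  apply: nnmM; first by apply: nnm_cst; rewrite lee_fin invr_ge0.
  by apply: nnmD; exact: mp.
rewrite (_ : (fun x => _) = fun w => \int[m (tau w)]_x \int[n (tau w)]_y G ((w, x), y)).
  apply: (tm _ _ tau (fun z => \int[n (tau z.1)]_y G (z, y))) => //.
  apply: (tn _ _ (fun z => tau z.1) G) => //.
  by apply: measurableT_comp => //; exact: measurable_fst.
by apply/funext => w; rewrite mix2E//; exact: nnm_sec.
Qed.
End families.

(** Fubini for bounded functions follows from Tonelli after adding a
    constant. *)
Lemma RI_swap (R : realType) dX dY (X : measurableType dX) (Y : measurableType dY)
    (m : {finite_measure set X -> \bar R}) (n : {finite_measure set Y -> \bar R})
    (g : X * Y -> R) : bm g ->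
  RI m (fun x => RI n (fun y => g (x, y))) = RI n (fun y => RI m (fun x => g (x, y))).
Proof.
have swap (h : X * Y -> R) : bm h -> bm (fun z : Y * X => h (z.2, z.1)).
  apply: (bm_comp (phi := fun z : Y * X => (z.2, z.1))).
  by apply: measurable_fun_pair; [exact: measurable_snd|exact: measurable_fst].
have i1 (h : X * Y -> R) : bm h -> bm (fun x => RI n (fun y => h (x, y))) by exact: bm_RI.
have i2 (h : X * Y -> R) : bm h -> bm (fun y => RI m (fun x => h (x, y))).
  by move=> /swap/(@bm_RI _ _ _ _ _ m).
have s2 (h : X * Y -> R) y : bm h -> bm (fun x => h (x, y)) by move=> /swap/(bm_sec y).
have pos (h : X * Y -> R) : bm h -> (forall z, 0 <= h z) ->
    RI m (fun x => RI n (fun y => h (x, y))) = RI n (fun y => RI m (fun x => h (x, y))).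
  move=> bh h0; apply: EFin_inj; rewrite !RI_E//; [|exact: i2|exact: i1].
  rewrite (eq_integral (fun x => \int[n]_y (h (x, y))%:E)%E) => [|x _]; last first.
    by rewrite RI_E//; exact: bm_sec.
  rewrite [RHS](eq_integral (fun y => \int[m]_x (h (x, y))%:E)%E) => [|y _]; last first.
    by rewrite RI_E//; exact: s2.
  apply: (@fubini_tonelli _ _ _ _ _ m n (fun z => (h z)%:E)) => [|z].
    by apply/measurable_EFinP; case: bh.
  by rewrite lee_fin.
move=> bg; have [_ [C gC]] := bg.
have bC : bm (fun _ : X * Y => C) by exact: bm_cst.
have := pos (fun z => g z + C) (bmD bg bC).
have -> : RI m (fun x => RI n (fun y => g (x, y) + C)) =
    RI m (fun x => RI n (fun y => g (x, y))) + C * mass n * mass m.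
  rewrite -RI_cst -RID; [|exact: i1|exact: bm_cst].
  by congr RI; apply/funext => x; rewrite RID ?RI_cst//; [exact: bm_sec|exact: bm_cst].
have -> : RI n (fun y => RI m (fun x => g (x, y) + C)) =
    RI n (fun y => RI m (fun x => g (x, y))) + C * mass n * mass m.
  rewrite mulrAC -RI_cst -RID; [|exact: i2|exact: bm_cst].
  by congr RI; apply/funext => x; rewrite RID ?RI_cst//; [exact: s2|exact: bm_cst].
by move=> h; apply: (addIr _ (h _)) => z; have := gC z; rewrite ler_norml -lerBlDr sub0r => /andP[].
Qed.

Lemma RI_dens_unbounded (R : realType) d (X : measurableType d) (w : X -> R)
    (m : {finite_measure set X -> \bar R}) (g : X -> R) :
  measurable_fun setT w -> (forall x, 0 <= w x) -> (\int[m]_x (w x)%:E < +oo)%E ->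
  bm g -> m.-integrable setT (EFin \o (fun x => w x * g x)) /\
  RI (dens w m) g = \int[m]_x (w x * g x).
Proof.
move=> mw w0 wfin.
have iw : m.-integrable setT (EFin \o w).
  apply/integrableP; split; first exact/measurable_EFinP.
  by under eq_integral => x _ do rewrite /= ger0_norm//.
have ig (h : X -> R) : bm h -> m.-integrable setT (EFin \o (fun x => w x * h x)).
  move=> [mh [C hC]]; apply: (@le_integrable _ _ _ m setT _ _ (EFin \o (fun x => C * w x))) => //.
  - by apply/measurable_EFinP; exact: measurable_funM.
  - move=> x _ /=; rewrite lee_fin normrM (ger0_norm (w0 x)) mulrC.
    apply: le_trans (ler_norm _); by rewrite ler_wpM2r.
  - by under [X in _.-integrable _ X]eq_fun do rewrite EFinM; exact: integrableZl.
move=> bg; split; first exact: ig.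
apply: (@RI_shift _ _ _ _ (fun h => \int[m]_x (w x * h x))) bg => [h bh h0|h c bh].
  apply: EFin_inj; rewrite RI_E// densE//; last exact: nnm_bm.
  by rewrite fineK//; exact: integrable_fin_num (ig _ bh).
rewrite -RintegralD//; [|exact: ig|exact/ig/bm_cst].
by apply: eq_Rintegral => x _; rewrite mulrDr.
Qed.

(** * Phase space and the operations of the nonlinearity *)

Lemma measurable_cosR (R : realType) : measurable_fun setT (@cos R).
Proof. by apply: continuous_measurable_fun; exact: continuous_cos. Qed.

Lemma measurable_sinR (R : realType) : measurable_fun setT (@sin R).
Proof. by apply: continuous_measurable_fun; exact: continuous_sin. Qed.

Lemma measurable_normR (R : realType) : measurable_fun setT (fun x : R => `|x|).
Proof. exact: normr_measurable. Qed.

Ltac mstep := first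
  [ exact: measurable_cst | exact: measurable_id | exact: measurable_fst
  | exact: measurable_snd | assumption
  | match goal with
    | |- measurable_fun _ (fun x => (_, _)) => apply: measurable_fun_pair
    | |- measurable_fun _ (fun x => (if _ then _ else _)) => apply: measurable_fun_ifT
    | |- measurable_fun _ (fun x => _ == _) => apply: measurable_fun_eqr
    | |- measurable_fun _ (fun x => (_ < _)%R) => apply: measurable_fun_ltr
    | |- measurable_fun _ (fun x => (_ <= _)%R) => apply: measurable_fun_ler
    | |- measurable_fun _ (fun x => (_ + _)%R) => first [apply: measurable_funB | apply: measurable_funD]
    | |- measurable_fun _ (fun x => (_ * _)%R) => apply: measurable_funM
    | |- measurable_fun _ (fun x => (- _)%R) => apply: measurableT_comp
    | |- measurable_fun _ (fun x => cos _) => apply: (measurableT_comp (@measurable_cosR _))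
    | |- measurable_fun _ (fun x => sin _) => apply: (measurableT_comp (@measurable_sinR _))
    | |- measurable_fun _ (fun x => `|_|%R) => apply: (measurableT_comp (@measurable_normR _))
    | |- measurable_fun _ (fun x => expR _) => apply: (measurableT_comp (@measurable_expR _))
    | |- measurable_fun _ (fun x => _.1) => apply: (measurableT_comp measurable_fst)
    | |- measurable_fun _ (fun x => _.2) => apply: (measurableT_comp measurable_snd)
    end ].
Ltac meas := repeat mstep.

Definition freq (R : realType) : measurableType _ := (R * R * R)%type.

Section coordinates.
Context (R : realType).
Local Notation H := (freq R).
Local Notation fmH := {finite_measure set H -> \bar R}.
Implicit Types (p q : fmH).

Definition mkfreq (x y z : R) : H := (x, y, z).
Definition xi (h : H) : R := h.1.1.
Definition eta (h : H) : R := h.1.2.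
Definition phase (h : H) : R := h.2.

Lemma measurable_xi : measurable_fun setT xi.
Proof. by rewrite /xi; apply: (measurableT_comp measurable_fst); exact: measurable_fst. Qed.
Lemma measurable_eta : measurable_fun setT eta.
Proof. by rewrite /eta; apply: (measurableT_comp measurable_snd); exact: measurable_fst. Qed.
Lemma measurable_phase : measurable_fun setT phase.
Proof. exact: measurable_snd. Qed.
Lemma measurable_mkfreq d (X : measurableType d) (f g k : X -> R) :
  measurable_fun setT f -> measurable_fun setT g -> measurable_fun setT k ->
  measurable_fun setT (fun x => mkfreq (f x) (g x) (k x)).
Proof. by move=> mf mg mk; apply: measurable_fun_pair => //; exact: measurable_fun_pair. Qed.

Lemma xiE x y z : xi (mkfreq x y z) = x. Proof. by []. Qed.
Lemma etaE x y z : eta (mkfreq x y z) = y. Proof. by []. Qed.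
Lemma phaseE x y z : phase (mkfreq x y z) = z. Proof. by []. Qed.

End coordinates.

Ltac hmeas := repeat first [ exact: (@measurable_xi _) | exact: (@measurable_eta _) | exact: (@measurable_phase _) | match goal with
    | |- measurable_fun _ (fun x => mkfreq _ _ _) => apply: measurable_mkfreq
    | |- measurable_fun _ (fun x => xi _) => apply: (measurableT_comp (@measurable_xi _))
    | |- measurable_fun _ (fun x => eta _) => apply: (measurableT_comp (@measurable_eta _))
    | |- measurable_fun _ (fun x => phase _) => apply: (measurableT_comp (@measurable_phase _))
    end | mstep ].

HB.lock Definition lebr (R : realType) (A : set R) : {finite_measure set R -> \bar R} :=
  mk (fun f : R -> \bar R => \int[@lebesgue_measure R]_(t in A) f t)%E.

Section maps.
Context (R : realType).
Local Notation H := (freq R).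
Local Notation fmH := {finite_measure set H -> \bar R}.
Implicit Types (p q : fmH).

Lemma lebrE (A : set R) f : measurable A -> (@lebesgue_measure R A < +oo)%E -> nnm f ->
  (\int[lebr A]_t f t = \int[@lebesgue_measure R]_(t in A) f t)%E.
Proof.
move=> mA fA nf; rewrite lebr.unlock mkE//.
- split=> [g [_ g0]|g ng|k g k0 [mg g0]]; first by apply: integral_ge0.
    apply: integral_nneseries => // [n|n x _]; last by case: (ng n).
    by apply: measurable_funTS; case: (ng n).
  rewrite ge0_integralZl_EFin//; exact: measurable_funTS.
- by rewrite integral_cst//= mul1e.
Qed.

Lemma lebr_total (A : set R) : measurable A -> (@lebesgue_measure R A < +oo)%E ->
  lebr A setT = @lebesgue_measure R A.
Proof.
move=> mA fA; rewrite -integral1 (lebrE mA fA (nnm_cst _ (@lee01 R))).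
by rewrite integral_cst//= mul1e.
Qed.

Lemma bm_leb_integrable (A : set R) g : measurable A -> (@lebesgue_measure R A < +oo)%E -> bm g ->
  (@lebesgue_measure R).-integrable A (EFin \o g).
Proof.
move=> mA fA [mg [C gC]]; apply: measurable_bounded_integrable => //.
  exact: measurable_funTS.
exists C; split; first by rewrite num_real.
by move=> y Cy x _; apply: le_trans (gC x) (ltW Cy).
Qed.

Lemma RI_lebr (A : set R) g : measurable A -> (@lebesgue_measure R A < +oo)%E -> bm g ->
  RI (lebr A) g = (\int[@lebesgue_measure R]_(t in A) g t)%R.
Proof.
move=> mA fA.
apply: (@RI_shift _ _ _ _ (fun g : R -> R => \int[@lebesgue_measure R]_(t in A) g t)).
  move=> h bh h0; apply: EFin_inj; rewrite RI_E// lebrE//; last exact: nnm_bm.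
  by rewrite fineK//; apply: integrable_fin_num => //; exact: bm_leb_integrable.
move=> h c bh; rewrite RintegralD//; apply: bm_leb_integrable => //; exact: bm_cst.
Qed.

Lemma leb_segment (a b : R) : (@lebesgue_measure R `[a, b] < +oo)%E.
Proof. by rewrite lebesgue_measure_itv/=; case: ifP => // _; rewrite -EFinB ltry. Qed.

Definition unif : {finite_measure set R -> \bar R} := lebr `[0%R, 1%R].

Lemma unif_total : unif setT = 1%E.
Proof.
rewrite lebr_total//; last exact: leb_segment.
by rewrite lebesgue_measure_itv/= lte_fin ltr01 -EFinB subr0.
Qed.

Lemma RI_unif g : bm g ->
  RI unif g = (\int[@lebesgue_measure R]_(t in `[0%R, 1%R]) g t)%R.
Proof. by apply: RI_lebr => //; exact: leb_segment. Qed.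

(** The pair (h, t) is sent to the frequency of x |-> cos(xi (x - t y) +
    theta): averaging over t in [0,1] gives the slope of a primitive. *)
Definition lift (ht : H * R) : H := mkfreq (xi ht.1) (ht.2 * xi ht.1) (phase ht.1).
(** Sum or difference of the two waves, according to the sign s. The phase
    pi/2 makes two successive products contribute the factor -1 of the
    alternating series in S^2. *)
Definition comb (s : R) (ab : H * H) : H :=
  mkfreq (xi ab.1 + s * xi ab.2) (eta ab.1 + s * eta ab.2) (phase ab.1 + s * phase ab.2 + pi / 2).
(** The waves of u(x) and of -u(x - y), respectively, for [lay] and [tilt]. *)
Definition lay (h : H) : H := mkfreq (xi h) 0 (phase h).
Definition tilt (h : H) : H := mkfreq (xi h) (xi h) (phase h + pi).

Lemma measurable_lift : measurable_fun setT lift.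
Proof. by rewrite /lift; hmeas. Qed.
Lemma measurable_comb s : measurable_fun setT (comb s).
Proof. by rewrite /comb; hmeas. Qed.
Lemma measurable_lay : measurable_fun setT lay.
Proof. by rewrite /lay; hmeas. Qed.
Lemma measurable_tilt : measurable_fun setT tilt.
Proof. by rewrite /tilt; hmeas. Qed.

End maps.

Local Notation fmH R := ({finite_measure set (freq R) -> \bar R}) (only parsing).

HB.lock Definition slopem (R : realType) (p : fmH R) : fmH R := push2 (@lift R) p (unif R).
HB.lock Definition diffm (R : realType) (p : fmH R) : fmH R :=
  madd (pushf (@lay R) p) (pushf (@tilt R) p).
HB.lock Definition mulm (R : realType) (q p : fmH R) : fmH R :=
  mix2 (@comb R 1) (@comb R (-1)) q (slopem p).

Section operators.
Context (R : realType).
Local Notation H := (freq R).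
Local Notation fmH := {finite_measure set H -> \bar R}.
Implicit Types (p q : fmH).
Local Notation unif := (unif R).

Local Open Scope ereal_scope.

Lemma slopemE p f : nnm f -> \int[slopem p]_h f h = \int[p]_h \int[unif]_t f (lift (h, t)).
Proof. by move=> nf; rewrite slopem.unlock push2E//; exact: measurable_lift. Qed.

Lemma diffmE p f : nnm f ->
  \int[diffm p]_h f h = \int[p]_h f (lay h) + \int[p]_h f (tilt h).
Proof.
by move=> nf; rewrite diffm.unlock maddE// !pushfE//; [exact: measurable_tilt|exact: measurable_lay].
Qed.

Lemma mulmE q p f : nnm f ->
  \int[mulm q p]_h f h = \int[q]_a \int[slopem p]_b mixf (comb 1) (comb (-1)) f (a, b).
Proof. by move=> nf; rewrite mulm.unlock mix2E//; exact: measurable_comb. Qed.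

Lemma RI_mulm q p g : bm g -> RI (mulm q p) g =
  RI q (fun a => RI (slopem p) (fun b => 2^-1 * (g (comb 1 (a, b)) + g (comb (-1) (a, b)))))%R.
Proof. by move=> bg; rewrite mulm.unlock RI_mix2//; exact: measurable_comb. Qed.

Lemma RI_slopem p g : bm g ->
  RI (slopem p) g = RI p (fun h => RI unif (fun t => g (lift (h, t)))).
Proof. by move=> bg; rewrite slopem.unlock RI_push2//; exact: measurable_lift. Qed.

Lemma RI_diffm p g : bm g ->
  RI (diffm p) g = (RI p (fun h => g (lay h)) + RI p (fun h => g (tilt h)))%R.
Proof.
by move=> bg; rewrite diffm.unlock RI_madd// !RI_pushf//; [exact: measurable_tilt|exact: measurable_lay].
Qed.

Lemma pushf_total dX dY (X : measurableType dX) (Y : measurableType dY) (phi : X -> Y)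
   (m : {finite_measure set X -> \bar R}) : measurable_fun setT phi -> pushf phi m setT = m setT.
Proof. by move=> mphi; rewrite -integral1 (pushfE _ mphi (nnm_cst _ (@lee01 R))) integral1. Qed.

Lemma madd_total d (X : measurableType d) (m n : {finite_measure set X -> \bar R}) :
  madd m n setT = m setT + n setT.
Proof. by rewrite -integral1 (maddE _ _ (nnm_cst _ (@lee01 R))) !integral1. Qed.

Lemma mser_total d (X : measurableType d) (m : nat -> {finite_measure set X -> \bar R}) :
  \sum_(k <oo) m k setT < +oo -> mser m setT = \sum_(k <oo) m k setT.
Proof.
move=> h; rewrite -integral1 (mserE h (nnm_cst _ (@lee01 R))).
by apply: eq_eseriesr => k _; rewrite integral1.
Qed.

Lemma slopem_total p : slopem p setT = p setT.
Proof.
rewrite -integral1 (slopemE _ (nnm_cst _ (@lee01 R))) -[RHS]integral1.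
by apply: eq_integral => h _; rewrite integral1; exact: unif_total.
Qed.

Lemma mulm_total q p : mulm q p setT = q setT * p setT.
Proof. by rewrite mulm.unlock mix2_total ?slopem_total//; exact: measurable_comb. Qed.

Lemma diffm_total p : diffm p setT = p setT + p setT.
Proof.
by rewrite diffm.unlock madd_total !pushf_total//; [exact: measurable_tilt|exact: measurable_lay].
Qed.

Lemma minc_slopem (p_ : nat -> fmH) p : minc p_ p -> minc (fun n => slopem (p_ n)) (slopem p).
Proof.
move=> pp f nf; under eq_fun do rewrite slopemE//; rewrite slopemE//.
by apply: pp; apply: (@nnm_fubini _ _ _ _ _ unif (fun z => f (lift z)));
   exact: (nnm_comp (@measurable_lift R) nf).
Qed.

Lemma minc_mulm (q_ : nat -> fmH) q (p_ : nat -> fmH) p : minc q_ q -> minc p_ p ->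
  minc (fun n => mulm (q_ n) (p_ n)) (mulm q p).
Proof.
by rewrite mulm.unlock; move=> qq /minc_slopem pp; apply: minc_mix2 => //; exact: measurable_comb.
Qed.

Lemma minc_diffm (p_ : nat -> fmH) p : minc p_ p -> minc (fun n => diffm (p_ n)) (diffm p).
Proof.
by rewrite diffm.unlock; move=> pp; apply: minc_madd; apply: minc_pushf => //; [exact: measurable_lay|exact: measurable_tilt].
Qed.

Lemma tmeas_slopem (m : R -> fmH) : tmeas m -> tmeas (fun t => slopem (m t)).
Proof.
move=> tm d' X tau F mtau nF.
rewrite (_ : (fun x => _) = fun x => \int[m (tau x)]_h \int[unif]_t F (x, lift (h, t))).
  apply: (tm _ _ tau (fun z => \int[unif]_t F (z.1, lift (z.2, t)))) => //.
  apply: (@nnm_fubini _ _ _ _ _ unif (fun z => F (z.1.1, lift (z.1.2, z.2)))).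
  apply: (nnm_comp (phi := fun z : (X * H) * R => (z.1.1, lift (z.1.2, z.2))) _ nF).
  apply: measurable_fun_pair.
    by apply: (measurableT_comp measurable_fst); exact: measurable_fst.
  apply: measurableT_comp; first exact: measurable_lift.
  apply: measurable_fun_pair; last exact: measurable_snd.
  by apply: (measurableT_comp measurable_snd); exact: measurable_fst.
by apply/funext => x; rewrite slopemE//; exact: nnm_sec.
Qed.

Lemma tmeas_mulm (m n : R -> fmH) : tmeas m -> tmeas n -> tmeas (fun t => mulm (m t) (n t)).
Proof.
by rewrite mulm.unlock; move=> tm /tmeas_slopem tn; apply: tmeas_mix2 => //; exact: measurable_comb.
Qed.

Lemma tmeas_diffm (m : R -> fmH) : tmeas m -> tmeas (fun t => diffm (m t)).
Proof.
by rewrite diffm.unlock; move=> tm; apply: tmeas_madd; apply: tmeas_pushf => //; [exact: measurable_lay|exact: measurable_tilt].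
Qed.

Lemma near_slopem p q e : near_by p q e -> near_by (slopem p) (slopem q) (slopem e).
Proof.
move=> pq f nf; rewrite !slopemE//; apply: pq.
by apply: (@nnm_fubini _ _ _ _ _ unif (fun z => f (lift z)));
   exact: (nnm_comp (@measurable_lift R) nf).
Qed.

Lemma mle_slopem p q : mle p q -> mle (slopem p) (slopem q).
Proof.
move=> pq f nf; rewrite !slopemE//; apply: pq.
by apply: (@nnm_fubini _ _ _ _ _ unif (fun z => f (lift z)));
   exact: (nnm_comp (@measurable_lift R) nf).
Qed.

Lemma near_pushf dX dY (X : measurableType dX) (Y : measurableType dY) (phi : X -> Y)
    (p q e : {finite_measure set X -> \bar R}) : measurable_fun setT phi ->
  near_by p q e -> near_by (pushf phi p) (pushf phi q) (pushf phi e).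
Proof. by move=> mphi pq f nf; rewrite !pushfE//; exact: (pq _ (nnm_comp mphi nf)). Qed.

Lemma near_diffm p q e : near_by p q e -> near_by (diffm p) (diffm q) (diffm e).
Proof.
move=> pq f nf; rewrite (diffmE p nf) (diffmE q nf) (diffmE e nf).
have [a1 a2] := pq _ (nnm_comp (@measurable_lay R) nf).
have [b1 b2] := pq _ (nnm_comp (@measurable_tilt R) nf).
by split; rewrite addeACA leeD.
Qed.

Lemma near_mulm q q' dq p p' dp Q P :
  near_by q q' dq -> near_by p p' dp -> mle q Q -> mle q' Q -> mle p P -> mle p' P ->
  near_by (mulm q p) (mulm q' p') (madd (mulm dq P) (mulm Q dp)).
Proof.
rewrite mulm.unlock => qq /near_slopem pp qQ qQ' /mle_slopem pP /mle_slopem pP'.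
by apply: near_mix2 => //; exact: measurable_comb.
Qed.
End operators.

(** The measure of (u(x) - u(x - y)) (- S^2)^k, S being the slope. *)
HB.lock Definition powm (R : realType) (p : fmH R) (k : nat) : fmH R :=
  iter k (fun q => mulm (mulm q p) p) (diffm p).
(** The sum of all terms with k > 0 is the measure of - (u(x) - u(x - y))
    S^2 / (1 + S^2). *)
HB.lock Definition tailm (R : realType) (p : fmH R) : fmH R := mser (fun k => powm p k.+1).
(** A bound of the change of [powm] when the measure below P changes by at
    most e: the Leibniz rule along the recursion. *)
HB.lock Definition errm (R : realType) (P e : fmH R) (k : nat) : fmH R :=
  iteri k (fun k' r => madd (mulm (madd (mulm r P) (mulm (powm P k') e)) P)
                            (mulm (mulm (powm P k') P) e)) (diffm e).
HB.lock Definition errt (R : realType) (P e : fmH R) : fmH R := mser (fun k => errm P e k.+1).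

Section powers.
Context (R : realType).
Implicit Types p P e : fmH R.

Lemma powm0 p : powm p 0 = diffm p. Proof. by rewrite powm.unlock. Qed.
Lemma powmS p k : powm p k.+1 = mulm (mulm (powm p k) p) p.
Proof. by rewrite powm.unlock. Qed.
Lemma errm0 P e : errm P e 0 = diffm e. Proof. by rewrite errm.unlock. Qed.
Lemma errmS P e k : errm P e k.+1 =
  madd (mulm (madd (mulm (errm P e k) P) (mulm (powm P k) e)) P)
       (mulm (mulm (powm P k) P) e).
Proof. by rewrite errm.unlock. Qed.
End powers.

(** * Bounds with exponential weights *)

Section muskat_operator.
Context (R : realType).
Local Notation H := (freq R).
Local Notation fmH := {finite_measure set H -> \bar R}.
Implicit Types (p q : fmH) (b : R).
Local Open Scope ereal_scope.

Definition wt b (h : H) : R := expR (b * `|xi h|)%R.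

Lemma wt_ge0 b h : (0 <= wt b h)%R. Proof. exact: expR_ge0. Qed.
Lemma measurable_wt b : measurable_fun setT (wt b).
Proof. by rewrite /wt; hmeas. Qed.
Lemma nnm_wt b : nnm (fun h => (wt b h)%:E).
Proof. by apply: nnm_EFin; [exact: measurable_wt|exact: wt_ge0]. Qed.

(** The inequality e^{b |xi|} p <= P between measures. *)
Definition wle b p (P : fmH) := forall f : H -> \bar R, nnm f ->
  \int[p]_h ((wt b h)%:E * f h) <= \int[P]_h f h.

Lemma wle0 p (P : fmH) : wle 0 p P <-> mle p P.
Proof.
have e f : \int[p]_h ((wt 0 h)%:E * f h) = \int[p]_h f h.
  by apply: eq_integral => h _; rewrite /wt mul0r expR0 mul1e.
by split=> h f nf; have := h f nf; rewrite e.
Qed.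

Lemma wle_mle b p (P : fmH) : (0 <= b)%R -> wle b p P -> mle p P.
Proof.
move=> b0 h f nf; apply: le_trans (h f nf).
apply: le_nnm => //; first by apply: nnmM => //; exact: nnm_wt.
move=> x; rewrite lee_pemull//; first by case: nf.
by rewrite lee_fin /wt -expR0 ler_expR mulr_ge0.
Qed.

Lemma wle_pushf b phi p (P : fmH) : measurable_fun setT phi ->
  (0 <= b)%R -> (forall h, (`|xi (phi h)| <= `|xi h|)%R) ->
  wle b p P -> wle b (pushf phi p) (pushf phi P).
Proof.
move=> mphi b0 hphi pP f nf; rewrite !pushfE//; last first.
  by apply: nnmM => //; exact: nnm_wt.
apply: le_trans (pP _ (nnm_comp mphi nf)).
have nw := nnm_wt b.
apply: le_nnm; [exact: (nnm_comp mphi (nnmM nw nf))|exact: nnmM nw (nnm_comp mphi nf)|].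
move=> h; rewrite lee_wpmul2r//; first by case: nf.
by rewrite lee_fin /wt ler_expR ler_wpM2l.
Qed.

Lemma wle_madd b p q (P Q : fmH) : wle b p P -> wle b q Q -> wle b (madd p q) (madd P Q).
Proof.
move=> pP qQ f nf; rewrite !maddE//; last by apply: nnmM => //; exact: nnm_wt.
by apply: leeD; [exact: pP|exact: qQ].
Qed.

Lemma wle_mser b (p P : nat -> fmH) :
  \sum_(k <oo) p k setT < +oo -> \sum_(k <oo) P k setT < +oo ->
  (forall k, wle b (p k) (P k)) -> wle b (mser p) (mser P).
Proof.
move=> pf Pf pP f nf; have nw := nnmM (nnm_wt b) nf.
rewrite !mserE//; apply: lee_nneseries => k _; first by move=> _; exact: nnm_integral.
exact: pP.
Qed.

Lemma wle_slopem b p (P : fmH) : wle b p P -> wle b (slopem p) (slopem P).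
Proof.
move=> pP f nf; have nw := nnmM (nnm_wt b) nf.
rewrite !slopemE//.
have nin : nnm (fun h => \int[unif R]_t f (lift (h, t))).
  by apply: (@nnm_fubini _ _ _ _ _ (unif R) (fun z => f (lift z)));
    exact: (nnm_comp (@measurable_lift R) nf).
apply: le_trans (pP _ nin).
rewrite le_eqVlt; apply/orP; left; apply/eqP; apply: eq_integral => h _.
rewrite -ge0_integralZl_EFin//.
- by move=> t _; case: nf.
- by have [] := nnm_sec h (nnm_comp (@measurable_lift R) nf).
- exact: wt_ge0.
Qed.

(** The frequencies of a product are sums or differences of frequencies,
    hence the weight is submultiplicative. *)
Lemma wle_mulm b q p (Q P : fmH) : (0 <= b)%R -> wle b q Q -> wle b p P ->
  wle b (mulm q p) (mulm Q P).
Proof.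
move=> b0 qQ /wle_slopem pP f nf; have nw := nnmM (nnm_wt b) nf.
rewrite (mulmE _ _ nw) (mulmE _ _ nf).
have mc s := @measurable_comb R s.
have nmf : nnm (mixf (comb 1) (comb (-1)) f) by exact: nnm_mixf.
pose g (ab : H * H) := (wt b ab.1)%:E * ((wt b ab.2)%:E * mixf (comb 1) (comb (-1)) f ab).
have ng : nnm g.
  apply: nnmM; first exact: (nnm_comp measurable_fst (nnm_wt b)).
  by apply: nnmM => //; exact: (nnm_comp measurable_snd (nnm_wt b)).
apply: (@le_trans _ _ (\int[q]_a \int[slopem p]_b' g (a, b'))).
  apply: le_nnm; [exact: (nnm_mix_in (mc 1%R) (mc (-1)%R) _ nw)|exact: nnm_fubini|].
  move=> a; apply: le_nnm; [exact: (nnm_mix_sec (mc 1%R) (mc (-1)%R) _ nw)|exact: nnm_sec|].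
  move=> b'; rewrite /g /mixf /=.
  rewrite muleA -EFinM [leRHS]muleCA; apply: lee_wpmul2l; first by rewrite lee_fin invr_ge0.
  have f0 h : 0 <= f h by case: nf.
  rewrite ge0_muleDr//.
  have ww s : (`|s| <= 1)%R -> (wt b (comb s (a, b')) <= wt b a * wt b b')%R.
    move=> s1; rewrite /wt -expRD ler_expR -mulrDr ler_wpM2l// /comb xiE /=.
    apply: le_trans (ler_normD _ _) _; rewrite lerD2l normrM.
    by rewrite ler_piMl.
  by apply: leeD; apply: lee_wpmul2r => //; rewrite lee_fin ww// ?normrN normr1.
rewrite /g.
have ne a : \int[slopem p]_b' ((wt b a)%:E * ((wt b b')%:E * mixf (comb 1) (comb (-1)) f (a, b')))
   = (wt b a)%:E * \int[slopem p]_b' ((wt b b')%:E * mixf (comb 1) (comb (-1)) f (a, b')).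
  rewrite ge0_integralZl_EFin//; last exact: wt_ge0.
  - by move=> b' _; rewrite mule_ge0 ?lee_fin ?wt_ge0//; case: nmf.
  - by have [] := nnmM (nnm_wt b) (nnm_sec a nmf).
under eq_integral do rewrite ne.
have nin (m : fmH) : nnm (fun a => \int[m]_b' mixf (comb 1) (comb (-1)) f (a, b')).
  exact: nnm_fubini.
apply: (@le_trans _ _ (\int[q]_a ((wt b a)%:E * \int[slopem P]_b' mixf (comb 1) (comb (-1)) f (a, b')))).
  apply: le_nnm.
  - apply: nnmM; first exact: nnm_wt.
    apply: (@nnm_fubini _ _ _ _ _ (slopem p) (fun z => (wt b z.2)%:E * mixf (comb 1) (comb (-1)) f z)).
    by apply: nnmM => //; exact: (nnm_comp measurable_snd (nnm_wt b)).
  - by apply: nnmM => //; exact: nnm_wt.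
  - by move=> a; apply: lee_wpmul2l; [rewrite lee_fin wt_ge0|exact: pP (nnm_sec a nmf)].
exact: qQ.
Qed.

Lemma wle_diffm b p (P : fmH) : (0 <= b)%R -> wle b p P -> wle b (diffm p) (diffm P).
Proof.
move=> b0 pP; rewrite diffm.unlock; apply: wle_madd.
  exact: (wle_pushf (@measurable_lay R) b0 (fun h => lexx _) pP).
exact: (wle_pushf (@measurable_tilt R) b0 (fun h => lexx _) pP).
Qed.

Lemma wle_powm b p (P : fmH) k : (0 <= b)%R -> wle b p P -> wle b (powm p k) (powm P k).
Proof.
move=> b0 pP; elim: k => [|k ih]; first by rewrite !powm0; exact: wle_diffm.
by rewrite !powmS; apply: (wle_mulm b0 _ pP); exact: (wle_mulm b0 ih pP).
Qed.

Lemma powm_total p (a : R) k : p setT <= a%:E ->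
  powm p k setT <= (2 * a * (a ^+ 2) ^+ k)%:E.
Proof.
move=> pa; have a0 : (0 <= a)%R by rewrite -lee_fin (le_trans _ pa).
elim: k => [|k ih].
  by rewrite powm0 diffm_total expr0 mulr1 mulr_natl mulr2n EFinD leeD.
rewrite powmS !mulm_total -muleA exprS.
apply: (@le_trans _ _ ((2 * a * (a ^+ 2) ^+ k)%:E * (a%:E * a%:E))).
  by apply: lee_pmul => //; [exact: mule_ge0|exact: lee_pmul].
rewrite -!EFinM lee_fin; move: ((a ^+ 2) ^+ k)%R => z.
by rewrite (_ : (_ * (a * a) = 2 * a * (a ^+ 2 * z))%R) //; ring.
Qed.

Lemma geometric_le (a r : R) (u : nat -> \bar R) : (0 <= a)%R -> (0 <= r)%R -> (r <= 2^-1)%R ->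
  (forall k, 0 <= u k) -> (forall k, u k <= (a * r ^+ k)%:E) ->
  \sum_(k <oo) u k <= (2 * a)%:E.
Proof.
move=> a0 r0 r1 u0 ua.
apply: (@le_trans _ _ (\sum_(k <oo) (a * 2^-1 ^+ k)%:E)).
  apply: lee_nneseries => // k _; apply: le_trans (ua k) _.
  by rewrite lee_fin ler_wpM2l// lerXn2r// nnegrE ?invr_ge0.
have h := @cvg_geometric_series R a 2^-1.
have half1 : (`|2^-1| < 1 :> R)%R by rewrite ger0_norm ?invr_ge0// invf_lt1// ltr1n.
rewrite (_ : \sum_(k <oo) _ = (a / (1 - 2^-1))%:E).
  by rewrite lee_fin (_ : (1 - 2^-1 = 2^-1 :> R)%R) ?invrK ?(mulrC a)//; field.
apply/cvg_lim => //.
rewrite (_ : (fun n => _) = EFin \o series (geometric a 2^-1)).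
  by apply: cvg_EFin; [exact: nearW|exact: h].
by apply/funext => n /=; rewrite /series/= sumEFin.
Qed.

Lemma powm_total_half p (a : R) k : (a <= 2^-1)%R -> p setT <= a%:E ->
  powm p k.+1 setT <= (2 * a ^+ 3 * 2^-1 ^+ k)%:E.
Proof.
move=> a1 pa; have a0 : (0 <= a)%R by rewrite -lee_fin (le_trans _ pa).
apply: le_trans (powm_total k.+1 pa) _; rewrite lee_fin exprS.
rewrite (_ : (2 * a * (a ^+ 2 * _) = 2 * a ^+ 3 * (a ^+ 2) ^+ k)%R); last first.
  by move: ((a ^+ 2) ^+ k)%R => z; ring.
apply: ler_wpM2l; first by rewrite mulr_ge0// exprn_ge0.
apply: lerXn2r; rewrite ?nnegrE ?exprn_ge0 ?invr_ge0//.
rewrite expr2 -[leRHS]mulr1; apply: ler_pM => //.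
by apply: le_trans a1 _; rewrite invf_le1// ler1n.
Qed.

Lemma powm_sum p (a : R) : (a <= 2^-1)%R -> p setT <= a%:E ->
  \sum_(k <oo) powm p k.+1 setT <= (4 * a ^+ 3)%:E.
Proof.
move=> a1 pa; have a0 : (0 <= a)%R by rewrite -lee_fin (le_trans _ pa).
rewrite (_ : (4 * a ^+ 3 = 2 * (2 * a ^+ 3))%R); last by ring.
apply: (@geometric_le _ 2^-1) => //.
- by rewrite mulr_ge0// exprn_ge0.
- by move=> k; exact: powm_total_half.
Qed.

Definition small p := p setT <= (2^-1)%:E.

Lemma powm_fin p : small p -> \sum_(k <oo) powm p k.+1 setT < +oo.
Proof. by move=> sp; apply: le_lt_trans (powm_sum (lexx _) sp) _; rewrite ltry. Qed.

Lemma tailm_total p (a : R) : (a <= 2^-1)%R -> p setT <= a%:E ->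
  tailm p setT <= (4 * a ^+ 3)%:E.
Proof.
move=> a1 pa; have sp : small p by apply: le_trans pa _; rewrite lee_fin.
by rewrite tailm.unlock mser_total ?powm_fin// powm_sum.
Qed.

Lemma wle_tailm b p (P : fmH) : (0 <= b)%R -> small p -> small P -> wle b p P ->
  wle b (tailm p) (tailm P).
Proof.
by rewrite tailm.unlock => b0 sp sP pP; apply: wle_mser; [exact: powm_fin|exact: powm_fin|]=> k; exact: wle_powm.
Qed.

Lemma minc_powm (p_ : nat -> fmH) p k : minc p_ p ->
  minc (fun n => powm (p_ n) k) (powm p k).
Proof.
move=> pp; elim: k => [|k ih].
  by under eq_fun do rewrite powm0; rewrite powm0; exact: minc_diffm.
under eq_fun do rewrite powmS; rewrite powmS.
by apply: (minc_mulm _ pp); exact: (minc_mulm ih pp).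
Qed.

Lemma minc_tailm (p_ : nat -> fmH) p : minc p_ p -> (forall n, small (p_ n)) -> small p ->
  minc (fun n => tailm (p_ n)) (tailm p).
Proof.
rewrite tailm.unlock => pp sp_ sp; apply: (@minc_series _ _ _ (fun n k => powm (p_ n) k.+1)).
- by move=> k; exact: minc_powm.
- by move=> n; exact: powm_fin.
- exact: powm_fin.
Qed.

Lemma tmeas_powm (p : R -> fmH) k : tmeas p -> tmeas (fun t => powm (p t) k).
Proof.
move=> tp; elim: k => [|k ih].
  by under eq_fun do rewrite powm0; exact: tmeas_diffm.
under eq_fun do rewrite powmS.
exact: (tmeas_mulm (tmeas_mulm ih tp) tp).
Qed.

Lemma tmeas_tailm (p : R -> fmH) : tmeas p -> (forall t, small (p t)) ->
  tmeas (fun t => tailm (p t)).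
Proof.
rewrite tailm.unlock => tp sp; apply: tmeas_mser => [t|k]; first exact: powm_fin.
exact: (tmeas_powm _ tp).
Qed.

Lemma mle_powm p (P : fmH) k : mle p P -> mle (powm p k) (powm P k).
Proof. by move=> /wle0 pP; apply/wle0; exact: wle_powm. Qed.

Lemma mle_mulm q p (Q P : fmH) : mle q Q -> mle p P -> mle (mulm q p) (mulm Q P).
Proof. by move=> /wle0 qQ /wle0 pP; apply/wle0; exact: wle_mulm. Qed.

Lemma near_powm p q (P e : fmH) k : near_by p q e -> mle p P -> mle q P ->
  near_by (powm p k) (powm q k) (errm P e k).
Proof.
move=> pq pP qP; elim: k => [|k ih]; first by rewrite !powm0 errm0; exact: near_diffm.
have h1 : near_by (mulm (powm p k) p) (mulm (powm q k) q)
    (madd (mulm (errm P e k) P) (mulm (powm P k) e)).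
  exact: (near_mulm ih pq (mle_powm k pP) (mle_powm k qP) pP qP).
rewrite !powmS errmS.
exact: (near_mulm h1 pq (mle_mulm (mle_powm k pP) pP) (mle_mulm (mle_powm k qP) qP) pP qP).
Qed.

(** The Leibniz rule produces about 2k terms; the factor 4^k absorbs this
    number. *)
Lemma errm_total (P e : fmH) (a d : R) k : P setT <= a%:E -> e setT <= d%:E ->
  errm P e k setT <= (2 * d * (4 * a ^+ 2) ^+ k)%:E.
Proof.
move=> Pa ed; have a0 : (0 <= a)%R by rewrite -lee_fin (le_trans _ Pa).
have d0 : (0 <= d)%R by rewrite -lee_fin (le_trans _ ed).
elim: k => [|k ih].
  by rewrite errm0 diffm_total expr0 mulr1 mulr_natl mulr2n EFinD leeD.
rewrite errmS madd_total !mulm_total madd_total !mulm_total.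
have Q := powm_total k Pa.
set E := (2 * d * (4 * a ^+ 2) ^+ k)%R in ih *.
set q := (2 * a * (a ^+ 2) ^+ k)%R in Q *.
apply: (@le_trans _ _ (((E%:E * a%:E) + q%:E * d%:E) * a%:E + (q%:E * a%:E) * d%:E)).
  apply: leeD; last by apply: lee_pmul => //; [exact: mule_ge0|exact: lee_pmul].
  apply: lee_pmul => //; first by rewrite adde_ge0// mule_ge0.
  by apply: leeD; exact: lee_pmul.
rewrite -?EFinM -?EFinD -?EFinM -?EFinD lee_fin exprS.
have qE : (q * d <= a * E)%R.
  rewrite /q /E (_ : (2 * a * _ * d = (2 * a * d) * (a ^+ 2) ^+ k)%R); last by ring.
  rewrite (_ : (a * (2 * d * _) = (2 * a * d) * (4 * a ^+ 2) ^+ k)%R); last by ring.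
  apply: ler_wpM2l; first by rewrite !mulr_ge0.
  apply: lerXn2r; rewrite ?nnegrE ?mulr_ge0 ?exprn_ge0//.
  by rewrite ler_peMl ?exprn_ge0// ler1n.
have -> : (2 * d * (4 * a ^+ 2 * (4 * a ^+ 2) ^+ k) = 4 * a ^+ 2 * E)%R.
  by rewrite /E; ring.
have E0 : (0 <= E)%R by rewrite /E !mulr_ge0// exprn_ge0// mulr_ge0// exprn_ge0.
have h : (q * d * a <= a * E * a)%R by apply: ler_wpM2r.
have : (0 <= a ^+ 2 * E)%R by rewrite mulr_ge0// exprn_ge0.
move: h; clear; nra.
Qed.

Lemma errm_sum (P e : fmH) (a d : R) : (a <= 4^-1)%R -> P setT <= a%:E -> e setT <= d%:E ->
  \sum_(k <oo) errm P e k.+1 setT <= (16 * a ^+ 2 * d)%:E.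
Proof.
move=> a1 Pa ed; have a0 : (0 <= a)%R by rewrite -lee_fin (le_trans _ Pa).
have d0 : (0 <= d)%R by rewrite -lee_fin (le_trans _ ed).
have a20 : (0 <= a ^+ 2)%R by rewrite exprn_ge0.
rewrite (_ : (16 * a ^+ 2 * d = 2 * (2 * d * (4 * a ^+ 2)))%R); last by ring.
apply: (@geometric_le _ (4 * a ^+ 2)%R).
- by rewrite !mulr_ge0.
- by rewrite mulr_ge0.
- by move: a1 a0; clear; nra.
- by [].
- by move=> k; rewrite -mulrA -exprS; exact: errm_total.
Qed.

Definition tiny (P : fmH) := P setT <= (4^-1)%:E.

Lemma tiny_small (P : fmH) : tiny P -> small P.
Proof. by move=> h; apply: le_trans h _; rewrite lee_fin lef_pV2// ?posrE// ler_nat. Qed.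

Lemma errm_fin (P e : fmH) : tiny P -> \sum_(k <oo) errm P e k.+1 setT < +oo.
Proof.
move=> tP; have ed : e setT <= (mass e)%:E by rewrite massE.
by apply: le_lt_trans (errm_sum (lexx _) tP ed) _; rewrite ltry.
Qed.

Lemma errt_total (P e : fmH) (a d : R) : (a <= 4^-1)%R -> P setT <= a%:E -> e setT <= d%:E ->
  errt P e setT <= (16 * a ^+ 2 * d)%:E.
Proof.
rewrite errt.unlock => a1 Pa ed; rewrite mser_total; first exact: errm_sum.
by apply: errm_fin; apply: le_trans Pa _; rewrite lee_fin.
Qed.

Lemma near_tailm p q (P e : fmH) : near_by p q e -> mle p P -> mle q P -> tiny P ->
  near_by (tailm p) (tailm q) (errt P e).
Proof.
move=> pq pP qP tP; have sP := tiny_small tP.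
have sp : small p by apply: le_trans (mle_total pP) sP.
have sq : small q by apply: le_trans (mle_total qP) sP.
have ge (m : fmH) f : nnm f -> 0 <= \int[m]_h f h by exact: nnm_integral.
move=> f nf; rewrite tailm.unlock errt.unlock (mserE (powm_fin sp) nf) (mserE (powm_fin sq) nf) (mserE (errm_fin e tP) nf).
rewrite -!nneseriesD//; try by move=> i _ _; exact: ge.
have nn k := near_powm k.+1 pq pP qP nf.
split; (apply: lee_nneseries; first by move=> k _ _; exact: ge).
- by move=> k _; case: (nn k).
- by move=> k _; case: (nn k).
Qed.

Lemma wle_errm b (P e P' e' : fmH) k : (0 <= b)%R -> wle b P P' -> wle b e e' ->
  wle b (errm P e k) (errm P' e' k).
Proof.
move=> b0 PP ee; elim: k => [|k ih]; first by rewrite !errm0; exact: wle_diffm.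
have hp := wle_powm k b0 PP.
rewrite !errmS.
apply: wle_madd.
- apply: (wle_mulm b0 _ PP); apply: wle_madd.
  + exact: (wle_mulm b0 ih PP).
  + exact: (wle_mulm b0 hp ee).
- exact: (wle_mulm b0 (wle_mulm b0 hp PP) ee).
Qed.

Lemma wle_errt b (P e P' e' : fmH) : (0 <= b)%R -> wle b P P' -> wle b e e' ->
  tiny P -> tiny P' -> wle b (errt P e) (errt P' e').
Proof.
rewrite errt.unlock => b0 PP ee tP tP'; apply: wle_mser.
- exact: errm_fin.
- exact: errm_fin.
- by move=> k; exact: wle_errm.
Qed.

End muskat_operator.

Section tau.
Context (R : realType) (kap : R).
Local Notation H := (freq R).
(** The map of frequencies made by the principal value: the sign of kap xi
    eta becomes a phase pi. Waves with eta = 0 contribute nothing to the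
    principal value; they are sent to xi = 0, where the factor |xi| kills
    them. *)
Definition tau (h : H) : H :=
  if eta h == 0%R then mkfreq 0 0 0
  else mkfreq (xi h) (eta h) (phase h + if (kap * (xi h * eta h) < 0)%R then pi else 0%R)%R.

Lemma measurable_tau : measurable_fun setT tau.
Proof. by rewrite /tau; hmeas. Qed.

Lemma xi_tau h : (`|xi (tau h)| <= `|xi h|)%R.
Proof. by rewrite /tau; case: ifP => // _; rewrite xiE normr0. Qed.

End tau.

HB.lock Definition Tm (R : realType) (kap : R) (p : fmH R) : fmH R := pushf (tau kap) (tailm p).
HB.lock Definition Em (R : realType) (kap : R) (P e : fmH R) : fmH R := pushf (tau kap) (errt P e).

Section Tm_theory.
Context (R : realType) (kap : R).
Local Notation H := (freq R).
Local Notation fmH := {finite_measure set H -> \bar R}.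
Implicit Types (p q : fmH) (b : R).
Local Open Scope ereal_scope.
Local Notation Tm := (Tm kap).
Local Notation Em := (Em kap).
Local Notation measurable_tau := (measurable_tau kap).
Local Notation xi_tau := (xi_tau kap).
Lemma Tm_total p (a : R) : (a <= 2^-1)%R -> p setT <= a%:E -> Tm p setT <= (4 * a ^+ 3)%:E.
Proof. by move=> a1 pa; rewrite Tm.unlock pushf_total; [exact: tailm_total|exact: measurable_tau]. Qed.

Lemma wle_Tm b p (P : fmH) : (0 <= b)%R -> small p -> small P -> wle b p P ->
  wle b (Tm p) (Tm P).
Proof.
rewrite Tm.unlock => b0 sp sP pP; apply: (wle_pushf measurable_tau b0 xi_tau).
exact: wle_tailm.
Qed.

Lemma minc_Tm (p_ : nat -> fmH) p : minc p_ p -> (forall n, small (p_ n)) -> small p ->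
  minc (fun n => Tm (p_ n)) (Tm p).
Proof. by rewrite Tm.unlock => pp sp_ sp; apply: minc_pushf measurable_tau _; exact: minc_tailm. Qed.

Lemma tmeas_Tm (p : R -> fmH) : tmeas p -> (forall t, small (p t)) -> tmeas (fun t => Tm (p t)).
Proof. by rewrite Tm.unlock => tp sp; apply: tmeas_pushf measurable_tau _; exact: tmeas_tailm. Qed.

Lemma near_Tm p q (P e : fmH) : near_by p q e -> mle p P -> mle q P -> tiny P ->
  near_by (Tm p) (Tm q) (Em P e).
Proof. by rewrite Tm.unlock Em.unlock => pq pP qP tP; apply: near_pushf measurable_tau _; exact: near_tailm. Qed.

Lemma Em_total (P e : fmH) (a d : R) : (a <= 4^-1)%R -> P setT <= a%:E -> e setT <= d%:E ->
  Em P e setT <= (16 * a ^+ 2 * d)%:E.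
Proof. by move=> a1 Pa ed; rewrite Em.unlock pushf_total; [exact: errt_total|exact: measurable_tau]. Qed.

Lemma wle_Em b (P e P' e' : fmH) : (0 <= b)%R -> wle b P P' -> wle b e e' ->
  tiny P -> tiny P' -> wle b (Em P e) (Em P' e').
Proof.
rewrite Em.unlock => b0 PP ee tP tP'; apply: (wle_pushf measurable_tau b0 xi_tau).
exact: wle_errt.
Qed.
End Tm_theory.

(** * Calculus and the sine integral *)

Section calculus.
Context (R : realType).
Implicit Types (f g df F : R -> R) (a b x k l : R).

(** Derivatives are computed by composing rules and adjusting the value at
    the end. *)
Lemma dv_cvt f x l l' : is_derive x 1 f l -> l = l' -> is_derive x 1 f l'.
Proof. by move=> h <-. Qed.

Lemma dv_cst x k : is_derive x 1 (fun _ : R => k) 0.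
Proof. exact: is_derive_cst. Qed.

Lemma dv_id x : is_derive x 1 (fun y : R => y) 1.
Proof. exact: is_derive_id. Qed.

Lemma dvD f g x l k : is_derive x 1 f l -> is_derive x 1 g k ->
  is_derive x 1 (fun y => f y + g y) (l + k).
Proof. by move=> hf hg; exact: is_deriveD. Qed.

Lemma dvN f x l : is_derive x 1 f l -> is_derive x 1 (fun y => - f y) (- l).
Proof. by move=> hf; exact: is_deriveN. Qed.

Lemma dvB f g x l k : is_derive x 1 f l -> is_derive x 1 g k ->
  is_derive x 1 (fun y => f y - g y) (l - k).
Proof. by move=> hf hg; exact: is_deriveB. Qed.

Lemma dvZ c f x l : is_derive x 1 f l -> is_derive x 1 (fun y => c * f y) (c * l).
Proof. by move=> hf; exact: is_deriveZ. Qed.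

Lemma dvM f g x l k : is_derive x 1 f l -> is_derive x 1 g k ->
  is_derive x 1 (fun y => f y * g y) (l * g x + f x * k).
Proof.
move=> hf hg; have h := is_deriveM hf hg; apply: (dv_cvt h).
by rewrite /GRing.scale/= addrC mulrC (mulrC l).
Qed.

Lemma dv_comp f g x l k : is_derive (g x) 1 f l -> is_derive x 1 g k ->
  is_derive x 1 (fun y => f (g y)) (l * k).
Proof. by move=> hf hg; exact: (is_derive1_comp hf hg). Qed.

Lemma dv_inv x : x != 0 -> is_derive x 1 (fun y : R => y^-1) (- (x ^+ 2)^-1).
Proof.
move=> x0; have h := @is_deriveV R (fun y => y) x 1 1 x0 (dv_id x).
by apply: (dv_cvt h); rewrite /GRing.scale/= mulr1.
Qed.

Lemma is_derive_continuous f x l : is_derive x 1 f l -> {for x, continuous f}.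
Proof. by move=> h; apply/differentiable_continuous/derivable1_diffP. Qed.

Lemma is_derive_within f df a b : (forall x, x \in `[a, b] -> is_derive x 1 f (df x)) ->
  {within `[a, b], continuous f}.
Proof.
move=> h; apply: continuous_in_subspaceT => x; rewrite inE => xab.
exact: (is_derive_continuous (h x xab)).
Qed.

Lemma deriv_ge0_le f df a b : a <= b -> (forall x, x \in `[a, b] -> is_derive x 1 f (df x)) ->
  (forall x, x \in `[a, b] -> 0 <= df x) -> f a <= f b.
Proof.
move=> ab dfE df0; have [c cab ->] : exists2 c, c \in `[a, b] & f b = f a + df c * (b - a).
  have h1 x : x \in `]a, b[ -> is_derive x 1 f (df x).
    by move=> xab; apply: dfE; exact: subset_itv_oo_cc.
  have [c cab e] := MVT_segment ab h1 (is_derive_within dfE).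
  by exists c => //; rewrite -e addrC subrK.
by rewrite lerDl mulr_ge0 ?df0// subr_ge0.
Qed.

Lemma deriv_bound f df a b (K : R) : (forall x, x \in `[Num.min a b, Num.max a b] -> is_derive x 1 f (df x)) ->
  (forall x, x \in `[Num.min a b, Num.max a b] -> `|df x| <= K) -> `|f b - f a| <= K * `|b - a|.
Proof.
wlog ab : a b / a <= b.
  move=> h; have /orP[ab|ba] := le_total a b; first exact: h.
  rewrite minC maxC => h1 h2; rewrite distrC (distrC b); exact: h.
rewrite min_l// max_r// => dfE dfK.
have h1 x : x \in `]a, b[ -> is_derive x 1 f (df x).
  by move=> xab; apply: dfE; exact: subset_itv_oo_cc.
have [c cab ->] := MVT_segment ab h1 (is_derive_within dfE).
by rewrite normrM ler_wpM2r// dfK.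
Qed.

Lemma FTC_R f F a b : a <= b -> (forall x, x \in `[a, b] -> is_derive x 1 F (f x)) ->
  {within `[a, b], continuous f} ->
  \int[@lebesgue_measure R]_(x in `[a, b]) f x = F b - F a.
Proof.
rewrite le_eqVlt => /predU1P[<- _ _|ab dF cf].
  by rewrite set_itv1 Rintegral_set1 subrr.
rewrite /Rintegral (@continuous_FTC2 R f F a b ab cf)//.
- split.
  + by move=> x xab; have [] := dF x (subset_itv_oo_cc xab).
  + apply: cvg_at_right_filter; apply: is_derive_continuous (dF a _).
    by rewrite in_itv/= lexx ltW.
  + apply: cvg_at_left_filter; apply: is_derive_continuous (dF b _).
    by rewrite in_itv/= lexx ltW.
- move=> x xab; rewrite derive1E; have := dF x (subset_itv_oo_cc xab).
  by move=> h; rewrite derive_val.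
Qed.

Lemma antideriv f a b : 0 < a -> (forall x, 0 < x -> {for x, continuous f}) ->
  exists F, forall x, x \in `[a, b] -> is_derive x 1 F (f x).
Proof.
move=> a0 cf.
pose l := a / 2; pose u := b + 1.
have l0 : 0 < l by rewrite divr_gt0.
have la : l < a by rewrite /l; move: a0; clear; lra.
exists (fun x => \int[@lebesgue_measure R]_(t in `[l, x]) f t).
move=> x; rewrite in_itv/= => /andP[ax xb].
have xu : x < u by rewrite /u; move: xb; clear; lra.
have fi : (@lebesgue_measure R).-integrable `[l, u] (EFin \o f).
  apply: continuous_compact_integrable => //; first exact: segment_compact.
  apply: continuous_in_subspaceT => y; rewrite inE/= in_itv/= => /andP[ly _].
  by apply: cf; exact: lt_le_trans ly.
have lx : (BLeft l < BRight x)%O by rewrite bnd_simp ltW// (lt_le_trans la).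
have [d e] := @continuous_FTC1_closed R f l x u xu fi (lt_le_trans la ax) (cf _ (lt_le_trans a0 ax)).
apply: DeriveDef; first exact: d.
by rewrite -derive1E; exact: e.
Qed.

Lemma deriv_under d (T : measurableType d) (m : {measure set T -> \bar R})
    (f df : R -> T -> R) (G : T -> R) (x : R) :
  (forall x, m.-integrable setT (EFin \o f x)) ->
  (forall x h, is_derive x 1 (f^~ h) (df x h)) ->
  m.-integrable setT (EFin \o G) -> (forall x h, `|df x h| <= G h) ->
  is_derive x 1 (fun x => \int[m]_h f x h) (\int[m]_h df x h).
Proof.
move=> fi fd Gi dG.
have Ix : (`]x - 1, x + 1[)%classic x by rewrite /= in_itv/= ltrBlDr ltrDl ltr01.
have Gge h : 0 <= G h by apply: le_trans (dG x h).
have d1 y h : partial1of2 f y h = df y h.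
  by rewrite partial1of2E; have H := fd y h; rewrite derive_val.
have h1 : forall y h, (`]x - 1, x + 1[)%classic y -> setT h -> derivable (f^~ h) y 1.
  by move=> y h _ _; have [] := fd y h.
have h2 : forall y h, (`]x - 1, x + 1[)%classic y -> setT h -> `|partial1of2 f y h| <= G h.
  by move=> y h _ _; rewrite d1.
have h3 : forall y, (`]x - 1, x + 1[)%classic y -> m.-integrable setT (EFin \o f y) by move=> y _.
apply: DeriveDef.
  exact: (@derivable_under_integral _ _ _ m f setT measurableT x _ _ Ix h3 h1 G Gge Gi h2).
rewrite -derive1E (@differentiation_under_integral _ _ _ m f setT measurableT x _ _ Ix h3 h1 G Gge Gi h2).
by congr (fine _); apply: eq_integral => h _; rewrite d1.
Qed.

Lemma measurable_invR : measurable_fun setT (fun x : R => x^-1).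
Proof.
rewrite (_ : (fun x : R => x^-1) = fun x => if x == 0 then 0 else
    if x < 0 then - expR (- ln `|x|) else expR (- ln `|x|)).
  by repeat first [mstep | apply: (measurableT_comp (@measurable_ln R))].
apply/funext => x; have [->|x0] := eqVneq x 0; first by rewrite invr0.
rewrite expRN lnK ?posrE ?normr_gt0//.
by case: ltrgt0P x0 => // h _; rewrite ?invrN ?opprK.
Qed.

Lemma norm_cos x : `|cos x| <= 1.
Proof. by rewrite ler_norml cos_geN1 cos_le1. Qed.
Lemma norm_sin x : `|sin x| <= 1.
Proof. by rewrite ler_norml sin_geN1 sin_le1. Qed.

Lemma bm_cos d (T : measurableType d) (g : T -> R) : measurable_fun setT g ->
  bm (fun h => cos (g h)).
Proof.
move=> mg; split; first by apply: (measurableT_comp (@measurable_cosR R)).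
by exists 1 => h; exact: norm_cos.
Qed.

Lemma bm_sin d (T : measurableType d) (g : T -> R) : measurable_fun setT g ->
  bm (fun h => sin (g h)).
Proof.
move=> mg; split; first by apply: (measurableT_comp (@measurable_sinR R)).
by exists 1 => h; exact: norm_sin.
Qed.

Lemma norm_sin_le x : `|sin x| <= `|x|.
Proof.
have := @deriv_bound (@sin R) (@cos R) 0 x 1.
rewrite sin0 !subr0 mul1r; apply.
by move=> y _; exact: norm_cos.
Qed.

Lemma is_derive_affine (A B : R) f l x : is_derive (A * x + B) 1 f l ->
  is_derive x 1 (fun y => f (A * y + B)) (A * l).
Proof.
move=> h; have -> : A * l = l * A by rewrite mulrC.
apply: (@dv_comp f (fun y => A * y + B) x l A h).
by apply: dv_cvt (dvD (dvZ A (dv_id x)) (dv_cst x B)) _; rewrite mulr1 addr0.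
Qed.
End calculus.

Section sine_integral.
Context (R : realType).
Local Notation unif := (unif R).
Implicit Types (x y z t : R).

Definition sint z t : R := if t == 0 then z else sin (z * t) / t.
(** The sine integral, written as an integral over [0,1] so that dominated
    convergence and Fubini apply to it. *)
Definition Si z := RI unif (sint z).

Lemma is_derive_sint z t : is_derive z 1 (sint^~ t) (cos (z * t)).
Proof.
rewrite /sint; have [->|t0] := eqVneq t 0; first by rewrite mulr0 cos0; exact: is_derive_id.
have h := @is_derive_affine R t 0 (@sin R) (cos (t * z + 0)) z (is_derive_sin _).
rewrite (_ : (fun z => sin (z * t) / t) = fun y => t^-1 * sin (t * y + 0)); last first.
  by apply/funext => y; rewrite addr0 [RHS]mulrC (mulrC t y).
by apply: dv_cvt (dvZ t^-1 h) _; rewrite addr0 (mulrC t z) mulrA mulVf// mul1r.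
Qed.

Lemma sint_bound z t : `|sint z t| <= `|z|.
Proof.
rewrite /sint; have [//|t0] := eqVneq t 0.
rewrite normrM normfV ler_pdivrMr ?normr_gt0// -normrM; exact: norm_sin_le.
Qed.

Lemma bm_sint z : bm (sint z).
Proof.
split; last by exists `|z|; exact: sint_bound.
rewrite /sint; apply: measurable_fun_ifT.
- by meas.
- by meas.
- apply: measurable_funM; first by meas.
  by apply: (measurableT_comp (@measurable_invR R)); meas.
Qed.

Lemma mass_unif : mass unif = 1.
Proof. by rewrite /mass unif_total. Qed.

Lemma Si_bound1 z : `|Si z| <= `|z|.
Proof.
by have := RI_bound unif (bm_sint z) (sint_bound z); rewrite mass_unif mulr1.
Qed.

Lemma bm_cosz z : bm (fun t => cos (z * t)).
Proof. by apply: bm_cos; meas. Qed.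

Lemma RI_cosz z : z != 0 -> RI unif (fun t => cos (z * t)) = sin z / z.
Proof.
move=> z0; rewrite RI_unif; last exact: bm_cosz.
have h1 t : is_derive t 1 (fun t => sin (z * t) / z) (cos (z * t)).
  have h := @is_derive_affine R z 0 (@sin R) (cos (z * t + 0)) t (is_derive_sin _).
  rewrite (_ : (fun t => sin (z * t) / z) = fun y => z^-1 * sin (z * y + 0)); last first.
    by apply/funext => y; rewrite addr0 mulrC.
  by apply: dv_cvt (dvZ z^-1 h) _; rewrite addr0 mulrA mulVf// mul1r.
have h2 t : is_derive t 1 (fun t => cos (z * t)) (- (z * sin (z * t))).
  have h := @is_derive_affine R z 0 (@cos R) (- sin (z * t + 0)) t (is_derive_cos _).
  rewrite (_ : (fun t => cos (z * t)) = fun y => cos (z * y + 0)); last first.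
    by apply/funext => y; rewrite addr0.
  by apply: dv_cvt h _; rewrite addr0 mulrN.
have := FTC_R (@ler01 R) (fun t _ => h1 t) (is_derive_within (fun t _ => h2 t)).
by move=> ->; rewrite mulr1 mulr0 sin0 mul0r subr0.
Qed.

Lemma is_derive_Si z : z != 0 -> is_derive z 1 Si (sin z / z).
Proof.
move=> z0; rewrite -RI_cosz//.
apply: (@deriv_under R _ _ unif sint (fun z t => cos (z * t)) (fun=> 1)).
- by move=> x; apply: bm_integrable; exact: bm_sint.
- by move=> x h; exact: is_derive_sint.
- by apply: (@bm_integrable R _ _ unif (fun=> 1)); exact: bm_cst.
- by move=> x h; exact: norm_cos.
Qed.

Lemma SiN z : Si (- z) = - Si z.
Proof.
rewrite /Si -RIN; last exact: bm_sint.
congr RI; apply/funext => t; rewrite /sint; case: ifP => // _.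
by rewrite mulNr sinN mulNr.
Qed.

Lemma Si0 : Si 0 = 0.
Proof. by apply/eqP; rewrite -normr_le0; apply: le_trans (Si_bound1 0) _; rewrite normr0. Qed.

Let G z := Si z + cos z / z.

Let dG z : 0 < z -> is_derive z 1 G (- (cos z / z ^+ 2)).
Proof.
move=> z0; have zn0 : z != 0 by rewrite gt_eqF.
apply: dv_cvt (dvD (is_derive_Si zn0) (dvM (is_derive_cos z) (dv_inv zn0))) _.
by rewrite mulNr mulrN addrA subrr add0r.
Qed.

Let dGV (s : R) z : 0 < z -> is_derive z 1 (fun z => G z + s * z^-1) (- (cos z / z ^+ 2) - s * (z ^+ 2)^-1).
Proof.
move=> z0; have zn0 : z != 0 by rewrite gt_eqF.
by apply: dv_cvt (dvD (dG z0) (dvZ s (dv_inv zn0))) _; rewrite mulrN.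
Qed.

Let G_lo z w : 0 < z -> z <= w -> G z - z^-1 <= G w - w^-1.
Proof.
move=> z0 zw.
have := @deriv_ge0_le R (fun z => G z + (-1) * z^-1)
  (fun z => - (cos z / z ^+ 2) - (-1) * (z ^+ 2)^-1) z w zw.
rewrite !mulN1r; apply => y; rewrite in_itv/= => /andP[zy _].
  by apply: dGV; exact: lt_le_trans zy.
rewrite mulN1r opprK addrC -{1}[(y ^+ 2)^-1]mul1r -mulrBl.
by rewrite mulr_ge0 ?invr_ge0 ?exprn_even_ge0// subr_ge0 cos_le1.
Qed.

Let G_hi z w : 0 < z -> z <= w -> G w + w^-1 <= G z + z^-1.
Proof.
move=> z0 zw; rewrite -lerN2.
have := @deriv_ge0_le R (fun z => - (G z + 1 * z^-1))
  (fun z => - (- (cos z / z ^+ 2) - 1 * (z ^+ 2)^-1)) z w zw.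
rewrite !mul1r; apply => y; rewrite in_itv/= => /andP[zy _].
  by apply: dvN; apply: dGV; exact: lt_le_trans zy.
rewrite mul1r opprB opprK -{1}[(y ^+ 2)^-1]mul1r -mulrDl.
by rewrite mulr_ge0 ?invr_ge0 ?exprn_even_ge0// -lerBlDl sub0r cos_geN1.
Qed.

(** The limit of the sine integral at infinity, as the supremum of an
    increasing function with the same limit. *)
Definition kappa : R := sup [set Si z + cos z / z - z^-1 | z in [set z | 0 < z]].

(** Si z + cos z / z has derivative - cos z / z^2, so subtracting 1/z makes
    it increasing and adding 1/z makes it decreasing. *)
Lemma Si_cvg z : 0 < z -> `|Si z - kappa| <= 2 / z.
Proof.
move=> z0.
have cross y w : 0 < y -> 0 < w -> G y - y^-1 <= G w + w^-1.
  move=> y0 w0; have /orP[yw|wy] := le_total y w.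
    apply: le_trans (G_lo y0 yw) _; rewrite lerD2l.
    by apply: (@le_trans _ _ 0); rewrite ?oppr_le0 invr_ge0 ltW.
  apply: le_trans (G_hi w0 wy); rewrite lerD2l.
  by apply: (@le_trans _ _ 0); rewrite ?oppr_le0 invr_ge0 ltW.
have nE : [set G z - z^-1 | z in [set z | 0 < z]] !=set0 by exists (G 1 - 1^-1); exists 1 => //=; exact: ltr01.
have lo : G z - z^-1 <= kappa.
  apply: ub_le_sup; last by exists z.
  by exists (G z + z^-1) => _ [y y0 <-]; exact: cross.
have hi : kappa <= G z + z^-1 by apply: ge_sup => // _ [y y0 <-]; exact: cross.
have c : `|cos z / z| <= z^-1.
  by rewrite normrM normfV (gtr0_norm z0) ler_piMl ?norm_cos// invr_ge0 ltW.
have -> : 2 / z = z^-1 + z^-1 by rewrite mulr_natl mulr2n.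
move: lo hi c; rewrite /G !ler_norml => lo hi /andP[c1 c2].
by apply/andP; move: lo hi c1 c2; clear; split; lra.
Qed.

Definition Sib : R := `|kappa| + 2.

Lemma Si_bound z : `|Si z| <= Sib.
Proof.
have pos w : 0 < w -> `|Si w| <= Sib.
  move=> w0; have [w1|/ltW w1] := leP w 1.
    apply: le_trans (Si_bound1 w) _; rewrite gtr0_norm//.
    by apply: le_trans w1 _; rewrite /Sib; have := normr_ge0 kappa; lra.
  have h : `|Si w - kappa| <= 2.
    by apply: le_trans (Si_cvg w0) _; rewrite ler_pdivrMr// ler_peMr.
  by rewrite -[Si w](subrK kappa) (le_trans (ler_normD _ _))// addrC lerD2l.
have [z0|z0|->] := ltgtP z 0; last 2 first.
- exact: pos.
- by rewrite Si0 normr0 /Sib addr_ge0.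
by rewrite -normrN -SiN; apply: pos; rewrite oppr_gt0.
Qed.

Lemma measurable_Si : measurable_fun setT Si.
Proof.
apply: continuous_measurable_fun => z.
apply: (@is_derive_continuous R _ z (RI unif (fun t => cos (z * t)))).
apply: (@deriv_under R _ _ unif sint (fun z t => cos (z * t)) (fun=> 1)).
- by move=> x; apply: bm_integrable; exact: bm_sint.
- by move=> x h; exact: is_derive_sint.
- by apply: (@bm_integrable R _ _ unif (fun=> 1)); exact: bm_cst.
- by move=> x h; exact: norm_cos.
Qed.

Definition sg y : R := if y == 0 then 0 else if y < 0 then -1 else 1.

(** The two end points of a truncated integral: at infinity Si tends to its
    limit, at 0 it is at most linear. *)
Lemma Si_diff (a b y : R) : 0 < a -> 0 < b ->
  `|Si (y * b) - Si (y * a) - kappa * sg y| <= (2 / `|y|) / b + `|y| * a.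
Proof.
move=> a0 b0; rewrite /sg; have [->|y0] := eqVneq y 0.
  by rewrite normr0 invr0 !mul0r !mulr0 !mul0r Si0 !subrr normr0 addr0.
have main w : 0 < w -> `|Si (w * b) - kappa| <= 2 / w / b.
  move=> w0; apply: le_trans (Si_cvg (mulr_gt0 w0 b0)) _.
  by rewrite invfM mulrA.
have S1 : `|Si (y * a)| <= `|y| * a.
  by apply: le_trans (Si_bound1 _) _; rewrite normrM (gtr0_norm a0).
rewrite addrAC (le_trans (ler_normB _ _))// lerD//.
case: ltP => [yn|yp].
  rewrite (ltr0_norm yn) mulrN1 opprK -normrN opprD -SiN -mulNr main// oppr_gt0//.
by rewrite (ger0_norm yp) mulr1 main// lt_neqAle eq_sym y0.
Qed.

End sine_integral.

(** * The function of a phase-space measure *)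

Section transform.
Context (R : realType).
Local Notation H := (freq R).
Local Notation fmH := {finite_measure set H -> \bar R}.
Implicit Types (p q W : fmH) (x y b : R).

Definition arg x y (h : H) : R := xi h * x - eta h * y + phase h.
Definition ev p x y b : R := RI p (fun h => cos (arg x y h + b)).

Lemma measurable_arg x y : measurable_fun setT (arg x y).
Proof. by rewrite /arg; hmeas. Qed.

Lemma bm_carg x y b : bm (fun h => cos (arg x y h + b)).
Proof. by apply: bm_cos; apply: measurable_funD => //; exact: measurable_arg. Qed.

Lemma ev_pi p x y b : ev p x y (b + pi) = - ev p x y b.
Proof.
rewrite /ev -RIN; last exact: bm_carg.
by congr RI; apply/funext => h; rewrite addrA cosDpi.
Qed.

Lemma norm_ev p x y b : `|ev p x y b| <= mass p.
Proof. by rewrite -[mass p]mul1r; apply: RI_bound; [exact: bm_carg|move=> h; exact: norm_cos]. Qed.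

Lemma arg_comb s x y (a c : H) : arg x y (comb s (a, c)) = arg x y a + s * arg x y c + pi / 2.
Proof. by rewrite /arg /comb xiE etaE phaseE /=; ring. Qed.

(** The product formula for cosines. *)
Lemma ev_mulm q p x y b : ev (mulm q p) x y b = ev q x y (b + pi / 2) * ev (slopem p) x y 0.
Proof.
rewrite /ev RI_mulm; last exact: bm_carg.
rewrite mulrC -RIZ; last exact: bm_carg.
congr RI; apply/funext => a; rewrite mulrC -RIZ; last exact: bm_carg.
congr RI; apply/funext => c; rewrite !arg_comb mul1r mulN1r addr0.
have -> : arg x y a + arg x y c + pi / 2 + b = (arg x y a + (b + pi / 2)) + arg x y c by ring.
have -> : arg x y a - arg x y c + pi / 2 + b = (arg x y a + (b + pi / 2)) - arg x y c by ring.
by rewrite cosD cosB; field.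
Qed.

Lemma ev_diffm p x y b : ev (diffm p) x y b = ev p x 0 b - ev p (x - y) 0 b.
Proof.
rewrite /ev RI_diffm; last exact: bm_carg.
rewrite -RIN; last exact: bm_carg.
congr (_ + _); congr RI; apply/funext => h.
  by congr cos; rewrite /arg /lay xiE etaE phaseE; ring.
rewrite -cosDpi; congr cos.
by rewrite /arg /tilt xiE etaE phaseE; ring.
Qed.

Lemma ev_powm p k x y b :
  ev (powm p k) x y b = (- (ev (slopem p) x y 0) ^+ 2) ^+ k * (ev p x 0 b - ev p (x - y) 0 b).
Proof.
elim: k b => [|k ih] b; first by rewrite powm0 ev_diffm expr0 mul1r.
rewrite powmS !ev_mulm -addrA -splitr ev_pi ih (exprS _ k).
move: ((- (_ ^+ 2)) ^+ k) => z; ring.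
Qed.

(** The geometric series in - S^2 converges because |S| <= 1/2. *)
Lemma ev_tailm p x y b : small p -> let S := ev (slopem p) x y 0 in
  ev (tailm p) x y b = - ((ev p x 0 b - ev p (x - y) 0 b) * (S ^+ 2 / (1 + S ^+ 2))).
Proof.
move=> sp S; set D := ev p x 0 b - _.
have S1 : S ^+ 2 <= 4^-1.
  have mp : mass (slopem p) <= 2^-1 by rewrite -lee_fin massE slopem_total.
  have h := le_trans (norm_ev (slopem p) x y 0) mp.
  move: h; rewrite -/S ler_norml => /andP[h1 h2]; move: h1 h2; clear; nra.
have S0 : 0 <= S ^+ 2 by rewrite sqr_ge0.
have cv : (\sum_(0 <= k < n) ev (powm p k.+1) x y b) @[n --> \oo] --> ev (tailm p) x y b.
  by rewrite /ev tailm.unlock; apply: cvg_RI_mser; [exact: powm_fin|exact: bm_carg].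
have cv2 : (\sum_(0 <= k < n) ev (powm p k.+1) x y b) @[n --> \oo] -->
    - (S ^+ 2) * D / (1 - - S ^+ 2).
  rewrite (_ : (fun n => _) = series (geometric (- (S ^+ 2) * D) (- S ^+ 2))).
    apply: cvg_geometric_series; rewrite normrN ger0_norm//.
    by apply: le_lt_trans S1 _; rewrite invf_lt1// ltr1n.
  apply/funext => n; apply: eq_bigr => k _; rewrite ev_powm exprS /geometric/=.
  by rewrite mulrAC.
rewrite (cvg_unique _ cv cv2)// opprK.
by rewrite !mulNr mulrAC mulrC.
Qed.

(** At xi = 0 the primitive is linear; starting it at 0 keeps it bounded by
    |x| uniformly in xi. *)
Definition prim x (h : H) : R :=
  if xi h == 0 then x * cos (phase h) else (sin (xi h * x + phase h) - sin (phase h)) / xi h.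

Lemma is_derive_prim x h : is_derive x 1 (prim^~ h) (cos (xi h * x + phase h)).
Proof.
rewrite /prim; have [->|xn0] := eqVneq (xi h) 0.
  apply: dv_cvt (dvM (dv_id x) (dv_cst x (cos (phase h)))) _.
  by rewrite mul1r mulr0 addr0 mul0r add0r.
have h1 := @is_derive_affine R (xi h) (phase h) (@sin R) (cos (xi h * x + phase h)) x (is_derive_sin _).
rewrite (_ : (fun x => _) = fun x => (xi h)^-1 * (sin (xi h * x + phase h) - sin (phase h))); last first.
  by apply/funext => y; rewrite mulrC.
apply: dv_cvt (dvZ (xi h)^-1 (dvB h1 (dv_cst x (sin (phase h))))) _.
by rewrite subr0 mulrA mulVf// mul1r.
Qed.

Lemma prim0 h : prim 0 h = 0.
Proof. by rewrite /prim; case: ifP => _; rewrite ?mul0r// mulr0 add0r subrr mul0r. Qed.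

Lemma norm_prim x h : `|prim x h| <= `|x|.
Proof.
have := @deriv_bound R (prim^~ h) (fun x => cos (xi h * x + phase h)) 0 x 1.
rewrite prim0 !subr0 mul1r; apply => y _; first exact: is_derive_prim.
exact: norm_cos.
Qed.

Lemma bm_prim x : bm (prim x).
Proof.
split; last by exists `|x|; exact: norm_prim.
rewrite /prim; apply: measurable_fun_ifT; first by hmeas.
  by hmeas.
apply: measurable_funM; first by hmeas.
by apply: (measurableT_comp (@measurable_invR R)); hmeas.
Qed.

Lemma prim_slope x y h :
  prim x h - prim (x - y) h = y * RI (unif R) (fun t => cos (arg x y (lift (h, t)))).
Proof.
pose F t := - prim (x - t * y) h.
have dF (t : R) : is_derive t 1 F (y * cos (xi h * (x - t * y) + phase h)).
  have h1 := @is_derive_affine R (- y) x (prim^~ h) (cos (xi h * (- y * t + x) + phase h)) t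
    (is_derive_prim _ _).
  rewrite (_ : F = fun t => - prim (- y * t + x) h); last first.
    by apply/funext => s; rewrite /F mulNr (mulrC y) addrC.
  apply: dv_cvt (dvN h1) _; rewrite mulNr opprK; congr (_ * cos (_ * _ + _)).
  by rewrite mulNr addrC mulrC.
have c (t : R) : is_derive t 1 (fun t => y * cos (xi h * (x - t * y) + phase h))
    (y * ((- (xi h * y)) * - sin (- (xi h * y) * t + (xi h * x + phase h)))).
  have h1 := @is_derive_affine R (- (xi h * y)) (xi h * x + phase h) (@cos R)
    (- sin (- (xi h * y) * t + (xi h * x + phase h))) t (is_derive_cos _).
  rewrite (_ : (fun t => _) = fun t => y * cos (- (xi h * y) * t + (xi h * x + phase h))).
    exact: dvZ.
  by apply/funext => s; congr (_ * cos _); ring.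
have := FTC_R (@ler01 R) (fun t _ => dF t) (is_derive_within (fun t _ => c t)).
rewrite /F mul1r mul0r subr0 opprK addrC => <-.
have bl : bm (fun t : R => cos (arg x y (lift (h, t)))).
  apply: bm_cos; apply: (measurableT_comp (measurable_arg x y)).
  by apply: (measurableT_comp (@measurable_lift R)); exact: pair1_measurable.
rewrite -RIZ; last exact: bl.
rewrite RI_unif; last by apply: bmM => //; exact: bm_cst.
apply: eq_Rintegral => t _; congr (_ * cos _).
by rewrite /arg /lift xiE etaE phaseE /=; ring.
Qed.

Definition curve p x : R := RI p (prim x).

Lemma is_derive_curve p x : is_derive x 1 (curve p) (ev p x 0 0).
Proof.
rewrite /ev (_ : (fun h => _) = fun h => cos (xi h * x + phase h)); last first.
  by apply/funext => h; rewrite /arg mulr0 subr0 addr0.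
apply: (@deriv_under R _ _ p prim (fun x h => cos (xi h * x + phase h)) (fun=> 1)).
- by move=> z; apply: bm_integrable; exact: bm_prim.
- by move=> z h; exact: is_derive_prim.
- by apply: (@bm_integrable R _ _ p (fun=> 1)); exact: bm_cst.
- by move=> z h; exact: norm_cos.
Qed.

(** The slope of a primitive is the average of the derivative. *)
Lemma curve_slope p x y : curve p x - curve p (x - y) = y * ev (slopem p) x y 0.
Proof.
rewrite /curve -RIB; [|exact: bm_prim|exact: bm_prim].
rewrite /ev RI_slopem; last exact: bm_carg.
rewrite -RIZ; last first.
  by apply: (@bm_RI _ _ _ _ _ (unif R) (fun z => cos (arg x y (lift z) + 0)));
     apply: (bm_comp (@measurable_lift R) (bm_carg x y 0)).
congr RI; apply/funext => h; rewrite prim_slope; congr (_ * RI _ _).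
by apply/funext => t; rewrite addr0.
Qed.

Lemma primitive_slope p (g : R -> R) x y : (forall z : R, is_derive z 1 g (ev p z 0 0)) ->
  g x - g (x - y) = y * ev (slopem p) x y 0.
Proof.
move=> dg; rewrite -curve_slope.
have d0 (z : R) : is_derive z 1 (fun z => g z - curve p z) 0.
  by apply: dv_cvt (dvB (dg z) (is_derive_curve p z)) _; rewrite subrr.
have := @deriv_bound R (fun z => g z - curve p z) (fun=> 0) (x - y) x 0 (fun z _ => d0 z).
rewrite mul0r normr_le0 => h; apply/eqP; rewrite -subr_eq0.
suff -> : g x - g (x - y) - (curve p x - curve p (x - y)) = g x - curve p x - (g (x - y) - curve p (x - y)).
  by rewrite -normr_le0; apply: h => z _.
by ring.
Qed.

End transform.

(** * The Muskat nonlinearity in Fourier variables *)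

Section muskat_nonlinearity.
Context (R : realType).
Local Notation H := (freq R).
Local Notation fmH := {finite_measure set H -> \bar R}.
Local Notation leb := (@lebesgue_measure R).
Implicit Types (p W : fmH) (x y a b : R) (g : R -> R).

Definition annulus x a b : set R := [set x' | a < `|x - x'| < b].

Lemma annulusE x a b : 0 < a ->
  annulus x a b = (`]x - b, x - a[ `|` `]x + a, x + b[)%classic.
Proof.
move=> a0; apply/seteqP; split=> z /=; rewrite !in_itv/=.
  move=> /andP[za zb]; have [xz|zx] := leP x z.
    move: za zb; rewrite ler0_norm ?subr_le0// => za zb.
    by right; apply/andP; move: za zb; clear; split; lra.
  move: za zb; rewrite gtr0_norm ?subr_gt0// => za zb.
  by left; apply/andP; move: za zb; clear; split; lra.
move=> [|] /andP[h1 h2].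
  by rewrite /annulus/= gtr0_norm ?subr_gt0; [apply/andP; move: h1 h2; clear; split; lra|move: a0 h1 h2; clear; lra].
by rewrite /annulus/= ltr0_norm ?subr_lt0; [apply/andP; move: h1 h2; clear; split; lra|move: a0 h1 h2; clear; lra].
Qed.

Lemma measurable_annulus x a b : 0 < a -> measurable (annulus x a b).
Proof. by move=> a0; rewrite annulusE//; apply: measurableU; exact: measurable_itv. Qed.

Lemma annulus_fin x a b : 0 < a -> (leb (annulus x a b) < +oo)%E.
Proof.
move=> a0; apply: le_lt_trans (leb_segment (x - b) (x + b)).
apply: le_measure; rewrite ?inE; [exact: measurable_annulus|exact: measurable_itv|].
move=> z /= /andP[_]; rewrite in_itv/= ltr_norml => /andP[h1 h2].
by apply/andP; move: h1 h2; clear; split; lra.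
Qed.

Lemma annulus_integral (f : R -> R) x a b : 0 < a ->
  leb.-integrable (annulus x a b) (EFin \o f) ->
  \int[leb]_(x' in annulus x a b) f x' =
  \int[leb]_(x' in `[x - b, x - a]) f x' + \int[leb]_(x' in `[x + a, x + b]) f x'.
Proof.
move=> a0; rewrite annulusE// => fi.
have f1 : leb.-integrable (`]x - b, x - a[)%classic (EFin \o f).
  by apply: integrableS fi => //; exact: measurableU.
have f2 : leb.-integrable (`]x + a, x + b[)%classic (EFin \o f).
  by apply: integrableS fi => //; exact: measurableU.
have cc c e : leb.-integrable (`]c, e[)%classic (EFin \o f) ->
    \int[leb]_(x' in `]c, e[) f x' = \int[leb]_(x' in `[c, e]) f x'.
  move=> fce; rewrite Rintegral_itv_bndo_bndc// Rintegral_itv_obnd_cbnd//.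
  move/integrableP: fce => [/measurable_EFinP mf lf].
  have mf' : measurable_fun (`]c, e])%classic f by apply/measurable_fun_itv_bndo_bndcP.
  apply/integrableP; split; first exact/measurable_EFinP.
  rewrite -integral_itv_bndo_bndc//.
  apply/measurable_EFinP; apply: measurableT_comp => //; exact: mf.
rewrite Rintegral_setU//; last first.
  apply/disj_setPS => z [] /=; rewrite !in_itv/= => /andP[_ h1] /andP[h2 _].
  by move: a0 h1 h2; clear; lra.
by rewrite !cc.
Qed.

Definition cutinv a y : R := if a < `|y| then y^-1 else 0.

Lemma bm_cutinv a : 0 < a -> bm (cutinv a).
Proof.
move=> a0; split.
  by rewrite /cutinv; apply: measurable_fun_ifT; [meas|exact: measurable_invR|meas].
exists a^-1 => y; rewrite /cutinv; case: ifP => [ay|_]; last first.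
  by rewrite normr0 invr_ge0 ltW.
by rewrite normfV lef_pV2 ?posrE ?(lt_trans a0 ay)// ltW.
Qed.

Lemma is_derive_within_ex (f : R -> R) a b : (forall x, x \in `[a, b] -> exists l, is_derive x 1 f l) ->
  {within `[a, b], continuous f}.
Proof.
move=> h; apply: continuous_in_subspaceT => x; rewrite inE => xab.
by have [l] := h x xab; exact: is_derive_continuous.
Qed.

Lemma is_derive_Si_scale k y : y != 0 ->
  is_derive y 1 (fun y => Si (k * y)) (sin (k * y) / y).
Proof.
move=> y0; have [->|k0] := eqVneq k 0.
  rewrite mul0r sin0 mul0r (_ : (fun _ => _) = fun=> Si 0); first exact: is_derive_cst.
  by apply/funext => z; rewrite mul0r.
have ky : k * y != 0 by rewrite mulf_neq0.
have h := dv_comp (is_derive_Si ky) (dvZ k (dv_id y)).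
by apply: (dv_cvt h); move: (sin _) k0 y0 => z k0 y0; field; rewrite y0.
Qed.

(** The part of the wave that is even in y cancels against 1/y over the
    symmetric domain. *)
Lemma kernel_integral x a b (h : H) : 0 < a -> a < b ->
  \int[leb]_(x' in annulus x a b) (cos (arg x (x - x') h + 0) * cutinv a (x - x')) =
  2 * sin (xi h * x + phase h) * (Si (eta h * b) - Si (eta h * a)).
Proof.
move=> a0 ab; set k := eta h; set th := xi h * x + phase h.
pose f (x' : R) := cos (th - k * (x - x')) * (x - x')^-1.
have fE : {in annulus x a b, forall x', cos (arg x (x - x') h + 0) * cutinv a (x - x') = f x'}.
  move=> z; rewrite inE => /andP[za _]; rewrite /f /cutinv za; congr (cos _ * _).
  by rewrite /arg /th /k; ring.
rewrite (@eq_Rintegral _ _ _ leb _ f _ fE) annulus_integral//; last first.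
  apply: (@eq_integrable _ _ _ leb (annulus x a b) (measurable_annulus x b a0)
    (EFin \o (fun x' => cos (arg x (x - x') h + 0) * cutinv a (x - x')))).
    by move=> z zA; rewrite /= fE.
  apply: bm_leb_integrable; [exact: measurable_annulus|exact: annulus_fin|].
  apply: bmM; first by apply: bm_cos; rewrite /arg; meas.
  by apply: bm_comp (bm_cutinv a0); meas.
pose phi z := cos (th + k * z) * z^-1.
have dcos (s z : R) : is_derive z 1 (fun z : R => cos (th + s * z)) (s * - sin (s * z + th)).
  rewrite (_ : (fun _ => _) = fun z => cos (s * z + th)); last first.
    by apply/funext => w; rewrite addrC.
  exact: is_derive_affine (is_derive_cos _).
(* The two halves of the domain carry cos (th - k z) / z and - cos (th + k z) / z; a
   primitive P of the latter, up to sign, is not elementary but cancels in the sum. *)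
have [P dP] : exists P : R -> R, forall z : R, z \in `[a, b] -> is_derive z 1 P (phi z).
  apply: (antideriv b a0) => z z0.
  have zn : z != 0 by rewrite gt_eqF.
  by apply: (is_derive_continuous (dvM (dcos k z) (dv_inv zn))).
pose Q (z : R) : R := P z + 2 * sin th * Si (k * z).
have dQ (z : R) : z \in `[a, b] -> is_derive z 1 Q (cos (th - k * z) * z^-1).
  move=> zab; have zn : z != 0.
    by move: zab; rewrite in_itv/= => /andP[az _]; rewrite gt_eqF// (lt_le_trans a0).
  have h1 := dvD (dP _ zab) (dvZ (2 * sin th) (is_derive_Si_scale k zn)).
  apply: (dv_cvt h1); rewrite /phi cosD cosB; ring.
have i1 : \int[leb]_(x' in `[x - b, x - a]) f x' = Q b - Q a.
  have inab (z : R) : z \in `[x - b, x - a] -> x - z \in `[a, b].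
    by rewrite !in_itv/= => /andP[h1 h2]; apply/andP; move: h1 h2; clear; split; lra.
  pose F (x' : R) : R := - Q (-1 * x' + x).
  have -> : Q b - Q a = F (x - a) - F (x - b).
    by rewrite /F !mulN1r !opprB !subrK addrC opprK.
  have l1 : x - b <= x - a by rewrite lerD2l lerN2 ltW.
  have l2 (z : R) : z \in `[x - b, x - a] -> is_derive z 1 F (f z).
    move=> zI; have e : -1 * z + x = x - z by rewrite mulN1r addrC.
    have h1 := @is_derive_affine R (-1) x Q (cos (th - k * (x - z)) * (x - z)^-1) z.
    by rewrite e in h1; apply: (dv_cvt (dvN (h1 (dQ _ (inab _ zI))))); rewrite mulN1r opprK.
  have l3 : {within `[x - b, x - a], continuous f}.
    apply: is_derive_within_ex => z zI.
    have xz : x - z != 0.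
      by have := inab _ zI; rewrite in_itv/= => /andP[az _]; rewrite gt_eqF// (lt_le_trans a0).
    have e : -1 * z + x = x - z by rewrite mulN1r addrC.
    have h1 := @is_derive_affine R (-1) x (fun w => cos (th + (- k) * w) * w^-1) _ z.
    rewrite e in h1; have h2 := h1 _ (dvM (dcos (- k) (x - z)) (dv_inv xz)).
    rewrite (_ : f = fun y : R => cos (th + - k * (-1 * y + x)) * (-1 * y + x)^-1); last first.
      by apply/funext => w; rewrite /f mulN1r (addrC (- w)) mulNr.
    by eexists; exact: h2.
  exact: (@FTC_R R f F (x - b) (x - a) l1 l2 l3).
have i2 : \int[leb]_(x' in `[x + a, x + b]) f x' = - (P b - P a).
  have inab (z : R) : z \in `[x + a, x + b] -> z - x \in `[a, b].
    by rewrite !in_itv/= => /andP[h1 h2]; apply/andP; move: h1 h2; clear; split; lra.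
  have fE2 : f = fun y : R => - phi (1 * y - x).
    apply/funext => z; rewrite /f /phi mul1r.
    have -> : x - z = - (z - x) by rewrite opprB.
    by rewrite invrN mulrN; congr (- (cos _ * _)); ring.
  pose F (x' : R) : R := - P (1 * x' - x).
  have -> : - (P b - P a) = F (x + b) - F (x + a).
    by rewrite /F !mul1r !(addrC x) !addrK; ring.
  have l1 : x + a <= x + b by rewrite lerD2l ltW.
  have l2 (z : R) : z \in `[x + a, x + b] -> is_derive z 1 F (f z).
    move=> zI; have e : 1 * z - x = z - x by rewrite mul1r.
    have h1 := @is_derive_affine R 1 (- x) P (phi (z - x)) z.
    by rewrite e in h1; apply: (dv_cvt (dvN (h1 (dP _ (inab _ zI))))); rewrite fE2 !mul1r.
  have l3 : {within `[x + a, x + b], continuous f}.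
    apply: is_derive_within_ex => z zI.
    have xz : z - x != 0.
      by have := inab _ zI; rewrite in_itv/= => /andP[az _]; rewrite gt_eqF// (lt_le_trans a0).
    have e : 1 * z - x = z - x by rewrite mul1r.
    have h1 := @is_derive_affine R 1 (- x) phi _ z.
    rewrite e in h1; have h2 := dvN (h1 _ (dvM (dcos k (z - x)) (dv_inv xz))).
    by rewrite fE2; eexists; exact: h2.
  exact: (@FTC_R R f F (x + a) (x + b) l1 l2 l3).
by rewrite i1 i2 /Q; ring.
Qed.

Lemma truncated_muskat p g x a b : small p -> (forall z : R, is_derive z 1 g (ev p z 0 0)) ->
  0 < a -> a < b ->
  truncated_integral (muskat_integrand g x) x (a, b) =
  - (2 * RI (tailm p) (fun h => sin (xi h * x + phase h) * (Si (eta h * b) - Si (eta h * a)))).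
Proof.
move=> sp dg a0 ab; set W := tailm p.
have dgE z : derive1 g z = ev p z 0 0 by rewrite derive1E; have h := dg z; rewrite derive_val.
pose G (z : R * H) := cos (arg x (x - z.1) z.2 + 0) * cutinv a (x - z.1).
have bG : bm G.
  apply: bmM; first by apply: bm_cos; rewrite /arg; hmeas.
  by apply: (bm_comp _ (bm_cutinv a0)); meas.
have mA := measurable_annulus x b a0.
have fA := annulus_fin x b a0.
have bS y : bm (fun h : H => sin (xi h * x + phase h) * (Si (eta h * b) - Si (eta h * a))).
  apply: bmM; first by apply: bm_sin; hmeas.
  have bSi c : bm (fun h : H => Si (eta h * c)).
    split; last by exists (Sib R) => h; exact: Si_bound.
    by apply: (measurableT_comp (@measurable_Si R)); hmeas.
  exact: bmB.
have -> : truncated_integral (muskat_integrand g x) x (a, b) =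
    \int[leb]_(x' in annulus x a b) (- RI W (fun h => G (x', h))).
  rewrite /truncated_integral; apply: eq_Rintegral => x'; rewrite inE => /andP[/= xa _].
  have xx : x - x' != 0 by rewrite -normr_gt0 (lt_trans a0).
  rewrite /muskat_integrand !dgE /slope.
  have := primitive_slope x (x - x') dg; rewrite subKr => ->.
  rewrite [X in (X) ^+ 2]mulrC mulKf//.
  have := ev_tailm x (x - x') 0 sp; rewrite subKr /= => e.
  transitivity (- (cutinv a (x - x') * ev W x (x - x') 0)).
    rewrite e /cutinv xa; ring.
  congr (- _); rewrite /ev -RIZ; last exact: bm_carg.
  by congr RI; apply/funext => h; rewrite mulrC.
have bGs x' : bm (fun h => G (x', h)) by exact: bm_sec.
have bI : bm (fun x' => RI W (fun h => G (x', h))) by exact: bm_RI.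
rewrite -(RI_lebr mA fA (bmN bI)) RIN// (RI_swap _ _ bG); congr (- _).
rewrite -(RIZ _ 2 (bS 0)); congr RI; apply/funext => h.
rewrite RI_lebr//; last first.
  by apply: (bm_comp (phi := fun x' : R => (x', h)) _ bG); exact: pair2_measurable.
by rewrite /G kernel_integral// mulrA.
Qed.

Lemma norm_sg y : `|sg y| <= 1.
Proof. by rewrite /sg; case: ifP => _; [rewrite normr0|case: ifP => _; rewrite ?normrN normr1]. Qed.

Lemma measurable_sg : measurable_fun setT (@sg R).
Proof. by rewrite /sg; meas. Qed.

Let tolerance n y : R := Num.min (2 * Sib R + `|kappa R|) ((2 / `|y| + `|y|) * n.+1%:R^-1).

Let tolerance_ge0 n y : 0 <= tolerance n y.
Proof.
rewrite le_min !addr_ge0 ?mulr_ge0 ?addr_ge0 ?invr_ge0 ?mulr_ge0 ?invr_ge0 ?ler0n//.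
Qed.

Let tolerance_le n y : tolerance n y <= 2 * Sib R + `|kappa R|.
Proof. by rewrite ge_min lexx. Qed.

Let measurable_tolerance n : measurable_fun setT (tolerance n).
Proof.
apply: measurable_minr; first by meas.
apply: measurable_funM; last by meas.
apply: measurable_funD; last by meas.
apply: measurable_funM; first by meas.
by apply: (measurableT_comp (@measurable_invR R)); meas.
Qed.

Let tolerance_small W (e : R) : 0 < e -> exists n, RI W (fun h => tolerance n (eta h)) < e.
Proof.
move=> e0.
have cv : RI W (fun h => tolerance n (eta h)) @[n --> \oo] --> RI W (fun=> 0).
  apply: (@cvg_RI _ _ _ W (fun n h => tolerance n (eta h)) _ (2 * Sib R + `|kappa R|)).
  - by move=> n; apply: (measurableT_comp (measurable_tolerance n)); hmeas.
  - exact: measurable_cst.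
  - by move=> n h; rewrite ger0_norm// tolerance_le.
  - move=> h; set K := 2 / `|eta h| + `|eta h|.
    apply: (@squeeze_cvgr _ _ _ _ (fun=> 0 : R) (fun n => K * n.+1%:R^-1)).
    + by apply: nearW => n; rewrite tolerance_ge0 ge_min lexx orbT.
    + exact: cvg_cst.
    + by rewrite -[X in _ --> X](mulr0 K); apply: cvgMr; exact: cvg_harmonic.
rewrite RI_cst mul0r in cv.
move/cvgrPdist_lt : cv => /(_ _ e0)[n _ /(_ n (leqnn n))] /=.
by rewrite sub0r normrN => h; exists n; apply: le_lt_trans (ler_norm _) h.
Qed.

Lemma bm_pv x : bm (fun h : H => sin (xi h * x + phase h) * sg (eta h)).
Proof.
apply: bmM; first by apply: bm_sin; hmeas.
split; last by exists 1 => h; exact: norm_sg.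
by apply: (measurableT_comp measurable_sg); hmeas.
Qed.

(** Dominated convergence in frequency: the error of the truncated integral
    tends to 0 for each eta <> 0 and is bounded uniformly. *)
Lemma truncated_cvg p g x : small p -> (forall z : R, is_derive z 1 g (ev p z 0 0)) ->
  truncated_integral (muskat_integrand g x) x t @[t --> @pv_filter R] -->
  - (2 * (kappa R * RI (tailm p) (fun h => sin (xi h * x + phase h) * sg (eta h)))).
Proof.
move=> sp dg; set W := tailm p; apply/cvgrPdist_lt => e e0.
have [n hn] := tolerance_small W (divr_gt0 e0 (ltr0n R 2)).
have n0 : 0 < n.+1%:R :> R by rewrite ltr0n.
exists ([set a | 0 < a < n.+1%:R^-1], [set b | n.+1%:R < b]) => /=.
  split; last by apply: nbhs_pinfty_gt; exact: num_real.
  near=> a; apply/andP; split.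
    by near: a; exact: nbhs_right_gt.
  near: a; apply: nbhs_right_lt; by rewrite invr_gt0.
move=> [a b] /= [/andP[a0 an] nb].
have b0 : 0 < b by exact: lt_trans nb.
have ab : a < b.
  apply: lt_trans an _; apply: le_lt_trans nb.
  by apply: (@le_trans _ _ 1); rewrite ?invf_le1// ler1n.
rewrite (truncated_muskat x sp dg a0 ab) -/W.
have bSi c : bm (fun h : H => Si (eta h * c)).
  split; last by exists (Sib R) => h; exact: Si_bound.
  by apply: (measurableT_comp (@measurable_Si R)); hmeas.
have bS : bm (fun h : H => sin (xi h * x + phase h) * (Si (eta h * b) - Si (eta h * a))).
  by apply: bmM; [apply: bm_sin; hmeas|exact: bmB].
have bt : bm (fun h : H => tolerance n (eta h)).
  split; first by apply: (measurableT_comp (measurable_tolerance n)); hmeas.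
  by exists (2 * Sib R + `|kappa R|) => h; rewrite ger0_norm// tolerance_le.
rewrite opprK addrC -mulrBr normrM (@ger0_norm _ 2)//.
rewrite mulrC -ltr_pdivlMr//; apply: le_lt_trans hn.
have bp := bm_pv x.
rewrite -(RIZ _ (kappa R) bp) -RIB//; last by apply: bmM => //; exact: bm_cst.
have bD : bm (fun h : H => sin (xi h * x + phase h) * (Si (eta h * b) - Si (eta h * a)) -
    kappa R * (sin (xi h * x + phase h) * sg (eta h))).
  by apply: bmB => //; apply: bmM => //; exact: bm_cst.
apply: le_trans (le_norm_RI W bD) _.
apply: le_RI => //; first exact: bm_norm.
move=> h; rewrite mulrCA -mulrBr normrM.
apply: (@le_trans _ _ `|Si (eta h * b) - Si (eta h * a) - kappa R * sg (eta h)|).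
  by rewrite ler_piMl// norm_sin.
rewrite le_min; apply/andP; split.
  apply: le_trans (ler_normB _ _) _; apply: lerD.
    apply: le_trans (ler_normB _ _) _.
    by rewrite mulr_natl mulr2n lerD// Si_bound.
  by rewrite normrM ler_piMr// norm_sg.
apply: le_trans (Si_diff _ a0 b0) _.
rewrite [leRHS]mulrDl lerD// ler_wpM2l//; last exact: ltW.
by rewrite lef_pV2 ?posrE// ltW.
Unshelve. all: by end_near. Qed.

Lemma muskat_N_E (rho_m rho_p : R) p g x : small p -> (forall z : R, is_derive z 1 g (ev p z 0 0)) ->
  pv_exists g x /\
  muskat_N rho_m rho_p g x = (rho_m - rho_p) / pi *
    (kappa R * RI (tailm p) (fun h => sin (xi h * x + phase h) * sg (eta h))).
Proof.
move=> sp dg; have cv := truncated_cvg (x := x) sp dg.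
split; first by apply/cvg_ex; eexists; exact: cv.
rewrite /muskat_N (cvg_lim _ cv)//.
have := @pi_gt0 R; move: (RI _ _) (@pi R) => z q q0.
by field; rewrite gt_eqF.
Qed.

Definition absxi (h : H) : R := `|xi h|.

Lemma measurable_absxi : measurable_fun setT absxi.
Proof. by rewrite /absxi; hmeas. Qed.

Lemma absxi_fin b p (P : fmH) : 0 < b -> wle b p P -> (\int[p]_h (absxi h)%:E < +oo)%E.
Proof.
move=> b0 pP.
have n1 : nnm (fun _ : H => (b^-1)%:E) by apply: nnm_cst; rewrite lee_fin invr_ge0 ltW.
apply: (@le_lt_trans _ _ (\int[P]_h (b^-1)%:E)%E).
  apply: le_trans (pP _ n1); apply: le_nnm.
  - by apply: nnm_EFin => [|h]; [exact: measurable_absxi|exact: normr_ge0].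
  - by apply: nnmM => //; exact: nnm_wt.
  move=> h; rewrite -EFinM lee_fin ler_pdivlMr// mulrC /wt.
  by apply: le_trans (expR_ge1Dx _); rewrite lerDr.
by rewrite integral_cst// lte_mul_pinfty ?lee_fin ?invr_ge0 ?(ltW b0)// fin_total.
Qed.

Lemma RI_dens_pushf W (phi : H -> H) (w : H -> R) (f : H -> R) : measurable_fun setT phi ->
  measurable_fun setT w -> (forall h, 0 <= w h) -> (\int[W]_h (w (phi h))%:E < +oo)%E -> bm f ->
  RI (dens w (pushf phi W)) f = RI (dens (fun h => w (phi h)) W) (fun h => f (phi h)).
Proof.
move=> mphi mw w0 fin; have nw : nnm (fun h => (w h)%:E) by exact: nnm_EFin.
have mwp : measurable_fun setT (fun h => w (phi h)) by exact: measurableT_comp.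
apply: (@RI_shift _ _ _ _ (fun f => RI (dens (fun h => w (phi h)) W) (fun h => f (phi h)))).
  move=> k bk k0; have nk := nnm_bm bk k0.
  apply: EFin_inj; rewrite RI_E// RI_E; last exact: bm_comp.
  have fin' : (\int[pushf phi W]_h (w h)%:E < +oo)%E by rewrite (pushfE _ mphi nw).
  rewrite (densE mw w0 fin' nk).
  rewrite densE//; last exact: (nnm_comp mphi nk).
  by rewrite pushfE//; exact: nnmM.
move=> k c bk; rewrite RID//; [exact: bm_comp|exact: bm_cst].
Qed.

(** Differentiating sin(xi x + theta) brings down xi, whose sign is absorbed
    with the sign of eta by [tau], so that |xi| remains. *)
Lemma muskat_N_derive (rho_m rho_p : R) p (P : fmH) b g x : 0 < b -> small p -> small P -> wle b p P ->
  (forall z : R, is_derive z 1 g (ev p z 0 0)) ->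
  is_derive x 1 (muskat_N rho_m rho_p g)
    ((rho_m - rho_p) / pi * (`|kappa R| * ev (dens absxi (Tm (kappa R) p)) x 0 0)).
Proof.
move=> b0 sp sP pP dg; set W := tailm p.
have -> : muskat_N rho_m rho_p g = fun x => (rho_m - rho_p) / pi *
    (kappa R * RI W (fun h => sin (xi h * x + phase h) * sg (eta h))).
  by apply/funext => z; have [] := muskat_N_E rho_m rho_p z sp dg.
have Wfin : (\int[W]_h (absxi h)%:E < +oo)%E.
  exact: (absxi_fin b0 (wle_tailm (ltW b0) sp sP pP)).
have tfin : (\int[W]_h (absxi (tau (kappa R) h))%:E < +oo)%E.
  apply: le_lt_trans Wfin; apply: le_nnm => [||h].
  - apply: nnm_EFin => [|h]; last exact: normr_ge0.
    by apply: (measurableT_comp measurable_absxi); exact: measurable_tau.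
  - by apply: nnm_EFin => [|h]; [exact: measurable_absxi|exact: normr_ge0].
  - by rewrite lee_fin xi_tau.
have iW : W.-integrable setT (EFin \o absxi).
  apply/integrableP; split; first by apply/measurable_EFinP; exact: measurable_absxi.
  by under eq_integral => h _ do rewrite /= ger0_norm ?normr_ge0//.
have d1 : is_derive x 1 (fun x => RI W (fun h => sin (xi h * x + phase h) * sg (eta h)))
    (RI W (fun h => xi h * cos (xi h * x + phase h) * sg (eta h))).
  apply: (@deriv_under R _ _ W (fun x h => sin (xi h * x + phase h) * sg (eta h))
    (fun x h => xi h * cos (xi h * x + phase h) * sg (eta h)) absxi).
  - by move=> z; apply: bm_integrable; exact: bm_pv.
  - move=> z h; rewrite [_ * sg _]mulrC.
    rewrite (_ : (fun _ => _) = fun z => sg (eta h) * sin (xi h * z + phase h)); last first.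
      by apply/funext => w; rewrite mulrC.
    by apply: dvZ; exact: is_derive_affine (is_derive_sin _).
  - by [].
  - move=> z h; rewrite -mulrA normrM ler_piMr// normrM mulr_ile1 ?norm_cos ?norm_sg//.
apply: (dv_cvt (dvZ _ (dvZ _ d1))); congr (_ * _).
rewrite /ev Tm.unlock RI_dens_pushf//; last 4 first.
- exact: measurable_tau.
- exact: measurable_absxi.
- by move=> h; exact: normr_ge0.
- exact: bm_carg.
have bc : bm (fun h => cos (arg x 0 (tau (kappa R) h) + 0)).
  by apply: (bm_comp (@measurable_tau R (kappa R)) (bm_carg x 0 0)).
have mt : measurable_fun setT (fun h => absxi (tau (kappa R) h)).
  by apply: (measurableT_comp measurable_absxi); exact: measurable_tau.
have [ig ->] := RI_dens_unbounded mt (fun h => normr_ge0 _) tfin bc.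
have ic : W.-integrable setT (EFin \o (fun h => xi h * cos (xi h * x + phase h) * sg (eta h))).
  apply: (le_integrable measurableT _ _ iW).
    apply/measurable_EFinP; apply: measurable_funM; first by hmeas.
    by apply: (measurableT_comp measurable_sg); hmeas.
  move=> h _; rewrite /= lee_fin /absxi normr_id -mulrA normrM ler_piMr//.
  by rewrite normrM mulr_ile1 ?norm_cos ?norm_sg.
rewrite /RI -RintegralZl// -RintegralZl//; apply: eq_Rintegral => h _.
rewrite /tau /sg /absxi /arg; have [e0|e0] := eqVneq (eta h) 0.
  by rewrite xiE normr0 mul0r !mulr0.
rewrite xiE etaE phaseE mulr0 subr0 addr0 addrA.
set th := xi h * x + phase h; set s := if eta h < 0 then -1 else 1.
case: ifPn => [neg|]; last rewrite -leNgt => pos.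
  rewrite cosDpi; have e1 : kappa R * xi h * s = - (`|kappa R| * `|xi h|).
    rewrite -normrM /s; have [e|e] := ltP (eta h) 0.
      by rewrite mulrN1 gtr0_norm//; move: neg; rewrite mulrA nmulr_llt0.
    have ep : 0 < eta h by rewrite lt_neqAle eq_sym e0.
    have k : kappa R * xi h < 0 by move: neg; rewrite mulrA pmulr_llt0.
    by rewrite mulr1 (ltr0_norm k) opprK.
  transitivity (kappa R * xi h * s * cos th); first by ring.
  by rewrite e1; ring.
rewrite addr0; have e1 : kappa R * xi h * s = `|kappa R| * `|xi h|.
  rewrite -normrM /s; have [e|e] := ltP (eta h) 0.
    by rewrite mulrN1 ler0_norm//; move: pos; rewrite mulrA nmulr_lge0.
  have ep : 0 < eta h by rewrite lt_neqAle eq_sym e0.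
  have k : 0 <= kappa R * xi h by move: pos; rewrite mulrA pmulr_lge0.
  by rewrite mulr1 (ger0_norm k).
transitivity (kappa R * xi h * s * cos th); first by ring.
by rewrite e1; ring.
Qed.

End muskat_nonlinearity.

(** * Limits and time integrals of measures *)

(** A measure for increasing sequences, because suprema of increasing
    sequences commute with series of nonnegative terms. *)
HB.lock Definition mlim (R : realType) d (T : measurableType d)
    (m_ : nat -> {finite_measure set T -> \bar R}) : {finite_measure set T -> \bar R} :=
  mk (fun f => ereal_sup (range (fun n => \int[m_ n]_x f x)))%E.

HB.lock Definition mscale (R : realType) d (T : measurableType d) (k : R)
    (m : {finite_measure set T -> \bar R}) : {finite_measure set T -> \bar R} :=
  dens (fun=> k) m.

HB.lock Definition tint (R : realType) d (T : measurableType d)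
    (m : R -> {finite_measure set T -> \bar R}) (A : set R) (w : R * T -> R) :
    {finite_measure set T -> \bar R} :=
  mk (fun f => \int[lebr A]_s \int[m s]_h ((w (s, h))%:E * f h))%E.

Section limits.
Local Open Scope ereal_scope.
Context (R : realType).

Lemma mlim_minc d (T : measurableType d) (m_ : nat -> {finite_measure set T -> \bar R}) (a : R) :
  (forall n, mle (m_ n) (m_ n.+1)) -> (forall n, m_ n setT <= a%:E) ->
  minc m_ (mlim m_).
Proof.
move=> mS ma.
have nd f : nnm f -> nondecreasing_seq (fun n => \int[m_ n]_x f x).
  by move=> nf; apply/nondecreasing_seqP => n; exact: mS.
pose L (f : T -> \bar R) := ereal_sup (range (fun n => \int[m_ n]_x f x)).
have cL f : nnm f -> \int[m_ n]_x f x @[n --> \oo] --> L f.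
  by move=> nf; apply: ereal_nondecreasing_cvgn; exact: nd.
suff E f : nnm f -> \int[mlim m_]_x f x = L f.
  by move=> f nf; split; [exact: nd|rewrite E//; exact: cL].
rewrite mlim.unlock; apply: mkE; last first.
  apply: (@le_lt_trans _ _ a%:E); last by rewrite ltry.
  by apply: ge_ereal_sup => _ [n _ <-]; rewrite integral1; exact: ma.
split=> [g ng|g ng|k g k0 ng].
- apply: (@le_trans _ _ (\int[m_ 0%N]_x g x)); first exact: nnm_integral.
  by apply: ereal_sup_ubound; exists 0%N.
- have h1 := cL _ (nnm_series ng).
  have E1 n : \int[m_ n]_x (\sum_(k <oo) g k x) = \int[counting]_k \int[m_ n]_x g k x.
    rewrite ge0_integral_count; last by move=> k; exact: nnm_integral.
    by apply: integral_nneseries => // [k|k x _]; case: (ng k).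
  rewrite -/(L _) -(cvg_lim _ h1)//; under eq_fun do rewrite E1.
  rewrite -ge0_integral_count; last first.
    move=> k; apply: (@le_trans _ _ (\int[m_ 0%N]_x g k x)); first exact: nnm_integral.
    by apply: ereal_sup_ubound; exists 0%N.
  apply/cvg_lim => //.
  rewrite (eq_integral (fun k => limn (fun n => \int[m_ n]_x g k x))); last first.
    by move=> k _; apply/esym/cvg_lim => //; exact: cL.
  apply: cvg_monotone_convergence => //.
  + by move=> n k _; exact: nnm_integral.
  + by move=> k _; exact: nd.
- have nk : nnm (fun x => k%:E * g x) by apply: nnmM => //; apply: nnm_cst; rewrite lee_fin.
  have h1 := cL _ nk; have h2 := cL _ ng.
  have h3 : \int[m_ n]_x (k%:E * g x) @[n --> \oo] --> k%:E * L g.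
    rewrite (_ : (fun n => _) = fun n => k%:E * \int[m_ n]_x g x); first exact: cvgeZl.
    by apply/funext => n; rewrite ge0_integralZl_EFin//; case: ng.
  exact: (cvg_unique _ h1 h3).
Qed.

Lemma minc_le d (T : measurableType d) (m_ : nat -> {finite_measure set T -> \bar R}) m f y :
  minc m_ m -> nnm f -> (forall n, \int[m_ n]_x f x <= y) -> \int[m]_x f x <= y.
Proof.
move=> mm nf h; have [nd cv] := mm _ nf; rewrite -(cvg_lim _ cv)//.
by apply: lime_le; [exact: ereal_nondecreasing_is_cvgn|exact: nearW].
Qed.

Lemma minc_shift d (T : measurableType d) (m_ : nat -> {finite_measure set T -> \bar R}) m m' f :
  minc m_ m -> minc (fun n => m_ n.+1) m' -> nnm f -> \int[m]_x f x = \int[m']_x f x.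
Proof.
move=> mm mm' nf; have [_ c1] := mm _ nf; have [_ c2] := mm' _ nf.
by move: c2; rewrite (cvg_shiftS (fun n => \int[m_ n]_x f x)) => c2; exact: (cvg_unique _ c1 c2).
Qed.

Lemma tmeas_minc d (T : measurableType d) (p_ : nat -> R -> {finite_measure set T -> \bar R}) p :
  (forall n, tmeas (p_ n)) -> (forall t, minc (p_^~ t) (p t)) -> tmeas p.
Proof.
move=> tp pp d' X tau F mtau nF; split; last first.
  by move=> x; apply: nnm_integral; exact: nnm_sec.
apply: (emeasurable_fun_cvg (fun n x => \int[p_ n (tau x)]_y F (x, y))).
  by move=> n; have [] := tp n _ X tau F mtau nF.
by move=> x _; have [] := pp (tau x) _ (nnm_sec x nF).
Qed.

Section scale.
Context d (T : measurableType d).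
Implicit Types m : {finite_measure set T -> \bar R}.

Lemma mscaleE k m f : (0 <= k)%R -> nnm f -> \int[mscale k m]_x f x = k%:E * \int[m]_x f x.
Proof.
move=> k0 nf; rewrite mscale.unlock densE//; last first.
  by rewrite integral_cst// lte_mul_pinfty ?lee_fin// fin_total.
by rewrite ge0_integralZl_EFin//; case: nf.
Qed.

Lemma mscale_total k m : (0 <= k)%R -> mscale k m setT = k%:E * m setT.
Proof. by move=> k0; rewrite -integral1 (mscaleE _ k0 (nnm_cst _ (@lee01 R))) integral1. Qed.

Lemma minc_mscale k (m_ : nat -> {finite_measure set T -> \bar R}) m : (0 <= k)%R -> minc m_ m -> minc (fun n => mscale k (m_ n)) (mscale k m).
Proof.
move=> k0 mm f nf; rewrite mscaleE//; under eq_fun do rewrite mscaleE//.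
have [nd cv] := mm _ nf; split; last exact: cvgeZl.
by move=> i j ij; apply: lee_wpmul2l; [rewrite lee_fin|exact: nd].
Qed.

Definition nullm : {finite_measure set T -> \bar R} := mzero.

Lemma nullmE f : \int[nullm]_x f x = 0. Proof. exact: integral_measure_zero. Qed.
End scale.

Section time_integral.
Context d (T : measurableType d).
Implicit Types (m : R -> {finite_measure set T -> \bar R}) (A : set R) (w : R * T -> R).

Lemma nnm_tint m w f : tmeas m -> measurable_fun setT w -> (forall z, 0 <= w z)%R -> nnm f ->
  nnm (fun s => \int[m s]_h ((w (s, h))%:E * f h)).
Proof.
move=> tm mw w0 nf; apply: (tm _ _ id (fun z => (w z)%:E * f z.2)) => //.
by apply: nnmM; [exact: nnm_EFin|exact: (nnm_comp measurable_snd nf)].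
Qed.

Lemma tintE m A w f : tmeas m -> measurable_fun setT w -> (forall z, 0 <= w z)%R ->
  \int[lebr A]_s \int[m s]_h (w (s, h))%:E < +oo -> nnm f ->
  \int[tint m A w]_h f h = \int[lebr A]_s \int[m s]_h ((w (s, h))%:E * f h).
Proof.
move=> tm mw w0 fin nf; rewrite tint.unlock.
apply: (@mkE _ _ _ (fun f => \int[lebr A]_s \int[m s]_h ((w (s, h))%:E * f h))) nf; last first.
  by under eq_integral => s _ do under eq_integral => h _ do rewrite mule1.
apply: (@posfun_kernel _ _ _ _ _ (fun f => \int[lebr A]_s f s)
    (fun f s => \int[m s]_h ((w (s, h))%:E * f h))) => [|g ng|s].
- exact: posfun_integral.
- exact: nnm_tint.
- apply: (@posfun_kernel _ _ _ _ _ (fun f => \int[m s]_h f h) (fun f h => (w (s, h))%:E * f h)).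
  + exact: posfun_integral.
  + move=> g ng; apply: nnmM => //.
    apply: (nnm_sec (f := fun z => (w z)%:E) s); exact: nnm_EFin.
  + move=> h; split => [g [_ g0]|g ng|k g k0 ng]; first by rewrite mule_ge0 ?lee_fin.
      by rewrite nneseriesZl// => n _; case: (ng n).
    by rewrite muleCA.
Qed.
End time_integral.
End limits.

(** * The Duhamel kernel *)

Section duhamel.
Context (R : realType) (al gam : R).
Hypotheses (al0 : 0 < al) (gam0 : 0 <= gam).
Local Notation H := (freq R).
Local Notation fmH := {finite_measure set H -> \bar R}.
Local Notation K := (gam / al).
Implicit Types (m : R -> fmH) (Q : fmH) (s t x : R).

(** The symbol of the semigroup, with c = 2 al. *)
Definition decay t (h : H) : R := expR (- (2 * al * `|t|) * `|xi h|).

Lemma decay_ge0 t h : 0 <= decay t h. Proof. exact: expR_ge0. Qed.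
Lemma decay_le1 t h : decay t h <= 1.
Proof. by rewrite /decay -expR0 ler_expR mulNr oppr_le0 !mulr_ge0// ltW. Qed.
Lemma measurable_decay t : measurable_fun setT (decay t).
Proof. by rewrite /decay; hmeas. Qed.

Definition propag t (z : R * H) : R := gam * `|xi z.2| * decay (t - z.1) z.2.

Lemma propag_ge0 t z : 0 <= propag t z.
Proof. by rewrite /propag !mulr_ge0// decay_ge0. Qed.
Lemma measurable_propag t : measurable_fun setT (propag t).
Proof. by rewrite /propag /decay; hmeas. Qed.

(** The weight of the Duhamel integral from s0 to t, when the source decays
    like e^{-al s |xi|}. *)
Definition gain s0 t (h : H) : R :=
  K * (1 - expR (- (al * (t - s0)) * `|xi h|)) * expR (- (al * t) * `|xi h|).

Lemma measurable_gain s0 t : measurable_fun setT (gain s0 t).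
Proof. by rewrite /gain; hmeas. Qed.

Lemma gain_ge0 s0 t h : s0 <= t -> 0 <= gain s0 t h.
Proof.
move=> st; rewrite /gain !mulr_ge0 ?invr_ge0 ?expR_ge0 ?(ltW al0)//.
by rewrite subr_ge0 -expR0 ler_expR mulNr oppr_le0 !mulr_ge0 ?subr_ge0// ltW.
Qed.

Lemma gain_le s0 t h : s0 <= t -> gain s0 t h <= K * expR (- (al * t) * `|xi h|).
Proof.
move=> st; rewrite /gain ler_wpM2r ?expR_ge0// ler_piMr ?mulr_ge0 ?invr_ge0 ?(ltW al0)//.
Qed.

Lemma time_weight s0 t (h : H) : 0 <= s0 -> s0 <= t ->
  (\int[lebr `[s0, t]]_s (expR (- (al * `|s|) * `|xi h|) * propag t (s, h))%:E = (gain s0 t h)%:E)%E.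
Proof.
move=> s00 st; pose x : R := `|xi h|.
pose g (s : R) : R := expR (- (al * `|s|) * x) * propag t (s, h).
have bg : bm g.
  split.
    apply: measurable_funM; first by rewrite /x; meas.
    by rewrite /propag /decay; cbn [fst snd]; meas.
  exists (gam * x) => s; rewrite (ger0_norm (mulr_ge0 (expR_ge0 _) (propag_ge0 _ _))) -[leRHS]mul1r.
  apply: ler_pM; rewrite ?expR_ge0 ?propag_ge0//.
    by rewrite -expR0 ler_expR mulNr oppr_le0 !mulr_ge0 ?normr_ge0// ltW.
  by rewrite /propag /= ler_piMr ?decay_le1 ?mulr_ge0.
rewrite -(RI_E _ bg); congr (_%:E).
rewrite RI_lebr//; last exact: leb_segment.
pose C := gam * x * expR (- (2 * al * t) * x).
pose f (s : R) : R := C * expR (al * x * s + 0).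
pose F (s : R) : R := (K * expR (- (2 * al * t) * x)) * expR (al * x * s + 0).
have fE : {in (`[s0, t])%classic, g =1 f}.
  move=> s; rewrite inE/= in_itv/= => /andP[s0s sT].
  have s0' : 0 <= s by exact: le_trans s0s.
  rewrite /g /f /propag /decay /= -/x (ger0_norm s0') ger0_norm ?subr_ge0//.
  rewrite mulrCA -expRD /C -!mulrA -!expRD; congr (_ * (_ * expR _)); ring.
rewrite (@eq_Rintegral _ _ _ (@lebesgue_measure R) _ f _ fE).
have dexp (s : R) : is_derive s 1 (fun s : R => expR (al * x * s + 0)) (al * x * expR (al * x * s + 0)).
  exact: is_derive_affine (is_derive_expR _).
have l2 (s : R) : s \in `[s0, t] -> is_derive s 1 F (f s).
  move=> _; apply: (dv_cvt (dvZ _ (dexp s))); rewrite /f /C; field.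
  by rewrite gt_eqF.
have l3 : {within `[s0, t], continuous f}.
  by apply: is_derive_within_ex => s _; eexists; exact: (dvZ C (dexp s)).
rewrite (@FTC_R R f F s0 t st l2 l3) /F /gain -/x -mulrBr -!mulrA; congr (_ * (_ * _)).
rewrite mulrBr mulrBl mul1r -!expRD; congr (expR _ - expR _); ring.
Qed.

Local Open Scope ereal_scope.

Lemma nnm_propag t : nnm (fun z : R * H => (propag t z)%:E).
Proof. by apply: nnm_EFin; [exact: measurable_propag|exact: propag_ge0]. Qed.

(** The exponent al s + 2 al (t - s) exceeds al t by al (t - s), which
    integrates |xi| to a constant. *)
Lemma duh_bound m Q s0 t f : tmeas m -> (forall s, wle (al * `|s|) (m s) Q) ->
  (0 <= s0)%R -> (s0 <= t)%R -> nnm f ->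
  \int[lebr `[s0, t]]_s \int[m s]_h ((propag t (s, h))%:E * f h) <=
  \int[Q]_h ((gain s0 t h)%:E * f h).
Proof.
move=> tm mQ s00 st nf.
pose E s (h : H) := expR (- (al * `|s|) * `|xi h|)%R.
pose G (z : R * H) := (E z.1 z.2 * propag t z)%:E * f z.2.
have nG : nnm G.
  apply: nnmM; last exact: (nnm_comp measurable_snd nf).
  apply: nnm_EFin; first by rewrite /E /propag /decay; hmeas.
  by move=> z; rewrite mulr_ge0 ?expR_ge0 ?propag_ge0.
apply: (@le_trans _ _ (\int[lebr `[s0, t]]_s \int[Q]_h G (s, h))).
  apply: le_nnm; [exact: nnm_tint (measurable_propag t) (propag_ge0 t) nf|exact: nnm_fubini|].
  move=> s; apply: le_trans (mQ s _ (nnm_sec s nG)).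
  rewrite le_eqVlt; apply/orP; left; apply/eqP; apply: eq_integral => h _.
  rewrite /G /= muleA -EFinM mulrA /wt /E -expRD.
  by rewrite (_ : (_ + _ = 0)%R) ?expR0 ?mul1r//; ring.
rewrite (@fubini_tonelli _ _ _ _ _ (lebr `[s0, t]) Q G); [|by case: nG|by case: nG].
rewrite le_eqVlt; apply/orP; left; apply/eqP; apply: eq_integral => h _.
rewrite -(time_weight h s00 st) muleC -ge0_integralZl//.
- by apply: eq_integral => s _; rewrite /G /= muleC.
- apply/measurable_EFinP; rewrite /propag /decay; apply: measurable_funM; first by meas.
  by cbn [fst snd]; meas.
- by move=> s _; rewrite lee_fin mulr_ge0 ?expR_ge0 ?propag_ge0.
- by case: nf.
Qed.

End duhamel.

(** * The mild formulation and its fixed point *)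

HB.lock Definition duh (R : realType) (al gam : R) (m : R -> {finite_measure set (freq R) -> \bar R})
    (t : R) : {finite_measure set (freq R) -> \bar R} :=
  tint m `[0%R, t]%classic (propag al gam t).
HB.lock Definition step (R : realType) (al gam kap : R) (p0 : {finite_measure set (freq R) -> \bar R})
    (m : R -> {finite_measure set (freq R) -> \bar R}) (t : R) : {finite_measure set (freq R) -> \bar R} :=
  madd (dens (decay al t) p0) (duh al gam (fun s => Tm kap (m s)) t).

Section mild.
Context (R : realType) (al gam : R).
Hypotheses (al0 : 0 < al) (gam0 : 0 <= gam).
Local Notation H := (freq R).
Local Notation fmH := {finite_measure set H -> \bar R}.
Local Notation K := (gam / al).
Local Notation decay := (decay al).
Local Notation propag := (propag al gam).
Local Notation leb := (@lebesgue_measure R).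
Implicit Types (m n : R -> fmH) (Q M : fmH) (s t : R).
Local Open Scope ereal_scope.

Lemma lebr_empty s t (g : R -> \bar R) : (t < s)%R -> nnm g -> \int[lebr `[s, t]]_r g r = 0.
Proof.
move=> ts ng; rewrite lebrE//; last exact: leb_segment.
by rewrite set_itv_ge ?integral_set0// bnd_simp -ltNge.
Qed.

Lemma densE_le1 (w : H -> R) p0 f : measurable_fun setT w -> (forall h, 0 <= w h <= 1)%R -> nnm f ->
  \int[dens w p0]_h f h = \int[p0]_h ((w h)%:E * f h).
Proof.
move=> mw w1 nf; rewrite densE//; first by move=> h; case/andP: (w1 h).
apply: (@le_lt_trans _ _ (\int[p0]_h 1)); last by rewrite integral1 fin_total.
apply: le_nnm; [by apply: nnm_EFin => // h; case/andP: (w1 h)|exact: (nnm_cst _ (@lee01 R))|].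
by move=> h; rewrite lee_fin; case/andP: (w1 h).
Qed.

(** A measurable family that gains analyticity at rate al: e^{al t |xi|} m_t
    <= M for all times with the same M. *)
Definition admissible m M := tmeas m /\ forall t, wle (al * `|t|)%R (m t) M.

Lemma admissible_mle m M t : admissible m M -> mle (m t) M.
Proof. by move=> [_ mM]; apply: wle_mle (mM t); rewrite mulr_ge0// ltW. Qed.

Lemma admissible_small m M t : admissible m M -> small M -> small (m t).
Proof. by move=> am; apply: le_trans; exact: (mle_total (admissible_mle t am)). Qed.

Lemma duh_fin m Q t : admissible m Q ->
  \int[lebr `[0%R, t]]_s \int[m s]_h (propag t (s, h))%:E < +oo.
Proof.
move=> [tm mQ]; have n1 := nnm_cst H (@lee01 R).
have [t0|t0] := leP 0%R t; last first.
  rewrite lebr_empty ?ltry//.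
  have := nnm_tint tm (measurable_propag al gam t) (propag_ge0 al gam0 t) n1.
  by under eq_fun do under eq_integral do rewrite mule1.
have := @duh_bound _ al gam al0 gam0 m Q 0%R t _ tm mQ (lexx _) t0 n1.
under eq_integral do under eq_integral do rewrite mule1.
move=> /le_lt_trans; apply.
apply: (@le_lt_trans _ _ (\int[Q]_h K%:E)).
  apply: le_nnm.
  - apply: nnmM => //; apply: nnm_EFin; first exact: measurable_gain.
    by move=> h; exact: gain_ge0.
  - by apply: nnm_cst; rewrite lee_fin divr_ge0// ltW.
  move=> h; rewrite mule1 lee_fin; apply: le_trans (gain_le _ _ _ _) _ => //.
  rewrite ler_piMr ?divr_ge0 ?(ltW al0)// -expR0 ler_expR mulNr oppr_le0.
  by rewrite !mulr_ge0// ltW.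
by rewrite integral_cst// lte_mul_pinfty ?lee_fin ?divr_ge0 ?(ltW al0)// fin_total.
Qed.

Local Notation duh := (duh al gam).
Lemma duhE m Q t f : admissible m Q -> nnm f ->
  \int[duh m t]_h f h = \int[lebr `[0%R, t]]_s \int[m s]_h ((propag t (s, h))%:E * f h).
Proof.
rewrite duh.unlock => am nf; have [tm mQ] := am; apply: tintE => //.
- exact: measurable_propag.
- by move=> z; exact: propag_ge0.
- exact: duh_fin am.
Qed.

Lemma tmeas_duh m Q : admissible m Q -> tmeas (duh m).
Proof.
move=> am d' X tau F mtau nF; have [tm mQ] := am.
pose G (z : X * R) : \bar R := if (0 <= z.2)%R && (z.2 <= tau z.1)%R
  then \int[m z.2]_h ((propag (tau z.1) (z.2, h))%:E * F (z.1, h)) else 0.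
have mt1 : measurable_fun setT (fun z : X * R => tau z.1).
  by apply: (measurableT_comp mtau); exact: measurable_fst.
have mt2 : measurable_fun setT (fun z : (X * R) * H => tau z.1.1).
  by apply: (measurableT_comp mt1); exact: measurable_fst.
have nG0 : nnm (fun z : X * R => \int[m z.2]_h ((propag (tau z.1) (z.2, h))%:E * F (z.1, h))).
  apply: (tm _ _ (fun z : X * R => z.2)
    (fun z : (X * R) * H => (propag (tau z.1.1) (z.1.2, z.2))%:E * F (z.1.1, z.2))).
    exact: measurable_snd.
  apply: nnmM.
    apply: nnm_EFin; last by move=> z; exact: propag_ge0.
    by rewrite /propag /decay; cbn [fst snd]; hmeas.
  apply: (nnm_comp (phi := fun z : (X * R) * H => (z.1.1, z.2)) _ nF).
  by meas.
have nG : nnm G.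
  split; last by move=> z; rewrite /G; case: ifP => // _; case: nG0.
  apply: measurable_fun_ifT => //; last by case: nG0.
  by apply: measurable_and; meas.
have GE (x : X) (k : nat) : (tau x <= k%:R)%R ->
    \int[lebr `[0%R, k%:R]]_s G (x, s) = \int[duh m (tau x)]_y F (x, y).
  move=> xk; rewrite (duhE _ am); last exact: nnm_sec.
  have ng := nnm_tint tm (measurable_propag al gam (tau x)) (propag_ge0 al gam0 (tau x)) (nnm_sec x nF).
  rewrite (lebrE _ (leb_segment _ _) ng)// (lebrE _ (leb_segment _ _) (nnm_sec x nG))//.
  rewrite integral_mkcond [RHS]integral_mkcond; apply: eq_integral => s _; rewrite /patch /G /=.
  rewrite !mem_setE !in_itv/=; case: ifP => [/andP[-> _]//|h1].
  by case: ifP => // /andP[s0 sx]; move: h1; rewrite s0 (le_trans sx xk).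
split; last by move=> x; apply: nnm_integral; exact: nnm_sec.
apply: (emeasurable_fun_cvg (fun k x => \int[lebr `[0%R, k%:R]]_s G (x, s))).
  by move=> k; have [] := nnm_fubini (lebr `[0%R, k%:R]) nG.
move=> x _; apply: cvg_near_cst; near=> k; apply: GE.
by near: k; exact: nbhs_infty_ger.
Unshelve. all: by end_near. Qed.

Section step.
Variables (kap : R) (p0 : fmH).
Local Notation Tm := (Tm kap).

Local Notation step := (step al gam kap p0).

Lemma admissible_Tm m M : small M -> admissible m M -> admissible (fun s => Tm (m s)) (Tm M).
Proof.
move=> sM am; have [tm mM] := am; split.
  by apply: tmeas_Tm => // t; exact: admissible_small am sM.
move=> t; apply: wle_Tm => //; first by rewrite mulr_ge0// ltW.
exact: admissible_small am sM.
Qed.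

Lemma decay01 t (h : H) : (0 <= decay t h <= 1)%R.
Proof. by rewrite decay_ge0 decay_le1. Qed.

Lemma stepE m M t f : small M -> admissible m M -> nnm f ->
  \int[step m t]_h f h = \int[p0]_h ((decay t h)%:E * f h) +
    \int[lebr `[0%R, t]]_s \int[Tm (m s)]_h ((propag t (s, h))%:E * f h).
Proof.
rewrite step.unlock => sM am nf; rewrite maddE// (duhE _ (admissible_Tm sM am))//.
by rewrite densE_le1//; [exact: measurable_decay|exact: decay01].
Qed.

Lemma admissible_step m M : small M -> admissible m M ->
  (forall f, nnm f -> \int[p0]_h f h + K%:E * \int[Tm M]_h f h <= \int[M]_h f h) ->
  admissible (step m) M.
Proof.
move=> sM am pM; have [tm mM] := am.
have aT := admissible_Tm sM am; split.
  rewrite step.unlock; apply: tmeas_madd; last exact: tmeas_duh aT.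
  move=> d' X tau F mtau nF.
  rewrite (_ : (fun x => _) = fun x : X => \int[p0]_h ((decay (tau x) h)%:E * F (x, h))); last first.
    apply/funext => x; rewrite densE_le1//; [exact: measurable_decay|exact: decay01|exact: nnm_sec].
  apply: (@nnm_fubini _ _ _ _ _ p0 (fun z => (decay (tau z.1) z.2)%:E * F z)).
  apply: nnmM => //; apply: nnm_EFin.
    have mt : measurable_fun setT (fun z : X * H => tau z.1).
      by apply: (measurableT_comp mtau); exact: measurable_fst.
    by rewrite /decay; hmeas.
  by move=> z; exact: decay_ge0.
move=> t f nf; have nw := nnmM (nnm_wt (al * `|t|)%R) nf.
rewrite (stepE _ sM am nw); apply: le_trans (pM _ nf); apply: leeD.
  apply: le_nnm => //; first by apply: nnmM => //; apply: nnm_EFin; [exact: measurable_decay|exact: decay_ge0].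
  move=> h; rewrite muleA -EFinM -[leRHS]mul1e; apply: lee_wpmul2r; first by case: nf.
  rewrite lee_fin /decay /wt -expRD expR_le1 -mulrDl; apply: mulr_le0_ge0 => //.
  have : (0 <= al * `|t|)%R by rewrite mulr_ge0// ltW.
  by rewrite -mulrA mulr_natl mulr2n opprD addrNK oppr_le0.
have [t0|t0] := leP 0%R t; last first.
  rewrite lebr_empty//; first by rewrite mule_ge0 ?lee_fin ?divr_ge0 ?(ltW al0)//; exact: nnm_integral.
  exact: nnm_tint (proj1 aT) (measurable_propag al gam t) (propag_ge0 al gam0 t) nw.
apply: le_trans (duh_bound al0 gam0 (proj1 aT) (proj2 aT) (lexx _) t0 nw) _.
rewrite -ge0_integralZl_EFin//; last 3 first.
- by case: nf.
- by case: nf.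
- by rewrite divr_ge0// ltW.
apply: le_nnm.
- by apply: nnmM => //; apply: nnm_EFin; [exact: measurable_gain|move=> h; exact: gain_ge0].
- by apply: nnmM => //; apply: nnm_cst; rewrite lee_fin divr_ge0// ltW.
move=> h; rewrite muleA -EFinM; apply: lee_wpmul2r; first by case: nf.
rewrite lee_fin; have h1 := gain_le al0 gam0 h t0.
apply: le_trans (ler_wpM2r (wt_ge0 _ _) h1) _.
move: K => k; by rewrite -mulrA /wt -expRD (ger0_norm t0) -mulrDl addNr mul0r expR0 mulr1.
Qed.

Lemma le_step m n M t : small M -> admissible m M -> admissible n M ->
  (forall s, mle (m s) (n s)) -> mle (step m t) (step n t).
Proof.
move=> sM am an mn f nf; rewrite (stepE _ sM am nf) (stepE _ sM an nf) leeD2l//.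
apply: le_nnm.
- exact: nnm_tint (proj1 (admissible_Tm sM am)) (measurable_propag al gam t) (propag_ge0 al gam0 t) nf.
- exact: nnm_tint (proj1 (admissible_Tm sM an)) (measurable_propag al gam t) (propag_ge0 al gam0 t) nf.
move=> s; have : mle (Tm (m s)) (Tm (n s)).
  apply/wle0; apply: wle_Tm => //; [exact: admissible_small am sM|exact: admissible_small an sM|].
  exact/wle0.
apply; apply: nnmM => //; exact: (nnm_sec s (nnm_propag al gam0 t)).
Qed.

Lemma minc_step (p_ : nat -> R -> fmH) p M t f : small M -> (forall k, admissible (p_ k) M) ->
  admissible p M -> (forall s, minc (p_^~ s) (p s)) -> nnm f ->
  \int[step (p_ k) t]_h f h @[k --> \oo] --> \int[step p t]_h f h.
Proof.
move=> sM ap_ ap pp nf; rewrite (stepE _ sM ap nf).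
under eq_fun do rewrite (stepE _ sM (ap_ _) nf).
have nk (q : R -> fmH) : admissible q M ->
    nnm (fun s => \int[Tm (q s)]_h ((propag t (s, h))%:E * f h)).
  move=> aq.
  exact: nnm_tint (proj1 (admissible_Tm sM aq)) (measurable_propag al gam t) (propag_ge0 al gam0 t) nf.
have nw s : nnm (fun h => (propag t (s, h))%:E * f h).
  by apply: nnmM => //; exact: (nnm_sec s (nnm_propag al gam0 t)).
have mT s : minc (fun k => Tm (p_ k s)) (Tm (p s)).
  apply: minc_Tm => // [k|]; [exact: admissible_small (ap_ k) sM|exact: admissible_small ap sM].
apply: cvgeD.
- by apply: ge0_adde_def; rewrite inE; apply: nnm_integral; [apply: nnmM => //; apply: nnm_EFin; [exact: measurable_decay|exact: decay_ge0]|exact: nk].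
- exact: cvg_cst.
apply: (proj2 (minc_int (p_ := fun=> lebr `[0%R, t])
  (g_ := fun k s => \int[Tm (p_ k s)]_h ((propag t (s, h))%:E * f h))
  (g := fun s => \int[Tm (p s)]_h ((propag t (s, h))%:E * f h)) (minc_cst _) _ _ _ _)).
- by move=> k; exact: nk.
- exact: nk.
- by move=> s; case: (mT s _ (nw s)).
- by move=> s; case: (mT s _ (nw s)).
Qed.

End step.
End mild.

Section mild_solution.
Context (R : realType) (al gam : R).
Hypotheses (al0 : 0 < al) (gam0 : 0 <= gam).
Local Notation H := (freq R).
Local Notation fmH := {finite_measure set H -> \bar R}.
Local Notation K := (gam / al).
Variables (kap : R) (p0 : fmH).
Local Notation Tm := (Tm kap).
Local Notation step := (step al gam kap p0).
Local Notation admissible := (admissible al).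
Local Open Scope ereal_scope.

Let K0 : (0 <= K)%R. Proof. by rewrite divr_ge0// ltW. Qed.

Lemma mle_Tm p (P : fmH) : small p -> small P -> mle p P -> mle (Tm p) (Tm P).
Proof. by move=> sp sP /wle0 pP; apply/wle0; exact: wle_Tm. Qed.

Lemma mle_madd (p q P Q : fmH) : mle p P -> mle q Q -> mle (madd p q) (madd P Q).
Proof. by move=> /wle0 h1 /wle0 h2; apply/wle0; exact: wle_madd. Qed.

Lemma mle_mscale k (p q : fmH) : (0 <= k)%R -> mle p q -> mle (mscale k p) (mscale k q).
Proof. by move=> k0 pq f nf; rewrite !mscaleE// lee_wpmul2l ?lee_fin//; exact: pq. Qed.

Lemma mle_nullm (p : fmH) : mle (nullm R H) p.
Proof. by move=> f nf; rewrite nullmE; exact: nnm_integral. Qed.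

(** The bound M is the limit of M_{n+1} = p0 + K Tm M_n and the solution is
    the limit of the iterates of the Duhamel map, both increasing from 0.
    The mass of M stays below a because the term in Tm is cubic. *)
Lemma mild_exists (a : R) : (a <= 4^-1)%R -> (K * (4 * a ^+ 3) <= a / 2)%R ->
  p0 setT <= (a / 2)%:E ->
  exists (M : fmH) (p : R -> fmH),
  [/\ M setT <= a%:E, admissible p M,
      forall f, nnm f -> \int[M]_h f h = \int[p0]_h f h + K%:E * \int[Tm M]_h f h &
      forall t f, nnm f -> \int[p t]_h f h = \int[step p t]_h f h].
Proof.
move=> a4 aK pa.
have a20 : (0 <= a / 2)%R by rewrite -lee_fin (le_trans _ pa).
have a2 : (a <= 2^-1)%R by apply: le_trans a4 _; rewrite lef_pV2 ?posrE// ler_nat.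
pose M_ n : fmH := iter n (fun M => madd p0 (mscale K (Tm M))) (nullm R H).
have M_S n : M_ n.+1 = madd p0 (mscale K (Tm (M_ n))) by [].
have M_a n : M_ n setT <= a%:E.
  elim: n => [|n ih].
    by rewrite -integral1 nullmE lee_fin; move: a20; rewrite pmulr_lge0.
  rewrite M_S madd_total mscale_total//.
  have -> : a%:E = (a / 2)%:E + (a / 2)%:E by rewrite -EFinD -splitr.
  apply: leeD => //; apply: le_trans (lee_wpmul2l _ (Tm_total kap a2 ih)) _; rewrite ?lee_fin//.
have M_s n : small (M_ n) by apply: le_trans (M_a n) _; rewrite lee_fin.
have M_inc n : mle (M_ n) (M_ n.+1).
  elim: n => [|n ih]; first exact: mle_nullm.
  rewrite !M_S; apply: mle_madd; first exact: mle_refl.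
  exact: (mle_mscale K0 (mle_Tm (M_s n) (M_s n.+1) ih)).
pose M := mlim M_.
have MM : minc M_ M by exact: (mlim_minc M_inc M_a).
have Ma : M setT <= a%:E.
  rewrite -integral1; apply: (minc_le MM (nnm_cst _ (@lee01 R))) => n.
  by rewrite integral1; exact: M_a.
have sM : small M by apply: le_trans Ma _; rewrite lee_fin.
have MS : minc (fun n => M_ n.+1) (madd p0 (mscale K (Tm M))).
  apply: minc_madd; first exact: minc_cst.
  by apply: minc_mscale => //; exact: minc_Tm.
have ME f : nnm f -> \int[M]_h f h = \int[p0]_h f h + K%:E * \int[Tm M]_h f h.
  by move=> nf; rewrite (minc_shift MM MS nf) maddE// mscaleE.
have Mle f : nnm f -> \int[p0]_h f h + K%:E * \int[Tm M]_h f h <= \int[M]_h f h.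
  by move=> nf; rewrite ME.
pose p_ n : R -> fmH := iter n step (fun=> nullm R H).
have p_S n : p_ n.+1 = step (p_ n) by [].
have ap_ n : admissible (p_ n) M.
  elim: n => [|n ih]; last by rewrite p_S; exact: admissible_step.
  split; first exact: tmeas_cst.
  by move=> t f nf; rewrite nullmE; exact: nnm_integral.
have p_inc t n : mle (p_ n t) (p_ n.+1 t).
  elim: n t => [|n ih] t; first exact: mle_nullm.
  rewrite [p_ n.+2]p_S {1}p_S.
  exact: (le_step al0 gam0 kap p0 t sM (ap_ n) (ap_ n.+1) ih).
pose p t : fmH := mlim (p_^~ t).
have pp t : minc (p_^~ t) (p t).
  apply: (mlim_minc (a := a) (p_inc t)) => n.
  by apply: le_trans Ma; exact: (mle_total (admissible_mle al0 t (ap_ n))).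
have ap : admissible p M.
  split; first by apply: (tmeas_minc _ pp) => n; case: (ap_ n).
  move=> t f nf; have nw := nnmM (nnm_wt (al * `|t|)%R) nf.
  by apply: (minc_le (pp t) nw) => n; have [_] := ap_ n; apply.
exists M, p; split=> // t f nf.
have c1 := @minc_step R al gam al0 gam0 kap p0 p_ p M t f sM ap_ ap pp nf.
have [_ c2] := pp t f nf.
move: c2; rewrite -(cvg_shiftS (fun n => \int[p_ n t]_h f h)) => c2.
exact: (cvg_unique _ c2 c1).
Qed.

End mild_solution.

(** * Regularity in time of the mild solution *)

Section time_splitting.
Context (R : realType).
Local Open Scope ereal_scope.
Local Notation leb := (@lebesgue_measure R).
Implicit Types (s t r : R) (g : R -> \bar R).

Lemma lebr_split s r t g : (s <= r)%R -> (r <= t)%R -> nnm g ->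
  \int[lebr `[s, t]]_x g x = \int[lebr `[s, r]]_x g x + \int[lebr `[r, t]]_x g x.
Proof.
move=> sr rt ng; have [mg g0] := ng.
rewrite !(lebrE _ (leb_segment _ _) ng)//.
have -> : (`[s, t] = `[s, r] `|` `]r, t])%classic.
  by rewrite -itv_bndbnd_setU// bnd_simp.
rewrite ge0_integral_setU//=.
- congr (_ + _); apply: integral_itv_obnd_cbnd; exact: measurable_funTS.
- exact: measurable_funTS.
- by apply/disj_setPS => y [] /=; rewrite !in_itv/= => /andP[_ yr] /andP[ry _]; rewrite ltNge yr in ry.
Qed.

Lemma lebr_cst s t (k : \bar R) : (s <= t)%R -> 0 <= k -> \int[lebr `[s, t]]_x k = k * (t - s)%:E.
Proof.
move=> st k0; transitivity (k * lebr `[s, t]%classic setT); first exact: integral_cst.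
rewrite lebr_total//; last exact: leb_segment.
rewrite lebesgue_measure_itv/= lte_fin; case: ltP => [_|ts]; first by rewrite EFinB.
have -> : t = s by apply/eqP; rewrite eq_le st ts.
by rewrite subrr.
Qed.

Lemma le_lebr s t (f g : R -> \bar R) : nnm f -> nnm g -> (forall r, r \in `[s, t] -> f r <= g r) ->
  \int[lebr `[s, t]]_x f x <= \int[lebr `[s, t]]_x g x.
Proof.
move=> nf ng fg; rewrite !lebrE//; try exact: leb_segment.
have [mf f0] := nf; have [mg g0] := ng.
apply: ge0_le_integral => //; exact: measurable_funTS.
Qed.

Lemma eq_lebr s t (f g : R -> \bar R) : nnm f -> nnm g -> (forall r, r \in `[s, t] -> f r = g r) ->
  \int[lebr `[s, t]]_x f x = \int[lebr `[s, t]]_x g x.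
Proof.
by move=> nf ng fg; apply/eqP; rewrite eq_le !le_lebr// => r /fg ->.
Qed.

End time_splitting.

Lemma decayD (R : realType) (al s t : R) (h : freq R) : 0 <= s -> 0 <= t ->
  decay al s h * decay al t h = decay al (s + t) h.
Proof.
move=> s0 t0; rewrite /decay -expRD -mulrDl (ger0_norm s0) (ger0_norm t0) (ger0_norm (addr_ge0 s0 t0)).
by rewrite -opprD -mulrDr.
Qed.

Lemma RI_mscale (R : realType) d (T : measurableType d) (k : R) (m : {finite_measure set T -> \bar R}) g :
  0 <= k -> bm g -> RI (mscale k m) g = k * RI m g.
Proof.
by move=> k0 bg; rewrite mscale.unlock RI_dens//; [rewrite RIZ|exact: bm_cst].
Qed.

Lemma expRN_quadratic (R : realType) (z : R) : 0 <= z ->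
  1 <= expR (- z) + z /\ expR (- z) + z <= 1 + z ^+ 2.
Proof.
move=> z0; split; first by rewrite -lerBlDr expR_ge1Dx.
have z1 : 0 < 1 + z by rewrite ltr_pwDl.
have h1 : expR (- z) * (1 + z) <= 1.
  rewrite expRN mulrC ler_pdivrMr ?expR_gt0// mul1r; exact: expR_ge1Dx.
have h2 : 1 <= (1 - z + z ^+ 2) * (1 + z).
  by rewrite (_ : _ * _ = 1 + z ^+ 3) ?lerDl ?exprn_ge0//; ring.
have := le_trans h1 h2; rewrite ler_pM2r//; lra.
Qed.

Lemma near_RI_mass (R : realType) d (T : measurableType d) (q q' e : {finite_measure set T -> \bar R})
    (g : T -> R) (k : R) : near_by q q' e -> bm g -> (forall x, `|g x| <= 1) -> (e setT <= k%:E)%E ->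
  `|RI q g - RI q' g| <= k.
Proof.
move=> qq bg g1 ek; apply: le_trans (near_RI qq bg) _.
have := RI_bound e (bm_norm bg) (fun x => (_ : `| `|g x| | <= 1)).
move=> /(_ (fun x => _)) h.
have {}h : `|RI e (fun x => `|g x|)| <= 1 * mass e by apply: h => x; rewrite normr_id.
apply: le_trans (ler_norm _) (le_trans h _).
by rewrite mul1r -lee_fin massE.
Qed.

(** A quadratic error is a uniform way of proving differentiability, without
    passing to the limit in measures. *)
Lemma is_derive_quadratic (R : realType) (y : R -> R) (t l k e : R) : 0 < e ->
  (forall s, `|s - t| < e -> `|y s - y t - (s - t) * l| <= k * (s - t) ^+ 2) ->
  is_derive t 1 y l.
Proof.
move=> e0 h.
have cv : (fun z : R => z^-1 *: ((y \o shift t) (z *: (1 : R)) - y t)) @ 0^' --> l.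
  apply/cvgrPdist_le => d d0; near=> z.
  have z0 : z != 0 by near: z; exact: nbhs_dnbhs_neq.
  have ze : `|z| < e.
    by near: z; apply: dnbhs0_lt.
  have zd : `|z| < d / (`|k| + 1).
    by near: z; apply: dnbhs0_lt; rewrite divr_gt0// ltr_wpDl.
  have := h (z + t); rewrite addrK => /(_ ze) hz.
  rewrite /= /GRing.scale /= mulr1.
  have -> : l - z^-1 * (y (z + t) - y t) = - (z^-1 * (y (z + t) - y t - z * l)).
    by rewrite [in RHS]mulrBr mulrA mulVf// mul1r opprB.
  rewrite normrN normrM normfV ler_pdivrMl ?normr_gt0//.
  apply: le_trans hz _; rewrite -real_normK ?num_real// expr2 mulrA mulrC ler_wpM2l//.
  apply: (@le_trans _ _ ((`|k| + 1) * `|z|)).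
    by rewrite ler_wpM2r// (le_trans (ler_norm k))// lerDl.
  by rewrite mulrC -ler_pdivlMr ?ltW// ltr_wpDl.
have dy : derivable y t 1 by apply/cvg_ex; exists l; exact: cv.
by apply: DeriveDef => //; exact: cvg_lim cv.
Unshelve. all: by end_near. Qed.

Section weights.
Context (R : realType).
Local Notation H := (freq R).
Local Notation fmH := {finite_measure set H -> \bar R}.
Implicit Types (q Q : fmH) (b : R).
Local Open Scope ereal_scope.

Lemma wle_weaken b b' q Q : (b <= b')%R -> wle b' q Q -> wle b q Q.
Proof.
move=> bb h f nf; apply: le_trans (h f nf); apply: le_nnm.
- by apply: nnmM => //; exact: nnm_wt.
- by apply: nnmM => //; exact: nnm_wt.
move=> x; apply: lee_wpmul2r; first by case: nf.
by rewrite lee_fin ler_expR ler_wpM2r.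
Qed.

(** Polynomial weights are absorbed by the exponential one. *)
Lemma wle_weight b k q Q (w : H -> R) : wle b q Q -> measurable_fun setT w -> (0 <= k)%R ->
  (forall h, 0 <= w h <= k * wt b h)%R -> \int[q]_h (w h)%:E <= k%:E * Q setT.
Proof.
move=> qQ mw k0 wk; have nk : nnm (fun _ : H => k%:E) by apply: nnm_cst; rewrite lee_fin.
apply: le_trans (_ : \int[Q]_h k%:E <= _); last by rewrite integral_cst.
apply: le_trans (qQ _ nk); apply: le_nnm.
- by apply: nnm_EFin => // h; case/andP: (wk h).
- by apply: nnmM => //; exact: nnm_wt.
- by move=> h; rewrite -EFinM lee_fin mulrC; case/andP: (wk h).
Qed.

Definition absxi2 (h : H) : R := (absxi h ^+ 2)%R.

Lemma measurable_absxi2 : measurable_fun setT absxi2.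
Proof. by apply: measurable_funX; exact: measurable_absxi. Qed.

Lemma absxi_wt b h : (0 < b)%R -> (0 <= absxi h <= b^-1 * wt b h)%R.
Proof.
move=> b0; rewrite normr_ge0/= ler_pdivlMl//.
by apply: le_trans (expR_ge1Dx _); rewrite lerDr.
Qed.

Lemma absxi2_wt b h : (0 < b)%R -> (0 <= absxi2 h <= (2 / b) ^+ 2 * wt b h)%R.
Proof.
move=> b0; rewrite sqr_ge0/=; have b20 : (0 < b / 2)%R by rewrite divr_gt0.
have -> : wt b h = (wt (b / 2) h ^+ 2)%R.
  by rewrite expr2 /wt -expRD -mulrDl -splitr.
have /andP[h0 h1] := absxi_wt h b20; rewrite invf_div in h1.
by rewrite -exprMn /absxi2 lerXn2r ?nnegrE// (le_trans h0 h1).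
Qed.

Lemma wle_fin b k q Q (w : H -> R) : wle b q Q -> measurable_fun setT w -> (0 <= k)%R ->
  (forall h, 0 <= w h <= k * wt b h)%R -> \int[q]_h (w h)%:E < +oo.
Proof.
move=> qQ mw k0 wk; apply: le_lt_trans (wle_weight qQ mw k0 wk) _.
by rewrite lte_mul_pinfty ?lee_fin// fin_total.
Qed.

Lemma densE_wt b k q Q (w : H -> R) f : wle b q Q -> measurable_fun setT w -> (0 <= k)%R ->
  (forall h, 0 <= w h <= k * wt b h)%R -> nnm f ->
  \int[dens w q]_h f h = \int[q]_h ((w h)%:E * f h).
Proof.
move=> qQ mw k0 wk nf; apply: densE => //; first by move=> h; case/andP: (wk h).
exact: wle_fin qQ mw k0 wk.
Qed.

Lemma dens_wt_total b k q Q (w : H -> R) : wle b q Q -> measurable_fun setT w -> (0 <= k)%R ->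
  (forall h, 0 <= w h <= k * wt b h)%R -> dens w q setT <= k%:E * Q setT.
Proof.
move=> qQ mw k0 wk; rewrite -integral1 (densE_wt qQ mw k0 wk (nnm_cst _ (@lee01 R))).
apply: le_trans (wle_weight qQ mw k0 wk).
by rewrite le_eqVlt; apply/orP; left; apply/eqP; apply: eq_integral => h _; rewrite mule1.
Qed.

Lemma near_dens_wt b k q q' e Q Q' Q'' (w : H -> R) : wle b q Q -> wle b q' Q' -> wle b e Q'' ->
  measurable_fun setT w -> (0 <= k)%R -> (forall h, 0 <= w h <= k * wt b h)%R ->
  near_by q q' e -> near_by (dens w q) (dens w q') (dens w e).
Proof.
move=> h1 h2 h3 mw k0 wk qq f nf.
rewrite (densE_wt h1 mw k0 wk nf) (densE_wt h2 mw k0 wk nf) (densE_wt h3 mw k0 wk nf).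
by apply: qq; apply: nnmM => //; apply: nnm_EFin => // h; case/andP: (wk h).
Qed.

Lemma nnm_weight (w : H -> R) (f : H -> \bar R) : measurable_fun setT w -> (forall h, 0 <= w h)%R -> nnm f ->
  nnm (fun h => (w h)%:E * f h).
Proof. by move=> mw w0 nf; apply: nnmM => //; exact: nnm_EFin. Qed.

Lemma le_weight q (w w' : H -> R) f : measurable_fun setT w -> measurable_fun setT w' ->
  (forall h, 0 <= w h)%R -> (forall h, w h <= w' h)%R -> nnm f ->
  \int[q]_h ((w h)%:E * f h) <= \int[q]_h ((w' h)%:E * f h).
Proof.
move=> mw mw' w0 ww nf; apply: le_nnm.
- exact: nnm_weight.
- by apply: nnm_weight => // h; exact: le_trans (ww h).
- by move=> h; apply: lee_wpmul2r; [case: nf|rewrite lee_fin].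
Qed.

Lemma weightD q (w w' : H -> R) k f : measurable_fun setT w -> measurable_fun setT w' ->
  (forall h, 0 <= w h)%R -> (forall h, 0 <= w' h)%R -> (0 <= k)%R -> nnm f ->
  \int[q]_h ((w h + k * w' h)%:E * f h) =
  \int[q]_h ((w h)%:E * f h) + k%:E * \int[q]_h ((w' h)%:E * f h).
Proof.
move=> mw mw' w0 w0' k0 nf; have n1 := nnm_weight mw w0 nf; have n2 := nnm_weight mw' w0' nf.
rewrite -ge0_integralZl_EFin//; last 2 first.
- by move=> h _; case: n2.
- by case: n2.
have n3 : nnm (fun h => k%:E * ((w' h)%:E * f h)).
  by apply: nnmM => //; apply: nnm_cst; rewrite lee_fin.
rewrite -ge0_integralD//; last 4 first.
- by move=> h _; case: n1.
- by case: n1.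
- by move=> h _; case: n3.
- by case: n3.
apply: eq_integral => h _; rewrite EFinD EFinM muleA -ge0_muleDl ?mule_ge0 ?lee_fin//.
Qed.

Lemma near_mle q q' e (e' : fmH) : near_by q q' e -> mle e e' -> near_by q q' e'.
Proof.
move=> qq ee f nf; have [h1 h2] := qq f nf.
by split; [apply: le_trans h1 _|apply: le_trans h2 _]; rewrite leeD2l// ee.
Qed.

End weights.
Arguments absxi {R}.
Arguments absxi2 {R}.

Section mild_regularity.
Context (R : realType) (al gam : R).
Hypotheses (al0 : 0 < al) (gam0 : 0 <= gam).
Local Notation H := (freq R).
Local Notation fmH := {finite_measure set H -> \bar R}.
Local Notation K := (gam / al).
Variables (kap a : R) (p0 M : fmH) (p : R -> fmH).
Local Notation Tm := (Tm kap).
Local Notation Em := (Em kap).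
Local Notation step := (step al gam kap p0).
Local Notation decay := (decay al).
Local Notation propag := (propag al gam).
Local Notation gain := (gain al gam).
Hypotheses (a4 : a <= 4^-1) (Ma : (M setT <= a%:E)%E) (ap : admissible al p M).
Hypothesis ME : forall f, nnm f ->
  (\int[M]_h f h = \int[p0]_h f h + K%:E * \int[Tm M]_h f h)%E.
Hypothesis pE : forall t f, nnm f -> (\int[p t]_h f h = \int[step p t]_h f h)%E.
Local Open Scope ereal_scope.

Lemma M_tiny : tiny M. Proof. by apply: le_trans Ma _; rewrite lee_fin. Qed.
Lemma M_small : small M. Proof. exact: tiny_small M_tiny. Qed.
Lemma admissible_Tmp : admissible al (fun s => Tm (p s)) (Tm M).
Proof. exact: (admissible_Tm al0 kap M_small ap). Qed.

Lemma nnm_decay t : nnm (fun h => (decay t h)%:E).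
Proof. by apply: nnm_EFin => [|h]; [exact: measurable_decay|exact: decay_ge0]. Qed.

Lemma nnm_duh t f : nnm f -> nnm (fun s => \int[Tm (p s)]_h ((propag t (s, h))%:E * f h)).
Proof. exact: nnm_tint (proj1 admissible_Tmp) (measurable_propag al gam t) (propag_ge0 al gam0 t). Qed.

(** Duhamel from any earlier time, since the semigroup property passes
    through the integral. *)
Lemma mild_semigroup s t f : (0 <= s)%R -> (s <= t)%R -> nnm f ->
  \int[p t]_h f h = \int[p s]_h ((decay (t - s) h)%:E * f h) +
    \int[lebr `[s, t]]_r \int[Tm (p r)]_h ((propag t (r, h))%:E * f h).
Proof.
move=> s0 st nf; have nw := nnmM (nnm_decay (t - s)) nf.
have t0 := le_trans s0 st.
rewrite (pE t nf) (pE s nw) (stepE al0 gam0 kap p0 t M_small ap nf) (stepE al0 gam0 kap p0 s M_small ap nw).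
rewrite -addeA; congr (_ + _).
  apply: eq_integral => h _; rewrite muleA -EFinM; congr (_%:E * _).
  by rewrite decayD ?subr_ge0// addrC subrK.
rewrite [X in X = _](lebr_split s0 st (nnm_duh t nf)); congr (_ + _).
apply: eq_lebr; [exact: nnm_duh|exact: nnm_duh|].
move=> r; rewrite in_itv/= => /andP[r0 rs]; apply: eq_integral => h _.
rewrite muleA -EFinM; congr (_%:E * _).
rewrite /propag /= -[RHS]mulrA decayD ?subr_ge0// (_ : s - r + (t - s) = t - r)%R//; ring.
Qed.

Lemma KTm_le f : nnm f -> K%:E * \int[Tm M]_h f h <= \int[M]_h f h.
Proof. by move=> nf; rewrite ME// leeDr//; exact: nnm_integral. Qed.

(** A bound of the change of the solution from s to t: it tends to 0 with t
    - s, at every frequency. *)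
Definition jump s t (h : H) : R :=
  ((1 - expR (- (2 * al * (t - s)) * `|xi h|)) * expR (- (al * s) * `|xi h|))%R.

Lemma jump_ge0 s t h : (s <= t)%R -> (0 <= jump s t h)%R.
Proof.
move=> st; rewrite mulr_ge0 ?expR_ge0// subr_ge0 expR_le1 mulNr oppr_le0.
by rewrite !mulr_ge0 ?subr_ge0 ?(ltW al0).
Qed.

Lemma jump_le1 s t h : (0 <= s)%R -> (jump s t h <= 1)%R.
Proof.
move=> s0; rewrite -[leRHS](mulr1 1%R); apply: le_trans (_ : (1 * expR (- (al * s) * `|xi h|) <= _)%R).
  by rewrite ler_wpM2r ?expR_ge0// gerBl expR_ge0.
by rewrite !mul1r expR_le1 mulNr oppr_le0 !mulr_ge0// ltW.
Qed.

Lemma measurable_jump s t : measurable_fun setT (jump s t).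
Proof. by rewrite /jump; hmeas. Qed.

Lemma jumpE s t f : (0 <= s)%R -> (s <= t)%R -> nnm f ->
  \int[dens (jump s t) M]_h f h = \int[M]_h ((jump s t h)%:E * f h).
Proof.
move=> s0 st; apply: densE_le1; first exact: measurable_jump.
by move=> h; rewrite jump_ge0// jump_le1.
Qed.

Lemma nnm_jump s t : (s <= t)%R -> nnm (fun h => (jump s t h)%:E).
Proof. by move=> st; apply: nnm_EFin => [|h]; [exact: measurable_jump|exact: jump_ge0]. Qed.

(** Between s and t the part transported from time s loses at most 1 -
    e^{-c(t-s)|xi|}, and the source adds at most as much; both are measured
    against M, which dominates the solution and the Duhamel integral. *)
Lemma near_mild s t : (0 <= s)%R -> (s <= t)%R -> near_by (p t) (p s) (dens (jump s t) M).
Proof.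
move=> s0 st f nf; have t0 := le_trans s0 st.
have f0 h : 0 <= f h by case: nf.
rewrite jumpE//; split.
  rewrite (mild_semigroup s0 st nf); apply: leeD.
    apply: le_nnm => //; first by apply: nnmM => //; exact: nnm_decay.
    move=> h; rewrite -[leRHS]mul1e; apply: lee_wpmul2r => //.
    by rewrite lee_fin decay_le1.
  apply: le_trans (duh_bound al0 gam0 (proj1 admissible_Tmp) (proj2 admissible_Tmp) s0 st nf) _.
  pose w (h : H) : R := ((1 - expR (- (al * (t - s)) * `|xi h|)) * expR (- (al * t) * `|xi h|))%R.
  have w0 h : (0 <= w h)%R.
    rewrite mulr_ge0 ?expR_ge0// subr_ge0 expR_le1 mulNr oppr_le0.
    by rewrite !mulr_ge0 ?subr_ge0 ?(ltW al0).
  have nw : nnm (fun h => (w h)%:E * f h).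
    by apply: nnmM => //; apply: nnm_EFin => //; rewrite /w; hmeas.
  apply: le_trans (_ : K%:E * \int[Tm M]_h ((w h)%:E * f h) <= _).
    rewrite -ge0_integralZl_EFin//; last 3 first.
    - by move=> h _; case: nw.
    - by case: nw.
    - by rewrite divr_ge0// ltW.
    rewrite le_eqVlt; apply/orP; left; apply/eqP; apply: eq_integral => h _.
    by rewrite muleA -EFinM /gain /w; congr (_%:E * _); rewrite mulrA.
  apply: le_trans (KTm_le nw) _; apply: le_nnm => //; first by apply: nnmM => //; exact: nnm_jump.
  move=> h; apply: lee_wpmul2r => //; rewrite lee_fin /w /jump.
  apply: ler_pM; rewrite ?expR_ge0//.
  - rewrite subr_ge0 expR_le1 mulNr oppr_le0.
    by rewrite !mulr_ge0 ?subr_ge0 ?(ltW al0).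
  - rewrite lerB// ler_expR ler_wpM2r// lerN2 -mulrA ler_peMl ?ler1n//.
    by rewrite mulr_ge0 ?subr_ge0 ?(ltW al0).
  - by rewrite ler_expR ler_wpM2r// lerN2 ler_wpM2l// ltW.
apply: (@le_trans _ _ (\int[p s]_h ((decay (t - s) h)%:E * f h) +
    \int[p s]_h ((1 - decay (t - s) h)%R%:E * f h))).
  have nd : nnm (fun h => (1 - decay (t - s) h)%R%:E * f h).
    apply: nnmM => //; apply: nnm_EFin; first by rewrite /decay; hmeas.
    by move=> h; rewrite subr_ge0 decay_le1.
  rewrite -ge0_integralD//.
  - apply: le_nnm => //; first by apply: nnmD => //; apply: nnmM => //; exact: nnm_decay.
    move=> h; rewrite -ge0_muleDl ?lee_fin ?subr_ge0 ?decay_le1 ?decay_ge0// -EFinD addrC subrK.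
    by rewrite mul1e.
  - by move=> h _; rewrite mule_ge0 ?lee_fin ?decay_ge0.
  - by have [] := nnmM (nnm_decay (t - s)) nf.
  - by move=> h _; case: nd.
  - by case: nd.
apply: leeD.
  rewrite (mild_semigroup s0 st nf) leeDl//; apply: nnm_integral; exact: nnm_duh.
have njf : nnm (fun h => (jump s t h)%:E * f h) by apply: nnmM => //; exact: nnm_jump.
have [_ /(_ s _ njf)] := ap; apply: le_trans.
rewrite le_eqVlt; apply/orP; left; apply/eqP; apply: eq_integral => h _.
rewrite muleA -EFinM; congr (_%:E * _); have ts : (0 <= t - s)%R by rewrite subr_ge0.
rewrite /wt /jump /decay (ger0_norm ts) (ger0_norm s0).
by rewrite mulrCA -expRD -mulrDl subrr mul0r expR0 mulr1.
Qed.

Section differentiability.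
Variables (t0 : R).
Hypothesis t00 : (0 < t0)%R.
Local Notation b := (al * t0 / 2)%R.
Local Notation c := (2 * al)%R.

Let b0 : (0 < b)%R. Proof. by rewrite divr_gt0// mulr_gt0. Qed.

(** Dominates the solution at all times after t0, with an exponential moment
    left to absorb |xi| and |xi|^2. *)
Definition envelope : fmH := dens (fun h => expR (- (al * t0) * `|xi h|)%R) M.
Local Notation P := envelope.

Let envelopeE f : nnm f ->
  \int[P]_h f h = \int[M]_h ((expR (- (al * t0) * `|xi h|))%:E * f h).
Proof.
move=> nf; apply: densE_le1 => //; first by hmeas.
move=> h; rewrite expR_ge0 expR_le1 mulNr oppr_le0.
by rewrite !mulr_ge0// ltW.
Qed.

Let nnm_exp (y : R) : nnm (fun h : H => (expR (y * `|xi h|))%:E).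
Proof. by apply: nnm_EFin => [|h]; [hmeas|exact: expR_ge0]. Qed.

Lemma mle_envelope r : (t0 <= r)%R -> mle (p r) P.
Proof.
move=> tr f nf; rewrite envelopeE//; have r0 : (0 <= r)%R by rewrite (le_trans _ tr)// ltW.
have [_ /(_ r _ (nnmM (nnm_exp (- (al * r))%R) nf)) h] := ap.
apply: le_trans (le_trans h _).
  rewrite le_eqVlt; apply/orP; left; apply/eqP; apply: eq_integral => x _.
  by rewrite muleA -EFinM /wt (ger0_norm r0) -expRD -mulrDl subrr mul0r expR0 mul1e.
apply: le_nnm; [exact: nnmM|exact: nnmM|] => x.
apply: lee_wpmul2r; first by case: nf.
by rewrite lee_fin ler_expR ler_wpM2r// lerN2 ler_wpM2l// ltW.
Qed.

Lemma wle_envelope : wle b P M.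
Proof.
move=> f nf; rewrite envelopeE; last by apply: nnmM => //; exact: nnm_wt.
apply: le_nnm => //; first by apply: nnmM => //; apply: nnmM => //; exact: nnm_wt.
move=> h; rewrite muleA -EFinM -[leRHS]mul1e; apply: lee_wpmul2r; first by case: nf.
rewrite lee_fin /wt -expRD -mulrDl expR_le1 mulr_le0_ge0//.
rewrite addrC subr_le0 ler_pdivrMr// ler_peMr ?ler1n// mulr_ge0// ltW//.
Qed.

Lemma mle_envelope_M : mle P M.
Proof. exact: wle_mle (ltW b0) wle_envelope. Qed.

Lemma envelope_tiny : tiny P.
Proof. exact: le_trans (mle_total mle_envelope_M) M_tiny. Qed.

Lemma wle_pr r : (t0 <= r)%R -> wle b (p r) M.
Proof.
move=> tr; have [_ /(_ r)] := ap; apply: wle_weaken.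
have r0 : (0 <= r)%R by rewrite (le_trans _ tr)// ltW.
rewrite (ger0_norm r0) ler_pdivrMr//; apply: (@le_trans _ _ (al * r)%R).
  by rewrite ler_wpM2l// ltW.
by rewrite ler_peMr ?ler1n// mulr_ge0// ltW.
Qed.

Lemma small_pr r : small (p r). Proof. exact: (admissible_small al0 r ap M_small). Qed.

Lemma wle_Tpr r : (t0 <= r)%R -> wle b (Tm (p r)) (Tm M).
Proof. by move=> tr; apply: wle_Tm (wle_pr tr); [exact: ltW|exact: small_pr|exact: M_small]. Qed.

Local Notation C1 := (c / b)%R.

Let C10 : (0 <= C1)%R. Proof. by rewrite divr_ge0 ?(ltW b0)// mulr_ge0// ltW. Qed.

Lemma wle_jump s t : (t0 <= s)%R -> (s <= t)%R ->
  wle b (dens (jump s t) M) (mscale (C1 * (t - s)) M).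
Proof.
move=> ts st f nf; have s0 : (0 <= s)%R by rewrite (le_trans _ ts)// ltW.
have st0 : (0 <= t - s)%R by rewrite subr_ge0.
have nw := nnmM (nnm_wt b) nf.
rewrite (jumpE s0 st nw) mscaleE//; last by rewrite mulr_ge0.
rewrite -ge0_integralZl_EFin//; last 3 first.
- by move=> h _; case: nf.
- by case: nf.
- by rewrite mulr_ge0.
apply: le_nnm; first by apply: nnmM => //; exact: nnm_jump.
  by apply: nnmM => //; apply: nnm_cst; rewrite lee_fin mulr_ge0.
move=> h; rewrite muleA -EFinM; apply: lee_wpmul2r; first by case: nf.
rewrite lee_fin /jump.
have /andP[x0 x1] := absxi_wt h b0.
have e1 : (1 - expR (- (c * (t - s)) * `|xi h|) <= c * (t - s) * `|xi h|)%R.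
  by rewrite lerBlDr -lerBlDl -mulNr expR_ge1Dx.
have e2 : (expR (- (al * s) * `|xi h|) * wt b h * wt b h <= 1)%R.
  rewrite /wt -!expRD expR_le1 -!mulrDl mulr_le0_ge0//.
  by rewrite -addrA -splitr addrC subr_le0 ler_wpM2l// ltW.
have ct : (0 <= c * (t - s))%R by rewrite !mulr_ge0// ltW.
have E0 := expR_ge0 (- (al * s) * `|xi h|)%R; have W0 := wt_ge0 b h.
move: x0 x1 e1 e2 E0 W0 ct; rewrite -/(absxi h).
move: (absxi h) (wt b h) (expR (- (al * s) * absxi h)) (1 - _)%R => X W E1 A X0 XW AX EW E0 W0 ct.
apply: (@le_trans _ _ (c * (t - s) * (b^-1 * W) * (E1 * W))%R).
  rewrite -[leLHS]mulrA; apply: ler_wpM2r; first exact: mulr_ge0.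
  by apply: le_trans AX _; exact: ler_wpM2l.
rewrite (_ : _ * _ = C1 * (t - s) * (E1 * W * W))%R; last by ring.
by rewrite ler_piMr// mulr_ge0.
Qed.

Definition drift s t : fmH := Em P (dens (jump s t) M).

Lemma wle_drift s t : (t0 <= s)%R -> (s <= t)%R ->
  wle b (drift s t) (Em M (mscale (C1 * (t - s)) M)).
Proof.
move=> ts st.
exact: (wle_Em kap (ltW b0) wle_envelope (wle_jump ts st) envelope_tiny M_tiny).
Qed.

Let a0 : (0 <= a)%R. Proof. by rewrite -lee_fin (le_trans _ Ma). Qed.

Lemma drift_envelope_total h : (0 <= h)%R ->
  Em M (mscale (C1 * h) M) setT <= (16 * a ^+ 2 * (C1 * h * a))%:E.
Proof.
move=> h0; apply: Em_total => //.
by rewrite (mscale_total M (mulr_ge0 C10 h0)) [leRHS]EFinM lee_wpmul2l// lee_fin mulr_ge0.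
Qed.

Lemma near_drift s r t : (t0 <= s)%R -> (s <= r)%R -> (r <= t)%R ->
  near_by (Tm (p r)) (Tm (p s)) (drift s t).
Proof.
move=> ts sr rt; have s0 : (0 <= s)%R by rewrite (le_trans _ ts)// ltW.
have st := le_trans sr rt.
apply: near_Tm envelope_tiny; last 2 first.
- exact: mle_envelope (le_trans ts sr).
- exact: mle_envelope.
have nm := near_mild s0 sr.
refine (near_mle nm _).
move=> f nf.
rewrite [leLHS](jumpE s0 sr nf).
rewrite [leRHS](jumpE s0 st nf).
apply: le_weight => //; [exact: measurable_jump|exact: measurable_jump|by move=> h; exact: jump_ge0|].
move=> h; rewrite /jump ler_wpM2r ?expR_ge0// lerB// ler_expR ler_wpM2r// lerN2 ler_wpM2l ?mulr_ge0 ?(ltW al0)//.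
by rewrite lerB.
Qed.

Definition speed r : fmH := dens absxi (p r).
Definition force r : fmH := dens absxi (Tm (p r)).
Definition remainder s t : fmH :=
  madd (mscale ((c * (t - s)) ^+ 2) (dens absxi2 (p s)))
    (madd (mscale (gam * (t - s)) (dens absxi (drift s t)))
          (mscale (gam * (t - s) * (c * (t - s))) (dens absxi2 (Tm P)))).

Let ib0 : (0 <= b^-1)%R. Proof. by rewrite invr_ge0 ltW. Qed.
Let ib20 : (0 <= (2 / b) ^+ 2)%R. Proof. exact: sqr_ge0. Qed.
Let c0 : (0 <= c)%R. Proof. by rewrite mulr_ge0// ltW. Qed.

Lemma wle_Tenvelope : wle b (Tm P) (Tm M).
Proof. exact: (wle_Tm kap (ltW b0) (tiny_small envelope_tiny) M_small wle_envelope). Qed.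

Let speedE r f : (t0 <= r)%R -> nnm f -> \int[speed r]_h f h = \int[p r]_h ((absxi h)%:E * f h).
Proof. by move=> tr; exact: (densE_wt (wle_pr tr) (@measurable_absxi R) ib0 (fun h => absxi_wt h b0)). Qed.
Let forceE r f : (t0 <= r)%R -> nnm f -> \int[force r]_h f h = \int[Tm (p r)]_h ((absxi h)%:E * f h).
Proof. by move=> tr; exact: (densE_wt (wle_Tpr tr) (@measurable_absxi R) ib0 (fun h => absxi_wt h b0)). Qed.
Let drift1E s t f : (t0 <= s)%R -> (s <= t)%R -> nnm f ->
  \int[dens absxi (drift s t)]_h f h = \int[drift s t]_h ((absxi h)%:E * f h).
Proof. by move=> ts st; exact: (densE_wt (wle_drift ts st) (@measurable_absxi R) ib0 (fun h => absxi_wt h b0)). Qed.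
Let speed2E r f : (t0 <= r)%R -> nnm f ->
  \int[dens absxi2 (p r)]_h f h = \int[p r]_h ((absxi2 h)%:E * f h).
Proof. by move=> tr; exact: (densE_wt (wle_pr tr) (@measurable_absxi2 R) ib20 (fun h => absxi2_wt h b0)). Qed.
Let envelope2E f : nnm f ->
  \int[dens absxi2 (Tm P)]_h f h = \int[Tm P]_h ((absxi2 h)%:E * f h).
Proof. exact: (densE_wt wle_Tenvelope (@measurable_absxi2 R) ib20 (fun h => absxi2_wt h b0)). Qed.

Let absxi0 (h : H) : (0 <= absxi h)%R. Proof. exact: normr_ge0. Qed.
Let absxi20 (h : H) : (0 <= absxi2 h)%R. Proof. exact: sqr_ge0. Qed.
Let mabsxi := @measurable_absxi R.
Let mabsxi2 := @measurable_absxi2 R.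
Let mdecay t : measurable_fun setT (decay t). Proof. exact: measurable_decay. Qed.

Let duh_upper s t f : (t0 <= s)%R -> (s <= t)%R -> nnm f ->
  \int[lebr `[s, t]]_r \int[Tm (p r)]_h ((propag t (r, h))%:E * f h) <=
  (gam * (t - s))%:E * \int[Tm (p s)]_h ((absxi h)%:E * f h) +
  (gam * (t - s))%:E * \int[drift s t]_h ((absxi h)%:E * f h).
Proof.
move=> ts st nf; have n1 := nnm_weight mabsxi absxi0 nf.
have I0 (q : fmH) : 0 <= \int[q]_h ((absxi h)%:E * f h) by exact: nnm_integral.
set B := \int[Tm (p s)]_h _; set D := \int[drift s t]_h _.
have BD : 0 <= gam%:E * (B + D) by rewrite mule_ge0 ?lee_fin// adde_ge0// I0.
apply: (@le_trans _ _ (\int[lebr `[s, t]]_r (gam%:E * (B + D)))); last first.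
  rewrite lebr_cst// -ge0_muleDr ?I0//.
  by rewrite muleAC EFinM.
apply: le_lebr; [exact: nnm_duh|exact: nnm_cst|] => r.
rewrite in_itv/= => /andP[sr rt].
apply: (@le_trans _ _ (gam%:E * \int[Tm (p r)]_h ((absxi h)%:E * f h))); last first.
  by apply: lee_wpmul2l; [rewrite lee_fin|have [] := near_drift ts sr rt n1].
rewrite -ge0_integralZl_EFin//; last 2 first.
- by move=> h _; case: n1.
- by case: n1.
under [leRHS]eq_integral do rewrite muleA -EFinM.
apply: le_weight => //.
- have h := nnm_sec r (nnm_propag al gam0 t); have [/measurable_EFinP] := h; exact.
- by apply: measurable_funM.
- by move=> h; exact: propag_ge0.
- by move=> h; rewrite /propag /= ler_piMr ?mulr_ge0// decay_le1.
Qed.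

Let duh_lower s t f : (t0 <= s)%R -> (s <= t)%R -> nnm f ->
  (gam * (t - s))%:E * \int[Tm (p s)]_h ((absxi h)%:E * f h) <=
  \int[lebr `[s, t]]_r \int[Tm (p r)]_h ((propag t (r, h))%:E * f h) +
  ((gam * (t - s))%:E * \int[drift s t]_h ((absxi h)%:E * f h) +
   (gam * (t - s) * (c * (t - s)))%:E * \int[Tm P]_h ((absxi2 h)%:E * f h)).
Proof.
move=> ts st nf; have n1 := nnm_weight mabsxi absxi0 nf.
have n2 := nnm_weight mabsxi2 absxi20 nf.
have st0 : (0 <= t - s)%R by rewrite subr_ge0.
have I0 (q : fmH) : 0 <= \int[q]_h ((absxi h)%:E * f h) by exact: nnm_integral.
have I20 (q : fmH) : 0 <= \int[q]_h ((absxi2 h)%:E * f h) by exact: nnm_integral.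
set B := \int[Tm (p s)]_h _; set D := \int[drift s t]_h _; set E := \int[Tm P]_h _.
pose k : \bar R := gam%:E * D + (gam * (c * (t - s)))%:E * E.
have gc0 : (0 <= gam * (c * (t - s)))%R by rewrite mulr_ge0// mulr_ge0.
have D0 : 0 <= D by exact: I0.
have E0 : 0 <= E by exact: I20.
have k0 : 0 <= k by rewrite /k adde_ge0// mule_ge0// lee_fin.
have -> : (gam * (t - s))%:E * B = \int[lebr `[s, t]]_r (gam%:E * B).
  by rewrite lebr_cst ?mule_ge0 ?lee_fin ?I0// EFinM muleAC.
have -> : (gam * (t - s))%:E * D + (gam * (t - s) * (c * (t - s)))%:E * E = \int[lebr `[s, t]]_r k.
  rewrite lebr_cst// ge0_muleDl ?mule_ge0 ?lee_fin//.
  rewrite EFinM [X in _ = X + _]muleAC; congr (_ + _).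
  by rewrite muleAC -EFinM mulrAC.
have nd := nnm_duh t nf; have nk := nnm_cst R k0.
have -> : \int[lebr `[s, t]]_r \int[Tm (p r)]_h ((propag t (r, h))%:E * f h) + \int[lebr `[s, t]]_r k =
    \int[lebr `[s, t]]_r (\int[Tm (p r)]_h ((propag t (r, h))%:E * f h) + k).
  by rewrite [RHS]ge0_integralD//; [move=> r _; case: nd|case: nd].
apply: le_lebr; [by apply: nnm_cst; rewrite mule_ge0 ?lee_fin ?I0|exact: nnmD|] => r.
rewrite in_itv/= => /andP[sr rt].
have sr0 : (0 <= t - r)%R by rewrite subr_ge0.
apply: (@le_trans _ _ (gam%:E * \int[Tm (p r)]_h ((absxi h)%:E * f h) + gam%:E * D)).
  rewrite -ge0_muleDr ?I0//; apply: lee_wpmul2l; first by rewrite lee_fin.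
  by have [] := near_drift ts sr rt n1.
rewrite /k addeCA addeC; apply: leeD => //.
have mp : measurable_fun setT (fun h => propag t (r, h)).
  have h := nnm_sec r (nnm_propag al gam0 t); have [/measurable_EFinP] := h; exact.
apply: (@le_trans _ _ (\int[Tm (p r)]_h ((propag t (r, h))%:E * f h) +
    (gam * (c * (t - s)))%:E * \int[Tm (p r)]_h ((absxi2 h)%:E * f h))).
  rewrite -weightD//; last by move=> h; exact: propag_ge0.
  rewrite -ge0_integralZl_EFin//; last 2 first.
  - by move=> h _; case: n1.
  - by case: n1.
  under [leLHS]eq_integral do rewrite muleA -EFinM.
  apply: le_weight => //.
  - by apply: measurable_funM.
  - by apply: measurable_funD => //; apply: measurable_funM.
  - by move=> h; rewrite mulr_ge0.
  move=> h; rewrite /propag /= -/(absxi h) -!mulrA -mulrDr; apply: ler_wpM2l => //.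
  have h1 : (1 <= decay (t - r) h + c * (t - s) * absxi h)%R.
    rewrite /decay (ger0_norm sr0) -/(absxi h) mulNr.
    have [h1 _] := expRN_quadratic (mulr_ge0 (mulr_ge0 c0 sr0) (absxi0 h)).
    by apply: le_trans h1 _; rewrite lerD2l ler_wpM2r// ler_wpM2l// lerB.
  have := ler_wpM2l (absxi0 h) h1; rewrite mulr1 mulrDr => h2; apply: le_trans h2 _.
  by rewrite lerD2l /absxi2 le_eqVlt; apply/orP; left; apply/eqP; ring.
apply: leeD => //; apply: lee_wpmul2l; first by rewrite lee_fin mulr_ge0// mulr_ge0.
by apply: (mle_Tm kap (small_pr r) (tiny_small envelope_tiny) (mle_envelope (le_trans ts sr))).
Qed.

(** Second-order expansion of Duhamel's formula on a short interval: the
    exponential is replaced by 1 - c(t-s)|xi| and the source by its value at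
    time s. *)
Lemma near_quadratic s t : (t0 <= s)%R -> (s <= t)%R ->
  near_by (madd (p t) (mscale (c * (t - s)) (speed s)))
          (madd (p s) (mscale (gam * (t - s)) (force s))) (remainder s t).
Proof.
move=> ts st f nf; have s0 : (0 <= s)%R by rewrite (le_trans _ ts)// ltW.
have st0 : (0 <= t - s)%R by rewrite subr_ge0.
have ct0 : (0 <= c * (t - s))%R by rewrite mulr_ge0.
have gt0 : (0 <= gam * (t - s))%R by rewrite mulr_ge0.
have ct20 : (0 <= (c * (t - s)) ^+ 2)%R by rewrite sqr_ge0.
have gct0 : (0 <= gam * (t - s) * (c * (t - s)))%R by rewrite mulr_ge0.
rewrite /remainder.
rewrite (maddE (p t) _ nf).
rewrite (maddE (p s) _ nf).
rewrite (maddE _ (madd _ _) nf).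
rewrite (maddE (mscale _ (dens absxi _)) _ nf).
rewrite (mscaleE (speed s) ct0 nf).
rewrite (mscaleE (force s) gt0 nf).
rewrite (mscaleE _ ct20 nf).
rewrite (mscaleE _ gt0 nf).
rewrite (mscaleE _ gct0 nf).
rewrite (speedE ts nf).
rewrite (forceE ts nf) (speed2E ts nf).
rewrite (drift1E ts st nf) (envelope2E nf).
rewrite (mild_semigroup s0 st nf) addeAC -weightD//; last by move=> h; exact: decay_ge0.
have U := duh_upper ts st nf; have L := duh_lower ts st nf.
have zz (z : R) := @expRN_quadratic R z.
have wE (h : H) : (1 <= decay (t - s) h + c * (t - s) * absxi h)%R /\
   (decay (t - s) h + c * (t - s) * absxi h <= 1 + (c * (t - s)) ^+ 2 * absxi2 h)%R.
  rewrite /decay (ger0_norm st0) mulNr -/(absxi h) /absxi2 -exprMn; apply: zz.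
  by rewrite mulr_ge0.
have m1 : measurable_fun setT (fun h : H => decay (t - s) h + c * (t - s) * absxi h)%R.
  by apply: measurable_funD => //; apply: measurable_funM.
have e1 (q : fmH) : \int[q]_h f h = \int[q]_h (1%R%:E * f h).
  by apply: eq_integral => h _; rewrite mul1e.
split.
  apply: (@le_trans _ _ ((\int[p s]_h f h + ((c * (t - s)) ^+ 2)%:E * \int[p s]_h ((absxi2 h)%:E * f h)) +
    ((gam * (t - s))%:E * \int[Tm (p s)]_h ((absxi h)%:E * f h) +
     (gam * (t - s))%:E * \int[drift s t]_h ((absxi h)%:E * f h)))).
    apply: leeD => //; rewrite e1 -weightD//; apply: le_weight => //.
    - by apply: measurable_funD => //; apply: measurable_funM.
    - by move=> h; rewrite addr_ge0 ?decay_ge0// mulr_ge0.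
    - by move=> h; case: (wE h).
  rewrite addeACA leeD2l// leeD2l// leeDl// mule_ge0 ?lee_fin//.
  by apply: nnm_integral; exact: nnm_weight.
rewrite -addeA; apply: leeD.
  rewrite e1; apply: le_weight => // h; by case: (wE h).
apply: le_trans L _; rewrite leeD2l// leeDr// mule_ge0 ?lee_fin//.
by apply: nnm_integral; exact: nnm_weight.
Qed.

Local Notation Cd := (b^-1 * (16 * a ^+ 2 * (C1 * a)))%R.
Local Notation Cs := (b^-1 * (C1 * a))%R.
Local Notation Cr := (c ^+ 2 * ((2 / b) ^+ 2 * a) + gam * Cd + gam * c * ((2 / b) ^+ 2 * (4 * a ^+ 3)))%R.

Let drift1_total s t : (t0 <= s)%R -> (s <= t)%R ->
  dens absxi (drift s t) setT <= (Cd * (t - s))%:E.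
Proof.
move=> ts st; have st0 : (0 <= t - s)%R by rewrite subr_ge0.
apply: le_trans (dens_wt_total (wle_drift ts st) mabsxi ib0 (fun h => absxi_wt h b0)) _.
apply: le_trans (lee_wpmul2l _ (drift_envelope_total st0)) _; first by rewrite lee_fin.
by rewrite -EFinM lee_fin le_eqVlt; apply/orP; left; apply/eqP; ring.
Qed.

Let remainder_total s t : (t0 <= s)%R -> (s <= t)%R ->
  remainder s t setT <= (Cr * (t - s) ^+ 2)%:E.
Proof.
move=> ts st; have st0 : (0 <= t - s)%R by rewrite subr_ge0.
have gt0 : (0 <= gam * (t - s))%R by rewrite mulr_ge0.
have ct20 : (0 <= (c * (t - s)) ^+ 2)%R by rewrite sqr_ge0.
have gct0 : (0 <= gam * (t - s) * (c * (t - s)))%R := mulr_ge0 gt0 (mulr_ge0 c0 st0).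
rewrite /remainder !madd_total (mscale_total _ ct20) (mscale_total _ gt0) (mscale_total _ gct0).
have h1 := le_trans (dens_wt_total (wle_pr ts) mabsxi2 ib20 (fun h => absxi2_wt h b0))
   (lee_wpmul2l (_ : 0 <= ((2 / b) ^+ 2)%:E) Ma).
have h2 := drift1_total ts st.
have h3 := le_trans (dens_wt_total wle_Tenvelope mabsxi2 ib20 (fun h => absxi2_wt h b0))
   (lee_wpmul2l (_ : 0 <= ((2 / b) ^+ 2)%:E) (Tm_total kap (_ : (a <= 2^-1)%R) Ma)).
have a2 : (a <= 2^-1)%R by apply: le_trans a4 _; rewrite lef_pV2 ?posrE// ler_nat.
have {}h1 := h1 ib20; have {}h3 := h3 ib20 a2.
rewrite (_ : (Cr * (t - s) ^+ 2)%:E = ((c * (t - s)) ^+ 2)%:E * ((2 / b) ^+ 2 * a)%:E +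
  ((gam * (t - s))%:E * (Cd * (t - s))%:E +
   (gam * (t - s) * (c * (t - s)))%:E * ((2 / b) ^+ 2 * (4 * a ^+ 3))%:E)); last first.
  by rewrite -!EFinM -!EFinD; congr (_%:E); ring.
by apply: leeD; [|apply: leeD]; apply: lee_wpmul2l; rewrite ?lee_fin// EFinM.
Qed.

Variables (phi : H -> R).
Hypotheses (bphi : bm phi) (phi1 : forall h, (`|phi h| <= 1)%R).

Definition rate r : R := (gam * RI (force r) phi - c * RI (speed r) phi)%R.

Let taylor s t : (t0 <= s)%R -> (s <= t)%R ->
  (`|RI (p t) phi - RI (p s) phi - (t - s) * rate s| <= Cr * (t - s) ^+ 2)%R.
Proof.
move=> ts st; have st0 : (0 <= t - s)%R by rewrite subr_ge0.
have := near_RI_mass (near_quadratic ts st) bphi phi1 (remainder_total ts st).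
rewrite !RI_madd// !RI_mscale//; [|by rewrite mulr_ge0|by rewrite mulr_ge0].
congr (_ <= _)%R; congr (`|_|)%R; rewrite /rate; ring.
Qed.

Let rate_lip s t : (t0 <= s)%R -> (s <= t)%R ->
  (`|rate t - rate s| <= (gam * Cd + c * Cs) * (t - s))%R.
Proof.
move=> ts st; have st0 : (0 <= t - s)%R by rewrite subr_ge0.
have s0 : (0 <= s)%R by rewrite (le_trans _ ts)// ltW.
have tt := le_trans ts st.
have ns := near_dens_wt (wle_pr tt) (wle_pr ts) (wle_jump ts st) mabsxi ib0
  (fun h => absxi_wt h b0) (near_mild s0 st).
have nf := near_dens_wt (wle_Tpr tt) (wle_Tpr ts) (wle_drift ts st) mabsxi ib0
  (fun h => absxi_wt h b0) (near_drift ts st (lexx t)).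
have js : dens absxi (dens (jump s t) M) setT <= (Cs * (t - s))%:E.
  apply: le_trans (dens_wt_total (wle_jump ts st) mabsxi ib0 (fun h => absxi_wt h b0)) _.
  have k0 : (0 <= C1 * (t - s))%R by rewrite mulr_ge0.
  rewrite (mscale_total M k0) (_ : (Cs * (t - s))%:E = (b^-1)%:E * ((C1 * (t - s))%:E * a%:E)).
    by apply: lee_wpmul2l; rewrite ?lee_fin//; apply: lee_wpmul2l; rewrite ?lee_fin.
  by rewrite -!EFinM; congr (_%:E); ring.
have h1 := near_RI_mass ns bphi phi1 js.
have h2 := near_RI_mass nf bphi phi1 (drift1_total ts st).
rewrite /rate (_ : _ - _ - _ = gam * (RI (force t) phi - RI (force s) phi) -
   c * (RI (speed t) phi - RI (speed s) phi))%R; last by ring.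
apply: le_trans (ler_normB _ _) _; rewrite [leRHS]mulrDl.
apply: lerD; rewrite normrM.
  by rewrite (ger0_norm gam0) -[leRHS]mulrA; exact: ler_wpM2l.
by rewrite (ger0_norm c0) -[leRHS](mulrA c); exact: ler_wpM2l.
Qed.

Lemma is_derive_mild_after t : (t0 < t)%R -> is_derive t 1%R (fun t => RI (p t) phi) (rate t).
Proof.
move=> tt.
apply: (@is_derive_quadratic R _ t (rate t) (Cr + (gam * Cd + c * Cs)) (t - t0)); first by rewrite subr_gt0.
move=> s; rewrite ltr_norml => /andP[s1 s2].
have s0 : (t0 <= s)%R by move: s1; rewrite opprB ltrBlDr subrK => /ltW.
have dC : (0 <= gam * Cd + c * Cs)%R.
  have Cs0 : (0 <= Cs)%R := mulr_ge0 ib0 (mulr_ge0 C10 a0).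
  have Cd0 : (0 <= Cd)%R.
    by rewrite (mulr_ge0 ib0)// (mulr_ge0 _ (mulr_ge0 C10 a0))// mulr_ge0// sqr_ge0.
  by rewrite (addr_ge0 (mulr_ge0 gam0 Cd0) (mulr_ge0 c0 Cs0)).
have [st|ts] := leP t s.
  apply: le_trans (taylor (ltW tt) st) _; rewrite ler_wpM2r ?sqr_ge0//.
  by rewrite lerDl.
have h1 := taylor s0 (ltW ts); have h2 := rate_lip s0 (ltW ts).
have st0 : (0 <= t - s)%R by rewrite subr_ge0 ltW.
rewrite (_ : _ - _ - _ = (t - s) * (rate t - rate s) - (RI (p t) phi - RI (p s) phi - (t - s) * rate s))%R; last by ring.
apply: le_trans (ler_normB _ _) _; rewrite addrC -[(s - t)%R]opprB sqrrN [leRHS]mulrDl; apply: lerD => //.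
rewrite normrM (ger0_norm st0) mulrC [X in (_ <= _ * X)%R]expr2 [leRHS]mulrA; exact: ler_wpM2r.
Qed.

End differentiability.

(** A positive time t lies after t0 = t/2, where all moments are available. *)
Lemma is_derive_mild (phi : H -> R) (t : R) : bm phi -> (forall h, `|phi h| <= 1)%R -> (0 < t)%R ->
  is_derive t 1%R (fun t => RI (p t) phi)
    (gam * RI (dens absxi (Tm (p t))) phi - 2 * al * RI (dens absxi (p t)) phi)%R.
Proof.
move=> bphi phi1 t0; have t20 : (0 < t / 2)%R by rewrite divr_gt0.
by apply: (is_derive_mild_after t20 bphi phi1); rewrite ltr_pdivrMr// ltr_pMr// ltr1n.
Qed.

End mild_regularity.

(** * Charges as differences of measures *)

HB.lock Definition pvar (R : realType) d (T : measurableType d) (nu : {charge set T -> \bar R}) :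
    {finite_measure set T -> \bar R} :=
  mk (fun f => \int[positive_variation nu]_x f x)%E.
HB.lock Definition nvar (R : realType) d (T : measurableType d) (nu : {charge set T -> \bar R}) :
    {finite_measure set T -> \bar R} :=
  mk (fun f => \int[negative_variation nu]_x f x)%E.
HB.lock Definition mcharge (R : realType) d (T : measurableType d) (m n : {finite_measure set T -> \bar R}) :
    {charge set T -> \bar R} :=
  cadd (charge_of_finite_measure m) (copp (charge_of_finite_measure n)).

Section charges.
Local Open Scope ereal_scope.
Context (R : realType) d (T : measurableType d).
Implicit Types (nu : {charge set T -> \bar R}) (m n : {finite_measure set T -> \bar R}).

Lemma measureE m A : measurable A -> m A = \int[m]_x (\1_A x)%:E.
Proof. by move=> mA; rewrite integral_indic// setIT. Qed.

Lemma mchargeE m n A : measurable A -> mcharge m n A = m A - n A.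
Proof. by move=> mA; rewrite mcharge.unlock. Qed.

Lemma jordan_pos_set nu P N (h : hahn_decomposition nu P N) A : measurable A ->
  jordan_pos h A = nu (A `&` P).
Proof. by move=> mA; rewrite jordan_posE cjordan_posE /crestr0 mem_set. Qed.

Lemma jordan_neg_set nu P N (h : hahn_decomposition nu P N) A : measurable A ->
  jordan_neg h A = - nu (A `&` N).
Proof. by move=> mA; rewrite jordan_negE cjordan_negE /crestr0 mem_set. Qed.

Lemma positive_variation_set nu : exists2 P, measurable P &
  forall A, measurable A -> positive_variation nu A = nu (A `&` P).
Proof.
rewrite /positive_variation.
case: (cid _) => P hP; case: (cid _) => N hN /=.
exists P; first by have [[] ] := hN.
by move=> A mA; exact: jordan_pos_set.
Qed.

Lemma negative_variation_set nu : exists2 N, measurable N &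
  forall A, measurable A -> negative_variation nu A = - nu (A `&` N).
Proof.
rewrite /negative_variation.
case: (cid _) => P hP; case: (cid _) => N hN /=.
exists N; first by have [_ [] ] := hN.
by move=> A mA; exact: jordan_neg_set.
Qed.

Lemma variation_sub nu A : measurable A -> nu A = positive_variation nu A - negative_variation nu A.
Proof.
move=> mA; rewrite /positive_variation /negative_variation.
case: (cid _) => P hP; case: (cid _) => N hN /=.
by rewrite (jordan_decomp hN mA) /cadd/= cscaleN1.
Qed.

Lemma pvarE nu f : nnm f -> \int[pvar nu]_x f x = \int[positive_variation nu]_x f x.
Proof.
rewrite pvar.unlock; apply: mkE; first exact: posfun_integral.
have [P mP h] := positive_variation_set nu.
by rewrite integral1 h// setTI ltey_eq fin_num_measure.
Qed.

Lemma nvarE nu f : nnm f -> \int[nvar nu]_x f x = \int[negative_variation nu]_x f x.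
Proof.
rewrite nvar.unlock; apply: mkE; first exact: posfun_integral.
have [P mP h] := negative_variation_set nu.
rewrite integral1 h// setTI ltey_eq fin_numN fin_num_measure//.
Qed.

Lemma pvar_set nu A : measurable A -> pvar nu A = positive_variation nu A.
Proof. by move=> mA; rewrite measureE// pvarE ?integral_indic ?setIT//; exact: nnm_indic. Qed.

Lemma nvar_set nu A : measurable A -> nvar nu A = negative_variation nu A.
Proof. by move=> mA; rewrite measureE// nvarE ?integral_indic ?setIT//; exact: nnm_indic. Qed.

Lemma pvar_nvar nu A : measurable A -> nu A = pvar nu A - nvar nu A.
Proof. by move=> mA; rewrite pvar_set// nvar_set// -variation_sub. Qed.

Lemma fin_meas m A : measurable A -> m A \is a fin_num.
Proof. exact: fin_num_measure. Qed.

Lemma mleP m n : (forall A, measurable A -> m A <= n A) -> mle m n.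
Proof. by move=> h f nf; apply: mle_set. Qed.

Lemma pvar_le nu m : (forall A, measurable A -> nu A <= m A) -> mle (pvar nu) m.
Proof.
move=> num; apply: mleP => A mA; rewrite pvar_set//.
have [P mP ->//] := positive_variation_set nu.
apply: le_trans (num _ (measurableI _ _ mA mP)) _.
by apply: le_measure; rewrite ?inE//; exact: measurableI.
Qed.

Lemma nvar_le nu m : (forall A, measurable A -> - nu A <= m A) -> mle (nvar nu) m.
Proof.
move=> num; apply: mleP => A mA; rewrite nvar_set//.
have [P mP ->//] := negative_variation_set nu.
apply: le_trans (num _ (measurableI _ _ mA mP)) _.
by apply: le_measure; rewrite ?inE//; exact: measurableI.
Qed.

Lemma eq_meas_integral m n f : (forall A, measurable A -> m A = n A) -> nnm f ->
  \int[m]_x f x = \int[n]_x f x.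
Proof.
move=> mn nf; apply/eqP; rewrite eq_le.
by apply/andP; split; apply: mleP => // A mA; rewrite mn.
Qed.

Lemma madd_set m n A : measurable A -> madd m n A = m A + n A.
Proof. by move=> mA; rewrite !measureE// maddE//; exact: nnm_indic. Qed.

(** Two ways of writing a charge as a difference of finite measures give the
    same integrals; the cross-multiplied form makes sense for unbounded
    functions as well. *)
Lemma charge_cross nu m n f : (forall A, measurable A -> nu A = m A - n A) -> nnm f ->
  \int[pvar nu]_x f x + \int[n]_x f x = \int[nvar nu]_x f x + \int[m]_x f x.
Proof.
move=> h nf; rewrite -!maddE//; apply: eq_meas_integral => // A mA.
rewrite !madd_set//; have := pvar_nvar nu mA; rewrite h//.
have := fin_meas m mA; have := fin_meas n mA; have := fin_meas (pvar nu) mA.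
have := fin_meas (nvar nu) mA.
move: (m A) (n A) (pvar nu A) (nvar nu A) => [a||] [b||] [c||] [e||] //= _ _ _ _ [] q.
by rewrite -!EFinD; congr (_%:E); move: q; lra.
Qed.

Lemma pvar_mle nu m n : (forall A, measurable A -> nu A = m A - n A) -> mle (pvar nu) m.
Proof. by move=> h; apply: pvar_le => A mA; rewrite h// leeBlDr ?fin_meas// leeDl. Qed.

Lemma nvar_mle nu m n : (forall A, measurable A -> nu A = m A - n A) -> mle (nvar nu) n.
Proof.
move=> h; apply: nvar_le => A mA; rewrite h// fin_num_oppeB ?fin_meas//.
by rewrite addeC leeBlDr ?fin_meas// leeDl.
Qed.

Lemma charge_integral_bm nu m n g : (forall A, measurable A -> nu A = m A - n A) -> bm g ->
  charge_integral nu setT g = (RI m g - RI n g)%R.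
Proof.
move=> h bg.
have -> : charge_integral nu setT g = (RI (pvar nu) g - RI (nvar nu) g)%R.
  rewrite /charge_integral; congr (_ - _)%R.
    apply/esym; apply: (@RI_shift _ _ _ _ (fun g => \int[positive_variation nu]_x g x)%R) bg => [k bk k0|k c bk].
      by apply: EFin_inj; rewrite RI_E// pvarE; [|exact: nnm_bm]; rewrite /Rintegral -pvarE; [rewrite -RI_E|exact: nnm_bm].
    have ib (k' : T -> R) : bm k' -> (positive_variation nu).-integrable setT (EFin \o k').
      move=> [mk [C hC]]; apply: measurable_bounded_integrable => //.
        by have [P mP ->] := positive_variation_set nu; rewrite // setTI ltey_eq fin_num_measure.
      exists C; split; first by rewrite num_real.
      by move=> y Cy x _; apply: le_trans (hC x) (ltW Cy).
    by rewrite RintegralD//; apply: ib => //; exact: bm_cst.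
  apply/esym; apply: (@RI_shift _ _ _ _ (fun g => \int[negative_variation nu]_x g x)%R) bg => [k bk k0|k c bk].
    by apply: EFin_inj; rewrite RI_E// nvarE; [|exact: nnm_bm]; rewrite /Rintegral -nvarE; [rewrite -RI_E|exact: nnm_bm].
  have ib (k' : T -> R) : bm k' -> (negative_variation nu).-integrable setT (EFin \o k').
    move=> [mk [C hC]]; apply: measurable_bounded_integrable => //.
      by have [P mP ->] := negative_variation_set nu; rewrite // setTI ltey_eq fin_numN fin_num_measure.
    exists C; split; first by rewrite num_real.
    by move=> y Cy x _; apply: le_trans (hC x) (ltW Cy).
  by rewrite RintegralD//; apply: ib => //; exact: bm_cst.
have key k : bm k -> RI (madd (pvar nu) n) k = RI (madd (nvar nu) m) k.
  apply: (@RI_shift _ _ _ _ (fun k => RI (madd (nvar nu) m) k)) => [l bl l0|l c bl].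
    by apply: EFin_inj; rewrite !RI_E// !maddE ?(charge_cross h)//; exact: nnm_bm.
  by rewrite RID//; exact: bm_cst.
by have := key g bg; rewrite !RI_madd//; lra.
Qed.

(** Finiteness of both integrals excludes the difference of two infinities. *)
Lemma charge_integral_ge0 nu m n (g : T -> R) A : (forall A, measurable A -> nu A = m A - n A) ->
  measurable A -> measurable_fun setT g -> (forall x, 0 <= g x)%R ->
  \int[m]_x (g x)%:E < +oo -> \int[n]_x (g x)%:E < +oo ->
  (charge_integral nu A g)%:E = \int[m]_(x in A) (g x)%:E - \int[n]_(x in A) (g x)%:E.
Proof.
move=> h mA mg g0 mfin nfin.
pose k x := (\1_A x)%:E * (g x)%:E.
have nk : nnm k by apply: nnmM; [exact: nnm_indic|exact: nnm_EFin].
have ng : nnm (fun x => (g x)%:E) by exact: nnm_EFin.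
have kE (mu : {measure set T -> \bar R}) : \int[mu]_(x in A) (g x)%:E = \int[mu]_x k x.
  rewrite integral_mkcond; apply: eq_integral => x _; rewrite patchE /k indicE.
  by case: (x \in A); rewrite ?mul1e ?mul0e.
have kg x : k x <= (g x)%:E.
  by rewrite /k indicE; case: (x \in A); rewrite ?mul1e ?mul0e// lee_fin.
have fin (q : {finite_measure set T -> \bar R}) : \int[q]_x (g x)%:E < +oo -> \int[q]_x k x \is a fin_num.
  move=> qf; rewrite ge0_fin_numE; last exact: nnm_integral.
  by apply: le_lt_trans qf; apply: le_nnm.
have pfin : \int[pvar nu]_x k x \is a fin_num.
  by apply: fin; apply: le_lt_trans mfin; exact: (pvar_mle h).
have qfin : \int[nvar nu]_x k x \is a fin_num.
  by apply: fin; apply: le_lt_trans nfin; exact: (nvar_mle h).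
rewrite /charge_integral /Rintegral !kE -pvarE// -nvarE//.
rewrite EFinB !fineK//.
have := charge_cross h nk; have := fin m mfin; have := fin n nfin; move: pfin qfin.
case: (\int[m]_x k x) => [a||] //; case: (\int[n]_x k x) => [b||] //.
case: (\int[pvar nu]_x k x) => [e||] //; case: (\int[nvar nu]_x k x) => [f||] // _ _ _ _ [] q.
by rewrite -!EFinB; congr (_%:E); move: q; lra.
Qed.

Lemma total_variation_ge (nu : complex_measure T R) A : measurable A ->
  (modulus nu A)%:E <= Defs.total_variation nu A.
Proof.
move=> mA; apply: ereal_sup_ubound; exists 1%N, (fun i => if i is 0%N then A else set0).
split=> //.
- by case.
- apply/trivIsetP => -[|i] [|j] _ _ // _; rewrite ?setI0 ?set0I//.
- by case=> // ? ? [].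
- by rewrite big_ord1.
Qed.

Lemma re_le_total_variation (nu : complex_measure T R) A : measurable A ->
  `|re_part nu A| <= Defs.total_variation nu A.
Proof.
move=> mA; apply: le_trans (total_variation_ge nu mA); rewrite /modulus.
have h : re_part nu A \is a fin_num by exact: fin_num_measure.
by rewrite -(fineK h) /= lee_fin -sqrtr_sqr ler_wsqrtr// lerDl sqr_ge0.
Qed.

Lemma im_le_total_variation (nu : complex_measure T R) A : measurable A ->
  `|im_part nu A| <= Defs.total_variation nu A.
Proof.
move=> mA; apply: le_trans (total_variation_ge nu mA); rewrite /modulus.
have h : im_part nu A \is a fin_num by exact: fin_num_measure.
by rewrite -(fineK h) /= lee_fin -sqrtr_sqr ler_wsqrtr// lerDr sqr_ge0.
Qed.

(** Bounding the modulus by the sum of the parts loses a factor 2, which the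
    smallness constants absorb. *)
Lemma total_variation_le (nu : complex_measure T R) m A : 
  (forall B, measurable B -> `|re_part nu B| <= m B) ->
  (forall B, measurable B -> `|im_part nu B| <= m B) -> measurable A ->
  Defs.total_variation nu A <= m A + m A.
Proof.
move=> re im mA; apply: ge_ereal_sup => _ [n [B [mB tB BA ->]]].
apply: (@le_trans _ _ (\sum_(i < n) (m (B i) + m (B i)))).
  apply: lee_sum => i _; have := re _ (mB i); have := im _ (mB i); rewrite /modulus.
  have hr : re_part nu (B i) \is a fin_num by exact: fin_num_measure.
  have hi : im_part nu (B i) \is a fin_num by exact: fin_num_measure.
  rewrite -(fineK hr) -(fineK hi) -(fineK (fin_meas m (mB i))) /=.
  move: (fine (re_part nu (B i))) (fine (im_part nu (B i))) (fine (m (B i))) => r s k.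
  rewrite -EFinD !lee_fin => sk rk.
  have k0 : (0 <= k)%R by exact: le_trans rk.
  rewrite -(ger0_norm (addr_ge0 k0 k0)) -sqrtr_sqr ler_wsqrtr//.
  rewrite -(real_normK (num_real r)) -(real_normK (num_real s)).
  have := normr_ge0 r; have := normr_ge0 s; move: (`|r|)%R (`|s|)%R rk sk => r' s' rk sk; nra.
rewrite big_split/=.
have : \sum_(i < n) m (B i) <= m A.
  have <- := @measure_bigsetU _ _ _ m B mB tB n.
  apply: le_measure; rewrite ?inE//; first exact: bigsetU_measurable.
  by move=> x; rewrite -bigcup_mkord => -[i _ /BA].
  move=> h; exact: leeD.
Qed.
End charges.

(** * From phase-space measures to complex measures on the line, and back *)

HB.lock Definition place (R : realType) (b : R) (m : {finite_measure set (measurableTypeR R) -> \bar R}) :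
    {finite_measure set (freq R) -> \bar R} :=
  pushf (fun x : measurableTypeR R => mkfreq (x : R) 0 b) m.
(** A phase pi changes the sign of a function: [madd p (shiftm pi q)] is the
    measure of a difference. *)
HB.lock Definition shiftm (R : realType) (b : R) (m : {finite_measure set (freq R) -> \bar R}) :
    {finite_measure set (freq R) -> \bar R} :=
  pushf (fun h => mkfreq (xi h) (eta h) (phase h + b)) m.
(** The Fourier measure of a real function is Hermitian; adding the image
    under (xi, theta) |-> (-xi, -theta) produces it. *)
HB.lock Definition symm (R : realType) (m : {finite_measure set (freq R) -> \bar R}) :
    {finite_measure set (freq R) -> \bar R} :=
  madd m (pushf (fun h => mkfreq (- xi h) 0 (- phase h)) m).
HB.lock Definition marg (R : realType) (m : {finite_measure set (freq R) -> \bar R}) :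
    {finite_measure set (measurableTypeR R) -> \bar R} :=
  pushf (fun h => xi h : measurableTypeR R) m.
(** The positive density 1 + cos(theta + b) stands for the signed density
    cos(theta + b), up to subtraction of the measure itself. *)
HB.lock Definition phased (R : realType) (b : R) (m : {finite_measure set (freq R) -> \bar R}) :
    {finite_measure set (freq R) -> \bar R} :=
  dens (fun h => 1 + cos (phase h + b)) m.
(** The charge pi cos(theta + b) integrated over theta: the real part of the
    Fourier measure for b = 0 and its imaginary part for b = - pi/2. *)
Definition phase_charge (R : realType) (b : R) (m : {finite_measure set (freq R) -> \bar R}) :
    {charge set (measurableTypeR R) -> \bar R} :=
  mcharge (mscale pi (marg (phased b (symm m)))) (mscale pi (marg (symm m))).
Definition fourier (R : realType) (m : {finite_measure set (freq R) -> \bar R}) :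
    complex_measure (measurableTypeR R) R :=
  ComplexMeasure (phase_charge 0 m) (phase_charge (- (pi / 2)) m).
(** The four phases of a complex measure: positive, negative, positive
    imaginary and negative imaginary parts. *)
HB.lock Definition quad (R : realType) (m1 m2 m3 m4 : {finite_measure set (measurableTypeR R) -> \bar R}) :
    {finite_measure set (freq R) -> \bar R} :=
  mscale (2 * pi)^-1 (madd (madd (place 0 m1) (place pi m2))
    (madd (place (pi / 2) m3) (place (- (pi / 2)) m4))).
(** The inverse of [fourier] on functions; 1/(2 pi) is the constant of
    Fourier inversion. *)
Definition lift_line (R : realType) (nu : complex_measure (measurableTypeR R) R) :
    {finite_measure set (freq R) -> \bar R} :=
  quad (pvar (re_part nu)) (nvar (re_part nu)) (pvar (im_part nu)) (nvar (im_part nu)).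

Section transform_pairs.
Context (R : realType).
Local Notation H := (freq R).
Local Notation fmH := {finite_measure set H -> \bar R}.
Local Notation line := (measurableTypeR R).
Local Notation fmL := {finite_measure set line -> \bar R}.
Local Notation cmeasure := (complex_measure line R).
Implicit Types (p q e : fmH) (m n : fmL) (x b : R) (g : line -> R) (nu : cmeasure).

Lemma measurable_xi_line : measurable_fun setT (fun h : H => xi h : line).
Proof. exact: measurable_xi. Qed.

Lemma measurable_line_mk b : measurable_fun setT (fun x : line => mkfreq (x : R) 0 b).
Proof. by apply: measurable_mkfreq; [exact: measurable_id|exact: measurable_cst|exact: measurable_cst]. Qed.

Lemma measurable_flip : measurable_fun setT (fun h : H => mkfreq (- xi h) 0 (- phase h)).
Proof. by hmeas. Qed.

Lemma measurable_shiftm b : measurable_fun setT (fun h : H => mkfreq (xi h) (eta h) (phase h + b)).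
Proof. by hmeas. Qed.

Lemma bm_xi g : bm g -> bm (fun h : H => g (xi h)).
Proof. by move=> bg; apply: bm_comp bg; exact: measurable_xi_line. Qed.

Lemma bm_phase b : bm (fun h : H => cos (phase h + b)).
Proof. by apply: bm_cos; hmeas. Qed.

Lemma RI_marg p g : bm g -> RI (marg p) g = RI p (fun h => g (xi h)).
Proof. by move=> bg; rewrite marg.unlock RI_pushf//; exact: measurable_xi_line. Qed.

Lemma margE p (f : line -> \bar R) : nnm f -> (\int[marg p]_x f x = \int[p]_h f (xi h))%E.
Proof. by move=> nf; rewrite marg.unlock pushfE//; exact: measurable_xi_line. Qed.

Lemma RI_symm p (G : H -> R) : bm G ->
  RI (symm p) G = RI p G + RI p (fun h => G (mkfreq (- xi h) 0 (- phase h))).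
Proof. by move=> bG; rewrite symm.unlock RI_madd// RI_pushf//; exact: measurable_flip. Qed.

Lemma symmE p (f : H -> \bar R) : nnm f ->
  (\int[symm p]_h f h = \int[p]_h f h + \int[p]_h f (mkfreq (- xi h) 0 (- phase h)))%E.
Proof. by move=> nf; rewrite symm.unlock maddE// pushfE//; exact: measurable_flip. Qed.

Lemma symm_total p : (symm p setT = p setT + p setT)%E.
Proof. by rewrite symm.unlock madd_total pushf_total//; exact: measurable_flip. Qed.

Lemma marg_total p : marg p setT = p setT.
Proof. by rewrite marg.unlock pushf_total//; exact: measurable_xi_line. Qed.

Lemma phased_ge0 b (h : H) : 0 <= 1 + cos (phase h + b).
Proof. by have := cos_geN1 (phase h + b); lra. Qed.

Lemma bm_phased b : bm (fun h : H => 1 + cos (phase h + b)).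
Proof. by apply: bmD; [exact: bm_cst|exact: bm_phase]. Qed.

Lemma RI_phased b p (G : H -> R) : bm G ->
  RI (phased b p) G = RI p (fun h => (1 + cos (phase h + b)) * G h).
Proof. by move=> bG; rewrite phased.unlock; exact: (RI_dens p (bm_phased b) (phased_ge0 b) bG). Qed.

Lemma bm_indic (A : set line) : measurable A -> bm (\1_A : line -> R).
Proof.
move=> mA; split; first exact: measurable_indic.
by exists 1 => x; rewrite indicE; case: (x \in A); rewrite ?normr1 ?normr0.
Qed.

Lemma bm_twist b g : bm g -> bm (fun h : H => cos (phase h + b) * g (xi h)).
Proof. by move=> bg; apply: bmM; [exact: bm_phase|exact: bm_xi]. Qed.

Lemma phase_charge_integral b p g : bm g ->
  charge_integral (phase_charge b p) setT g =
  pi * RI (symm p) (fun h => cos (phase h + b) * g (xi h)).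
Proof.
move=> bg; have pi0 := pi_ge0 R.
rewrite (@charge_integral_bm _ _ _ _ _ _ g (fun A mA => mchargeE _ _ mA))//.
rewrite !RI_mscale// !RI_marg// RI_phased ?RIB; last exact: bm_xi.
rewrite -mulrBr -RIB; last 2 first.
- by apply: bmM; [exact: bm_phased|exact: bm_xi].
- exact: bm_xi.
by congr (_ * RI _ _); apply/funext => h; rewrite mulrDl mul1r addrAC subrr add0r.
Qed.

Lemma measure_RI m (A : set line) : measurable A -> m A = (RI m \1_A)%:E.
Proof. by move=> mA; rewrite measureE// RI_E//; exact: bm_indic. Qed.

Lemma phase_charge_set b p A : measurable A ->
  phase_charge b p A = (pi * RI (symm p) (fun h => cos (phase h + b) * \1_A (xi h)))%:E.
Proof.
move=> mA; have bg := bm_indic mA; have pi0 := pi_ge0 R.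
rewrite /phase_charge mchargeE// !measure_RI// -EFinB; congr (_%:E).
rewrite !RI_mscale// !RI_marg// RI_phased ?RIB; last exact: bm_xi.
rewrite -mulrBr -RIB; last 2 first.
- by apply: bmM; [exact: bm_phased|exact: bm_xi].
- exact: bm_xi.
by congr (_ * RI _ _); apply/funext => h; rewrite mulrDl mul1r addrAC subrr add0r.
Qed.

Lemma RI_twist b p g : bm g -> RI (symm p) (fun h => cos (phase h + b) * g (xi h)) =
  RI p (fun h => cos (phase h + b) * g (xi h)) + RI p (fun h => cos (phase h - b) * g (- xi h)).
Proof.
move=> bg; rewrite RI_symm; last exact: bm_twist.
by congr (_ + RI _ _); apply/funext => h; rewrite !phaseE xiE -cosN opprD opprK.
Qed.

Lemma RI_symm_cos p x b : RI (symm p) (fun h => cos (xi h * x + phase h + b)) =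
  2 * cos b * ev p x 0 0.
Proof.
rewrite RI_symm; last by apply: bm_cos; hmeas.
rewrite -RID; [|by apply: bm_cos; hmeas|by apply: bm_cos; hmeas].
rewrite /ev -RIZ; last exact: bm_carg.
congr (RI _ _); apply/funext => h; rewrite !phaseE !xiE /arg mulr0 subr0 addr0.
have -> : - xi h * x - phase h + b = - ((xi h * x + phase h) - b) by ring.
by rewrite cosN cosD cosB; ring.
Qed.

(** The symmetrized measure reproduces the function twice, which with pi
    gives the factor 2 pi of the inversion formula, and its sine transform
    vanishes by oddness. *)
Lemma is_fourier_fourier p : is_fourier (fun x => ev p x 0 0) (fourier p).
Proof.
have bs x : bm (fun xi : line => sin (xi * x)) by apply: bm_sin; meas.
have bc x : bm (fun xi : line => cos (xi * x)) by apply: bm_cos; meas.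
have bt x b : bm (fun h : H => cos (phase h + b) * cos (xi h * x)) by exact: (bm_twist b (bc x)).
have bu x b : bm (fun h : H => cos (phase h + b) * sin (xi h * x)) by exact: (bm_twist b (bs x)).
move=> x; rewrite !phase_charge_integral//; split.
  rewrite -mulrBr -RIB//.
  rewrite [X in RI _ X](_ : _ = (fun h => cos (xi h * x + phase h + 0))); last first.
    by apply/funext => h; rewrite !addr0 cosB cosD cos_pihalf sin_pihalf; ring.
  by rewrite RI_symm_cos cos0; ring.
rewrite -mulrDr -RID//.
rewrite [X in RI _ X](_ : _ = (fun h => cos (xi h * x + phase h + - (pi / 2)))); last first.
  by apply/funext => h; rewrite !addr0 !cosB sinD cos_pihalf sin_pihalf; ring.
by rewrite RI_symm_cos cosN cos_pihalf; ring.
Qed.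

(** The signed density of p in any phase, projected to the line, is bounded
    by e. *)
Definition phase_bounded p e := forall b g, bm g ->
  `|RI p (fun h => cos (phase h + b) * g (xi h))| <= RI e (fun h => `|g (xi h)|).

Lemma bm_opp g : bm g -> bm (fun x : line => g (- (x : R))).
Proof. by move=> bg; apply: (@bm_comp _ _ _ line line (fun x : line => - (x : R) : line)) bg; exact: (@oppr_measurable R setT). Qed.

Lemma phase_bounded_symm p e : phase_bounded p e -> phase_bounded (symm p) (symm e).
Proof.
move=> h b g bg; rewrite RI_twist// (@RI_symm e); last exact: (bm_xi (bm_norm bg)).
rewrite (le_trans (ler_normD _ _))// lerD//; first exact: h.
exact: h _ _ (bm_opp bg).
Qed.

Lemma phase_bounded_mle p e E : phase_bounded p e -> mle e E -> phase_bounded p E.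
Proof.
move=> pe eE b g bg; apply: le_trans (pe b g bg) _.
by apply: mle_RI => //; exact: (bm_xi (bm_norm bg)).
Qed.

Lemma mscaleS (k : R) m A : 0 <= k -> measurable A -> mscale k m A = (k%:E * m A)%E.
Proof. by move=> k0 mA; rewrite !measureE// mscaleE//; exact: nnm_indic. Qed.

Lemma total_variation_fourier p e A : phase_bounded p e -> measurable A ->
  (Defs.total_variation (fourier p) A <= mscale (2 * pi) (marg (symm e)) A)%E.
Proof.
move=> pe mA; have pi0 := pi_ge0 R.
have -> : mscale (2 * pi) (marg (symm e)) A =
    (mscale pi (marg (symm e)) A + mscale pi (marg (symm e)) A)%E.
  by rewrite !mscaleS// ?mulr_ge0// measure_RI// -!EFinM -EFinD; congr (_%:E); ring.
apply: total_variation_le => // B mB; rewrite phase_charge_set// mscaleS// measure_RI// RI_marg;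
  [|exact: bm_indic| |exact: bm_indic];
  rewrite -EFinM lee_fin normrM ger0_norm// ler_wpM2l//;
  apply: le_trans (phase_bounded_symm pe _ (bm_indic mB)) _;
  by rewrite (_ : (fun h => `|_|) = (fun h => \1_B (xi h)))//;
    apply/funext => h; rewrite indicE; case: (_ \in B); rewrite ?normr1 ?normr0.
Qed.

Lemma phase_bounded_near p q e : near_by p q e -> phase_bounded (madd p (shiftm pi q)) e.
Proof.
move=> pq b g bg; have bt := bm_twist b bg.
rewrite RI_madd// shiftm.unlock RI_pushf//; last exact: measurable_shiftm.
rewrite [X in _ + RI _ X](_ : _ = (fun h => - (cos (phase h + b) * g (xi h)))); last first.
  by apply/funext => h; rewrite phaseE xiE addrAC cosDpi mulNr.
rewrite RIN//; apply: le_trans (near_RI pq bt) _.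
apply: le_RI => [||h]; [exact: bm_norm|exact: (bm_xi (bm_norm bg))|].
by rewrite normrM ler_piMl// norm_cos.
Qed.

Lemma phase_bounded_self p : phase_bounded p p.
Proof.
move=> b g bg; have bt := bm_twist b bg; apply: le_trans (le_norm_RI _ bt) _.
apply: le_RI => [||h]; [exact: bm_norm|exact: (bm_xi (bm_norm bg))|].
by rewrite normrM ler_piMl// norm_cos.
Qed.

Lemma ev_diff p q x : ev (madd p (shiftm pi q)) x 0 0 = ev p x 0 0 - ev q x 0 0.
Proof.
rewrite /ev RI_madd; last exact: bm_carg.
rewrite shiftm.unlock RI_pushf; [|exact: measurable_shiftm|exact: bm_carg].
rewrite -RIN; last exact: bm_carg.
congr (_ + RI _ _); apply/funext => h.
by rewrite /arg !xiE !etaE !phaseE !addr0 addrA cosDpi.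
Qed.

Lemma RI_place b m (G : H -> R) : bm G -> RI (place b m) G = RI m (fun x => G (mkfreq (x : R) 0 b)).
Proof. by move=> bG; rewrite place.unlock RI_pushf//; exact: measurable_line_mk. Qed.

Lemma placeE b m (f : H -> \bar R) : nnm f ->
  (\int[place b m]_h f h = \int[m]_x f (mkfreq (x : R) 0 b))%E.
Proof. by move=> nf; rewrite place.unlock pushfE//; exact: measurable_line_mk. Qed.

Lemma twopi_gt0 : 0 < (2 * pi : R). Proof. by rewrite mulr_gt0// pi_gt0. Qed.

Lemma RI_quad m1 m2 m3 m4 b g : bm g ->
  2 * pi * RI (quad m1 m2 m3 m4) (fun h => cos (phase h + b) * g (xi h)) =
  cos b * (RI m1 g - RI m2 g) - sin b * (RI m3 g - RI m4 g).
Proof.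
move=> bg; have bt := bm_twist b bg; have p0 := twopi_gt0.
rewrite quad.unlock RI_mscale ?invr_ge0 ?ltW// mulrA divff ?gt_eqF// mul1r.
rewrite !RI_madd// !RI_place//.
under [X in RI m1 X]eq_fun do rewrite phaseE xiE.
under [X in RI m2 X]eq_fun do rewrite phaseE xiE.
under [X in RI m3 X]eq_fun do rewrite phaseE xiE.
under [X in RI m4 X]eq_fun do rewrite phaseE xiE.
rewrite !RIZ// add0r addrC [in cos (pi + b)]addrC cosDpi !cosD cosN sinN cos_pihalf sin_pihalf.
by ring.
Qed.

Lemma quadE m1 m2 m3 m4 (f : H -> \bar R) : nnm f ->
  (\int[quad m1 m2 m3 m4]_h f h = ((2 * pi)^-1)%:E *
   ((\int[m1]_x f (mkfreq (x : R) 0 0%R) + \int[m2]_x f (mkfreq (x : R) 0 pi)) +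
    (\int[m3]_x f (mkfreq (x : R) 0 (pi / 2)%R) + \int[m4]_x f (mkfreq (x : R) 0 (- (pi / 2))%R))))%E.
Proof.
move=> nf; rewrite quad.unlock mscaleE ?invr_ge0 ?ltW ?twopi_gt0//.
by rewrite !maddE// !placeE.
Qed.

Lemma RI_lift_line nu b g : bm g ->
  2 * pi * RI (lift_line nu) (fun h => cos (phase h + b) * g (xi h)) =
  cos b * charge_integral (re_part nu) setT g - sin b * charge_integral (im_part nu) setT g.
Proof.
move=> bg; rewrite RI_quad// (charge_integral_bm (@pvar_nvar _ _ _ _))//.
by rewrite (charge_integral_bm (@pvar_nvar _ _ _ _)).
Qed.

Lemma ev_lift_line nu (u : R -> R) x : is_fourier u nu -> ev (lift_line nu) x 0 0 = u x.
Proof.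
move=> /(_ x)[+ _]; have p0 := twopi_gt0.
have bs : bm (fun xi : line => sin (xi * x)) by apply: bm_sin; meas.
have bc : bm (fun xi : line => cos (xi * x)) by apply: bm_cos; meas.
have := RI_lift_line nu 0 bc; rewrite cos0 sin0 mul1r mul0r subr0 => ec.
have := RI_lift_line nu (pi / 2) bs; rewrite cos_pihalf sin_pihalf mul1r mul0r sub0r => es.
rewrite -ec -es -mulrDr => /(mulfI (lt0r_neq0 p0)) <-.
rewrite -RID; [|exact: (bm_twist 0 bc)|exact: (bm_twist (pi / 2) bs)].
congr (RI _ _); apply/funext => h.
by rewrite /arg mulr0 subr0 !addr0 !cosD cos_pihalf sin_pihalf; ring.
Qed.

Local Open Scope ereal_scope.

Lemma wle_quad c (m1 m2 m3 m4 m : fmL) :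
  (forall f : line -> \bar R, nnm f ->
    [/\ \int[m1]_x ((expR (c * `|x : R|))%:E * f x) <= \int[m]_x f x,
        \int[m2]_x ((expR (c * `|x : R|))%:E * f x) <= \int[m]_x f x,
        \int[m3]_x ((expR (c * `|x : R|))%:E * f x) <= \int[m]_x f x &
        \int[m4]_x ((expR (c * `|x : R|))%:E * f x) <= \int[m]_x f x]) ->
  wle c (quad m1 m2 m3 m4) (quad m m m m).
Proof.
move=> h f nf; have nw : nnm (fun h : H => (wt c h)%:E * f h) by apply: nnmM => //; exact: nnm_wt.
have nl b : nnm (fun x : line => f (mkfreq (x : R) 0%R b)).
  by apply: nnm_comp nf; exact: measurable_line_mk.
rewrite !quadE// lee_pmul2l ?lte_fin ?invr_gt0 ?twopi_gt0//.
have [h1 _ _ _] := h _ (nl 0%R).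
have [_ h2 _ _] := h _ (nl pi).
have [_ _ h3 _] := h _ (nl (pi / 2)%R).
have [_ _ _ h4] := h _ (nl (- (pi / 2))%R).
by rewrite leeD// leeD.
Qed.

Lemma quad_total (m1 m2 m3 m4 : fmL) : quad m1 m2 m3 m4 setT =
  ((2 * pi)^-1)%:E * ((m1 setT + m2 setT) + (m3 setT + m4 setT)).
Proof. by rewrite -!integral1 quadE//; exact: nnm_cst. Qed.

Lemma variation_le nu (f : line -> \bar R) : nnm f ->
  [/\ \int[pvar (re_part nu)]_x f x <= \int[Defs.total_variation nu]_x f x,
      \int[nvar (re_part nu)]_x f x <= \int[Defs.total_variation nu]_x f x,
      \int[pvar (im_part nu)]_x f x <= \int[Defs.total_variation nu]_x f x &
      \int[nvar (im_part nu)]_x f x <= \int[Defs.total_variation nu]_x f x].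
Proof.
move=> nf.
have key (c : {charge set line -> \bar R}) : (forall A, measurable A -> `|c A| <= Defs.total_variation nu A) ->
    \int[pvar c]_x f x <= \int[Defs.total_variation nu]_x f x /\
    \int[nvar c]_x f x <= \int[Defs.total_variation nu]_x f x.
  move=> ck; split; apply: mle_set => // A mA.
    rewrite [leLHS](pvar_set c mA); have [P mP ->//] := positive_variation_set c.
    apply: le_trans (lee_abs _) _; apply: le_trans (ck _ (measurableI _ _ mA mP)) _.
    by apply: le_total_variation.
  rewrite [leLHS](nvar_set c mA); have [P mP ->//] := negative_variation_set c.
  apply: le_trans (lee_abs _) _; rewrite abseN; apply: le_trans (ck _ (measurableI _ _ mA mP)) _.
  by apply: le_total_variation.
have [? ?] := key _ (@re_le_total_variation _ _ _ nu).
by have [? ?] := key _ (@im_le_total_variation _ _ _ nu).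
Qed.

Lemma lift_line_total nu (k : R) : Defs.total_variation nu setT <= k%:E ->
  lift_line nu setT <= (2 * k / pi)%:E.
Proof.
move=> nk; rewrite quad_total.
have [] := @variation_le nu (fun=> 1) (nnm_cst _ lee01); rewrite !integral1 => h1 h2 h3 h4.
have -> : (2 * k / pi)%:E = ((2 * pi)^-1)%:E * ((k%:E + k%:E) + (k%:E + k%:E)).
  have p0 : (pi != 0 :> R)%R by rewrite gt_eqF// pi_gt0.
  by rewrite -!EFinD -EFinM; congr (_%:E); rewrite invfM; move: p0; move: (pi : R) => z z0; field.
rewrite lee_pmul2l ?lte_fin ?invr_gt0 ?twopi_gt0//.
by rewrite leeD// leeD// (le_trans _ nk).
Qed.

(** The weighted bound on the total variation is a bound on each of the four
    parts. *)
Lemma wle_lift_line c nu (mu : fmL) : (0 <= c)%R ->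
  (forall A : set line, measurable A ->
    \int[Defs.total_variation nu]_(x in A) (expR (c * `|x : R|))%:E <= mu A) ->
  wle c (lift_line nu) (quad mu mu mu mu).
Proof.
move=> c0 h; apply: wle_quad => f nf.
have mw : measurable_fun setT (fun x : line => expR (c * `|x : R|)) by meas.
have nw : nnm (fun x : line => (expR (c * `|x : R|))%:E).
  by apply: nnm_EFin => // x; exact: expR_ge0.
have w1 (x : line) : 1 <= (expR (c * `|x : R|))%:E.
  by rewrite lee_fin -expR0 ler_expR mulr_ge0.
have tvfin : Defs.total_variation nu setT < +oo.
  apply: le_lt_trans (fin_total mu); rewrite -integral1.
  by apply: le_trans (h _ measurableT); apply: ge0_le_integral => //; exact: nw.1.
pose tv : fmL := mk (fun k => \int[Defs.total_variation nu]_x k x).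
have tvE (k : line -> \bar R) : nnm k -> \int[tv]_x k x = \int[Defs.total_variation nu]_x k x.
  by apply: mkE; [exact: posfun_integral|rewrite integral1].
have wfin : \int[tv]_x (expR (c * `|x : R|))%:E < +oo.
  by rewrite tvE//; apply: le_lt_trans (h _ measurableT) (fin_total mu).
have nwf : nnm (fun x : line => (expR (c * `|x : R|))%:E * f x) by exact: nnmM.
suff H0 : \int[Defs.total_variation nu]_x ((expR (c * `|x : R|))%:E * f x) <= \int[mu]_x f x.
  by have [h1 h2 h3 h4] := variation_le nu nwf; split; apply: le_trans H0.
rewrite -tvE// -densE//; apply: mleP => // A mA.
rewrite measureE// densE//; last exact: nnm_indic.
rewrite tvE; last by apply: nnmM => //; exact: nnm_indic.
apply: le_trans (h _ mA); rewrite [leRHS]integral_mkcond.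
rewrite le_eqVlt; apply/orP; left; apply/eqP; apply: eq_integral => x _.
by rewrite patchE indicE; case: (x \in A); rewrite ?mule1 ?mule0.
Qed.

End transform_pairs.

(** * The mild solution solves the Muskat problem *)

Section fourier_of_measures.
Context (R : realType).
Local Notation H := (freq R).
Local Notation fmH := {finite_measure set H -> \bar R}.
Local Notation line := (measurableTypeR R).
Local Notation fmL := {finite_measure set line -> \bar R}.
Implicit Types (p q e P M : fmH) (m n : fmL) (x b : R).
Local Open Scope ereal_scope.

Lemma nnm_flip (f : H -> \bar R) : nnm f -> nnm (fun h : H => f (mkfreq (- xi h)%R 0%R (- phase h)%R)).
Proof. by move=> nf; apply: nnm_comp nf; exact: measurable_flip. Qed.

Lemma nnm_xi (f : line -> \bar R) : nnm f -> nnm (fun h : H => f (xi h)).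
Proof. by move=> nf; apply: nnm_comp nf; exact: measurable_xi_line. Qed.

Lemma phasedE b p (f : H -> \bar R) : nnm f ->
  \int[phased b p]_h f h = \int[p]_h ((1 + cos (phase h + b))%:E * f h).
Proof.
move=> nf; rewrite phased.unlock densE//; first exact: (bm_phased b).1.
apply: le_lt_trans (ltry (2 * mass p)).
rewrite -RI_cst RI_E; last exact: bm_cst.
apply: le_nnm => [||h]; [|exact: nnm_cst|].
  by apply: nnm_bm; [exact: bm_phased|exact: phased_ge0].
by rewrite lee_fin; have := cos_le1 (phase h + b); lra.
Qed.

Lemma symm_le p q (f g : H -> \bar R) : nnm f -> nnm g ->
  \int[p]_h f h <= \int[q]_h g h ->
  \int[p]_h f (mkfreq (- xi h)%R 0%R (- phase h)%R) <= \int[q]_h g (mkfreq (- xi h)%R 0%R (- phase h)%R) ->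
  \int[symm p]_h f h <= \int[symm q]_h g h.
Proof. by move=> nf ng h1 h2; rewrite !symmE//; apply: leeD. Qed.

Lemma total_variation_fourier_le p e (f : line -> \bar R) : phase_bounded p e -> nnm f ->
  \int[Defs.total_variation (fourier p)]_x f x <= (2 * pi)%:E * \int[symm e]_h f (xi h).
Proof.
move=> pe nf; rewrite -margE// -mscaleE ?(ltW (twopi_gt0 R))//.
by apply: mle_set => // A mA; exact: total_variation_fourier.
Qed.

(** The total variation on the line inherits the exponential weight. *)
Lemma fourier_wle c p e E (A : set line) : phase_bounded p e -> wle c e E -> measurable A ->
  \int[Defs.total_variation (fourier p)]_(x in A) (expR (c * `|x : R|)%R)%:E <=
  mscale (2 * pi)%R (marg (symm E)) A.
Proof.
move=> pe w mA; have nA : nnm (fun x : line => (\1_A x)%:E : \bar R) by exact: nnm_indic.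
have nw : nnm (fun x : line => (expR (c * `|x : R|)%R)%:E).
  by apply: nnm_EFin => [|x]; [meas|exact: expR_ge0].
have nAw : nnm (fun x : line => (expR (c * `|x : R|)%R)%:E * (\1_A x)%:E) by exact: nnmM.
rewrite integral_mkcond.
rewrite (_ : (fun x => _) = (fun x : line => (expR (c * `|x : R|)%R)%:E * (\1_A x)%:E)); last first.
  by apply/funext => x; rewrite patchE indicE; case: (x \in A); rewrite ?mule1 ?mule0.
apply: le_trans (total_variation_fourier_le pe nAw) _.
rewrite measureE// mscaleE ?(ltW (twopi_gt0 R))// margE// lee_wpmul2l ?lee_fin ?(ltW (twopi_gt0 R))//.
have nx := nnm_xi nA; have nxw := nnm_xi nAw.
apply: (@symm_le _ _ _ (fun h : H => (\1_A (xi h))%:E)) => //; first exact: w.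
under [leLHS]eq_integral do rewrite [xi (mkfreq _ _ _)]xiE normrN.
exact: w _ (nnm_flip nx).
Qed.

Local Notation absline := (fun x : line => `|x : R|%R).

Lemma nnm_absline : nnm (fun x : line => (absline x)%:E).
Proof. by apply: nnm_EFin => //; meas. Qed.

Lemma nnm_absxi : nnm (fun h : H => (absxi h)%:E).
Proof. by apply: nnm_EFin; [exact: measurable_absxi|move=> h; exact: normr_ge0]. Qed.

Section derivative.
Variable p : fmH.
Hypothesis pfin : \int[p]_h (absxi h)%:E < +oo.

Let dE (f : H -> \bar R) : nnm f -> \int[dens absxi p]_h f h = \int[p]_h ((absxi h)%:E * f h).
Proof. by move=> nf; apply: densE => //; [exact: measurable_absxi|move=> h; exact: normr_ge0]. Qed.

Lemma symm_absxi (f : H -> \bar R) : nnm f ->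
  \int[symm (dens absxi p)]_h f h = \int[symm p]_h ((absxi h)%:E * f h).
Proof.
move=> nf; rewrite !symmE//; last by apply: nnmM => //; exact: nnm_absxi.
rewrite !dE//; last exact: nnm_flip.
by under [X in _ = _ + X]eq_integral do rewrite /absxi xiE normrN.
Qed.

Lemma symm_absxi_fin : \int[symm p]_h (absxi h)%:E < +oo.
Proof.
rewrite symmE; last exact: nnm_absxi.
under [X in _ + X < _]eq_integral do rewrite /absxi xiE normrN.
by rewrite lte_add_pinfty.
Qed.

(** Multiplication by |xi| commutes with the passage to the line. *)
Lemma phase_charge_absxi b (A : set line) : measurable A ->
  phase_charge b (dens absxi p) A = (charge_integral (phase_charge b p) A absline)%:E.
Proof.
move=> mA; have pi0 := pi_ge0 R.
have nA : nnm (fun x : line => (\1_A x)%:E : \bar R) by exact: nnm_indic.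
have cE (g : line -> \bar R) : nnm g -> \int[mscale pi (marg (phased b (symm p)))]_x g x =
    pi%:E * \int[symm p]_h ((1 + cos (phase h + b))%:E * g (xi h)).
  by move=> ng; rewrite mscaleE// margE// phasedE//; exact: nnm_xi.
have cE' (g : line -> \bar R) : nnm g -> \int[mscale pi (marg (symm p))]_x g x =
    pi%:E * \int[symm p]_h g (xi h).
  by move=> ng; rewrite mscaleE// margE.
have nph : nnm (fun h : H => (1 + cos (phase h + b))%:E).
  by apply: nnm_bm; [exact: bm_phased|exact: phased_ge0].
rewrite (charge_integral_ge0 (fun A mA => mchargeE _ _ mA))//; last 3 first.
- by meas.
- rewrite cE; last exact: nnm_absline.
  apply: (@le_lt_trans _ _ (pi%:E * (2%:E * \int[symm p]_h (absxi h)%:E))).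
    rewrite lee_pmul2l ?lte_fin ?pi_gt0// -ge0_integralZl//; last 2 first.
    + exact: nnm_absxi.1.
    + by move=> h _; rewrite lee_fin; exact: normr_ge0.
    apply: le_nnm => [||h]; first by apply: nnmM => //; exact: nnm_absxi.
      by apply: nnmM; [exact: nnm_cst|exact: nnm_absxi].
    by rewrite lee_wpmul2r// lee_fin; have := cos_le1 (phase h + b); lra.
  by rewrite !lte_mul_pinfty ?lee_fin// symm_absxi_fin.
- rewrite cE'; last exact: nnm_absline.
  by rewrite lte_mul_pinfty ?lee_fin// symm_absxi_fin.
have mc (m : {measure set line -> \bar R}) : \int[m]_(x in A) (absline x)%:E = \int[m]_x ((absline x)%:E * (\1_A x)%:E).
  rewrite integral_mkcond; apply: eq_integral => x _.
  by rewrite patchE indicE; case: (x \in A); rewrite ?mule1 ?mule0.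
have nAA : nnm (fun x : line => (absline x)%:E * (\1_A x)%:E).
  by apply: nnmM => //; exact: nnm_absline.
rewrite !mc cE// cE'// /phase_charge mchargeE// !measureE// !mscaleE// !margE//.
have nx := nnm_xi nA.
rewrite phasedE// !symm_absxi//; last by apply: nnmM.
congr (_ * _ - _).
by apply: eq_integral => h _; rewrite muleCA.
Qed.

(** Multiplying the phase-space measure by |xi| multiplies the Fourier
    measure by |xi|. *)
Lemma is_Lambda_ev : is_Lambda (fun x => ev p x 0 0) (fun x => ev (dens absxi p) x 0 0).
Proof.
exists (fourier p), (fourier (dens absxi p)); split.
- exact: is_fourier_fourier.
- exact: is_fourier_fourier.
- apply/integrableP; split; first by apply/measurable_EFinP; meas.
  under eq_integral do rewrite /= normr_id.
  apply: le_lt_trans (total_variation_fourier_le (@phase_bounded_self _ p) nnm_absline) _.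
  by rewrite lte_mul_pinfty ?lee_fin ?(ltW (twopi_gt0 R))// symm_absxi_fin.
- by move=> A mA; split; exact: phase_charge_absxi.
Qed.
End derivative.

Lemma symm_mass e (k : R) : e setT <= k%:E -> symm e setT <= (2 * k)%:E.
Proof. by move=> ek; rewrite symm_total (_ : (2 * k)%R = (k + k)%R); [rewrite EFinD leeD|lra]. Qed.

Lemma B0_norm_le p e (k : R) : phase_bounded p e -> e setT <= k%:E ->
  B0_norm (fun x => ev p x 0 0) <= (4 * pi * k)%:E.
Proof.
move=> pe ek; have pi0 := pi_ge0 R.
apply: (@le_trans _ _ (Defs.total_variation (fourier p) setT)).
  by apply: ereal_inf_lbound; exists (fourier p) => //; exact: is_fourier_fourier.
rewrite -integral1; apply: le_trans (total_variation_fourier_le pe (nnm_cst _ lee01)) _.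
rewrite integral1 (_ : (4 * pi * k)%R = (2 * pi * (2 * k))%R); last by ring.
by rewrite [leRHS]EFinM lee_wpmul2l ?lee_fin ?mulr_ge0// symm_mass.
Qed.

End fourier_of_measures.

Section existence.
Context (R : realType) (al gam : R).
Hypotheses (al0 : 0 < al) (gam0 : 0 <= gam).
Local Notation H := (freq R).
Local Notation fmH := {finite_measure set H -> \bar R}.
Local Notation line := (measurableTypeR R).
Variables (kap a : R) (p0 M : fmH) (p : R -> fmH).
Hypotheses (a4 : a <= 4^-1) (Ma : (M setT <= a%:E)%E) (ap : admissible al p M).
Hypothesis ME : forall f, nnm f ->
  (\int[M]_h f h = \int[p0]_h f h + (gam / al)%:E * \int[Tm kap M]_h f h)%E.
Hypothesis pE : forall t f, nnm f -> (\int[p t]_h f h = \int[step al gam kap p0 p t]_h f h)%E.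
Local Notation v := (fun t x => ev (p t) x 0 0).

Lemma dominates_mild : dominates al v (mscale (2 * pi) (marg (symm M))).
Proof.
move=> t t0; exists (fourier (p t)); first exact: is_fourier_fourier.
have [_ /(_ t)] := ap; rewrite ger0_norm// => w A.
exact: (fourier_wle (@phase_bounded_self _ (p t)) w).
Qed.

Lemma Balpha_norm_mild : (Balpha_norm al v <= (4 * pi * a)%:E)%E.
Proof.
apply: (@le_trans _ _ (mscale (2 * pi) (marg (symm M)) setT)).
  by apply: ereal_inf_lbound; exists (mscale (2 * pi) (marg (symm M))) => //; exact: dominates_mild.
rewrite mscale_total ?(ltW (twopi_gt0 R))// marg_total (_ : (4 * pi * a) = (2 * pi * (2 * a))); last by ring.
by rewrite [leRHS]EFinM lee_wpmul2l ?lee_fin ?(ltW (twopi_gt0 R))// symm_mass.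
Qed.

Let lost (d : R) (h : H) : R := 1 - expR (- (2 * al * d) * `|xi h|).

Let lost_bm (d : R) : 0 <= d -> bm (lost d).
Proof.
move=> d0; split; first by rewrite /lost; hmeas.
exists 1 => h; rewrite ler_norml; have e0 := expR_ge0 (- (2 * al * d) * `|xi h|).
have e1 : expR (- (2 * al * d) * `|xi h|) <= 1.
  by rewrite expR_le1 mulNr oppr_le0 !mulr_ge0// ltW.
by rewrite /lost; apply/andP; split; lra.
Qed.

Let jump_lost (s t d : R) (h : H) : 0 <= s -> s <= t -> t - s <= d -> jump al s t h <= lost d h.
Proof.
move=> s0 st std; rewrite /jump /lost.
have e0 := expR_ge0 (- (al * s) * `|xi h|).
have e1 : expR (- (al * s) * `|xi h|) <= 1.
  by rewrite expR_le1 mulNr oppr_le0 !mulr_ge0// ltW.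
have f1 : expR (- (2 * al * (t - s)) * `|xi h|) <= 1.
  by rewrite expR_le1 mulNr oppr_le0 !mulr_ge0// ?subr_ge0// ltW.
have f2 : expR (- (2 * al * d) * `|xi h|) <= expR (- (2 * al * (t - s)) * `|xi h|).
  by rewrite ler_expR !mulNr lerN2 ler_wpM2r// ler_wpM2l// mulr_ge0// ltW.
nra.
Qed.

Let jump_total (s t d : R) : 0 <= s -> s <= t -> t - s <= d ->
  (dens (jump al s t) M setT <= (RI M (lost d))%:E)%E.
Proof.
move=> s0 st std; rewrite -integral1 (jumpE al0 M s0 st (nnm_cst _ lee01)).
have d0 : 0 <= d by lra.
rewrite RI_E; last exact: lost_bm.
have nl : nnm (fun h => (lost d h)%:E).
  apply: nnm_bm; first exact: lost_bm.
  by move=> h; apply: le_trans (jump_lost h s0 st std); exact: jump_ge0.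
apply: le_nnm => // [|h]; first by apply: nnmM; [exact: nnm_jump|exact: (nnm_cst _ lee01)].
by rewrite mule1 lee_fin; exact: jump_lost.
Qed.

(** The difference at two times is bounded in mass by the loss 1 - e^{-c d
    |xi|} under the dominating measure. *)
Lemma B0_norm_mild (s t d : R) : 0 <= s -> 0 <= t -> `|s - t| <= d ->
  (B0_norm (fun x : R => v s x - v t x)%R <= (4 * pi * RI M (lost d))%:E)%E.
Proof.
move=> s0 t0 std.
rewrite (_ : (fun x => _) = (fun x => ev (madd (p s) (shiftm pi (p t))) x 0 0)); last first.
  by apply/funext => x; rewrite ev_diff.
have [st|/ltW st] := leP s t.
  apply: (@B0_norm_le _ _ (dens (jump al s t) M)).
    by apply: phase_bounded_near; apply: near_sym; exact: (near_mild al0 gam0 a4 Ma ap ME pE s0 st).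
  by apply: jump_total => //; apply: le_trans std; rewrite distrC ler_norm.
apply: (@B0_norm_le _ _ (dens (jump al t s) M)).
  by apply: phase_bounded_near; exact: (near_mild al0 gam0 a4 Ma ap ME pE t0 st).
by apply: jump_total => //; apply: le_trans std; rewrite ler_norm.
Qed.

Lemma B0_norm_ge0 (u : R -> R) : (0 <= B0_norm u)%E.
Proof. by apply: le_ereal_inf_tmp => _ [nu _ <-]; exact: Defs.total_variation_ge0. Qed.

Let lost_small : RI M (lost n.+1%:R^-1) @[n --> \oo] --> (0 : R).
Proof.
have -> : (0 : R) = RI M (fun=> 0) by rewrite RI_cst mul0r.
apply: (@cvg_RI _ _ _ _ _ _ 1) => [n||n h|h].
- by have [] := @lost_bm n.+1%:R^-1 _.
- exact: measurable_cst.
- rewrite ler_norml; have e0 := expR_ge0 (- (2 * al * n.+1%:R^-1) * `|xi h|).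
  have e1 : expR (- (2 * al * n.+1%:R^-1) * `|xi h|) <= 1.
    by rewrite expR_le1 mulNr oppr_le0 !mulr_ge0// ltW.
  by rewrite /lost; apply/andP; split; lra.
rewrite /lost -[X in _ --> X](subrr (1 : R)); apply: cvgB; first exact: cvg_cst.
rewrite -[X in _ --> X](@expR0 R).
apply: (@continuous_cvg _ _ _ _ _ _ (@expR R)); first exact: continuous_expR.
rewrite (_ : (fun n : nat => _) = ((fun=> - (2 * al) * `|xi h|) \* (@harmonic R))); last first.
  by apply/funext => n; rewrite /= !mulNr mulrAC.
by rewrite -[X in _ --> X](mulr0 (- (2 * al) * `|xi h|)); apply: cvgM; [exact: cvg_cst|exact: cvg_harmonic].
Qed.

Let near_dist (t e : R) : 0 < e -> \forall s \near t, `|s - t| <= e.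
Proof.
move=> e0; near=> s; rewrite distrC ltW//.
Unshelve. all: by end_near. Qed.

Lemma continuous_in_B0_mild : continuous_in_B0 v.
Proof.
split=> [t t0|t t0]; first by exists (fourier (p t)); exact: is_fourier_fourier.
have pi0 := pi_gt0 R.
have small e : 0 < e -> \forall s \near within `[0, +oo[%classic (nbhs t),
    (B0_norm (fun x : R => v s x - v t x)%R <= e%:E)%E.
  move=> e0; have e4 : 0 < e / (4 * pi) by rewrite divr_gt0// mulr_gt0.
  have /cvgrPdist_le/(_ _ e4)[n _ /(_ n (leqnn n))] := lost_small.
  rewrite /= sub0r normrN => hn.
  near=> s; have s0 : 0 <= s.
    suff : s \in `[0, +oo[ by rewrite in_itv/= andbT.
    by near: s; exact: withinT.
  apply: le_trans (@B0_norm_mild s t n.+1%:R^-1 s0 t0 _) _.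
    have : (fun s : R => `|s - t|) s <= n.+1%:R^-1; last by [].
    by near: s; apply: cvg_within; apply: near_dist.
  rewrite lee_fin mulrC -ler_pdivlMr ?mulr_gt0//.
  by apply: le_trans hn; rewrite ler_norm.
apply/fine_cvgP; split.
  have := small 1 ltr01; apply: filterS => s h.
  by rewrite ge0_fin_numE ?B0_norm_ge0// (le_lt_trans h) ?ltry.
apply/cvgrPdist_le => e e0; have := small e e0; apply: filterS => s h.
rewrite sub0r normrN ger0_norm ?fine_ge0 ?B0_norm_ge0//.
by rewrite -lee_fin fineK// ge0_fin_numE ?B0_norm_ge0// (le_lt_trans h) ?ltry.
Unshelve. all: by end_near. Qed.

Lemma in_Balpha_mild : in_Balpha al v.
Proof.
split; first exact: continuous_in_B0_mild.
by apply: le_lt_trans Balpha_norm_mild _; rewrite ltry.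
Qed.

(** At time 0 the semigroup is the identity and the time integral is over a
    point. *)
Lemma mild_initial x : v 0 x = ev p0 x 0 0.
Proof.
have near : near_by (p 0) p0 (nullm R H).
  move=> f nf; rewrite nullmE !adde0.
  suff -> : (\int[p 0%R]_h f h = \int[p0]_h f h)%E by [].
  rewrite pE// (stepE al0 gam0 kap p0 0 (M_small a4 Ma) ap nf).
  rewrite [X in (_ + X)%E](_ : _ = 0)%E ?adde0.
    apply: eq_integral => h _; rewrite /decay normr0 mulr0 oppr0 mul0r expR0 mul1e//.
  rewrite lebrE// ?leb_segment//; last exact: (nnm_duh al0 gam0 kap a4 Ma ap 0 nf).
  by rewrite set_itv1 integral_set1.
apply/eqP; rewrite -subr_eq0 -normr_le0.
apply: (near_RI_mass near (bm_carg x 0 0)) => // h.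
exact: norm_cos.
Qed.

Lemma derive1_val (f : R -> R) (x l : R) : is_derive x 1 f l -> derive1 f x = l.
Proof. by move=> h; rewrite derive1E; exact: derive_val. Qed.

Lemma is_derive_derivable (f : R -> R) (x l : R) : is_derive x 1 f l -> derivable f x 1.
Proof. by case. Qed.

Lemma muskat_mild (rho_m rho_p : R) (f0 : R -> R) : 2 * al = (rho_m - rho_p) / 2 ->
  gam = (rho_m - rho_p) / pi * `|kappa R| -> kap = kappa R ->
  (forall x, v 0 x = derive1 f0 x) ->
  muskat_solution rho_m rho_p al f0 (fun t => curve (p t)).
Proof.
move=> alE gamE kapE v0.
have dE : dx (fun t => curve (p t)) = v.
  by apply/funext => t; apply/funext => x; rewrite /dx (derive1_val (is_derive_curve (p t) x)).
split.
- by move=> t x _; exact: is_derive_derivable (is_derive_curve (p t) x).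
- by rewrite dE; exact: in_Balpha_mild.
- by move=> x; rewrite dE.
move=> t t0; rewrite dE; have at0 : 0 < al * `|t| by rewrite mulr_gt0// gtr0_norm.
have [_ /(_ t) w] := ap.
exists (fun x => ev (dens absxi (p t)) x 0 0); first by apply: is_Lambda_ev; exact: absxi_fin w.
have sp : small (p t) by apply: (admissible_small _ _ ap (M_small a4 Ma)) => //; exact: ltW.
move=> x.
have dv := is_derive_mild al0 gam0 a4 Ma ap ME pE (bm_carg x 0 0) (fun h => norm_cos _) t0.
have [pv _] := muskat_N_E rho_m rho_p x sp (is_derive_curve (p t)).
have dN := muskat_N_derive rho_m rho_p x at0 sp (M_small a4 Ma) w (is_derive_curve (p t)).
split; [exact: is_derive_derivable dv|exact: pv|exact: is_derive_derivable dN|].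
rewrite (derive1_val dv) (derive1_val dN) -alE kapE /ev mulrA -gamE.
by rewrite subrK.
Qed.

End existence.

(** * Local averages control measures *)

(** The measure restricted to the semiring of half-open intervals, of which
    it is the Caratheodory extension. *)
Definition on_intervals (R : realType) (n : {finite_measure set (measurableTypeR R) -> \bar R}) :
    set (ocitv_type R) -> \bar R := fun A => n A.

Section on_intervals.
Local Open Scope ereal_scope.
Context (R : realType) (n : {finite_measure set (measurableTypeR R) -> \bar R}).

Let mline (A : set (ocitv_type R)) : measurable A -> measurable (A : set (measurableTypeR R)).
Proof. exact: sub_sigma_algebra. Qed.

Let on0 : on_intervals n set0 = 0. Proof. exact: measure0. Qed.
Let on_ge0 A : 0 <= on_intervals n A. Proof. exact: measure_ge0. Qed.
Let on_sigma : measure_function.semi_sigma_additive (on_intervals n).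
Proof.
move=> F mF tF mU; apply: (@measure_semi_sigma_additive _ _ _ n F) => //.
- by move=> i; exact: mline.
- exact: mline.
Qed.

HB.instance Definition _ := isMeasure.Build _ (ocitv_type R) R (on_intervals n) on0 on_ge0 on_sigma.

Lemma on_intervals_sigma_finite : sigma_finite [set: ocitv_type R] (on_intervals n).
Proof.
have [F FT /all_and2[mF _]] := wlength_sigma_finite (@idfun R).
exists F => // k; split => //; rewrite /on_intervals.
by rewrite ltey_eq fin_num_measure//; exact: mline.
Qed.

(** The outer measure is an infimum over coverings by intervals, and an
    inequality on intervals passes to coverings. *)
Lemma mle_intervals (m : {finite_measure set (measurableTypeR R) -> \bar R}) :
  (forall a b : R, (a < b)%R -> m `]a, b]%classic <= n `]a, b]%classic) -> mle m n.
Proof.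
move=> h; apply: mleP => A mA.
have <- := measure_extension_unique on_intervals_sigma_finite (fun X mX => erefl (n X)) mA.
apply: le_ereal_inf_tmp => _ [F [mF AF] <-].
apply: (@le_trans _ _ (\sum_(k <oo) m (F k))).
  by apply: measure_sigma_subadditive => // i; exact: mline.
apply: lee_nneseries => [k _ _|k _]; first exact: measure_ge0.
have [[a b] _ <-] := mF k.
have [ab|ba] := ltP a b; first exact: h.
by rewrite set_itv_ge ?measure0 -?leNgt ?bnd_simp.
Qed.
End on_intervals.

Section poisson_kernel.
Context (R : realType).
Local Notation line := (measurableTypeR R).
Local Notation fmL := {finite_measure set line -> \bar R}.
Implicit Types (m n r q : fmL) (x y a b X : R).

(** The Poisson kernel, not normalized: its integrals over intervals are
    differences of arctangents. *)
Definition bump y : R := (1 + y ^+ 2)^-1.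

Lemma one_sqr_gt0 y : 0 < 1 + y ^+ 2.
Proof. by rewrite ltr_pwDl// sqr_ge0. Qed.

Lemma bump_ge0 y : 0 <= bump y. Proof. by rewrite invr_ge0 ltW// one_sqr_gt0. Qed.

Lemma bump_le1 y : bump y <= 1.
Proof. by rewrite invf_le1 ?one_sqr_gt0// lerDl sqr_ge0. Qed.

Lemma bm_bump d (T : measurableType d) (g : T -> R) : measurable_fun setT g ->
  bm (fun z : T => bump (g z)).
Proof.
move=> mg; split; last by exists 1 => z; rewrite ger0_norm ?bump_ge0// bump_le1.
rewrite /bump; apply: (measurableT_comp (@measurable_invR R)).
by apply: measurable_funD => //; under eq_fun do rewrite expr2; exact: measurable_funM.
Qed.

(** 2|z| <= 1 + z^2, at z = X y. *)
Lemma bump_moment X y : 0 < X -> 0 <= X * (`|y| * bump (X * y)) <= 2^-1.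
Proof.
move=> X0; rewrite !mulr_ge0 ?(ltW X0) ?bump_ge0//= mulrA -ler_pdivlMr; last first.
  by rewrite invr_gt0 one_sqr_gt0.
rewrite invrK -(gtr0_norm X0) -normrM (gtr0_norm X0) -(real_normK (num_real (X * y))).
by have := sqr_ge0 (`|X * y| - 1); rewrite sqrrB1; lra.
Qed.

Lemma bump_moment_cvg y : n.+1%:R * (`|y| * bump (n.+1%:R * y)) @[n --> \oo] --> (0 : R).
Proof.
have [->|y0] := eqVneq y 0.
  by under eq_fun do rewrite normr0 mul0r mulr0; exact: cvg_cst.
apply: (@squeeze_cvgr _ _ _ _ (fun=> 0) (fun k : nat => `|y|^-1 * k.+1%:R^-1) _); last 2 first.
- exact: cvg_cst.
- by rewrite -[X in _ --> X](mulr0 `|y|^-1); apply: cvgM; [exact: cvg_cst|exact: cvg_harmonic].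
apply: nearW => k; have k0 : 0 < k.+1%:R :> R by [].
have /andP[-> _] /= := bump_moment y k0.
have w0 : 0 < k.+1%:R * `|y| by rewrite mulr_gt0 ?normr_gt0.
rewrite /bump (_ : (k.+1%:R * y) ^+ 2 = (k.+1%:R * `|y|) ^+ 2); last first.
  by rewrite !exprMn real_normK ?num_real.
have -> : `|y|^-1 / k.+1%:R = (k.+1%:R * `|y|)^-1 by rewrite [RHS]invfM [RHS]mulrC.
rewrite mulrA.
move: (_ * `|y|) w0 => w w0; rewrite ler_pdivrMr ?one_sqr_gt0//.
by rewrite mulrDr mulr1 expr2 mulKf ?gt_eqF// lerDr invr_ge0 ltW.
Qed.

(** The kernel at scale X integrated over the centres in [a,b]. *)
Definition window X a b z : R := atan (X * (b - z)) - atan (X * (a - z)).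

Lemma measurable_atanR d (T : measurableType d) (g : T -> R) : measurable_fun setT g ->
  measurable_fun setT (fun z : T => atan (g z)).
Proof.
apply: measurableT_comp; apply: continuous_measurable_fun => x; exact: continuous_atan.
Qed.

Lemma norm_window X a b z : `|window X a b z| <= pi.
Proof.
have := atan_gtNpi2 (X * (b - z)); have := atan_ltpi2 (X * (b - z)).
have := atan_gtNpi2 (X * (a - z)); have := atan_ltpi2 (X * (a - z)); rewrite ler_norml /window => *.
by apply/andP; split; lra.
Qed.

Lemma bm_window X a b : bm (fun z : line => window X a b z).
Proof.
split; last by exists pi => z; exact: norm_window.
by apply: measurable_funB; apply: measurable_atanR; meas.
Qed.

Lemma RI_bump X a b z : 0 < X -> a <= b ->
  RI (lebr `[a, b]) (fun y : R => X * bump (X * (z - y))) = window X a b z.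
Proof.
move=> X0 ab; rewrite RI_lebr//; last 2 first.
- exact: leb_segment.
- by apply: bmM; [exact: bm_cst|apply: bm_bump; meas].
have dk y : is_derive y 1 (fun y => atan (X * (y - z))) (X * bump (X * (z - y))).
  have d1 : is_derive y 1 (fun y : R => X * (y - z)) X.
    by apply: dv_cvt (dvZ X (dvB (dv_id y) (dv_cst y z))) _; rewrite subr0 mulr1.
  apply: dv_cvt (dv_comp (is_derive1_atan _) d1) _.
  by rewrite mulrC /bump -(sqrrN (X * (z - y))) -mulrN opprB.
rewrite (@FTC_R _ (fun y => X * bump (X * (z - y))) (fun y => atan (X * (y - z))))//.
apply: is_derive_within_ex => y _.
have d2 : is_derive y 1 (fun y : R => 1 + (X * (z - y)) ^+ 2) (2 * (X * (z - y)) * - X).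
  have d1 : is_derive y 1 (fun y : R => X * (z - y)) (- X).
    by apply: dv_cvt (dvZ X (dvB (dv_cst y z) (dv_id y))) _; rewrite sub0r mulrN1.
  by under eq_fun do rewrite expr2; apply: dv_cvt (dvD (dv_cst y 1) (dvM d1 d1)) _; ring.
eexists; apply: dvZ; apply: (dv_comp (dv_inv _) d2).
by rewrite gt_eqF// one_sqr_gt0.
Qed.

Lemma atan_scale_cvg y : atan (n.+1%:R * y) @[n --> \oo] --> pi / 2 * sg y.
Proof.
have pos (z : R) : 0 < z -> atan (n.+1%:R * z) @[n --> \oo] --> pi / 2.
  move=> z0; apply: (cvg_comp _ _ _ (@cvgy_atan R)).
  apply/cvgryPge => A; near=> n.
  rewrite -ler_pdivrMr//; apply: (@le_trans _ _ n%:R); last by rewrite ler_nat.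
  by near: n; exact: nbhs_infty_ger.
rewrite /sg; case: eqP => [->|/eqP y0].
  by under eq_fun do rewrite mulr0 atan0; rewrite mulr0; exact: cvg_cst.
have [yn|yp] := ltP y 0; last by rewrite mulr1; apply: pos; rewrite lt_neqAle eq_sym y0.
rewrite (_ : (fun n : nat => _) = (fun n : nat => - atan (n.+1%:R * - y))); last first.
  by apply/funext => k; rewrite mulrN atanN opprK.
by rewrite mulrN1; apply: cvgN; apply: pos; rewrite oppr_gt0.
Unshelve. all: by end_near. Qed.

(** The pointwise limit of [window]: pi inside [a,b], half of it at the end
    points. *)
Definition soft_indic a b z : R := pi / 2 * (sg (b - z) - sg (a - z)).

Lemma window_cvg a b z : window n.+1%:R a b z @[n --> \oo] --> soft_indic a b z.
Proof. by rewrite /soft_indic mulrBr; apply: cvgB; exact: atan_scale_cvg. Qed.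

Section comparison.
Variables (m n r : fmL).
Hypothesis kernel_bound : forall X x, 0 < X ->
  RI m (fun z : line => bump (X * ((z : R) - x))) <=
  RI n (fun z : line => bump (X * ((z : R) - x))) +
  RI r (fun z : line => `|(z : R) - x| * bump (X * ((z : R) - x))).

Let G X (xz : R * line) : R := X * bump (X * ((xz.2 : R) - xz.1)).
Let E X (xz : R * line) : R := X * (`|(xz.2 : R) - xz.1| * bump (X * ((xz.2 : R) - xz.1))).

Let mdiff : measurable_fun setT (fun xz : R * line => (xz.2 : R) - xz.1).
Proof. by apply: measurable_funB; [exact: measurable_snd|exact: measurable_fst]. Qed.

Let bm_kernel X : bm (fun xz : R * line => bump (X * ((xz.2 : R) - xz.1))).
Proof. by apply: bm_bump; apply: measurable_funM. Qed.

Let bm_G X : bm (G X). Proof. by apply: bmM; [exact: bm_cst|exact: bm_kernel]. Qed.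

Let bm_E X : 0 < X -> bm (E X).
Proof.
move=> X0; split; last first.
  by exists 2^-1 => xz; have /andP[e0 e1] := bump_moment ((xz.2 : R) - xz.1) X0; rewrite ger0_norm.
apply: measurable_funM => //; apply: measurable_funM; last exact: (bm_kernel X).1.
exact: (measurableT_comp (@measurable_normR R)).
Qed.

Let swap q X a b : 0 < X -> a <= b -> RI q (fun z : line => window X a b z) =
  RI (lebr `[a, b]) (fun x : R => RI q (fun z => G X (x, z))).
Proof.
move=> X0 ab; rewrite RI_swap//; congr (RI _ _); apply/funext => z.
by rewrite /G /= RI_bump.
Qed.

Let kernel_section X x : bm (fun z : line => bump (X * ((z : R) - x))).
Proof. exact: (bm_sec x (bm_kernel X)). Qed.

Let window_bound X a b : 0 < X -> a <= b ->
  RI m (fun z : line => window X a b z) <= RI n (fun z : line => window X a b z) +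
    RI r (fun z => RI (lebr `[a, b]) (fun x : R => E X (x, z))).
Proof.
move=> X0 ab; have X0' := ltW X0; have bE := bm_E X0.
rewrite !swap// -RI_swap// -RID; [|exact: bm_RI|exact: bm_RI].
apply: le_RI => [||x]; [exact: bm_RI|by apply: bmD; exact: bm_RI|].
have bk := kernel_section X x.
have bk' : bm (fun z : line => `|(z : R) - x| * bump (X * ((z : R) - x))).
  have := bmM (bm_cst _ X^-1) (bm_sec x bE); rewrite /E/=.
  by under eq_fun do rewrite mulKf ?gt_eqF//.
by rewrite /G /E/= !RIZ// -mulrDr ler_wpM2l// kernel_bound.
Qed.

Let soft_bound a b : a <= b ->
  RI m (fun z : line => soft_indic a b z) <= RI n (fun z : line => soft_indic a b z).
Proof.
move=> ab.
have w0 q : RI q (fun z : line => window k.+1%:R a b z) @[k --> \oo] --> RI q (fun z : line => soft_indic a b z).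
  apply: (@cvg_RI _ _ _ _ _ _ pi) => [k||k z|z].
  - exact: (bm_window _ a b).1.
  - apply: measurable_funM => //; apply: measurable_funB;
      by apply: (measurableT_comp (@measurable_sg R)); meas.
  - exact: norm_window.
  - exact: window_cvg.
have bE k := @bm_E k.+1%:R (ltr0Sn R k).
have e0 : RI r (fun z => RI (lebr `[a, b]) (fun x : R => E k.+1%:R (x, z))) @[k --> \oo] --> (0 : R).
  have -> : 0 = RI r (fun=> 0) by rewrite RI_cst mul0r.
  have En k (x : R) (z : line) : `|E k.+1%:R (x, z)| <= 2^-1.
    by have /andP[h0 h1] := bump_moment ((z : R) - x) (ltr0Sn R k); rewrite ger0_norm.
  have bsec k z : bm (fun x : R => E k.+1%:R (x, z)).
    split; last by exists 2^-1 => x; exact: En.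
    by apply: (measurableT_comp (bE k).1); apply: measurable_fun_pair.
  apply: (@cvg_RI _ _ _ _ _ _ (2^-1 * mass (lebr `[a, b]))) => [k||k z|z].
  - have bs : bm (fun zx : line * R => E k.+1%:R (zx.2, zx.1)).
      split; last by exists 2^-1 => zx; exact: En.
      apply: (measurableT_comp (bE k).1).
      by apply: measurable_fun_pair; [exact: measurable_snd|exact: measurable_fst].
    exact: (bm_RI (lebr `[a, b]) bs).1.
  - exact: measurable_cst.
  - exact: RI_bound.
  have -> : 0 = RI (lebr `[a, b]) (fun=> 0) by rewrite RI_cst mul0r.
  apply: (@cvg_RI _ _ _ _ _ _ 2^-1) => [k||k x|x]; [exact: (bsec k z).1|exact: measurable_cst|exact: En|].
  exact: bump_moment_cvg.
have H : (fun k => RI n (fun z : line => window k.+1%:R a b z) +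
    RI r (fun z => RI (lebr `[a, b]) (fun x : R => E k.+1%:R (x, z)))) @ \oo -->
    RI n (fun z : line => soft_indic a b z).
  by rewrite -[X in _ --> X]addr0; apply: cvgD; [exact: w0|exact: e0].
apply: ler_cvg_to (w0 m) H _; apply: nearW => k; exact: window_bound.
Qed.

Let sg_right (c z : R) : sg (c + k.+1%:R^-1 - z) @[k --> \oo] --> (if z <= c then 1 else -1 : R).
Proof.
have [zc|cz] := leP z c.
  rewrite (_ : (fun k : nat => _) = (fun=> 1)); first exact: cvg_cst.
  apply/funext => k; have k0 : 0 < k.+1%:R^-1 :> R by rewrite invr_gt0.
  have h : 0 < c + k.+1%:R^-1 - z by rewrite subr_gt0 (le_lt_trans zc)// ltrDl.
  by rewrite /sg gt_eqF// ltNge ltW.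
apply: cvg_near_cst.
have zc : 0 < z - c by rewrite subr_gt0.
have /cvgrPdist_lt/(_ _ zc) := @cvg_harmonic R.
apply: filterS => k; rewrite sub0r normrN gtr0_norm ?invr_gt0// => kz.
have {}kz : k.+1%:R^-1 < z - c by exact: kz.
have h : c + k.+1%:R^-1 - z < 0 by move: kz; move: (_^-1) => w; lra.
by rewrite /sg lt_eqF// h.
Qed.

(** Integrating the hypothesis over the centres x in [a,b] and letting X
    tend to infinity, the first moment disappears and the kernel tends to
    the indicator of [a,b] with half weights at the end points. Shifting the
    interval to the right by 1/k removes the half weights and gives half-
    open intervals. *)
Lemma mle_kernel : mle m n.
Proof.
apply: mle_intervals => a b ab.
have mI : measurable (`]a, b]%classic : set line) by exact: (@measurable_itv R).
have lim q : RI q (fun z : line => soft_indic (a + k.+1%:R^-1) (b + k.+1%:R^-1) z) @[k --> \oo] -->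
    pi * RI q \1_(`]a, b]%classic).
  rewrite -RIZ; last exact: bm_indic.
  apply: (@cvg_RI _ _ _ _ _ _ pi) => [k||k z|z].
  - apply: measurable_funM => //; apply: measurable_funB;
      by apply: (measurableT_comp (@measurable_sg R)); meas.
  - by apply: measurable_funM => //; exact: measurable_indic.
  - have p0 : 0 <= pi / 2 :> R by rewrite divr_ge0// pi_ge0.
    rewrite /soft_indic normrM (ger0_norm p0).
    apply: (@le_trans _ _ (pi / 2 * 2)); last by rewrite divfK.
    rewrite ler_wpM2l// (le_trans (ler_normB _ _))//.
    by rewrite (_ : 2 = 1 + 1 :> R) ?lerD ?norm_sg.
  have -> : pi * \1_(`]a, b]%classic) z = pi / 2 * ((if z <= b then 1 else -1) - (if z <= a then 1 else -1)) :> R.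
    rewrite indicE (_ : (z \in _) = (a < z <= b)); last by apply/idP/idP; rewrite inE/= in_itv.
    by have [za|za] := leP z a; have [zb|zb] := leP z b; rewrite /=; lra.
  by rewrite /soft_indic; apply: cvgM; [exact: cvg_cst|apply: cvgB; exact: sg_right].
rewrite !(measure_RI _ mI) lee_fin -(ler_pM2l (pi_gt0 R)).
apply: ler_cvg_to (lim m) (lim n) _; apply: nearW => k; apply: soft_bound.
by rewrite lerD2r ltW.
Qed.
End comparison.
End poisson_kernel.

(** * Averages of Fourier transforms, relaxation, injectivity *)

Section laplace_kernel.
Context (R : realType).
Local Notation H := (freq R).
Local Notation fmH := {finite_measure set H -> \bar R}.
Local Notation unif := (unif R).
Implicit Types (p q : fmH) (x y a b X t : R).

Lemma bm_cosln y : bm (fun t : R => cos (y * ln t)).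
Proof. by apply: bm_cos; apply: measurable_funM => //; exact: measurable_ln. Qed.

Lemma is_derive_cosln y t : 0 < t ->
  is_derive t 1 (fun t => bump y * (t * (cos (y * ln t) + y * sin (y * ln t)))) (cos (y * ln t)).
Proof.
move=> t0; have dl : is_derive t 1 (fun t => y * ln t) (y * t^-1).
  by apply: dvZ; exact: is_derive1_ln.
have dc := @dv_comp _ cos (fun t => y * ln t) _ _ _ (is_derive_cos (y * ln t)) dl.
have ds := @dv_comp _ sin (fun t => y * ln t) _ _ _ (is_derive_sin (y * ln t)) dl.
apply: dv_cvt (dvZ (bump y) (dvM (dv_id t) (dvD dc (dvZ y ds)))) _.
have h := lt0r_neq0 (one_sqr_gt0 y).
by rewrite /bump; field; rewrite h (lt0r_neq0 t0).
Qed.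

(** The Laplace transform of the cosine: with t = e^{-s}, the kernel is the
    integral of e^{-s} cos(y s). The interval is cut at 1/n because the
    integrand oscillates at t = 0. *)
Lemma bump_unif y : RI unif (fun t : R => cos (y * ln t)) = bump y.
Proof.
pose d n : R := n.+1%:R^-1.
have d0 n : 0 < d n by rewrite invr_gt0.
have d1 n : d n <= 1 by rewrite invf_le1 ?ler1n.
pose f (n : nat) (t : R) : R := if d n <= t then cos (y * ln t) else 0.
have bf n : bm (f n).
  split; first by apply: measurable_fun_ifT => //; [exact: measurable_fun_ler|exact: (bm_cosln y).1].
  by exists 1 => t; rewrite /f; case: ifP => _; rewrite ?norm_cos// normr0.
have fE n : RI unif (f n) = bump y - bump y * (d n * (cos (y * ln (d n)) + y * sin (y * ln (d n)))).
  rewrite RI_unif//.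
  have -> : \int[@lebesgue_measure R]_(t in `[0, 1]) f n t = \int[@lebesgue_measure R]_(t in `[d n, 1]) cos (y * ln t).
    rewrite [RHS]Rintegral_mkcond [LHS]Rintegral_mkcond; congr Rintegral; apply/funext => t.
    rewrite !patchE !mem_setE/= !in_itv/= /f.
    have := d0 n; case: (leP (d n) t) => [dt|_]; last by rewrite if_same.
    by move=> dn0; rewrite (le_trans (ltW dn0) dt).
  have dF (t : R) : t \in `[d n, 1] ->
      is_derive t 1 (fun t => bump y * (t * (cos (y * ln t) + y * sin (y * ln t)))) (cos (y * ln t)).
    by rewrite in_itv/= => /andP[dt _]; apply: is_derive_cosln; exact: lt_le_trans dt.
  have cF : {within `[d n, 1], continuous (fun t : R => cos (y * ln t))}.
    apply: is_derive_within_ex => t; rewrite in_itv/= => /andP[dt _].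
    have dl : is_derive t 1 (fun t => y * ln t) (y * t^-1).
      by apply: dvZ; apply: is_derive1_ln; exact: lt_le_trans dt.
    by eexists; exact: (@dv_comp _ cos (fun t => y * ln t) _ _ _ (is_derive_cos (y * ln t)) dl).
  by rewrite (FTC_R (d1 n) dF cF) ln1 mulr0 cos0 sin0 mulr0 addr0 !mulr1.
pose g (t : R) : R := if 0 < t then cos (y * ln t) else 0.
have mg : measurable_fun setT g.
  by apply: measurable_fun_ifT => //; [exact: measurable_fun_ltr|exact: (bm_cosln y).1].
have bg : bm g by split=> //; exists 1 => t; rewrite /g; case: ifP => _; rewrite ?norm_cos// normr0.
have gE : RI unif (fun t : R => cos (y * ln t)) = RI unif g.
  rewrite !RI_unif//; last exact: bm_cosln.
  have I01 : (@lebesgue_measure R `]0%R, 1%R] < +oo)%E by rewrite lebesgue_measure_itv/= lte01 ltry.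
  rewrite -!Rintegral_itv_obnd_cbnd; last 2 first.
  - by apply: bm_leb_integrable.
  - by apply: bm_leb_integrable => //; exact: bm_cosln.
  apply: eq_Rintegral => t; rewrite inE/= in_itv/= => /andP[t0 _].
  by rewrite /g t0.
have l1 : RI unif (f n) @[n --> \oo] --> RI unif g.
  apply: (@cvg_RI _ _ _ _ _ _ 1) => [n|//|n t|t]; first exact: (bf n).1.
    by rewrite /f; case: ifP => _; rewrite ?norm_cos// normr0.
  rewrite /f /g; have [t0|t0] := ltP 0 t.
    apply: cvg_near_cst.
    have /cvgrPdist_lt/(_ _ t0) := @cvg_harmonic R.
    apply: filterS => n; rewrite sub0r normrN gtr0_norm ?invr_gt0// => nt.
    by rewrite (ltW (nt : d n < t)).
  rewrite (_ : (fun n : nat => _) = (fun=> 0)); first exact: cvg_cst.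
  by apply/funext => n; rewrite leNgt (le_lt_trans t0 (d0 n)).
have l2 : RI unif (f n) @[n --> \oo] --> bump y.
  have lim (s : R) : bump y + s * d n @[n --> \oo] --> bump y.
    rewrite -[X in _ --> X](addr0 (bump y)) -(mulr0 s); apply: cvgD; first exact: cvg_cst.
    by apply: cvgM; [exact: cvg_cst|exact: cvg_harmonic].
  apply: (@squeeze_cvgr _ _ _ _ (fun n : nat => bump y + - (1 + `|y|) * d n) (fun n : nat => bump y + (1 + `|y|) * d n) _);
    [|exact: lim|exact: lim].
  apply: nearW => n; rewrite fE.
  set w := cos _ + y * sin _.
  have w1 : `|w| <= 1 + `|y|.
    rewrite (le_trans (ler_normD _ _))// lerD ?norm_cos// normrM ler_piMr// norm_sin//.
  have : `|bump y * (d n * w)| <= (1 + `|y|) * d n.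
    rewrite !normrM (ger0_norm (bump_ge0 y)) (gtr0_norm (d0 n)).
    apply: (@le_trans _ _ (1 * (d n * `|w|))).
      by apply: ler_wpM2r; [rewrite mulr_ge0// ltW|exact: bump_le1].
    by rewrite mul1r mulrC ler_wpM2r// ltW.
  rewrite ler_norml => /andP[h1 h2]; rewrite mulNr; apply/andP; split; lra.
by rewrite gE; apply: cvg_unique l1 l2.
Qed.
(** The Laplace transform representation of the kernel turns a local average
    in frequency into an average of values of the function. *)
Lemma bump_transform q b x X :
  RI (symm q) (fun h => cos (phase h + b) * bump (X * (xi h - x))) =
  RI unif (fun t : R => cos (b - X * ln t * x) * ev q (X * ln t) 0 0 +
                        cos (b + X * ln t * x) * ev q (- (X * ln t)) 0 0).
Proof.
pose G (ht : H * R) : R := cos (phase ht.1 + b) * cos (X * (xi ht.1 - x) * ln ht.2).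
have mln d (T : measurableType d) (u : T -> R) : measurable_fun setT u ->
    measurable_fun setT (fun z : T => ln (u z)).
  by apply: measurableT_comp; exact: measurable_ln.
have bG : bm G.
  apply: bmM; apply: bm_cos; first by hmeas.
  by apply: measurable_funM; [hmeas|apply: mln; exact: measurable_snd].
have -> : RI (symm q) (fun h => cos (phase h + b) * bump (X * (xi h - x))) =
    RI (symm q) (fun h => RI unif (fun t => G (h, t))).
  congr (RI _ _); apply/funext => h; rewrite /G/= RIZ; last exact: bm_cosln.
  by rewrite bump_unif.
rewrite RI_swap//; congr (RI _ _); apply/funext => t; rewrite /G/=.
set a := X * ln t.
have bc (c e : R) : bm (fun h : H => cos (xi h * c + phase h + e)) by apply: bm_cos; hmeas.
rewrite (_ : (fun h => _) = (fun h : H => 2^-1 * cos (xi h * a + phase h + (b - a * x)) +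
    2^-1 * cos (xi h * (- a) + phase h + (b + a * x)))); last first.
  apply/funext => h.
  have -> : X * (xi h - x) * ln t = a * (xi h - x) by rewrite /a; ring.
  have -> : xi h * a + phase h + (b - a * x) = (phase h + b) + a * (xi h - x) by ring.
  have -> : xi h * - a + phase h + (b + a * x) = (phase h + b) - a * (xi h - x) by ring.
  by rewrite (cosD (phase h + b)) (cosB (phase h + b)); field.
rewrite RID; [|by apply: bmM => //; exact: bm_cst|by apply: bmM => //; exact: bm_cst].
by rewrite !RIZ// !RI_symm_cos; field.
Qed.

End laplace_kernel.

Section linear_ode.
Context (R : realType).
Implicit Types (z dz : R -> R).

(** [z] relaxes at rate [A] towards a region of size [b]: the weight e^{As}
    makes b + s rho -+ z increasing. *)
Lemma relaxation_bound z dz (A b rho t : R) : 0 <= A -> 0 <= b -> 0 <= rho -> 0 < t ->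
  (forall s : R, 0 < s -> is_derive s 1 z (dz s)) ->
  (forall s : R, 0 < s -> `|dz s + A * z s| <= A * b + rho) ->
  (forall e : R, 0 < e -> exists s : R, 0 < s <= t /\ `|z s| <= e) ->
  `|z t| <= b + t * rho.
Proof.
move=> A0 b0 rho0 t0.
suff key z1 dz1 : (forall s : R, 0 < s -> is_derive s 1 z1 (dz1 s)) ->
    (forall s : R, 0 < s -> dz1 s + A * z1 s <= A * b + rho) ->
    (forall e : R, 0 < e -> exists s : R, 0 < s <= t /\ `|z1 s| <= e) ->
    z1 t <= b + t * rho.
  move=> dzE bz lim; rewrite ler_norml lerNl; apply/andP; split.
    apply: (key (fun s => - z s) (fun s => - dz s)).
    - by move=> s s0; apply: dvN; exact: dzE.
    - by move=> s s0; have := bz s s0; rewrite ler_norml => /andP[+ _]; lra.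
    - by move=> e e0; have [s [? ?]] := lim e e0; exists s; rewrite normrN.
  apply: (key z dz) => // s s0.
  by have := bz s s0; rewrite ler_norml => /andP[].
move=> dzE bz lim.
have dE (s : R) : is_derive s 1 (fun s : R => expR (A * s)) (A * expR (A * s)).
  have d1 : is_derive s 1 (fun s : R => A * s) A by apply: dv_cvt (dvZ A (dv_id s)) _; rewrite mulr1.
  by apply: dv_cvt (dv_comp (is_derive_expR _) d1) _; rewrite mulrC.
have mono s : 0 < s -> s <= t ->
    expR (A * s) * (b + s * rho - z1 s) <= expR (A * t) * (b + t * rho - z1 t).
  move=> s0 st.
  apply: (@deriv_ge0_le _ (fun s => expR (A * s) * (b + s * rho - z1 s))
    (fun s => expR (A * s) * (A * (b + s * rho) + rho - (dz1 s + A * z1 s))) s t st);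
    move=> r /[!in_itv]/= /andP[sr _].
    have r0 : 0 < r by exact: lt_le_trans sr.
    have dl : is_derive r 1 (fun s : R => b + s * rho) rho.
      by apply: dv_cvt (dvD (dv_cst r b) (dvM (dv_id r) (dv_cst r rho))) _; ring.
    by apply: dv_cvt (dvM (dE r) (dvB dl (dzE r r0))) _; ring.
  have r0 : 0 < r by exact: lt_le_trans sr.
  apply: mulr_ge0; first exact: expR_ge0.
  have := bz r r0; have : 0 <= A * (r * rho) by rewrite !mulr_ge0// ltW.
  by lra.
rewrite leNgt; apply/negP => tz.
pose c := expR (A * t) * (z1 t - (b + t * rho)).
have c0 : 0 < c by rewrite mulr_gt0 ?expR_gt0// subr_gt0.
have E1 : 1 <= expR (A * t) by rewrite -expR0 ler_expR mulr_ge0// ltW.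
have Et0 : 0 < expR (A * t) by exact: expR_gt0.
have [|s [/andP[s0 st] zs]] := lim (c / (2 * expR (A * t))).
  by rewrite divr_gt0// mulr_gt0.
have := mono s s0 st; rewrite -[leRHS]opprK -mulrN opprB -/c => H.
have Es0 := expR_gt0 (A * s).
have Est : expR (A * s) <= expR (A * t) by rewrite ler_expR ler_wpM2l.
have e0 : 0 <= c / (2 * expR (A * t)) by rewrite ltW// divr_gt0// mulr_gt0.
have eE : c / (2 * expR (A * t)) * expR (A * t) = c / 2 by field; rewrite lt0r_neq0.
move: zs; rewrite ler_norml => /andP[_ zs].
have srho : 0 <= s * rho by rewrite mulr_ge0// ltW.
move: (c / (2 * _)) e0 eE zs => e e0 eE zs.
have h1 : expR (A * s) * - e <= expR (A * s) * (b + s * rho - z1 s).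
  by rewrite ler_wpM2l ?(ltW Es0)//; lra.
have h2 : expR (A * s) * e <= expR (A * t) * e by rewrite ler_wpM2r.
by lra.
Qed.
End linear_ode.

Section transform_injective.
Context (R : realType).
Local Notation H := (freq R).
Local Notation fmH := {finite_measure set H -> \bar R}.
Local Notation line := (measurableTypeR R).
Local Notation fmL := {finite_measure set line -> \bar R}.
Implicit Types (p q e r : fmH) (b : R).

Lemma bm_bump_xi (X x : R) : bm (fun y : line => bump (X * ((y : R) - x))).
Proof. by apply: bm_bump; meas. Qed.

Lemma RI_twist_phased b q (g : line -> R) : bm g ->
  RI (marg (phased b (symm q))) g =
  RI (marg (symm q)) g + RI (symm q) (fun h => cos (phase h + b) * g (xi h)).
Proof.
move=> bg; have bx := bm_xi bg; have bt := bm_twist b bg.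
rewrite !RI_marg// RI_phased// -RID//.
by congr (RI _ _); apply/funext => h; ring.
Qed.

(** The signed density cos(theta + b) is a difference of two positive measures, to
    which the comparison of local averages applies in both directions. *)
Lemma bump_bound q e r :
  (forall b X x : R, 0 < X ->
    `|RI (symm q) (fun h => cos (phase h + b) * bump (X * (xi h - x)))| <=
    RI e (fun h => bump (X * (xi h - x))) +
    RI r (fun h => `|xi h - x| * bump (X * (xi h - x)))) ->
  forall b, mle (marg (phased b (symm q))) (madd (marg (symm q)) (marg e)) /\
            mle (marg (symm q)) (madd (marg (phased b (symm q))) (marg e)).
Proof.
move=> h b; have bk X x := @bm_bump_xi X x.
have bk' X x : 0 < X -> bm (fun y : line => `|(y : R) - x| * bump (X * ((y : R) - x))).
  move=> X0; split; first by apply: measurable_funM; [meas|exact: (bk X x).1].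
  exists (X^-1 * 2^-1) => y; have /andP[_ h1] := bump_moment ((y : R) - x) X0.
  by rewrite ger0_norm ?mulr_ge0 ?bump_ge0// ler_pdivlMl.
split; apply: (@mle_kernel _ _ _ (marg r)) => X x X0; have {h} := h b X x X0;
  rewrite ler_norml => /andP[h1 h2];
  rewrite RI_madd// !RI_twist_phased// (@RI_marg _ e)// (@RI_marg _ r)//; try exact: bk'.
  by rewrite -addrA lerD2l.
by lra.
Qed.

Lemma eq_RI d (T : measurableType d) (m n : {finite_measure set T -> \bar R}) (g : T -> R) :
  (forall f, nnm f -> (\int[m]_x f x = \int[n]_x f x)%E) -> bm g -> RI m g = RI n g.
Proof.
move=> mn bg; have near : near_by m n (nullm R T).
  by move=> f nf; rewrite nullmE !adde0 mn.
apply/eqP; rewrite -subr_eq0 -normr_le0; apply: le_trans (near_RI near bg) _.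
have [_ [C hC]] := bg; rewrite (le_trans (ler_norm _))//.
rewrite (le_trans (@RI_bound _ _ _ (nullm R T) _ C (bm_norm bg) _))//.
  by move=> x; rewrite normr_id.
by rewrite /mass mulr0.
Qed.

Lemma ev_twist p x : ev p x 0 0 =
  RI p (fun h => cos (phase h + 0) * cos (xi h * x)) +
  RI p (fun h => cos (phase h + pi / 2) * sin (xi h * x)).
Proof.
have bc : bm (fun y : line => cos ((y : R) * x)) by apply: bm_cos; meas.
have bs : bm (fun y : line => sin ((y : R) * x)) by apply: bm_sin; meas.
rewrite -RID; [|exact: (bm_twist 0 bc)|exact: (bm_twist (pi / 2) bs)].
congr (RI _ _); apply/funext => h.
by rewrite /arg mulr0 subr0 !addr0 !cosD cos_pihalf sin_pihalf; ring.
Qed.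

Section vanishing.
Variable Q : fmH.
Hypothesis Q0 : forall x, ev Q x 0 0 = 0.

Lemma phased_vanishing b (f : line -> \bar R) : nnm f ->
  (\int[marg (phased b (symm Q))]_y f y = \int[marg (symm Q)]_y f y)%E.
Proof.
move=> nf.
have [|h1 h2] := @bump_bound Q (nullm R H) (nullm R H) _ b.
  move=> b' X x X0; rewrite bump_transform.
  under eq_fun do rewrite !Q0 !mulr0 addr0.
  by rewrite RI_cst mul0r normr0 addr_ge0// RI_ge0// => h; rewrite ?mulr_ge0// ?bump_ge0.
have n0 : (\int[marg (nullm R H)]_y f y = 0)%E by rewrite margE// nullmE.
apply/eqP; rewrite eq_le; apply/andP; split.
  by apply: le_trans (h1 f nf) _; rewrite maddE// n0 adde0.
by apply: le_trans (h2 f nf) _; rewrite maddE// n0 adde0.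
Qed.

(** If a function vanishes, so do all its local averages in frequency, hence
    the signed measure on the line that represents it; this remains true
    after multiplication by |xi|. *)
Lemma ev_absxi_vanishing x : (\int[Q]_h (absxi h)%:E < +oo)%E -> ev (dens absxi Q) x 0 0 = 0.
Proof.
move=> fin.
have tw b (g : line -> R) : bm g ->
    RI (symm (dens absxi Q)) (fun h => cos (phase h + b) * g (xi h)) = 0.
  move=> bg; apply: (@addrI _ (RI (marg (symm (dens absxi Q))) g)).
  rewrite -RI_twist_phased// addr0; apply: eq_RI => // f nf.
  have nx := nnm_xi nf; have na := @nnm_absxi R.
  have nl : nnm (fun y : line => (`|y : R|%:E * f y)%E) by apply: nnmM => //; exact: nnm_absline.
  have nph : nnm (fun h : H => (1 + cos (phase h + b))%:E).
    by apply: nnm_bm; [exact: bm_phased|exact: phased_ge0].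
  rewrite !margE// phasedE// !symm_absxi//; last exact: nnmM.
  have := phased_vanishing b nl; rewrite !margE//.
  rewrite phasedE; last exact: (nnm_xi nl).
  by move=> <-; apply: eq_integral => h _; rewrite muleCA.
have bc : bm (fun y : line => cos ((y : R) * x)) by apply: bm_cos; meas.
have bs : bm (fun y : line => sin ((y : R) * x)) by apply: bm_sin; meas.
have := RI_symm_cos (dens absxi Q) x 0; rewrite cos0 mulr1.
rewrite (_ : (fun h => _) = (fun h : H => cos (phase h + 0) * cos (xi h * x) + cos (phase h + pi / 2) * sin (xi h * x))).
  rewrite RID; [|exact: (bm_twist 0 bc)|exact: (bm_twist (pi / 2) bs)].
  by rewrite (tw 0 _ bc) (tw (pi / 2) _ bs) addr0 => /esym/eqP; rewrite mulf_eq0 pnatr_eq0/= => /eqP.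
by apply/funext => h; rewrite !addr0 !cosD cos_pihalf sin_pihalf; ring.
Qed.
End vanishing.

Local Open Scope ereal_scope.

Lemma absxi_diff_fin p q : \int[p]_h (absxi h)%:E < +oo -> \int[q]_h (absxi h)%:E < +oo ->
  \int[madd p (shiftm pi q)]_h (absxi h)%:E < +oo.
Proof.
move=> pf qf; have na := @nnm_absxi R; rewrite maddE// shiftm.unlock pushfE//; last exact: measurable_shiftm.
by rewrite lte_add_pinfty.
Qed.

Lemma ev_absxi_diff p q x : \int[p]_h (absxi h)%:E < +oo -> \int[q]_h (absxi h)%:E < +oo ->
  ev (dens absxi (madd p (shiftm pi q))) x 0%R 0%R =
  (ev (dens absxi p) x 0%R 0%R - ev (dens absxi q) x 0%R 0%R)%R.
Proof.
move=> pf qf; rewrite -ev_diff; apply: eq_RI; last exact: bm_carg.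
have na := @nnm_absxi R; have ma := @measurable_absxi R; have a0 (h : H) : (0 <= absxi h)%R := normr_ge0 _.
move=> f nf; have naf : nnm (fun h : H => (absxi h)%:E * f h) by exact: nnmM.
have ns : nnm (fun h : H => f (mkfreq (xi h) (eta h) (phase h + pi)%R)).
  by apply: nnm_comp nf; exact: measurable_shiftm.
rewrite densE//; last exact: absxi_diff_fin.
rewrite !maddE// shiftm.unlock !pushfE//; try exact: measurable_shiftm.
by rewrite !densE.
Qed.

Lemma ev_absxi_inj p q x : \int[p]_h (absxi h)%:E < +oo -> \int[q]_h (absxi h)%:E < +oo ->
  (forall y, ev p y 0%R 0%R = ev q y 0%R 0%R) ->
  ev (dens absxi p) x 0%R 0%R = ev (dens absxi q) x 0%R 0%R.
Proof.
move=> pf qf pq; apply/eqP; rewrite -subr_eq0 -ev_absxi_diff//; apply/eqP.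
apply: ev_absxi_vanishing; last exact: absxi_diff_fin.
by move=> y; rewrite ev_diff pq subrr.
Qed.

(** A function with two Fourier measures has the same Lambda for both, so
    that Lambda can be computed on any phase-space measure of the function. *)
Lemma is_Lambda_E (u w : R -> R) p x : \int[p]_h (absxi h)%:E < +oo ->
  (forall y, ev p y 0%R 0%R = u y) -> is_Lambda u w -> w x = ev (dens absxi p) x 0%R 0%R.
Proof.
move=> pf pu [nu [nu' [un wn' nint nuE]]].
have na := @nnm_absline R.
have fin (k : fmL) : (forall f : line -> \bar R, nnm f -> \int[k]_y f y <= \int[Defs.total_variation nu]_y f y) ->
    \int[k]_y (`|y : R|)%:E < +oo.
  move=> h; apply: le_lt_trans (h _ na) _.
  by move/integrableP : nint => [_]; under eq_integral do rewrite /= normr_id.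
have v := @variation_le _ nu.
have f1 := fin _ (fun f nf => let: And4 h _ _ _ := v f nf in h).
have f2 := fin _ (fun f nf => let: And4 _ h _ _ := v f nf in h).
have f3 := fin _ (fun f nf => let: And4 _ _ h _ := v f nf in h).
have f4 := fin _ (fun f nf => let: And4 _ _ _ h := v f nf in h).
have lf : \int[lift_line nu]_h (absxi h)%:E < +oo.
  rewrite quadE; last exact: nnm_absxi.
  rewrite lte_mul_pinfty ?lee_fin ?invr_ge0 ?(ltW (twopi_gt0 R))//.
  by apply: lte_add_pinfty; apply: lte_add_pinfty.
rewrite -(ev_lift_line x wn').
rewrite (@ev_absxi_inj p (lift_line nu))//; last by move=> y; rewrite pu (ev_lift_line y un).
have ma : measurable_fun setT (fun y : line => `|y : R|%R) by meas.
pose d (k : fmL) : fmL := dens (fun y : line => `|y : R|%R) k.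
have dE (k : fmL) f : \int[k]_y (`|y : R|)%:E < +oo -> nnm f ->
    \int[d k]_y f y = \int[k]_y ((`|y : R|)%:E * f y) by move=> kf nf; rewrite densE.
pose q' := quad (d (pvar (re_part nu))) (d (nvar (re_part nu))) (d (pvar (im_part nu))) (d (nvar (im_part nu))).
have -> : ev (dens absxi (lift_line nu)) x 0%R 0%R = ev q' x 0%R 0%R.
  apply: eq_RI; last exact: bm_carg.
  move=> f nf; have naf : nnm (fun h : H => (absxi h)%:E * f h) by apply: nnmM => //; exact: nnm_absxi.
  have nl b : nnm (fun y : line => f (mkfreq (y : R) 0%R b)).
    by apply: nnm_comp nf; exact: measurable_line_mk.
  rewrite densE//; [|exact: measurable_absxi|by move=> h; exact: normr_ge0].
  by rewrite !quadE// !dE.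
have dset (k : fmL) (A : set line) : \int[k]_y (`|y : R|)%:E < +oo -> measurable A ->
    d k A = \int[k]_(y in A) (`|y : R|)%:E.
  move=> kf mA; rewrite measureE// dE//; last exact: nnm_indic.
  rewrite [RHS]integral_mkcond; apply: eq_integral => y _.
  by rewrite patchE indicE; case: (y \in A); rewrite ?mule1 ?mule0.
have reE (A : set line) : measurable A ->
    re_part nu' A = d (pvar (re_part nu)) A - d (nvar (re_part nu)) A.
  move=> mA; have [-> _] := nuE A mA; rewrite !dset//.
  by apply: (@charge_integral_ge0 _ _ _ _ (pvar (re_part nu)) (nvar (re_part nu))) => //; exact: pvar_nvar.
have imE (A : set line) : measurable A ->
    im_part nu' A = d (pvar (im_part nu)) A - d (nvar (im_part nu)) A.
  move=> mA; have [_ ->] := nuE A mA; rewrite !dset//.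
  by apply: (@charge_integral_ge0 _ _ _ _ (pvar (im_part nu)) (nvar (im_part nu))) => //; exact: pvar_nvar.
have key b (g : line -> R) : bm g -> RI (lift_line nu') (fun h => cos (phase h + b) * g (xi h))%R =
    RI q' (fun h => cos (phase h + b) * g (xi h))%R.
  move=> bg; apply: (mulfI (lt0r_neq0 (twopi_gt0 R))).
  by rewrite RI_lift_line// RI_quad// (charge_integral_bm reE bg) (charge_integral_bm imE bg).
have bc : bm (fun y : line => cos ((y : R) * x)) by apply: bm_cos; meas.
have bs : bm (fun y : line => sin ((y : R) * x)) by apply: bm_sin; meas.
by rewrite !ev_twist (key _ _ bc) (key _ _ bs).
Qed.
End transform_injective.

(** * The difference of two solutions *)

Section uniqueness.
Context (R : realType).
Local Notation H := (freq R).
Local Notation fmH := {finite_measure set H -> \bar R}.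
Local Notation line := (measurableTypeR R).
Local Notation fmL := {finite_measure set line -> \bar R}.
Implicit Types (p q e : fmH).

Lemma wle_mono b p P Q : wle b p P -> mle P Q -> @wle R b p Q.
Proof. by move=> w PQ f nf; apply: le_trans (w f nf) (PQ f nf). Qed.

Lemma wle_shiftm b c p P : 0 <= b -> wle b p P -> @wle R b (shiftm c p) (shiftm c P).
Proof.
move=> b0 w; rewrite !shiftm.unlock; by apply: wle_pushf => //; exact: measurable_shiftm.
Qed.

(** The kernel k tames the unbounded weight |xi|. *)
Lemma RI_symm_absxi p b (k : line -> R) : (\int[p]_h (absxi h)%:E < +oo)%E ->
  bm k -> (forall x, 0 <= k x) -> bm (fun x : line => `|x : R| * k x) ->
  RI (symm (dens absxi p)) (fun h => cos (phase h + b) * k (xi h)) =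
  RI (symm p) (fun h => cos (phase h + b) * (absxi h * k (xi h))).
Proof.
move=> fin bk k0 bak.
have bp := @bm_phased R b; have bkx := bm_xi bk; have bakx := bm_xi bak.
have pos (g : H -> R) : bm g -> (forall h, 0 <= g h) -> bm (fun h => absxi h * g h) ->
    RI (symm (dens absxi p)) g = RI (symm p) (fun h => absxi h * g h).
  move=> bg g0 bag; apply: EFin_inj; rewrite !RI_E// symm_absxi//; last exact: nnm_bm.
have b1 : bm (fun h : H => (1 + cos (phase h + b)) * k (xi h)) by exact: bmM.
have b2 : bm (fun h : H => absxi h * ((1 + cos (phase h + b)) * k (xi h))).
  by under eq_fun do rewrite mulrCA; apply: bmM.
have e1 := pos _ b1 (fun h => mulr_ge0 (phased_ge0 b h) (k0 _)) b2.
have e2 := pos _ bkx (fun h => k0 _) bakx.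
have -> : (fun h : H => cos (phase h + b) * k (xi h)) =
    (fun h => (1 + cos (phase h + b)) * k (xi h) - k (xi h)) by apply/funext => h; ring.
rewrite RIB// e1 e2 -RIB//.
by congr (RI _ _); apply/funext => h; ring.
Qed.

Variables (al gam kap a : R) (P : fmH) (v1 v2 : R -> R -> R) (p1 p2 : R -> fmH).
Local Notation c := (2 * al).
Local Notation Tm := (Tm kap).
Local Notation Em := (Em kap).
Hypotheses (al0 : 0 < al) (gam0 : 0 <= gam) (a0 : 0 <= a) (a4 : 17 * a <= 4^-1).
Hypothesis contr : gam / c * (64 * (17 * a) ^+ 2) <= 2^-1.
Hypothesis Pa : (P setT <= a%:E)%E.
Definition represents (v : R -> R -> R) (p : R -> fmH) :=
  (forall t x : R, 0 <= t -> ev (p t) x 0 0 = v t x) /\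
  (forall t : R, 0 <= t -> wle (al * t) (p t) P).
(** The equation satisfied by v. The nonlinear term may be computed on any
    measure of v(t), not only on the given one; uniqueness depends on this
    freedom. *)
Definition evolves (v : R -> R -> R) (p : R -> fmH) := forall (t : R) (p' P' : fmH) (b : R), 0 < t -> 0 < b -> small p' -> small P' ->
  wle b p' P' -> (forall x, ev p' x 0 0 = v t x) -> forall x : R,
  is_derive t 1 (v ^~ x) (gam * ev (dens absxi (Tm p')) x 0 0 - c * ev (dens absxi (p t)) x 0 0).
Hypotheses (r1 : represents v1 p1) (r2 : represents v2 p2) (e1 : evolves v1 p1) (e2 : evolves v2 p2).
Hypothesis v0 : forall x, v1 0 x = v2 0 x.
Hypothesis vC : forall t e : R, 0 < t -> 0 < e -> exists s : R, 0 < s <= t /\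
  forall x, `|v1 s x - v2 s x| <= e.

Definition gap t : fmH := madd (p1 t) (shiftm pi (p2 t)).
(** A measure for v1 - v2 whose size is the size of its Fourier transform,
    unlike [gap], which does not see cancellations between the two
    solutions. *)
Definition gap_lift t : fmH := lift_line (fourier (gap t)).
Definition quad1 (m : fmL) : fmH := quad m m m m.
Definition gap_bound : fmH := quad1 (mscale (2 * pi) (marg (symm (madd P P)))).
(** A measure of v1 that differs from that of v2 by [gap_lift] only, so that
    the nonlinear terms differ by at most [Em] of a bound of the gap. *)
Definition alt1 t : fmH := madd (p2 t) (gap_lift t).
Definition wide : fmH := madd P gap_bound.

Lemma ev_gap t x : 0 <= t -> ev (gap t) x 0 0 = v1 t x - v2 t x.
Proof. by move=> t0; rewrite ev_diff (r1.1 _ _ t0) (r2.1 _ _ t0). Qed.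

Lemma phase_bounded_gap t : phase_bounded (gap t) (madd (p1 t) (p2 t)).
Proof.
apply: phase_bounded_near => f nf; rewrite !maddE//; split.
  by rewrite addeCA leeDl// adde_ge0// nnm_integral.
by rewrite addeA leeDr// adde_ge0// nnm_integral.
Qed.

Lemma wle_gap_sum t : 0 <= t -> wle (al * t) (madd (p1 t) (p2 t)) (madd P P).
Proof. by move=> t0; apply: wle_madd; [exact: r1.2|exact: r2.2]. Qed.

Lemma wle_gap_lift t : 0 <= t -> wle (al * t) (gap_lift t) gap_bound.
Proof.
move=> t0; have at0 : 0 <= al * t by rewrite mulr_ge0// ltW.
apply: wle_lift_line => // A mA.
exact: fourier_wle (@phase_bounded_gap t) (wle_gap_sum t0) mA.
Qed.

Lemma mle_gap_lift t : 0 <= t -> mle (gap_lift t) gap_bound.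
Proof. by move=> t0; apply: wle_mle (wle_gap_lift t0); rewrite mulr_ge0// ltW. Qed.

Lemma quad1_total (k d : R) (m : fmL) : (m setT <= (2 * pi * (k * d))%:E)%E -> (quad1 m setT <= (4 * k * d)%:E)%E.
Proof.
move=> md; rewrite quad_total.
have -> : (4 * k * d)%:E = (((2 * pi)^-1)%:E * ((2 * pi * (k * d))%:E + (2 * pi * (k * d))%:E +
    ((2 * pi * (k * d))%:E + (2 * pi * (k * d))%:E)))%E.
  rewrite -!EFinD -EFinM; congr (_%:E); have := lt0r_neq0 (twopi_gt0 R).
  by move: (2 * pi) => z z0; field.
by rewrite lee_pmul2l ?lte_fin ?invr_gt0 ?twopi_gt0// !leeD.
Qed.

Lemma gap_bound_total : (gap_bound setT <= (16 * a)%:E)%E.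
Proof.
rewrite (_ : 16 * a = 4 * 4 * a); last by ring.
apply: quad1_total; rewrite mscale_total ?(ltW (twopi_gt0 R))// marg_total symm_total madd_total.
rewrite [leRHS]EFinM lee_wpmul2l ?lee_fin ?(ltW (twopi_gt0 R))//.
rewrite (_ : (4 * a)%:E = (a%:E + a%:E + (a%:E + a%:E))%E); first by rewrite !leeD.
by rewrite -!EFinD; congr (_%:E); ring.
Qed.

Lemma wide_total : (wide setT <= (17 * a)%:E)%E.
Proof.
rewrite madd_total (_ : 17 * a = a + 16 * a); last by ring.
by rewrite EFinD leeD// gap_bound_total.
Qed.

Lemma tiny_wide : tiny wide.
Proof. by apply: le_trans wide_total _; rewrite lee_fin. Qed.

Lemma ev_gap_lift t x : 0 <= t -> ev (gap_lift t) x 0 0 = v1 t x - v2 t x.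
Proof. by move=> t0; rewrite (ev_lift_line x (@is_fourier_fourier _ (gap t))) ev_gap. Qed.

Lemma ev_alt1 t x : 0 <= t -> ev (alt1 t) x 0 0 = v1 t x.
Proof.
move=> t0; rewrite /ev RI_madd; last exact: bm_carg.
by rewrite -!/(ev _ x 0 0) (r2.1 _ _ t0) ev_gap_lift// addrC subrK.
Qed.

Lemma wle_alt1 t : 0 <= t -> wle (al * t) (alt1 t) wide.
Proof. by move=> t0; apply: wle_madd; [exact: r2.2|exact: wle_gap_lift]. Qed.

Lemma wle_p2_wide t : 0 <= t -> wle (al * t) (p2 t) wide.
Proof.
move=> t0; apply: wle_mono (r2.2 _ t0) _ => f nf.
by rewrite maddE// leeDl// nnm_integral.
Qed.

Section contraction.
Variables (B : fmH).
Hypothesis gapB : forall t, 0 < t -> mle (gap_lift t) B.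
Let E : fmH := Em wide B.
Let G t : fmH := madd (Tm (alt1 t)) (shiftm pi (Tm (p2 t))).

Let at0 t : 0 < t -> 0 < al * t. Proof. by move=> t0; rewrite mulr_gt0. Qed.

Let mle_wide p t : 0 < t -> wle (al * t) p wide -> mle p wide.
Proof. by move=> t0; apply: wle_mle; exact: ltW (at0 t0). Qed.

Lemma near_Tm_gap t : 0 < t -> near_by (Tm (alt1 t)) (Tm (p2 t)) E.
Proof.
move=> t0; apply: near_Tm tiny_wide.
- move=> f nf; rewrite maddE//; split; first by rewrite leeD2l// gapB.
  by rewrite -addeA leeDl// adde_ge0// nnm_integral.
- exact: mle_wide t0 (wle_alt1 (ltW t0)).
- exact: mle_wide t0 (wle_p2_wide (ltW t0)).
Qed.

Let small_wide := tiny_small tiny_wide.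

Let small_alt1 t : 0 < t -> small (alt1 t).
Proof. by move=> t0; apply: le_trans (mle_total (mle_wide t0 (wle_alt1 (ltW t0)))) small_wide. Qed.

Let small_p2 t : 0 < t -> small (p2 t).
Proof. by move=> t0; apply: le_trans (mle_total (mle_wide t0 (wle_p2_wide (ltW t0)))) small_wide. Qed.

Let wT t : 0 < t -> wle (al * t) (Tm (alt1 t)) (Tm wide) /\ wle (al * t) (Tm (p2 t)) (Tm wide).
Proof.
move=> t0; split; apply: wle_Tm => //; rewrite ?(ltW (at0 t0))//; try exact: small_alt1; try exact: small_p2.
  exact: wle_alt1 (ltW t0).
exact: wle_p2_wide (ltW t0).
Qed.

Let wG t : 0 < t -> wle (al * t) (G t) (madd (Tm wide) (shiftm pi (Tm wide))).
Proof.
by move=> t0; have [w1 w2] := wT t0; apply: wle_madd => //; apply: wle_shiftm w2; exact: ltW (at0 t0).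
Qed.

Let wgap t : 0 < t -> wle (al * t) (gap t) (madd P (shiftm pi P)).
Proof.
move=> t0; apply: wle_madd; first exact: r1.2 (ltW t0).
by apply: wle_shiftm (r2.2 _ (ltW t0)); exact: ltW (at0 t0).
Qed.

Let fin_absxi t p Q : 0 < t -> wle (al * t) p Q -> (\int[p]_h (absxi h)%:E < +oo)%E.
Proof. by move=> t0; exact: absxi_fin (at0 t0). Qed.

Let dv t x : R := gam * ev (dens absxi (G t)) x 0 0 - c * ev (dens absxi (gap t)) x 0 0.

Lemma is_derive_gap (t x : R) : 0 < t -> is_derive t 1 (fun s => v1 s x - v2 s x) (dv t x).
Proof.
move=> t0; have t0' := ltW t0; have [w1 w2] := wT t0.
have d1 := e1 t0 (at0 t0) (small_alt1 t0) small_wide (wle_alt1 t0') (fun y => ev_alt1 y t0') x.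
have d2 := e2 t0 (at0 t0) (small_p2 t0) small_wide (wle_p2_wide t0') (fun y => r2.1 _ y t0') x.
apply: dv_cvt (dvB d1 d2) _.
rewrite /dv ev_absxi_diff; [|exact: fin_absxi t0 w1|exact: fin_absxi t0 w2].
rewrite ev_absxi_diff; [|exact: fin_absxi t0 (r1.2 _ t0')|exact: fin_absxi t0 (r2.2 _ t0')].
by ring.
Qed.

Let speed_bound : R := al^-1 * (gam * mass (madd (Tm wide) (shiftm pi (Tm wide))) + c * mass (madd P (shiftm pi P))).

Let norm_dv (t x : R) : 0 < t -> `|dv t x| * t <= speed_bound.
Proof.
move=> t0; have ib0 : 0 <= (al * t)^-1 by rewrite invr_ge0 ltW// at0.
have ma := @measurable_absxi R.
have key p Q : wle (al * t) p Q -> `|ev (dens absxi p) x 0 0| <= (al * t)^-1 * mass Q.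
  move=> w; apply: le_trans (norm_ev _ _ _ _) _.
  rewrite -lee_fin EFinM !massE.
  by apply: dens_wt_total w ma ib0 _ => h; apply: absxi_wt; exact: at0.
have k1 := key _ _ (wG t0); have k2 := key _ _ (wgap t0).
have c0 : 0 <= c by rewrite mulr_ge0// ltW.
apply: (@le_trans _ _ ((gam * ((al * t)^-1 * mass (madd (Tm wide) (shiftm pi (Tm wide)))) +
    c * ((al * t)^-1 * mass (madd P (shiftm pi P)))) * t)).
  rewrite ler_wpM2r ?(ltW t0)// (le_trans (ler_normB _ _))// (normrM gam) (normrM c) (ger0_norm gam0) (ger0_norm c0).
  by rewrite lerD// ler_wpM2l.
rewrite /speed_bound le_eqVlt; apply/orP; left; apply/eqP.
by field; rewrite (lt0r_neq0 t0) (lt0r_neq0 al0).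
Qed.

Section local_average.
Variables (b X x : R).
Let lt (s : R) (t : R) : R := s * (X * ln t).
Let mlt s : measurable_fun setT (lt s).
Proof. by apply: measurable_funM => //; apply: measurable_funM => //; exact: measurable_ln. Qed.

Let bm_ev_ln p s : bm (fun t : R => ev p (lt s t) 0 0).
Proof.
have bG : bm (fun th : R * H => cos (arg (lt s th.1) 0 th.2 + 0)).
  apply: bm_cos; rewrite /arg.
  have m1 : measurable_fun setT (fun th : R * H => lt s th.1).
    by apply: (measurableT_comp (mlt s)); exact: measurable_fst.
  by hmeas.
exact: (bm_RI p bG).
Qed.

Let average (u : R -> R) (t : R) : R :=
  cos (b - X * ln t * x) * u (X * ln t) + cos (b + X * ln t * x) * u (- (X * ln t)).

Let bm_average p : bm (average (fun y => ev p y 0 0)).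
Proof.
have ml : measurable_fun setT (fun t : R => X * ln t * x).
  by apply: measurable_funM => //; apply: measurable_funM => //; exact: measurable_ln.
apply: bmD; apply: bmM.
- by apply: bm_cos; apply: measurable_funB.
- by have := bm_ev_ln p 1; rewrite /lt; under eq_fun do rewrite mul1r.
- by apply: bm_cos; apply: measurable_funD.
- by have := bm_ev_ln p (-1); rewrite /lt; under eq_fun do rewrite mulN1r.
Qed.

Let averageD (k l : R) (u w : R -> R) t :
  average (fun y => k * u y - l * w y) t = k * average u t - l * average w t.
Proof. by rewrite /average; ring. Qed.

Let z (s : R) : R := RI (unif R) (average (fun y => v1 s y - v2 s y)).
Let dz (s : R) : R := RI (unif R) (average (dv s)).
Let kernel (h : H) : R := cos (phase h + b) * bump (X * (xi h - x)).

Let zE s : 0 <= s -> z s = RI (symm (gap s)) kernel.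
Proof.
move=> s0; rewrite /kernel bump_transform /z; congr (RI _ _); apply/funext => t.
by rewrite /average !ev_gap.
Qed.

Let dzE s : dz s = gam * RI (symm (dens absxi (G s))) kernel - c * RI (symm (dens absxi (gap s))) kernel.
Proof.
rewrite /kernel !bump_transform -!RIZ -?RIB; try exact: bm_average.
- by congr (RI _ _); apply/funext => t; exact: averageD.
- by apply: bmM; [exact: bm_cst|exact: bm_average].
- by apply: bmM; [exact: bm_cst|exact: bm_average].
Qed.

Let norm_average (u : R -> R) (k t : R) : (forall y, `|u y| <= k) -> `|average u t| <= 2 * k.
Proof.
move=> uk; rewrite mulr2n mulrDl mul1r (le_trans (ler_normD _ _))// lerD// normrM.
  by apply: le_trans (uk (X * ln t)); rewrite ler_piMl// norm_cos.
by apply: le_trans (uk (- (X * ln t))); rewrite ler_piMl// norm_cos.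
Qed.

(** In logarithmic time the velocity is bounded uniformly, so that the integral
    can be differentiated. *)
Let is_derive_z (s : R) : 0 < s -> is_derive s 1 z (dz s).
Proof.
move=> s0.
have dF (r : R) : is_derive r 1 (fun r : R => \int[unif R]_t average (fun y => v1 (expR r) y - v2 (expR r) y) t)
    (\int[unif R]_t (expR r * average (dv (expR r)) t)).
  apply: (@deriv_under _ _ _ _ (fun (r t : R) => average (fun y => v1 (expR r) y - v2 (expR r) y) t)
    (fun (r t : R) => expR r * average (dv (expR r)) t) (fun=> 2 * speed_bound)) => [r'|r' t||r' t].
  - apply: bm_integrable; have := bm_average (gap (expR r')).
    by congr bm; apply/funext => t; rewrite /average !ev_gap ?expR_ge0.
  - have dg y : is_derive r' 1 (fun r : R => v1 (expR r) y - v2 (expR r) y) (dv (expR r') y * expR r').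
      exact: (@dv_comp _ (fun s : R => v1 s y - v2 s y) _ _ _ _ (is_derive_gap y (expR_gt0 r')) (is_derive_expR r')).
    apply: dv_cvt (dvD (dvZ (cos (b - X * ln t * x)) (dg (X * ln t)))
      (dvZ (cos (b + X * ln t * x)) (dg (- (X * ln t))))) _.
    by rewrite /average; ring.
  - by apply: bm_integrable; exact: bm_cst.
  - have e0 := expR_gt0 r'.
    rewrite normrM (gtr0_norm e0) -ler_pdivlMl//.
    apply: le_trans (@norm_average _ (speed_bound / expR r') t _) _.
      by move=> y; rewrite ler_pdivlMr//; exact: norm_dv.
    by rewrite mulrA mulrC.
have dl := is_derive1_ln s0.
have := dv_comp (dF (ln s)) dl.
have -> : (\int[unif R]_t (expR (ln s) * average (dv (expR (ln s))) t)) * s^-1 = dz s.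
  rewrite lnK ?posrE// -[X in X * _]/(RI (unif R) (fun t => s * average (dv s) t)) RIZ.
    by rewrite mulrAC mulfV ?mul1r ?lt0r_neq0.
  have := bmB (bmM (bm_cst _ gam) (bm_average (dens absxi (G s)))) (bmM (bm_cst _ c) (bm_average (dens absxi (gap s)))).
  by congr bm; apply/funext => t; rewrite -averageD.
apply: near_eq_is_derive; near=> r.
have r0 : 0 < r by near: r; exact: lt_nbhsr.
by rewrite lnK ?posrE.
Unshelve. all: by end_near. Qed.

Hypothesis X0 : 0 < X.
Let k (y : line) : R := bump (X * ((y : R) - x)).
Let j (y : line) : R := `|(y : R) - x| * k y.

Let bk : bm k. Proof. exact: bm_bump_xi. Qed.
Let k0 y : 0 <= k y. Proof. exact: bump_ge0. Qed.
Let j0 y : 0 <= j y. Proof. by rewrite mulr_ge0. Qed.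
Let bj : bm j.
Proof.
split; first by apply: measurable_funM; [meas|exact: bk.1].
exists (X^-1 * 2^-1) => y; rewrite ger0_norm// ler_pdivlMl//.
by have /andP[] := bump_moment ((y : R) - x) X0.
Qed.
Let ak_le y : `|y : R| * k y <= `|x| * k y + j y.
Proof.
rewrite -mulrDl ler_wpM2r//; rewrite -[X in `|X|](subrK x (y : R)) addrC.
by rewrite (le_trans (ler_normD _ _)).
Qed.
Let bak : bm (fun y : line => `|y : R| * k y).
Proof.
split; first by apply: measurable_funM; [meas|exact: bk.1].
have [_ [C hC]] := bmD (bmM (bm_cst _ `|x|) bk) bj.
exists C => y; apply: le_trans (hC y).
rewrite (ger0_norm (mulr_ge0 (normr_ge0 _) (k0 y))).
by rewrite (ger0_norm (addr_ge0 (mulr_ge0 (normr_ge0 _) (k0 y)) (j0 y))); exact: ak_le.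
Qed.

Let c0 : 0 < c. Proof. by rewrite mulr_gt0. Qed.
Let target : R := gam / c * RI (symm E) (fun h => k (xi h)).
Let error : R := gam * RI (symm E) (fun h => j (xi h)) + c * RI (symm (madd P P)) (fun h => j (xi h)).

Let relax (s : R) : 0 < s -> `|dz s + c * `|x| * z s| <= c * `|x| * target + error.
Proof.
move=> s0; have s0' := ltW s0.
have fG := fin_absxi s0 (wG s0); have fg := fin_absxi s0 (wgap s0).
rewrite dzE zE// /kernel.
rewrite (RI_symm_absxi b fG bk k0 bak) (RI_symm_absxi b fg bk k0 bak).
have bxj := bm_xi bj; have bxk := bm_xi bk; have bxa := bm_xi bak.
have bd : bm (fun y : line => (`|x| - `|y : R|) * k y).
  by under eq_fun do rewrite mulrBl; exact: (bmB (bmM (bm_cst _ `|x|) bk) bak).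
set Y := RI (symm (G s)) _.
(* the rate |xi| is frozen at |x|; the defect is at most |xi - x| against the kernel *)
have e3 : RI (symm (gap s)) (fun h => cos (phase h + b) * ((`|x| - `|xi h|) * k (xi h))) =
    `|x| * RI (symm (gap s)) (fun h => cos (phase h + b) * k (xi h)) -
    RI (symm (gap s)) (fun h => cos (phase h + b) * (absxi h * k (xi h))).
  have bt := bm_twist b bk; have bt' := bm_twist b bak.
  rewrite -RIZ// -RIB//; last by apply: bmM => //; exact: bm_cst.
  by congr (RI _ _); apply/funext => h; rewrite /absxi; ring.
rewrite [X in `|X|](_ : _ = gam * Y + c * RI (symm (gap s))
    (fun h => cos (phase h + b) * ((`|x| - `|xi h|) * k (xi h)))); last by rewrite e3; ring.
have h1 : `|Y| <= `|x| * RI (symm E) (fun h => k (xi h)) + RI (symm E) (fun h => j (xi h)).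
  have pb := phase_bounded_symm (phase_bounded_near (near_Tm_gap s0)).
  apply: le_trans (pb b _ bak) _; rewrite -RIZ// -RID//; last by apply: bmM => //; exact: bm_cst.
  apply: le_RI => [||h]; [exact: bm_norm|by apply: bmD => //; apply: bmM => //; exact: bm_cst|].
  by rewrite ger0_norm ?mulr_ge0//; exact: ak_le.
have h2 : `|RI (symm (gap s)) (fun h => cos (phase h + b) * ((`|x| - `|xi h|) * k (xi h)))| <=
    RI (symm (madd P P)) (fun h => j (xi h)).
  have pb := phase_bounded_symm (phase_bounded_mle (@phase_bounded_gap s)
    (wle_mle (ltW (at0 s0)) (wle_gap_sum s0'))).
  apply: le_trans (pb b _ bd) _; apply: le_RI => [||h]; [exact: (bm_xi (bm_norm bd))|by []|].
  rewrite normrM (ger0_norm (k0 _)) ler_wpM2r// distrC.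
  exact: ler_dist_dist.
apply: le_trans (ler_normD _ _) _; rewrite (normrM gam) (normrM c) (ger0_norm gam0) (gtr0_norm c0).
have -> : c * `|x| * target = gam * (`|x| * RI (symm E) (fun h => k (xi h))).
  by rewrite /target; field; exact: lt0r_neq0.
rewrite /error addrA -mulrDr lerD// ler_wpM2l ?(ltW c0)//.
Qed.

(** The average z of the gap near the frequency x satisfies z' = - c|x| z +
    source, up to errors of size |xi - x|, and the source is at most c|x|
    times the target. *)
Lemma gap_average (t : R) : 0 < t -> `|RI (symm (gap t)) kernel| <= target + t * error.
Proof.
move=> t0; rewrite -zE ?(ltW t0)//.
have E0 p (g : line -> R) : (forall y, 0 <= g y) -> 0 <= RI (symm p) (fun h => g (xi h)).
  by move=> g0; apply: RI_ge0 => h.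
apply: (@relaxation_bound _ z dz (c * `|x|)) => //.
- by rewrite mulr_ge0// ltW.
- by rewrite mulr_ge0 ?E0// divr_ge0// ltW.
- by rewrite addr_ge0 ?mulr_ge0 ?E0// ltW.
move=> e e_gt0; have [|s [st sv]] := @vC t (e / 2) t0; first by rewrite divr_gt0.
exists s; split=> //; have [s0 _] := andP st.
have := RI_bound (unif R) (_ : bm (average (fun y => v1 s y - v2 s y))) (fun t => norm_average t sv).
rewrite mass_unif mulr1 mulrC divfK//; apply.
have := bm_average (gap s).
by congr bm; apply/funext => u; rewrite /average !ev_gap// ltW.
Qed.
End local_average.

Let c0 : 0 < c. Proof. by rewrite mulr_gt0. Qed.
Let ratio0 : 0 <= gam / c. Proof. by rewrite divr_ge0// ltW. Qed.

Lemma gap_phased t b : 0 < t -> let e := mscale (gam / c) (symm E) in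
  mle (marg (phased b (symm (gap t)))) (madd (marg (symm (gap t))) (marg e)) /\
  mle (marg (symm (gap t))) (madd (marg (phased b (symm (gap t)))) (marg e)).
Proof.
move=> t0 e.
pose r := mscale t (madd (mscale gam (symm E)) (mscale c (symm (madd P P)))).
apply: (@bump_bound _ (gap t) e r) => b' X x X0.
have bk := bm_xi (@bm_bump_xi R X x).
have bj : bm (fun h : H => `|xi h - x| * bump (X * (xi h - x))).
  split; first by apply: measurable_funM; [hmeas|exact: bk.1].
  exists (X^-1 * 2^-1) => h; rewrite ger0_norm ?mulr_ge0 ?bump_ge0// ler_pdivlMl//.
  by have /andP[] := bump_moment (xi h - x) X0.
rewrite /e /r !RI_mscale ?RI_madd ?RI_mscale ?(ltW t0) ?(ltW c0)//.
exact: gap_average.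
Qed.

(** The bound of the gap deduced from a bound B. *)
Definition next : fmH := quad1 (mscale pi (marg (mscale (gam / c) (symm E)))).

Lemma gap_next t : 0 < t -> mle (gap_lift t) next.
Proof.
move=> t0; have pi0 := pi_ge0 R; set e := mscale (gam / c) (symm E).
have key b : mle (pvar (phase_charge b (gap t))) (mscale pi (marg e)) /\
    mle (nvar (phase_charge b (gap t))) (mscale pi (marg e)).
  have [h1 h2] := gap_phased b t0.
  have set_le (m n : fmL) (A : set line) : measurable A -> mle m (madd n (marg e)) ->
      (mscale pi m A <= mscale pi (marg e) A + mscale pi n A)%E.
    move=> mA mn; rewrite !mscaleS// !measure_RI// -!EFinM -EFinD lee_fin -mulrDr ler_wpM2l//.
    rewrite addrC -RI_madd; last exact: bm_indic.
    by apply: (mle_RI mn (bm_indic mA)) => y; rewrite indicE.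
  split; [apply: pvar_le|apply: nvar_le] => A mA; rewrite mchargeE//.
    by rewrite leeBlDr ?fin_meas//; exact: set_le.
  by rewrite fin_num_oppeB ?fin_meas// addeC leeBlDr ?fin_meas//; exact: set_le.
apply/wle0; apply: wle_quad => f nf.
have w1 (m : fmL) : (\int[m]_y ((expR (0 * `|y : R|))%:E * f y) = \int[m]_y f y)%E.
  by apply: eq_integral => y _; rewrite mul0r expR0 mul1e.
have [k1 k2] := key 0; have [k3 k4] := key (- (pi / 2)).
by rewrite !w1; split; [exact: k1|exact: k2|exact: k3|exact: k4].
Qed.

(** [Em] multiplies masses by the square of the small mass of the solutions. *)
Lemma next_total d : (B setT <= d%:E)%E -> (next setT <= (d / 2)%:E)%E.
Proof.
move=> Bd; have d0 : 0 <= d by rewrite -lee_fin (le_trans _ Bd).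
have Et : (E setT <= (16 * (17 * a) ^+ 2 * d)%:E)%E by exact: (Em_total kap a4 wide_total Bd).
apply: (@le_trans _ _ (4 * (gam / c) * (16 * (17 * a) ^+ 2 * d))%:E); last first.
  by rewrite lee_fin; have := ler_wpM2r d0 contr; lra.
apply: quad1_total; have pi0 := pi_ge0 R.
rewrite mscale_total// marg_total mscale_total//.
apply: (@le_trans _ _ (pi%:E * ((gam / c)%:E * (2 * (16 * (17 * a) ^+ 2 * d))%:E))%E).
  by rewrite lee_wpmul2l ?lee_fin// lee_wpmul2l ?lee_fin// symm_mass.
by rewrite -!EFinM lee_fin le_eqVlt; apply/orP; left; apply/eqP; ring.
Qed.

End contraction.

(** Each bound on the gap yields one of half the mass. *)
Lemma gap_vanishes t x : 0 <= t -> v1 t x = v2 t x.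
Proof.
rewrite le_eqVlt => /orP[/eqP <-|t0]; first exact: v0.
have bound n : exists2 B : fmH, forall s, 0 < s -> mle (gap_lift s) B &
    (B setT <= (16 * a * 2^-1 ^+ n)%:E)%E.
  elim: n => [|n [B gB Bn]].
    exists gap_bound => [s s0|]; first exact: mle_gap_lift (ltW s0).
    by rewrite expr0 mulr1; exact: gap_bound_total.
  exists (next B); first exact: gap_next.
  by rewrite exprSr mulrA; exact: next_total.
have m0 : mass (gap_lift t) <= 0.
  have cv : 16 * a * 2^-1 ^+ n @[n --> \oo] --> (0 : R).
    rewrite -[X in _ --> X](mulr0 (16 * a)); apply: cvgM; first exact: cvg_cst.
    by apply: cvg_expr; rewrite gtr0_norm ?invf_lt1// ltr1n.
  apply: (@ler_cvg_to _ _ _ _ (fun=> mass (gap_lift t)) _ _ _ (cvg_cst _) cv).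
  apply: nearW => n; have [B gB Bn] := bound n.
  by rewrite -lee_fin massE; apply: le_trans Bn; apply: mle_total; exact: gB.
apply/eqP; rewrite -subr_eq0 -ev_gap_lift ?(ltW t0)// -normr_le0.
by apply: le_trans (norm_ev _ _ _ _) m0.
Qed.
End uniqueness.

(** * Existence and uniqueness in a small ball *)

Section solutions.
Context (R : realType).
Local Notation H := (freq R).
Local Notation fmH := {finite_measure set H -> \bar R}.
Local Notation line := (measurableTypeR R).
Local Notation fmL := {finite_measure set line -> \bar R}.
Variables (rho_m rho_p al : R).
Hypotheses (al0 : 0 < al) (alE : 2 * al = (rho_m - rho_p) / 2).
Local Notation gam := ((rho_m - rho_p) / pi * `|kappa R|).
Local Notation kap := (kappa R).

Lemma B0_norm_sup (u : R -> R) (k x : R) : (B0_norm u < k%:E)%E -> `|u x| <= 2 * k / pi.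
Proof.
move=> /ereal_inf_lt[_ [nu un <-] /ltW nk].
rewrite -(ev_lift_line x un); apply: le_trans (norm_ev _ _ _ _) _.
by rewrite -lee_fin massE; exact: lift_line_total.
Qed.

Lemma continuous_at0 (v : R -> R -> R) (e : R) : continuous_in_B0 v -> 0 < e ->
  exists2 d : R, 0 < d & forall s x : R, 0 <= s < d -> `|v s x - v 0 x| <= e.
Proof.
move=> [_ /(_ 0 (lexx 0)) /fine_cvgP[vfin vlim]] e0.
have k0 : 0 < e * pi / 2 by rewrite divr_gt0// mulr_gt0// pi_gt0.
have /cvgrPdist_lt/(_ _ k0) vk := vlim.
have : \forall s \near within `[0, +oo[%classic (nbhs (0 : R)),
    (B0_norm (fun x : R => v s x - v 0 x)%R < (e * pi / 2)%:E)%E.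
  near=> s; have sf : B0_norm (fun x : R => v s x - v 0 x) \is a fin_num by near: s; exact: vfin.
  have : `|0 - fine (B0_norm (fun x : R => v s x - v 0 x))| < e * pi / 2 by near: s; exact: vk.
  rewrite sub0r normrN ger0_norm ?fine_ge0 ?B0_norm_ge0// => h.
  by rewrite -(fineK sf) lte_fin.
move=> /nbhs_ballP[d /= d0 hd]; exists d => // s x /andP[s0 sd].
have : (B0_norm (fun x : R => v s x - v 0 x)%R < (e * pi / 2)%:E)%E.
  apply: hd; last by rewrite /= in_itv/= s0.
  by rewrite /ball/= sub0r normrN ger0_norm.
move=> /(@B0_norm_sup _ _ x); congr (_ <= _); have := lt0r_neq0 (pi_gt0 R).
by move: (pi : R) => z z0; field.
Unshelve. all: by end_near. Qed.

(** The measure realizing the norm up to a factor 2 bounds the four parts of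
    the Fourier transform at every time. *)
Lemma represents_solution (r : R) (f : R -> R -> R) : 0 < r ->
  (Balpha_norm al f <= r%:E)%E ->
  exists (P : fmH) (p : R -> fmH), represents al P f p /\ (P setT <= (4 * r / pi)%:E)%E.
Proof.
move=> r0 fr.
have /ereal_inf_lt[_ [mu dmu <-] mur] : (Balpha_norm al f < (2 * r)%:E)%E.
  by apply: le_lt_trans fr _; rewrite lte_fin; lra.
have ex (t : R) : exists nu, 0 <= t -> is_fourier (f t) nu /\
    forall A : set line, measurable A ->
      (\int[Defs.total_variation nu]_(xi in A) (expR (al * t * `|xi : R|))%:E <= mu A)%E.
  have [t0|t0] := leP 0 t; first by have [nu n1 n2] := dmu t t0; exists nu.
  by exists (fourier (nullm R H)).
have /choice[nu nuP] := ex.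
exists (quad1 mu), (fun t => lift_line (nu t)); split; [split|].
- by move=> t x t0; have [nf _] := nuP t t0; exact: ev_lift_line.
- move=> t t0; have [_ nm] := nuP t t0; apply: wle_lift_line => //.
  by rewrite mulr_ge0// ltW.
rewrite (_ : 4 * r / pi = 4 * pi^-1 * r); last by ring.
apply: quad1_total; apply: le_trans (ltW mur) _; rewrite lee_fin le_eqVlt; apply/orP; left; apply/eqP.
by have := lt0r_neq0 (pi_gt0 R); move: (pi : R) => z z0; field.
Qed.

(** Both sides of the equation are computed on phase-space measures: Lambda
    by [is_Lambda_E], the nonlinear term by [muskat_N_derive] on the measure
    chosen. *)
Lemma evolves_solution (f0 : R -> R) (f : R -> R -> R) (P : fmH) (p : R -> fmH) :
  muskat_solution rho_m rho_p al f0 f -> represents al P (dx f) p ->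
  evolves al gam kap (dx f) p.
Proof.
move=> [fd _ _ feq] [pf pw] t p' P' b t0 b0 sp' sP' w' ep' x.
have t0' := ltW t0.
have [w Lw /(_ x)[dt _ dN eqn]] := feq t t0.
have dg (z : R) : is_derive z 1 (f t) (ev p' z 0 0).
  have := fd t z t0'; rewrite ep' => df; apply: DeriveDef => //.
  by rewrite -derive1E.
have dNE := muskat_N_derive rho_m rho_p x b0 sp' sP' w' dg.
have wE : w x = ev (dens absxi (p t)) x 0 0.
  apply: is_Lambda_E Lw; last by move=> y; exact: pf.
  by apply: absxi_fin (pw t t0'); rewrite mulr_gt0.
move: eqn; rewrite (derive1_val dNE) wE => eqn.
apply: DeriveDef => //; rewrite -derive1E.
by rewrite alE -mulrA -eqn; ring.
Qed.

Lemma muskat_unique (a : R) (f0 : R -> R) (f g : R -> R -> R) : 0 < a -> 0 <= gam ->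
  17 * (32 * a) <= 4^-1 -> gam / (2 * al) * (64 * (17 * (32 * a)) ^+ 2) <= 2^-1 ->
  muskat_solution rho_m rho_p al f0 f -> (Balpha_norm al (dx f) <= (4 * pi * a)%:E)%E ->
  muskat_solution rho_m rho_p al f0 g -> (Balpha_norm al (dx g) <= (4 * pi * a)%:E)%E ->
  forall t x, 0 <= t -> dx g t x = dx f t x.
Proof.
move=> a0 gam0 a4 contr sf rf sg rg.
have r0 : 0 < 4 * pi * a by rewrite !mulr_gt0// pi_gt0.
have [fd fB f0E _] := sf; have [gd gB g0E _] := sg.
have [Pf [pf [repf Pfa]]] := represents_solution r0 rf.
have [Pg [pg [repg Pga]]] := represents_solution r0 rg.
have aE : 4 * (4 * pi * a) / pi = 16 * a.
  by have := lt0r_neq0 (pi_gt0 R); move: (pi : R) => z z0; field.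
rewrite aE in Pfa Pga.
pose P := madd Pf Pg.
have Pa : (P setT <= (32 * a)%:E)%E.
  by rewrite madd_total (_ : 32 * a = 16 * a + 16 * a); [rewrite EFinD leeD|ring].
have wide (Q : fmH) v p : represents al Q v p -> mle Q P -> represents al P v p.
  by move=> [h1 h2] QP; split=> // s s0; apply: wle_mono (h2 s s0) QP.
have repf' : represents al P (dx f) pf.
  by apply: wide repf _ => h nh; rewrite maddE// leeDl// nnm_integral.
have repg' : represents al P (dx g) pg.
  by apply: wide repg _ => h nh; rewrite maddE// leeDr// nnm_integral.
have v0 x : dx g 0 x = dx f 0 x by rewrite g0E f0E.
have vC (t e : R) : 0 < t -> 0 < e -> exists s : R, 0 < s <= t /\ forall x, `|dx g s x - dx f s x| <= e.
  move=> t0 e0; have e20 : 0 < e / 2 by rewrite divr_gt0.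
  have [d1 d10 h1] := continuous_at0 fB.1 e20.
  have [d2 d20 h2] := continuous_at0 gB.1 e20.
  pose s := Num.min t (Num.min (d1 / 2) (d2 / 2)).
  have s0 : 0 < s by rewrite !lt_min t0 !divr_gt0.
  have st : s <= t by rewrite ge_min lexx.
  have sd1 : s < d1.
    by apply: (@le_lt_trans _ _ (d1 / 2)); [rewrite !ge_min lexx/= orbT|rewrite ltr_pdivrMr// mulr_natr mulr2n ltrDl].
  have sd2 : s < d2.
    by apply: (@le_lt_trans _ _ (d2 / 2)); [rewrite !ge_min lexx/= !orbT|rewrite ltr_pdivrMr// mulr_natr mulr2n ltrDl].
  exists s; split; first by rewrite s0.
  move=> x; have := h1 s x; have := h2 s x; rewrite (ltW s0) sd1 sd2 => /(_ isT) k2 /(_ isT) k1.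
  have -> : dx g s x - dx f s x = (dx g s x - dx g 0 x) - (dx f s x - dx f 0 x).
    by rewrite v0; ring.
  by apply: le_trans (ler_normB _ _) _; move: k1 k2; lra.
move=> t x t0.
apply: (gap_vanishes al0 gam0 a4 contr Pa repg' repf' _ _ v0 vC x t0).
- exact: evolves_solution sg repg'.
- exact: evolves_solution sf repf'.
Qed.

End solutions.

Lemma sqr_product_le (R : realType) (k y l m : R) : 0 <= y -> 0 <= l -> k <= y * y -> l * y <= m ->
  k * (l * l) <= m * m.
Proof.
move=> y0 l0 ky lym; apply: (@le_trans _ _ ((l * y) * (l * y))).
  by rewrite (_ : l * y * (l * y) = y * y * (l * l)); [rewrite ler_wpM2r// mulr_ge0|ring].
by apply: ler_pM => //; exact: mulr_ge0.
Qed.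

Theorem theorem2 (R : realType) (rho_m rho_p : R) (hrho : rho_p < rho_m) :
  exists eps alpha r : R, [/\ 0 < eps, 0 < alpha, 0 < r &
    forall f0 : R -> R,
      (forall x, derivable f0 x 1) ->
      (B0_norm (derive1 f0) <= eps%:E)%E ->
      exists f : R -> R -> R,
        [/\ muskat_solution rho_m rho_p alpha f0 f,
            (Balpha_norm alpha (dx f) <= r%:E)%E &
            forall g : R -> R -> R,
              muskat_solution rho_m rho_p alpha f0 g ->
              (Balpha_norm alpha (dx g) <= r%:E)%E ->
              forall t x, 0 <= t -> dx g t x = dx f t x]].
Proof.
pose al := (rho_m - rho_p) / 4; pose gam := (rho_m - rho_p) / pi * `|kappa R|.
have drho : 0 < rho_m - rho_p by rewrite subr_gt0.
have al0 : 0 < al by rewrite divr_gt0.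
have pi0 := pi_gt0 R.
have gam0 : 0 <= gam by rewrite mulr_ge0// divr_ge0// ltW.
have alE : 2 * al = (rho_m - rho_p) / 2 by rewrite /al; field.
pose K := gam / al; have K0 : 0 <= K by rewrite divr_ge0// ltW.
(* y = 10^-4 bounds a and K a.  The measure common to two solutions in the ball has
   mass 32 a, and 17 * 32 a bounds its enlargement; the contraction needs 544 y small. *)
pose y : R := 100^-1 * 100^-1; have y0 : 0 < y by rewrite mulr_gt0// invr_gt0.
have [L LE] : exists L : R, L = 17 * 32 by exists (17 * 32).
have L0 : 0 <= L by rewrite LE; lra.
have yE : L * y <= 16^-1 by rewrite LE /y; lra.
pose a := y / (1 + K).
have K1 : 0 < 1 + K by lra.
have a0 : 0 < a by rewrite divr_gt0.
have aE : a + K * a = y by rewrite /a; field; exact: lt0r_neq0.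
have Ka0 : 0 <= K * a by rewrite mulr_ge0// ltW.
have Kaa : K * a * a <= y * y by apply: ler_pM => //; lra.
have ay : a <= y by lra.
have c1 : a <= 4^-1 by move: ay; rewrite /y; lra.
have yy := sqr_product_le (ltW y0) L0 Kaa yE.
have c2 : K * (4 * a ^+ 3) <= a / 2.
  have -> : K * (4 * a ^+ 3) = 4 * (K * a * a) * a by ring.
  have -> : a / 2 = 2^-1 * a by ring.
  apply: ler_wpM2r; first exact: ltW.
  have y4 : y <= 4^-1 by rewrite /y; lra.
  have := le_trans Kaa (ler_pM (ltW y0) (ltW y0) y4 y4).
  by move: (K * a * a) => q; lra.
have c3 : 17 * (32 * a) <= 4^-1 by move: ay; rewrite /y; lra.
have c4 : gam / (2 * al) * (64 * (17 * (32 * a)) ^+ 2) <= 2^-1.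
  have -> : gam / (2 * al) * (64 * (17 * (32 * a)) ^+ 2) = 32 * (K * a * a * (L * L)).
    by rewrite LE /K; field; exact: lt0r_neq0.
  by move: yy; move: (K * a * a * (L * L)) => q; lra.
(* A complex measure of total variation 2 eps lifts to mass 4 eps / pi = a / 2; the
   radius is the norm of the mild solution with dominating mass a. *)
exists (pi * a / 8), al, (4 * pi * a); split=> //; first by rewrite divr_gt0// mulr_gt0.
  exact: mulr_gt0 (mulr_gt0 (ltr0Sn _ 3) pi0) a0.
move=> f0 f0d f0B.
have /ereal_inf_lt[_ [nu0 nuF <-] /ltW nu0a] : (B0_norm (derive1 f0) < (pi * a / 4)%:E)%E.
  apply: le_lt_trans f0B _; rewrite lte_fin (ltr_pM2l (mulr_gt0 pi0 a0)).
  by rewrite ltf_pV2 ?posrE// ltr_nat.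
pose p0 := lift_line nu0.
have p0a : (p0 setT <= (a / 2)%:E)%E.
  apply: le_trans (lift_line_total nu0a) _; rewrite lee_fin le_eqVlt; apply/orP; left; apply/eqP.
  by have := lt0r_neq0 pi0; move: (pi : R) => z z0; field.
have [M [p [Ma ap ME pE]]] := mild_exists al0 gam0 (kappa R) c1 c2 p0a.
have init x : ev (p 0) x 0 0 = derive1 f0 x.
  by rewrite (mild_initial al0 gam0 c1 Ma ap pE) (ev_lift_line x nuF).
have sol := muskat_mild al0 gam0 c1 Ma ap ME pE alE erefl erefl init.
have ball : (Balpha_norm al (dx (fun t => curve (p t))) <= (4 * pi * a)%:E)%E.
  rewrite (_ : dx _ = fun t x => ev (p t) x 0 0); first exact: Balpha_norm_mild Ma ap.
  apply/funext => t; apply/funext => x; exact: derive1_val (is_derive_curve (p t) x).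
exists (fun t => curve (p t)); split=> // g sg gball.
exact: (muskat_unique al0 alE a0 gam0 c3 c4 sol ball sg gball).
Qed.
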